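(* There exists $A_*\in(0,1)$ such that the Mathieu–Hankel operator $\mathbf H(A_* )$ has at least one flat (constant) band function and at least one non-flat (non-constant) band function.
   Context: Fix $T>0$, $\omega=2\pi/T$. For $A\in\mathbb R$, $\mathbf H(A)$ is the Hankel operator on $L^2(\mathbb R_+)$ with kernel $p_A(\log t)/t$, $p_A(\xi)=A+\operatorname{Re}(\Gamma(1-i\omega)e^{i\omega\xi})$. Its fiber operators are $H(k;A)$ on $\ell^2(\mathbb Z)$ with matrix $[H(k;A)]_{n,m}=\overline{\gamma_n(k)}\,\mathfrak s_{n-m}\,\gamma_m(k)$, $\gamma_n(k)=\Gamma(\frac12+i(\omega n+k))$, $\mathfrak s_0=A$, $\mathfrak s_{\pm1}=\frac12$, $\mathfrak s_j=0$ otherwise. Band functions: the (unique up to ordering) finite or countable list, repetitions allowed, of non-vanishing real analytic real functions on $\mathbb R$ such that for every $k$ the non-zero eigenvalues of $H(k;A)$ with multiplicity are exactly the values of the listed functions at $k$, counted with repetition. *)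

(* Defs.v *)
From Stdlib Require Import Reals ZArith List.
From Coquelicot Require Import Coquelicot.
Open Scope R_scope.

(** Euler Gamma on the critical line: Gamma(1/2 + i y)
    = int_0^oo t^(-1/2) e^(-t) t^(i y) dt, with t^(i y) = cos(y ln t) + i sin(y ln t).
    Real and imaginary parts are (absolutely convergent) improper integrals. *)
Definition Gamma_half (y : R) : C :=
  (RInt_gen (fun t => / sqrt t * exp (- t) * cos (y * ln t))
            (at_right 0) (Rbar_locally p_infty),
   RInt_gen (fun t => / sqrt t * exp (- t) * sin (y * ln t))
            (at_right 0) (Rbar_locally p_infty)).

Definition omega (T : R) : R := 2 * PI / T.

Definition gam (T k : R) (n : Z) : C := Gamma_half (omega T * IZR n + k).

Definition symb (A : R) (j : Z) : C :=
  if Z.eqb j 0 then RtoC A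
  else if Z.eqb (Z.abs j) 1 then RtoC (1/2) else RtoC 0.

Definition Hentry (T A k : R) (n m : Z) : C :=
  (Cconj (gam T k n) * symb A (n - m) * gam T k m)%C.

(** action of the (tridiagonal) matrix on a sequence x : Z -> C;
    since s_j = 0 for |j| >= 2, (Hx)_n = sum_m H_{n,m} x_m reduces to m in {n-1,n,n+1}. *)
Definition Happly (T A k : R) (x : Z -> C) (n : Z) : C :=
  (Hentry T A k n (n - 1) * x (n - 1)%Z + Hentry T A k n n * x n
   + Hentry T A k n (n + 1) * x (n + 1)%Z)%C.

Definition in_l2 (x : Z -> C) : Prop :=
  ex_series (fun j : nat => (Cmod (x (Z.of_nat j))) ^ 2) /\
  ex_series (fun j : nat => (Cmod (x (- Z.of_nat j)%Z)) ^ 2).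

Definition in_eigenspace (T A k : R) (lam : C) (x : Z -> C) : Prop :=
  in_l2 x /\ forall n, Happly T A k x n = (lam * x n)%C.

Definition lincomb (m : nat) (c : nat -> C) (v : nat -> Z -> C) (n : Z) : C :=
  fold_right Cplus (RtoC 0) (map (fun i => (c i * v i n)%C) (seq 0 m)).

Definition lin_indep (m : nat) (v : nat -> Z -> C) : Prop :=
  forall c : nat -> C, (forall n, lincomb m c v n = RtoC 0) ->
    forall i, (i < m)%nat -> c i = RtoC 0.

Definition has_indep_eigvecs (T A k : R) (lam : C) (m : nat) : Prop :=
  exists v : nat -> Z -> C,
    (forall i, (i < m)%nat -> in_eigenspace T A k lam (v i)) /\ lin_indep m v.

(** lam is an eigenvalue of H(k;A) of multiplicity m (= dimension of the eigenspace);
    multiplicity 0 means lam is not an eigenvalue *)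
Definition eig_mult (T A k : R) (lam : C) (m : nat) : Prop :=
  has_indep_eigvecs T A k lam m /\ ~ has_indep_eigvecs T A k lam (S m).

(** Index range of a finite (len = Some N) or countably infinite (len = None) list *)
Definition in_range (len : option nat) (j : nat) : Prop :=
  match len with Some N => (j < N)%nat | None => True end.

Definition real_analytic (f : R -> R) : Prop :=
  forall x0, exists r, 0 < r /\ exists a : nat -> R,
    forall x, Rabs (x - x0) < r -> is_pseries a (x - x0) (f x).

Definition band_count (len : option nat) (f : nat -> R -> R) (k : R) (lam : C) (m : nat)
  : Prop :=
  exists l : list nat, NoDup l /\ length l = m /\
    forall j, (in_range len j /\ RtoC (f j k) = lam) <-> In j l.

Definition is_band_functions (T A : R) (len : option nat) (f : nat -> R -> R) : Prop :=
  (forall j, in_range len j -> real_analytic (f j) /\ forall k, f j k <> 0) /\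
  (forall k (lam : C), lam <> RtoC 0 -> forall m : nat,
      eig_mult T A k lam m <-> band_count len f k lam m).

Definition flat (g : R -> R) : Prop := exists c, forall k, g k = c.

(* Main.v *)
Require Import Defs.
From Stdlib Require Import Reals ZArith List Lra Lia Psatz Ranalysis5 ClassicalEpsilon.
From Stdlib Require Cantor.
From Coquelicot Require Import Coquelicot.
Open Scope R_scope.

(** With [|Gamma(1/2 + i y)|^2 = C / cosh (pi y)] and [y_n = gamma_n x_n], the equation [H(k;A) x = lambda x]
    becomes [y_(n-1) + y_(n+1) = (2 cosh (pi (omega n + k)) / beta - 2 A) y_n] with [beta = C / lambda].  For
    [q = exp (- pi omega)] and [zeta = exp (- pi k)] its decaying solutions come from an entire solution of a
    second-order q-difference equation, and their Wronskian, which vanishes exactly at the eigenvalues (all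
    simple), is [D_0(beta) Th_0(k) + D_1(beta) Th_1(k)]: two fixed positive theta functions, with [D_0] even
    and [D_1] odd in [beta].  So [beta] is a flat band as soon as [beta] and [- beta] are both in the spectrum at
    [k = 0].  For small [A > 0] the Wronskian at minus the top of the odd spectrum is negative, for [A = 1] it
    is positive, and a zero in between is [A_*].  The top of the even spectrum gives a zero [beta] for which
    [- beta] is none; since [Th_1 / Th_0] is not constant, its band is not flat.

    Bands are global analytic branches of the zero set: along [beta' = pi beta] and along [beta' = - pi beta] the
    coefficients of the recurrence move monotonically in opposite directions, so zeros are transversal and
    [|beta'| <= pi |beta|] on every branch, and a branch continues over the whole line.  Distinct branches never
    meet, and each of them is determined by its value at [k = 0], where the zeros are isolated. *)

(** The whole proof stays within real analysis. The modulus of Gamma on the critical line is found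
    without the reflection formula: $|\Gamma(n+\frac12+iy)|^2$ and
    $\int_0^{\pi/2}\cos^{2n-1}t\,\cosh(2yt)\,dt$ obey reciprocal recurrences in $n$, so their
    product is explicit, and each factor has elementary asymptotics. The constant $C$ is
    $\Gamma(\frac12)^2$, of which only the positivity matters. Analyticity is carried by weighted
    $\ell^1$ norms of Taylor coefficients, which survive products, compositions and pointwise
    limits. The parameter $\beta=C/\lambda$ is preferred to $\lambda$ because the power series that
    solves the q-difference equation has coefficients polynomial in $\beta$, and because a change of
    sign of $\beta$ amounts to a change of sign of $A$. At $A=0$ both signs are on the same footing,
    and the Wronskian at minus the top of the odd spectrum vanishes. For small $A>0$ one of its two
    factors becomes positive while the other stays negative, so the intermediate value argument has
    to start from a small positive $A$. *)

Notation is_int0oo f l :=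
  (is_RInt_gen (V := R_NormedModule) f (at_right 0) (Rbar_locally p_infty) l).

(** * Improper integrals over the positive half-line *)

Lemma ex_RInt_pos (f : R -> R) (a b : R) :
  (forall t, 0 < t -> continuous f t) -> 0 < a -> 0 < b -> ex_RInt f a b.
Proof.
intros Hc Ha Hb; apply (ex_RInt_continuous (V := R_CompleteNormedModule)).
intros z [Hz _]; apply Hc.
apply Rlt_le_trans with (2 := Hz); apply Rmin_case; assumption.
Qed.

(** For a nonnegative integrand the proper integrals increase with the interval, so their supremum
    is the limit: one interval that nearly attains it controls all larger ones. *)
Lemma is_int0oo_nonneg_ex (f : R -> R) (M : R) :
  (forall t, 0 < t -> continuous f t) -> (forall t, 0 < t -> 0 <= f t) ->
  (forall a b, 0 < a -> a <= b -> RInt f a b <= M) ->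
  exists l, is_int0oo f l.
Proof.
intros Hc Hpos Hb.
set (E := fun x => exists a b, 0 < a /\ a <= b /\ x = RInt f a b).
destruct (completeness E) as [l [Hub Hlub]].
- exists M; intros x (a & b & Ha & Hab & ->); apply Hb; assumption.
- exists (RInt f 1 1), 1, 1; repeat split; lra.
exists l.
intros P [eps HP].
assert (Hex : exists a b, 0 < a /\ a <= b /\ l - eps < RInt f a b).
{ apply Classical_Prop.NNPP; intros Hn.
  assert (Hl : l <= l - eps).
  { apply Hlub; intros x (a & b & Ha & Hab & ->).
    apply Rnot_lt_le; intros Hlt; apply Hn; exists a, b; auto. }
  generalize (cond_pos eps); lra. }
destruct Hex as (a0 & b0 & Ha0 & Hab0 & Hlt).
apply Filter_prod with (Q := fun a => 0 < a < a0) (R := fun b => b0 < b).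
- exists (mkposreal _ Ha0); intros y Hy Hy0; split; [exact Hy0|].
  unfold ball in Hy; simpl in Hy; unfold AbsRing_ball, abs, minus, plus, opp in Hy.
  simpl in Hy; apply Rabs_lt_between in Hy; lra.
- exists b0; auto.
intros a b [Ha Haa] Hbb; simpl.
exists (RInt f a b); split.
{ apply (RInt_correct (V := R_CompleteNormedModule)), ex_RInt_pos; try assumption; lra. }
apply HP.
assert (H1 : RInt f a b <= l) by (apply Hub; exists a, b; repeat split; lra).
assert (H2 : RInt f a0 b0 <= RInt f a b).
{ assert (E1 := RInt_Chasles (V := R_CompleteNormedModule) f a a0 b
    (ex_RInt_pos f a a0 Hc Ha Ha0) (ex_RInt_pos f a0 b Hc Ha0 ltac:(lra))).
  assert (E2 := RInt_Chasles (V := R_CompleteNormedModule) f a0 b0 b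
    (ex_RInt_pos f a0 b0 Hc Ha0 ltac:(lra)) (ex_RInt_pos f b0 b Hc ltac:(lra) ltac:(lra))).
  unfold plus in E1, E2; simpl in E1, E2.
  assert (P1 : 0 <= RInt f a a0).
  { apply RInt_ge_0; [lra|apply ex_RInt_pos; try assumption|intros x Hx; apply Hpos; lra]. }
  assert (P2 : 0 <= RInt f b0 b).
  { apply RInt_ge_0; [lra|apply ex_RInt_pos; try assumption; lra|intros x Hx; apply Hpos; lra]. }
  lra. }
unfold ball; simpl; unfold AbsRing_ball, abs, minus, plus, opp; simpl.
apply Rabs_lt_between; generalize (cond_pos eps); lra.
Qed.

Lemma near_0oo (P : R * R -> Prop) :
  (forall a b, 0 < a -> a < b -> P (a, b)) ->
  filter_prod (at_right 0) (Rbar_locally p_infty) P.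
Proof.
intros HP.
apply Filter_prod with (Q := fun a => 0 < a < 1) (R := fun b => 1 < b).
- exists (mkposreal _ Rlt_0_1); intros y Hy Hy0; split; [exact Hy0|].
  unfold ball in Hy; simpl in Hy; unfold AbsRing_ball, abs, minus, plus, opp in Hy.
  simpl in Hy; apply Rabs_lt_between in Hy; lra.
- exists 1; auto.
- intros a b Ha Hb; apply HP; lra.
Qed.

Lemma is_int0oo_ext (f g : R -> R) (l : R) :
  (forall t, 0 < t -> f t = g t) -> is_int0oo f l -> is_int0oo g l.
Proof.
intros E; apply is_RInt_gen_ext; apply near_0oo; intros a b Ha Hab x Hx; simpl in Hx.
rewrite Rmin_left in Hx by lra; apply E; lra.
Qed.

Lemma is_int0oo_derive (F f : R -> R) (la lb : R) :
  (forall t, 0 < t -> is_derive F t (f t)) -> (forall t, 0 < t -> continuous f t) ->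
  filterlim F (at_right 0) (locally la) -> filterlim F (Rbar_locally p_infty) (locally lb) ->
  is_int0oo f (lb - la).
Proof.
intros HF Hc Ha Hb.
apply is_int0oo_ext with (Derive F).
{ intros t Ht; apply is_derive_unique, HF, Ht. }
apply is_RInt_gen_Derive; try assumption; apply near_0oo; intros a b Ha' Hab x Hx; simpl in Hx;
  rewrite Rmin_left in Hx by lra.
- eexists; apply HF; lra.
- apply continuous_ext_loc with f; [|apply Hc; lra].
  assert (Hx0 : 0 < x) by lra.
  exists (mkposreal _ Hx0); intros y Hy.
  unfold ball in Hy; simpl in Hy; unfold AbsRing_ball, abs, minus, plus, opp in Hy.
  simpl in Hy; apply Rabs_lt_between in Hy.
  symmetry; apply is_derive_unique, HF; lra.
Qed.

Lemma is_int0oo_lin (f g : R -> R) (a b lf lg : R) :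
  is_int0oo f lf -> is_int0oo g lg -> is_int0oo (fun t => a * f t + b * g t) (a * lf + b * lg).
Proof.
intros Hf Hg.
assert (Hf' := is_RInt_gen_scal f a lf Hf).
assert (Hg' := is_RInt_gen_scal g b lg Hg).
exact (is_RInt_gen_plus _ _ _ _ Hf' Hg').
Qed.

Lemma is_int0oo_le (f g : R -> R) (lf lg : R) :
  (forall t, 0 < t -> f t <= g t) -> is_int0oo f lf -> is_int0oo g lg -> lf <= lg.
Proof.
intros Hle Hf Hg.
assert (H := is_int0oo_lin g f 1 (-1) lg lf Hg Hf).
(* Nonnegativity of the integral of [g - f] is read off from the norm inequality, applied to the
   zero function dominated by [g - f]. *)
assert (norm (V := R_NormedModule) 0 <= 1 * lg + -1 * lf).
{ apply (RInt_gen_norm (V := R_CompleteNormedModule) (Fa := at_right 0)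
    (Fb := Rbar_locally p_infty) (fun _ => 0) (fun t => 1 * g t + -1 * f t)).
  - apply near_0oo; intros a b Ha Hab; simpl; lra.
  - apply near_0oo; intros a b Ha Hab x Hx; simpl in Hx; unfold norm; simpl; unfold abs; simpl.
    rewrite Rabs_R0; specialize (Hle x ltac:(lra)); lra.
  - assert (Z := is_int0oo_lin f f 0 0 lf lf Hf Hf).
    replace 0 with (0 * lf + 0 * lf) at 2 by ring.
    apply is_int0oo_ext with (2 := Z); intros; ring.
  - exact H. }
unfold norm in H0; simpl in H0; unfold abs in H0; simpl in H0; rewrite Rabs_R0 in H0; lra.
Qed.

Lemma is_int0oo_unique (f : R -> R) (l l' : R) : is_int0oo f l -> is_int0oo f l' -> l = l'.
Proof.
intros H H'; apply Rle_antisym; eapply is_int0oo_le; eauto; intros; lra.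
Qed.

Ltac Req := match goal with |- @eq _ ?x ?y => change (@eq R x y) end.

(** * Moments of the Gamma density and the modulus of Gamma(n + 1/2 + iy) *)

Definition gker (n : nat) (t : R) : R := / sqrt t * t ^ n * exp (- t).

Lemma gker_pos n t : 0 < t -> 0 < gker n t.
Proof.
intros Ht; unfold gker.
assert (0 < sqrt t) by (apply sqrt_lt_R0; exact Ht).
apply Rmult_lt_0_compat; [apply Rmult_lt_0_compat|apply exp_pos].
- apply Rinv_0_lt_compat; assumption.
- apply pow_lt; exact Ht.
Qed.

Lemma gker_cont n t : 0 < t -> continuous (gker n) t.
Proof.
intros Ht; assert (0 < sqrt t) by (apply sqrt_lt_R0; exact Ht).
apply (ex_derive_continuous (V := R_NormedModule)).
unfold gker; auto_derive; repeat split; auto; lra.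
Qed.

Lemma gker_S n t : gker (S n) t = t * gker n t.
Proof. unfold gker; simpl; ring. Qed.

(** Real combinations of the real and imaginary parts of $t^{iy}$. Carrying both coordinates at once
    turns the functional equation of Gamma into a linear change of [a] and [b]. *)
Definition trig (a b y t : R) : R := a * cos (y * ln t) + b * sin (y * ln t).

Lemma trig_le a b y t : Rabs (trig a b y t) <= Rabs a + Rabs b.
Proof.
unfold trig; eapply Rle_trans; [apply Rabs_triang|rewrite !Rabs_mult].
assert (Rabs (cos (y * ln t)) <= 1) by (apply Rabs_le; generalize (COS_bound (y * ln t)); lra).
assert (Rabs (sin (y * ln t)) <= 1) by (apply Rabs_le; generalize (SIN_bound (y * ln t)); lra).
generalize (Rabs_pos a) (Rabs_pos b); nra.
Qed.

Lemma gker_trig_cont n a b y t : 0 < t -> continuous (fun t => gker n t * trig a b y t) t.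
Proof.
intros Ht; assert (0 < sqrt t) by (apply sqrt_lt_R0; exact Ht).
apply (ex_derive_continuous (V := R_NormedModule)).
unfold gker, trig; auto_derive; repeat split; auto; lra.
Qed.

(** The boundary term of the integration by parts behind $\Gamma(s+1)=s\Gamma(s)$ at
    $s=n+\frac12+iy$; it vanishes at both ends. *)
Definition gprim (n : nat) (a b y t : R) : R := gker (S n) t * trig a b y t.

Lemma gprim_derive n a b y t : 0 < t ->
  is_derive (gprim n a b y) t
    (gker n t * trig ((INR n + /2) * a + y * b) ((INR n + /2) * b - y * a) y t
     - gker (S n) t * trig a b y t).
Proof.
intros Ht; assert (Hs : 0 < sqrt t) by (apply sqrt_lt_R0; exact Ht).
assert (E : t = sqrt t * sqrt t) by (rewrite sqrt_sqrt; lra).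
unfold gprim, trig, gker; auto_derive; [repeat split; auto; lra|].
rewrite <- (tech_pow_Rmult t n).
change (match n with O => 1 | S _ => INR n + 1 end) with (INR (S n)).
rewrite ?S_INR, ?Rmult_1_r; simpl pow; simpl pred.
generalize (t ^ n) (exp (- t)) (cos (y * ln t)) (sin (y * ln t)) (INR n).
intros p e c s N; revert Hs E; generalize (sqrt t); intros r Hs E.
subst t; field; lra.
Qed.

Lemma exp_pow_INR (x : R) (n : nat) : exp x ^ n = exp (INR n * x).
Proof.
induction n as [|n IH]; [simpl; rewrite Rmult_0_l, exp_0; reflexivity|].
rewrite <- tech_pow_Rmult, IH, <- exp_plus, S_INR; f_equal; ring.
Qed.

(** The inequality $u\le e^u$ at $u=t/(m+1)$, raised to the power $m+1$. *)
Lemma pow_exp_le (m : nat) (t : R) : 0 < t -> t ^ m * exp (- t) <= INR (S m) ^ S m / t.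
Proof.
intros Ht.
assert (Hm : 0 < INR (S m)) by apply lt_0_INR, Nat.lt_0_succ.
assert (He : (t / INR (S m)) ^ S m <= exp t).
{ replace (exp t) with (exp (t / INR (S m)) ^ S m).
  - apply pow_incr; split; [apply Rlt_le, Rdiv_lt_0_compat; assumption|].
    generalize (exp_ineq1_le (t / INR (S m))); lra.
  - rewrite exp_pow_INR; f_equal; field; lra. }
unfold Rdiv in He; rewrite Rpow_mult_distr, pow_inv in He.
assert (HP : 0 < INR (S m) ^ S m) by (apply pow_lt; exact Hm).
rewrite exp_Ropp.
apply Rmult_le_reg_r with (exp t * t); [apply Rmult_lt_0_compat; [apply exp_pos|exact Ht]|].
replace (t ^ m * / exp t * (exp t * t)) with (t ^ S m)
  by (simpl; field; apply Rgt_not_eq, exp_pos).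
replace (INR (S m) ^ S m / t * (exp t * t)) with (INR (S m) ^ S m * exp t) by (field; lra).
apply Rmult_le_reg_r with (/ INR (S m) ^ S m); [apply Rinv_0_lt_compat, HP|].
replace (INR (S m) ^ S m * exp t * / INR (S m) ^ S m) with (exp t) by (field; lra).
exact He.
Qed.

Lemma gker_le_sqrt n t : 0 < t <= 1 -> gker (S n) t <= sqrt t.
Proof.
intros [Ht Ht1]; assert (Hs : 0 < sqrt t) by (apply sqrt_lt_R0; exact Ht).
assert (E : t = sqrt t * sqrt t) by (rewrite sqrt_sqrt; lra).
unfold gker; rewrite <- (tech_pow_Rmult t n).
replace (/ sqrt t * (t * t ^ n) * exp (- t)) with (sqrt t * (t ^ n * exp (- t))).
- rewrite <- (Rmult_1_r (sqrt t)) at 2; apply Rmult_le_compat_l; [lra|].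
  assert (t ^ n <= 1) by (rewrite <- (pow1 n); apply pow_incr; lra).
  assert (0 <= t ^ n) by (apply pow_le; lra).
  assert (exp (- t) <= 1) by (rewrite <- exp_0; left; apply exp_increasing; lra).
  generalize (exp_pos (- t)); nra.
- generalize (t ^ n) (exp (- t)); revert Hs E; generalize (sqrt t); intros r Hs E p e.
  subst t; field; lra.
Qed.

Lemma gker_le_inv n t : 1 <= t -> gker n t <= INR (S n) ^ S n / t.
Proof.
intros Ht; eapply Rle_trans; [|apply pow_exp_le; lra].
unfold gker.
assert (1 <= sqrt t) by (rewrite <- sqrt_1; apply sqrt_le_1; lra).
assert (/ sqrt t <= 1) by (rewrite <- Rinv_1; apply Rinv_le_contravar; lra).
assert (0 < t ^ n * exp (- t)) by (apply Rmult_lt_0_compat; [apply pow_lt; lra|apply exp_pos]).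
rewrite Rmult_assoc; nra.
Qed.

Lemma gprim_abs n a b y t : 0 < t -> Rabs (gprim n a b y t) <= (Rabs a + Rabs b) * gker (S n) t.
Proof.
intros Ht; unfold gprim; rewrite Rabs_mult, (Rabs_pos_eq (gker _ _)) by (left; apply gker_pos, Ht).
rewrite Rmult_comm; apply Rmult_le_compat_r; [left; apply gker_pos, Ht|apply trig_le].
Qed.

Lemma gprim_lim0 n a b y : filterlim (gprim n a b y) (at_right 0) (locally 0).
Proof.
intros P [eps HP]; generalize (cond_pos eps); intros He.
set (c := Rabs a + Rabs b + 1).
assert (Hc : 0 < c) by (unfold c; generalize (Rabs_pos a) (Rabs_pos b); lra).
assert (Hd : 0 < Rmin 1 ((eps / c) ^ 2)).
{ apply Rmin_case; [lra|apply pow_lt, Rdiv_lt_0_compat; lra]. }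
exists (mkposreal _ Hd); intros t Ht Ht0; apply HP.
unfold ball in Ht |- *; simpl in Ht |- *; unfold AbsRing_ball, abs, minus, plus, opp in Ht |- *.
simpl in Ht |- *; rewrite Ropp_0, Rplus_0_r in Ht |- *; rewrite Rabs_pos_eq in Ht by lra.
eapply Rle_lt_trans; [apply gprim_abs, Ht0|].
assert (Ht1 : t < 1) by (eapply Rlt_le_trans; [exact Ht|apply Rmin_l]).
assert (Ht2 : t < (eps / c) ^ 2) by (eapply Rlt_le_trans; [exact Ht|apply Rmin_r]).
assert (Hs : sqrt t < eps / c).
{ rewrite <- (sqrt_pow2 (eps / c)) by (left; apply Rdiv_lt_0_compat; lra).
  apply sqrt_lt_1; [lra|apply pow2_ge_0|exact Ht2]. }
assert (Hg := gker_le_sqrt n t ltac:(lra)).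
apply Rle_lt_trans with (c * gker (S n) t).
- apply Rmult_le_compat_r; [left; apply gker_pos, Ht0|unfold c; lra].
- replace (pos eps) with (c * (eps / c)) by (field; lra).
  apply Rmult_lt_compat_l; lra.
Qed.

Lemma gprim_lim_oo n a b y : filterlim (gprim n a b y) (Rbar_locally p_infty) (locally 0).
Proof.
intros P [eps HP]; generalize (cond_pos eps); intros He.
set (c := Rabs a + Rabs b + 1).
assert (Hc : 0 < c) by (unfold c; generalize (Rabs_pos a) (Rabs_pos b); lra).
set (B := INR (S (S n)) ^ S (S n)).
assert (HB : 0 < B) by (apply pow_lt, lt_0_INR, Nat.lt_0_succ).
exists (Rmax 1 (c * B / eps)); intros t Ht; apply HP.
assert (Ht1 : 1 < t) by (eapply Rle_lt_trans; [apply Rmax_l|exact Ht]).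
assert (Ht2 : c * B / eps < t) by (eapply Rle_lt_trans; [apply Rmax_r|exact Ht]).
unfold ball; simpl; unfold AbsRing_ball, abs, minus, plus, opp; simpl.
rewrite Ropp_0, Rplus_0_r.
eapply Rle_lt_trans; [apply gprim_abs; lra|].
assert (Hg := gker_le_inv (S n) t ltac:(lra)); fold B in Hg.
apply Rle_lt_trans with (c * (B / t)).
- apply Rmult_le_compat; try (generalize (Rabs_pos a) (Rabs_pos b); lra).
  + left; apply gker_pos; lra.
  + unfold c; lra.
- apply Rmult_lt_reg_r with (t / eps); [apply Rdiv_lt_0_compat; lra|].
  replace (c * (B / t) * (t / eps)) with (c * B / eps) by (field; lra).
  replace (eps * (t / eps)) with t by (field; lra); exact Ht2.
Qed.

(** Induction on [n]. The case 0 compares $e^{-t}$ with $1/(1+t)$, whose integral against $t^{-1/2}$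
    is $2\arctan\sqrt t$. The step integrates by parts and needs only a pointwise bound on the
    boundary term. *)
Lemma gker_int_bound n : exists M, forall a b, 0 < a -> a <= b -> RInt (gker n) a b <= M.
Proof.
induction n as [|n [M IH]].
- exists PI; intros a b Ha Hab.
  assert (HD : is_RInt (fun t => / sqrt t / (1 + t)) a b (2 * atan (sqrt b) - 2 * atan (sqrt a))).
  { apply (is_RInt_derive (V := R_CompleteNormedModule) (fun t => 2 * atan (sqrt t))); intros t Ht;
      rewrite Rmin_left in Ht by exact Hab;
      assert (Hs : 0 < sqrt t) by (apply sqrt_lt_R0; lra).
    - auto_derive; [repeat split; auto; lra|].
      assert (E : t = sqrt t * sqrt t) by (rewrite sqrt_sqrt; lra).
      revert Hs E; generalize (sqrt t); intros r Hs E; rewrite E.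
      unfold Rsqr; field; repeat split; try lra; nra.
    - apply (ex_derive_continuous (V := R_NormedModule)).
      auto_derive; repeat split; auto; lra. }
  apply Rle_trans with (RInt (fun t => / sqrt t / (1 + t)) a b).
  + apply RInt_le; [exact Hab|apply ex_RInt_pos; [apply gker_cont|lra|lra]|eexists; exact HD|].
    intros t Ht; unfold gker; simpl; rewrite Rmult_1_r.
    apply Rmult_le_compat_l; [left; apply Rinv_0_lt_compat, sqrt_lt_R0; lra|].
    rewrite exp_Ropp; apply Rinv_le_contravar; [lra|apply exp_ineq1_le].
  + rewrite (is_RInt_unique _ _ _ _ HD).
    generalize (atan_bound (sqrt b)) (atan_bound (sqrt a)); intros.
    assert (atan (sqrt a) >= 0).
    { rewrite <- atan_0; apply Rle_ge; destruct (sqrt_pos a) as [Hs|Hs].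
      - left; apply atan_increasing, Hs.
      - rewrite <- Hs; lra. }
    lra.
- set (B := 1 + INR (S (S n)) ^ S (S n)).
  assert (HB : forall t, 0 < t -> gker (S n) t <= B).
  { intros t Ht; assert (HB0 : 0 < INR (S (S n)) ^ S (S n))
      by (apply pow_lt, lt_0_INR, Nat.lt_0_succ).
    destruct (Rle_lt_dec t 1).
    - eapply Rle_trans; [apply gker_le_sqrt; lra|].
      apply Rle_trans with 1; [rewrite <- sqrt_1; apply sqrt_le_1; lra|unfold B; lra].
    - eapply Rle_trans; [apply gker_le_inv; lra|].
      unfold B; assert (/ t <= 1) by (rewrite <- Rinv_1; apply Rinv_le_contravar; lra).
      unfold Rdiv; nra. }
  exists ((INR n + /2) * M + B); intros a b Ha Hab.
  assert (HD : is_RInt (fun t => (INR n + /2) * gker n t - gker (S n) t) a b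
                 (gker (S n) b - gker (S n) a)).
  { apply (is_RInt_derive (V := R_CompleteNormedModule) (gker (S n))); intros t Ht;
      rewrite Rmin_left in Ht by exact Hab.
    - apply is_derive_ext with (gprim n 1 0 0).
      + intros u; unfold gprim, trig; rewrite Rmult_0_l, cos_0; Req; ring.
      + evar_last; [apply gprim_derive; lra|].
        unfold trig; rewrite !Rmult_0_l, cos_0, sin_0; Req; ring.
    - apply (continuous_minus (V := R_NormedModule));
        [apply (continuous_mult (K := R_AbsRing)); [apply continuous_const|]|]; apply gker_cont; lra. }
  assert (X0 : ex_RInt (gker n) a b) by (apply ex_RInt_pos; [apply gker_cont|lra|lra]).
  assert (X1 : ex_RInt (gker (S n)) a b) by (apply ex_RInt_pos; [apply gker_cont|lra|lra]).
  assert (HE : is_RInt (fun t => (INR n + /2) * gker n t - gker (S n) t) a b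
    ((INR n + /2) * RInt (gker n) a b - RInt (gker (S n)) a b)).
  { apply (is_RInt_minus (V := R_NormedModule)); [|apply (RInt_correct (V := R_CompleteNormedModule)), X1].
    apply (is_RInt_scal (V := R_NormedModule)), (RInt_correct (V := R_CompleteNormedModule)), X0. }
  assert (EE := is_RInt_unique _ _ _ _ HD); rewrite (is_RInt_unique _ _ _ _ HE) in EE.
  assert (H1 := HB a Ha); assert (H2 := gker_pos (S n) b ltac:(lra)).
  assert (H3 := IH a b Ha Hab); assert (H4 := pos_INR n); nra.
Qed.

Lemma gker_trig_ex n a b y : exists l, is_int0oo (fun t => gker n t * trig a b y t) l.
Proof.
destruct (gker_int_bound n) as [M HM].
assert (H1 : exists l, is_int0oo (gker n) l).
{ apply is_int0oo_nonneg_ex with M; [apply gker_cont|intros; left; apply gker_pos; assumption|exact HM]. }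
destruct H1 as [l1 Hl1].
(* Shifting [trig] by [c] makes the integrand nonnegative, so that bounded monotone integrals apply;
   the shift is subtracted at the end. *)
set (c := Rabs a + Rabs b).
assert (Hc : 0 <= c) by (unfold c; generalize (Rabs_pos a) (Rabs_pos b); lra).
assert (HC : forall t, 0 < t -> continuous (fun t => gker n t * (c + trig a b y t)) t).
{ intros t Ht; apply continuous_ext with (fun t => c * gker n t + gker n t * trig a b y t).
  - intros; simpl; ring.
  - apply (continuous_plus (V := R_NormedModule)); [|apply gker_trig_cont, Ht].
    apply (continuous_mult (K := R_AbsRing)); [apply continuous_const|apply gker_cont, Ht]. }
assert (H2 : exists l, is_int0oo (fun t => gker n t * (c + trig a b y t)) l).
{ apply is_int0oo_nonneg_ex with (2 * c * M); [exact HC| |].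
  - intros t Ht; apply Rmult_le_pos; [left; apply gker_pos, Ht|].
    generalize (trig_le a b y t); fold c; intros H; apply Rabs_le_between in H; lra.
  - intros u v Hu Huv.
    assert (X0 : ex_RInt (gker n) u v) by (apply ex_RInt_pos; [apply gker_cont|lra|lra]).
    apply Rle_trans with (RInt (fun t => 2 * c * gker n t) u v).
    + apply RInt_le; [exact Huv|apply ex_RInt_pos; [exact HC|lra|lra]| |].
      * apply (ex_RInt_scal (V := R_NormedModule)), X0.
      * intros t Ht; rewrite Rmult_comm; apply Rmult_le_compat_r; [left; apply gker_pos; lra|].
        generalize (trig_le a b y t); fold c; intros H; apply Rabs_le_between in H; lra.
    + rewrite (RInt_scal (V := R_CompleteNormedModule)) by exact X0.
      apply Rmult_le_compat_l; [lra|apply HM; assumption]. }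
destruct H2 as [l2 Hl2].
exists (1 * l2 + (- c) * l1).
apply is_int0oo_ext with (2 := is_int0oo_lin _ _ 1 (- c) _ _ Hl2 Hl1); intros; ring.
Qed.

(** $a\,\mathrm{Re}\,\Gamma(n+\frac12+iy)+b\,\mathrm{Im}\,\Gamma(n+\frac12+iy)$. *)
Definition gmom (n : nat) (a b y : R) : R :=
  RInt_gen (fun t => gker n t * trig a b y t) (at_right 0) (Rbar_locally p_infty).

Lemma gmom_correct n a b y : is_int0oo (fun t => gker n t * trig a b y t) (gmom n a b y).
Proof.
destruct (gker_trig_ex n a b y) as [l Hl].
unfold gmom; rewrite (is_RInt_gen_unique _ _ Hl); exact Hl.
Qed.

Lemma gmom_lin n a b a' b' c d y :
  gmom n (c * a + d * a') (c * b + d * b') y = c * gmom n a b y + d * gmom n a' b' y.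
Proof.
eapply is_int0oo_unique; [apply gmom_correct|].
eapply is_int0oo_ext; [|apply (is_int0oo_lin _ _ c d _ _ (gmom_correct n a b y) (gmom_correct n a' b' y))].
intros t _; unfold trig; ring.
Qed.

Lemma gmom_coord n a b y : gmom n a b y = a * gmom n 1 0 y + b * gmom n 0 1 y.
Proof. rewrite <- gmom_lin; f_equal; ring. Qed.

(** This is $\Gamma(s+1)=s\Gamma(s)$ in coordinates: [(a, b)] undergoes the transpose of the
    multiplication by $s=n+\frac12+iy$. *)
Lemma gmom_S n a b y :
  gmom (S n) a b y = gmom n ((INR n + /2) * a + y * b) ((INR n + /2) * b - y * a) y.
Proof.
eapply is_int0oo_unique; [apply gmom_correct|].
assert (H := is_int0oo_derive (gprim n a b y) _ 0 0 (gprim_derive n a b y)).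
eapply (is_int0oo_ext (fun t => 1 * (gker n t * trig ((INR n + /2) * a + y * b) ((INR n + /2) * b - y * a) y t)
  + -1 * (gker n t * trig ((INR n + /2) * a + y * b) ((INR n + /2) * b - y * a) y t
     - gker (S n) t * trig a b y t))); [intros; ring|].
replace (gmom n _ _ y) with
  (1 * gmom n ((INR n + /2) * a + y * b) ((INR n + /2) * b - y * a) y + -1 * (0 - 0)) by ring.
apply is_int0oo_lin; [apply gmom_correct|].
apply H; [|apply gprim_lim0|apply gprim_lim_oo].
intros t Ht; apply (continuous_minus (V := R_NormedModule)); apply gker_trig_cont, Ht.
Qed.

Definition gnorm (n : nat) (y : R) : R := gmom n 1 0 y ^ 2 + gmom n 0 1 y ^ 2.

Lemma gnorm_S n y : gnorm (S n) y = ((INR n + /2) ^ 2 + y ^ 2) * gnorm n y.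
Proof.
unfold gnorm; rewrite !gmom_S, (gmom_coord n _ _ y), (gmom_coord n (_ * 0 + _) _ y); ring.
Qed.

Lemma gmom_0_S n : gmom (S n) 1 0 0 = (INR n + /2) * gmom n 1 0 0.
Proof. rewrite gmom_S, gmom_coord; ring. Qed.

Lemma gker_correct n : is_int0oo (gker n) (gmom n 1 0 0).
Proof.
eapply is_int0oo_ext; [|apply gmom_correct].
intros t _; unfold trig; rewrite Rmult_0_l, cos_0; ring.
Qed.

Lemma gmom_0_pos n : 0 < gmom n 1 0 0.
Proof.
assert (H := gker_correct n).
destruct (Rle_lt_dec (gmom n 1 0 0) 0) as [Hle|]; [exfalso|assumption].
assert (X : ex_RInt (gker n) 1 2) by (apply ex_RInt_pos; [apply gker_cont|lra|lra]).
assert (Hp : 0 < RInt (gker n) 1 2).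
{ apply RInt_gt_0; [lra|intros; apply gker_pos; lra|intros; apply gker_cont; lra]. }
set (e := RInt (gker n) 1 2) in *.
assert (HL : locally (gmom n 1 0 0) (fun x => x < gmom n 1 0 0 + e)).
{ exists (mkposreal _ Hp); intros y Hy.
  unfold ball in Hy; simpl in Hy; unfold AbsRing_ball, abs, minus, plus, opp in Hy.
  simpl in Hy; apply Rabs_lt_between in Hy; lra. }
specialize (H _ HL).
assert (H' : filter_prod (at_right 0) (Rbar_locally p_infty)
  (fun ab => (0 < fst ab < 1 /\ 2 < snd ab) /\
     (exists y, is_RInt (gker n) (fst ab) (snd ab) y /\ y < gmom n 1 0 0 + e))).
{ apply filter_and; [|exact H].
  apply Filter_prod with (Q := fun a => 0 < a < 1) (R := fun b => 2 < b).
  - exists (mkposreal _ Rlt_0_1); intros y Hy Hy0; split; [exact Hy0|].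
    unfold ball in Hy; simpl in Hy; unfold AbsRing_ball, abs, minus, plus, opp in Hy.
    simpl in Hy; apply Rabs_lt_between in Hy; lra.
  - exists 2; auto.
  - intros; simpl; auto. }
destruct (filter_ex _ H') as [[a b] [[Ha Hb] (z & Hz & Hlt)]]; simpl in *.
rewrite <- (is_RInt_unique _ _ _ _ Hz) in Hlt.
assert (Xa : ex_RInt (gker n) a 1) by (apply ex_RInt_pos; [apply gker_cont|lra|lra]).
assert (Xb : ex_RInt (gker n) 2 b) by (apply ex_RInt_pos; [apply gker_cont|lra|lra]).
assert (Xc : ex_RInt (gker n) 1 b) by (apply ex_RInt_pos; [apply gker_cont|lra|lra]).
assert (E1 := RInt_Chasles (V := R_CompleteNormedModule) _ _ _ _ Xa Xc).
assert (E2 := RInt_Chasles (V := R_CompleteNormedModule) _ _ _ _ X Xb).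
unfold plus in E1, E2; simpl in E1, E2; fold e in E2.
assert (0 <= RInt (gker n) a 1) by (apply RInt_ge_0; [lra|assumption|intros; left; apply gker_pos; lra]).
assert (0 <= RInt (gker n) 2 b) by (apply RInt_ge_0; [lra|assumption|intros; left; apply gker_pos; lra]).
lra.
Qed.

Lemma gmom_le n a b y : a ^ 2 + b ^ 2 = 1 -> gmom n a b y <= gmom n 1 0 0.
Proof.
intros Hab; eapply is_int0oo_le; [|apply gmom_correct|apply gker_correct].
intros t Ht; apply Rle_trans with (gker n t * 1); [|lra]; apply Rmult_le_compat_l; [left; apply gker_pos, Ht|].
assert (H := sin2_cos2 (y * ln t)); unfold Rsqr in H; unfold trig.
revert H; generalize (cos (y * ln t)) (sin (y * ln t)); intros c s H.
generalize (pow2_ge_0 (a - c)) (pow2_ge_0 (b - s)); nra.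
Qed.

(** Testing [gmom_le] on the unit vector in the direction of $\Gamma(s)$ yields
    $|\Gamma(s)|\le\Gamma(\mathrm{Re}\,s)$. *)
Lemma gnorm_le n y : gnorm n y <= gmom n 1 0 0 ^ 2.
Proof.
unfold gnorm; set (X := gmom n 1 0 y); set (Y := gmom n 0 1 y).
assert (Hm := gmom_0_pos n).
destruct (Req_dec (X ^ 2 + Y ^ 2) 0) as [E|E]; [rewrite E; nra|].
assert (Hp : 0 < X ^ 2 + Y ^ 2) by nra.
set (r := sqrt (X ^ 2 + Y ^ 2)).
assert (Hr : 0 < r) by (apply sqrt_lt_R0, Hp).
assert (Er : r * r = X ^ 2 + Y ^ 2) by (apply sqrt_sqrt; lra).
assert (H := gmom_le n (X / r) (Y / r) y).
rewrite gmom_coord in H; fold X Y in H.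
assert (H1 : X / r * X + Y / r * Y = r).
{ apply (Rmult_eq_reg_l r); [|lra]; rewrite Er; field; lra. }
rewrite H1 in H.
assert (H2 : (X / r) ^ 2 + (Y / r) ^ 2 = 1).
{ apply (Rmult_eq_reg_l (r * r)); [|nra]; rewrite Er at 2; field; lra. }
specialize (H H2); rewrite <- Er; nra.
Qed.

(** With $u=\frac12\ln x$ this is $(2u)^2\le(2\sinh u)^2$. It converts the error in
    $\cos(y\ln(t/n))$ into moments of neighbouring orders, which the recurrence evaluates. *)
Lemma ln_sqr_le x : 0 < x -> ln x ^ 2 <= x - 2 + / x.
Proof.
intros Hx.
assert (Eu : exists u, u = ln x / 2) by (eexists; reflexivity); destruct Eu as [u Eu].
assert (E1 : x = exp u * exp u).
{ rewrite <- exp_plus, <- (exp_ln x Hx) at 1; f_equal; rewrite Eu; field. }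
assert (E3 : exp u * exp (- u) = 1) by (rewrite <- exp_plus, Rplus_opp_r, exp_0; reflexivity).
assert (E2 : exp (- u) * exp (- u) = / x).
{ rewrite E1, exp_Ropp; field; apply Rgt_not_eq, exp_pos. }
replace (x - 2 + / x) with ((exp u - exp (- u)) ^ 2) by (rewrite <- E2; rewrite E1 at 1; nra).
replace (ln x ^ 2) with ((2 * u) ^ 2) by (rewrite Eu; field).
assert (Hs : forall v, 0 <= v -> 2 * v <= exp v - exp (- v)).
{ intros v Hv.
  destruct (MVT_gen (fun w => exp w - exp (- w)) 0 v (fun w => exp w + exp (- w))) as (c & Hc & Ec).
  - intros w _; auto_derive; [trivial|ring].
  - intros w _; apply continuity_pt_filterlim.
    apply (ex_derive_continuous (V := R_NormedModule) (fun w => exp w - exp (- w))).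
    auto_derive; trivial.
  - rewrite Ropp_0 in Ec.
    replace (exp v - exp (- v)) with ((exp c + exp (- c)) * v) by lra.
    apply Rmult_le_compat_r; [exact Hv|].
    assert (exp c * exp (- c) = 1) by (rewrite <- exp_plus, Rplus_opp_r, exp_0; reflexivity).
    assert (0 <= (exp c - exp (-c)) ^ 2) by apply pow2_ge_0.
    generalize (exp_pos c) (exp_pos (- c)); nra. }
destruct (Rle_lt_dec 0 u) as [Hu|Hu].
- specialize (Hs u Hu); nra.
- specialize (Hs (- u) ltac:(lra)); rewrite Ropp_involutive in Hs; nra.
Qed.

Lemma cos_ge_quad x : 1 - x ^ 2 / 2 <= cos x.
Proof.
assert (H : forall x, 0 <= x -> sin x <= x).
{ intros z [Hz|<-]; [left; apply sin_lt_x, Hz|rewrite sin_0; lra]. }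
replace x with (2 * (x / 2)) at 2 by field; rewrite cos_2a_sin.
assert (sin (x / 2) * sin (x / 2) <= (x / 2) ^ 2); [|nra].
destruct (Rle_lt_dec 0 (x / 2)) as [Hx|Hx].
- assert (H1 := H _ Hx).
  assert (H2 : - (x / 2) <= sin (x / 2)).
  { destruct (Rle_lt_dec (x / 2) 1).
    - assert (0 <= sin (x / 2)) by (apply sin_ge_0; [lra|generalize PI_4 PI2_1; lra]); lra.
    - generalize (SIN_bound (x / 2)); lra. }
  nra.
- assert (H1 := H (- (x / 2)) ltac:(lra)); rewrite sin_neg in H1.
  assert (H2 : sin (x / 2) <= - (x / 2)).
  { destruct (Rle_lt_dec (- (x / 2)) 1).
    - assert (0 <= sin (- (x / 2))) by (apply sin_ge_0; [lra|generalize PI_4 PI2_1; lra]).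
      rewrite sin_neg in H0; lra.
    - generalize (SIN_bound (x / 2)); lra. }
  nra.
Qed.

(* Rotating by [n^(-iy)] makes the oscillating factor [(t/n)^(iy)], which is close to [1] where
   the Gamma density [t^(n-1/2) e^(-t)] is concentrated. *)
Lemma gmom_ge p y : let n := S p in
  gmom n 1 0 0 * (1 - y ^ 2 / INR n) <= gmom n (cos (y * ln (INR n))) (sin (y * ln (INR n))) y.
Proof.
intros n; assert (Hn : 1 <= INR n) by (unfold n; rewrite S_INR; generalize (pos_INR p); lra).
set (c := y ^ 2 / 2).
(* The minorant $1-c\,(t/n-2+n/t)$ of the cosine, times the density, is a combination of three
   consecutive kernels. *)
assert (HI : is_int0oo (fun t => (1 + 2 * c) * gker n t +
    1 * ((- c / INR n) * gker (S n) t + (- c * INR n) * gker p t))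
  ((1 + 2 * c) * gmom n 1 0 0 + 1 * ((- c / INR n) * gmom (S n) 1 0 0 + (- c * INR n) * gmom p 1 0 0))).
{ apply is_int0oo_lin; [apply gker_correct|apply is_int0oo_lin; apply gker_correct]. }
assert (HL : (1 + 2 * c) * gmom n 1 0 0 +
    1 * ((- c / INR n) * gmom (S n) 1 0 0 + (- c * INR n) * gmom p 1 0 0)
  <= gmom n (cos (y * ln (INR n))) (sin (y * ln (INR n))) y).
{ eapply is_int0oo_le; [|exact HI|apply gmom_correct].
  intros t Ht.
  assert (EG : gker n t = t * gker p t) by apply gker_S.
  cbv beta; rewrite (gker_S n t), EG.
  assert (Hq : 0 < t / INR n) by (apply Rdiv_lt_0_compat; lra).
  assert (H1 := ln_sqr_le _ Hq).
  assert (H2 := cos_ge_quad (y * ln (t / INR n))).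
  assert (E : trig (cos (y * ln (INR n))) (sin (y * ln (INR n))) y t = cos (y * ln (t / INR n))).
  { unfold trig; rewrite (ln_div t (INR n)) by lra.
    rewrite Rmult_minus_distr_l, cos_minus; ring. }
  rewrite E.
  assert (H3 : t / INR n - 2 + / (t / INR n) >= 0) by (generalize (pow2_ge_0 (ln (t / INR n))); lra).
  assert (H4 : 1 - c * (t / INR n - 2 + / (t / INR n)) <= cos (y * ln (t / INR n))).
  { eapply Rle_trans; [|exact H2]; unfold c; rewrite Rpow_mult_distr.
    generalize (pow2_ge_0 y); nra. }
  assert (Hg := gker_pos p t Ht).
  apply Rle_trans with (t * gker p t * (1 - c * (t / INR n - 2 + / (t / INR n)))).
  - right; field; lra.
  - apply Rmult_le_compat_l; [nra|exact H4]. }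
eapply Rle_trans; [|exact HL].
assert (E1 : gmom (S n) 1 0 0 = (INR n + /2) * gmom n 1 0 0) by apply gmom_0_S.
assert (E2 : gmom n 1 0 0 = (INR n - /2) * gmom p 1 0 0).
{ unfold n at 1; rewrite gmom_0_S; unfold n; rewrite S_INR; f_equal; lra. }
assert (Hp := gmom_0_pos p).
rewrite E1, E2.
assert (Hc : 0 <= c) by (unfold c; generalize (pow2_ge_0 y); lra).
replace (y ^ 2) with (2 * c) by (unfold c; field).
apply Rminus_le_0.
replace (_ - _) with (gmom p 1 0 0 * c * ((INR n - /2) * (2 + 2 / INR n - (INR n + /2) / INR n) - INR n))
  by (field; lra).
apply Rmult_le_pos; [apply Rmult_le_pos; lra|].
replace (_ - _) with (1 - 3 / 4 * / INR n) by (field; lra).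
assert (/ INR n <= 1) by (rewrite <- Rinv_1; apply Rinv_le_contravar; lra); lra.
Qed.

(** A vector is at least as long as its component along the unit vector of [gmom_ge]. The hypothesis
    keeps that lower bound nonnegative, so that it can be squared. *)
Lemma gnorm_ge p y : y ^ 2 <= INR (S p) ->
  gmom (S p) 1 0 0 ^ 2 * (1 - y ^ 2 / INR (S p)) ^ 2 <= gnorm (S p) y.
Proof.
intros Hy; assert (H := gmom_ge p y); cbv zeta in H.
assert (Hn : 0 < INR (S p)) by apply lt_0_INR, Nat.lt_0_succ.
assert (Hm := gmom_0_pos (S p)).
rewrite (gmom_coord _ (cos _)) in H.
assert (Ht : 0 <= 1 - y ^ 2 / INR (S p)).
{ apply (Rmult_le_reg_r (INR (S p))); [exact Hn|].
  replace ((1 - y ^ 2 / INR (S p)) * INR (S p)) with (INR (S p) - y ^ 2) by (field; lra); lra. }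
assert (Hcs := sin2_cos2 (y * ln (INR (S p)))); unfold Rsqr in Hcs.
unfold gnorm; rewrite <- Rpow_mult_distr.
revert H Hcs; generalize (cos (y * ln (INR (S p)))) (sin (y * ln (INR (S p)))); intros c s H Hcs.
eapply Rle_trans; [apply pow_incr; split; [|exact H]; apply Rmult_le_pos; lra|].
set (X := gmom (S p) 1 0 y); set (Y := gmom (S p) 0 1 y).
assert (0 <= (s * X - c * Y) ^ 2) by apply pow2_ge_0.
replace (X ^ 2 + Y ^ 2) with ((s * s + c * c) * (X ^ 2 + Y ^ 2)) by (rewrite Hcs; ring).
nra.
Qed.

(** * Cosine integrals and the product of |Gamma(1/2 + iy)|^2 with cosh(pi y) *)

Ltac solve_cont := apply (ex_derive_continuous (V := R_NormedModule)); auto_derive; trivial.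

(** Chosen because its recurrence, at argument [2 * y] and odd order, contains the same factor
    $(n+\frac12)^2+y^2$ as that of [gnorm], while order 1 produces the hyperbolic cosine. *)
Definition cosmom (n : nat) (y : R) : R := RInt (fun t => cos t ^ n * cosh (y * t)) 0 (PI / 2).

Lemma cosmom_ex n y : ex_RInt (fun t => cos t ^ n * cosh (y * t)) 0 (PI / 2).
Proof.
apply (ex_RInt_continuous (V := R_CompleteNormedModule)); intros z _.
unfold cosh; solve_cont.
Qed.

Lemma cosmom_1 y : cosmom 1 y = cosh (PI / 2 * y) / (1 + y ^ 2).
Proof.
apply is_RInt_unique.
assert (Hy : 1 + y ^ 2 <> 0) by (generalize (pow2_ge_0 y); lra).
replace (cosh (PI / 2 * y) / (1 + y ^ 2)) with
  ((sin (PI / 2) * cosh (y * (PI / 2)) + y * cos (PI / 2) * sinh (y * (PI / 2))) / (1 + y ^ 2)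
   - (sin 0 * cosh (y * 0) + y * cos 0 * sinh (y * 0)) / (1 + y ^ 2)).
- apply (is_RInt_derive (V := R_CompleteNormedModule)
    (fun t => (sin t * cosh (y * t) + y * cos t * sinh (y * t)) / (1 + y ^ 2))); intros t _.
  + unfold cosh, sinh; auto_derive; [trivial|]; field; nra.
  + unfold cosh; solve_cont.
- rewrite sin_PI2, cos_PI2, sin_0, Rmult_0_r.
  unfold sinh at 2; rewrite Ropp_0, (Rmult_comm y (PI / 2)); field; exact Hy.
Qed.

Lemma cosmom_SS n y :
  (INR (S (S n)) ^ 2 + y ^ 2) * cosmom (S (S n)) y = INR (S (S n)) * INR (S n) * cosmom n y.
Proof.
apply Rminus_diag_uniq.
assert (H : is_RInt (fun t => (INR (S (S n)) ^ 2 + y ^ 2) * (cos t ^ S (S n) * cosh (y * t))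
  - INR (S (S n)) * INR (S n) * (cos t ^ n * cosh (y * t))) 0 (PI / 2)
  ((INR (S (S n)) ^ 2 + y ^ 2) * cosmom (S (S n)) y - INR (S (S n)) * INR (S n) * cosmom n y)).
{ apply (is_RInt_minus (V := R_NormedModule));
    apply (is_RInt_scal (V := R_NormedModule)), (RInt_correct (V := R_CompleteNormedModule)), cosmom_ex. }
rewrite <- (is_RInt_unique _ _ _ _ H); apply is_RInt_unique; clear H.
(* Two integrations by parts written as a single primitive, which vanishes at both ends. *)
set (F := fun t => INR (S (S n)) * cos t ^ S n * sin t * cosh (y * t) + y * cos t ^ S (S n) * sinh (y * t)).
replace 0 with (F (PI / 2) - F 0) at 2.
- apply (is_RInt_derive (V := R_CompleteNormedModule) F); intros t _.
  + unfold F, cosh, sinh; auto_derive; [trivial|].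
    change (match n with O => 1 | S _ => INR n + 1 end) with (INR (S n)).
    rewrite !S_INR; simpl pred; rewrite ?Rmult_1_r, <- !tech_pow_Rmult.
    assert (E := sin2_cos2 t); unfold Rsqr in E.
    apply Rminus_diag_uniq.
    transitivity ((INR n + 2) * (INR n + 1) * cos t ^ n * ((exp (y * t) + exp (- (y * t))) / 2)
      * (1 - (sin t * sin t + cos t * cos t))); [|rewrite E; ring].
    field.
  + unfold cosh; solve_cont.
- unfold F; rewrite cos_PI2, sin_0, !Rmult_0_r, sinh_0; simpl; ring.
Qed.

Lemma exp_le_compat x y : x <= y -> exp x <= exp y.
Proof. intros [H| ->]; [left; apply exp_increasing, H|lra]. Qed.

(** For $v\ge0$ one has $\cosh v-1=\frac12e^{-v}(e^v-1)^2$ and $e^v-1\le v\,e^v$; evenness does the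
    rest. *)
Lemma cosh_sub1_le x : cosh x - 1 <= x ^ 2 * exp (Rabs x) / 2.
Proof.
assert (H : forall v, 0 <= v -> cosh v - 1 <= v ^ 2 * exp v / 2).
{ intros v Hv; unfold cosh.
  assert (E : exp v * exp (- v) = 1) by (rewrite <- exp_plus, Rplus_opp_r, exp_0; reflexivity).
  assert (H1 := exp_ineq1_le (- v)).
  assert (H2 := exp_ineq1_le v).
  assert (H3 : exp v - 1 <= v * exp v) by (generalize (exp_pos v); nra).
  assert (H4 : (exp v - 1) ^ 2 <= (v * exp v) ^ 2) by (apply pow_incr; lra).
  assert (H5 : exp (- v) * (exp v - 1) ^ 2 <= exp (- v) * (v * exp v) ^ 2)
    by (apply Rmult_le_compat_l; [left; apply exp_pos|exact H4]).
  replace (exp (- v) * (exp v - 1) ^ 2) with (exp v * (exp v * exp (- v)) - 2 * (exp v * exp (- v)) + exp (- v)) in H5 by ring.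
  replace (exp (- v) * (v * exp v) ^ 2) with (v ^ 2 * exp v * (exp v * exp (- v))) in H5 by ring.
  rewrite E in H5; lra. }
unfold Rabs; destruct (Rcase_abs x) as [Hx|Hx].
- specialize (H (- x) ltac:(lra)).
  replace (cosh x) with (cosh (- x)) by (unfold cosh; rewrite Ropp_involutive; lra).
  replace (x ^ 2) with ((- x) ^ 2) by ring; exact H.
- apply H; lra.
Qed.

Lemma cosh_ge_1 x : 1 <= cosh x.
Proof.
unfold cosh.
assert (exp x * exp (- x) = 1) by (rewrite <- exp_plus, Rplus_opp_r, exp_0; reflexivity).
generalize (exp_pos x) (exp_pos (- x)) (pow2_ge_0 (exp x - exp (- x))); nra.
Qed.

Lemma mul_cos_le_sin t : 0 <= t <= PI / 2 -> t * cos t <= sin t.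
Proof.
intros Ht.
destruct (MVT_gen (fun u => sin u - u * cos u) 0 t (fun u => u * sin u)) as (c & Hc & Ec).
- intros u _; auto_derive; [trivial|ring].
- intros u _; apply continuity_pt_filterlim.
  apply (ex_derive_continuous (V := R_NormedModule) (fun u => sin u - u * cos u)); auto_derive; trivial.
- rewrite Rmin_left, Rmax_right in Hc by lra.
  rewrite sin_0 in Ec.
  assert (0 <= sin c) by (apply sin_ge_0; lra).
  assert (0 <= c * sin c * (t - 0)) by (apply Rmult_le_pos; [apply Rmult_le_pos|]; lra).
  lra.
Qed.

Lemma cosmom_0_pos n : 0 < cosmom n 0.
Proof.
assert (HP := PI_RGT_0).
apply RInt_gt_0; [lra| |intros; unfold cosh; solve_cont].
intros t Ht; rewrite Rmult_0_l, cosh_0, Rmult_1_r; apply pow_lt, cos_gt_0; lra.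
Qed.

Lemma cosmom_ge n y : cosmom n 0 <= cosmom n y.
Proof.
assert (HP := PI_RGT_0).
apply RInt_le; [lra|apply cosmom_ex|apply cosmom_ex|].
intros t Ht; rewrite Rmult_0_l, cosh_0; apply Rmult_le_compat_l; [apply pow_le, cos_ge_0; lra|apply cosh_ge_1].
Qed.

(* [t cos t <= sin t] reduces the excess to the integral of [sin^2 cos^n]. *)
Lemma cosmom_le n y : let K := y ^ 2 * exp (Rabs y * PI) / 2 in
  cosmom (S (S n)) y <= cosmom (S (S n)) 0 * (1 + K / INR (S n)).
Proof.
intros K; assert (HP := PI_RGT_0).
assert (Hn : 0 < INR (S n)) by apply lt_0_INR, Nat.lt_0_succ.
assert (HK : 0 <= K).
{ unfold K; generalize (pow2_ge_0 y) (exp_pos (Rabs y * PI)); nra. }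
assert (H : cosmom (S (S n)) y <= (1 - K) * cosmom (S (S n)) 0 + K * cosmom n 0).
{ assert (HI : is_RInt (fun t => (1 - K) * (cos t ^ S (S n) * cosh (0 * t)) + K * (cos t ^ n * cosh (0 * t)))
    0 (PI / 2) ((1 - K) * cosmom (S (S n)) 0 + K * cosmom n 0)).
  { apply (is_RInt_plus (V := R_NormedModule));
      apply (is_RInt_scal (V := R_NormedModule)), (RInt_correct (V := R_CompleteNormedModule)), cosmom_ex. }
  rewrite <- (is_RInt_unique _ _ _ _ HI).
  apply RInt_le; [lra|apply cosmom_ex|eexists; exact HI|].
  intros t Ht; rewrite Rmult_0_l, cosh_0, !Rmult_1_r, <- !tech_pow_Rmult.
  assert (Hc : 0 <= cos t) by (apply cos_ge_0; lra).
  assert (Hs := mul_cos_le_sin t ltac:(lra)).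
  assert (Hcn : 0 <= cos t ^ n) by (apply pow_le, Hc).
  assert (H1 := cosh_sub1_le (y * t)).
  assert (H2 : exp (Rabs (y * t)) <= exp (Rabs y * PI)).
  { apply exp_le_compat; rewrite Rabs_mult, (Rabs_pos_eq t) by lra.
    apply Rmult_le_compat_l; [apply Rabs_pos|lra]. }
  assert (H3 : cosh (y * t) <= 1 + t ^ 2 * K).
  { unfold K; rewrite Rpow_mult_distr in H1.
    assert (0 <= y ^ 2 * t ^ 2) by (apply Rmult_le_pos; apply pow2_ge_0); nra. }
  assert (H4 : (t * cos t) ^ 2 <= sin t ^ 2) by (apply pow_incr; split; [apply Rmult_le_pos; lra|exact Hs]).
  assert (E := sin2_cos2 t); unfold Rsqr in E.
  apply Rle_trans with (cos t * (cos t * cos t ^ n) * (1 + t ^ 2 * K)).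
  { apply Rmult_le_compat_l; [|exact H3]; apply Rmult_le_pos; [|apply Rmult_le_pos]; assumption. }
  apply Rminus_le_0.
  replace (_ - _) with (cos t ^ n * K * (1 - cos t * cos t - (t * cos t) ^ 2)) by ring.
  apply Rmult_le_pos; [apply Rmult_le_pos; assumption|lra]. }
assert (E := cosmom_SS n 0).
assert (E' : cosmom n 0 = cosmom (S (S n)) 0 * (INR (S (S n)) / INR (S n))).
{ apply (Rmult_eq_reg_l (INR (S (S n)) * INR (S n)));
    [rewrite <- E; field; lra|rewrite (S_INR (S n)); nra]. }
rewrite E', (S_INR (S n)) in H.
eapply Rle_trans; [exact H|right; field; lra].
Qed.

(** The factors of the two recurrences are reciprocal, so the product of both sequences, normalised
    by its value at [y = 0], does not depend on [n]; [cosmom_1] evaluates it at [n = 0]. *)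
Lemma gnorm_cosmom n y :
  gnorm (S n) y * cosmom (S (2 * n)) (2 * y) * gmom 0 1 0 0 ^ 2
  = gnorm 0 y * cosh (PI * y) * gmom (S n) 1 0 0 ^ 2 * cosmom (S (2 * n)) 0.
Proof.
induction n as [|n IH].
- rewrite gnorm_S, gmom_0_S; simpl (S (2 * 0)); rewrite !cosmom_1.
  replace (PI / 2 * (2 * y)) with (PI * y) by field.
  rewrite Rmult_0_r, cosh_0; simpl INR; field; nra.
- replace (2 * S n)%nat with (S (S (2 * n))) by lia.
  assert (E1 := cosmom_SS (S (2 * n)) (2 * y)).
  assert (E2 := cosmom_SS (S (2 * n)) 0).
  assert (EN : INR (S (S (S (2 * n)))) = 2 * (INR (S n) + /2)).
  { rewrite !S_INR, mult_INR; simpl (INR 2); lra. }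
  rewrite (gnorm_S (S n)), (gmom_0_S (S n)).
  set (N := INR (S n) + /2) in *.
  assert (HN : 0 < N) by (unfold N; generalize (pos_INR (S n)); lra).
  rewrite EN in E1, E2.
  set (M := INR (S (S (2 * n)))) in *.
  apply (Rmult_eq_reg_l 4); [|lra].
  transitivity (((2 * N) ^ 2 + (2 * y) ^ 2) * cosmom (S (S (S (2 * n)))) (2 * y) * gnorm (S n) y * gmom 0 1 0 0 ^ 2); [ring|].
  rewrite E1.
  transitivity (2 * N * M * (gnorm (S n) y * cosmom (S (2 * n)) (2 * y) * gmom 0 1 0 0 ^ 2)); [ring|].
  rewrite IH.
  transitivity (gnorm 0 y * cosh (PI * y) * gmom (S n) 1 0 0 ^ 2 * (2 * N * M * cosmom (S (2 * n)) 0)); [ring|].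
  rewrite <- E2; ring.
Qed.

Lemma le_of_le_inv_INR (a b K : R) :
  (forall n, a <= b + K / INR (S n)) -> a <= b.
Proof.
intros H; apply Rnot_lt_le; intros Hlt.
destruct (archimed_cor1 ((a - b) / (Rabs K + 1))) as (N & HN & HN0).
{ apply Rdiv_lt_0_compat; [lra|generalize (Rabs_pos K); lra]. }
destruct N as [|N]; [lia|].
specialize (H N).
assert (HK : 0 < Rabs K + 1) by (generalize (Rabs_pos K); lra).
assert (HI : 0 < / INR (S N)) by (apply Rinv_0_lt_compat, lt_0_INR; lia).
assert (K * / INR (S N) <= (Rabs K + 1) * / INR (S N)).
{ apply Rmult_le_compat_r; [lra|generalize (Rle_abs K); lra]. }
assert ((Rabs K + 1) * / INR (S N) < (Rabs K + 1) * ((a - b) / (Rabs K + 1)))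
  by (apply Rmult_lt_compat_l; assumption).
replace ((Rabs K + 1) * ((a - b) / (Rabs K + 1))) with (a - b) in H1 by (field; lra).
unfold Rdiv in H; lra.
Qed.

Lemma gnorm_0_cosh y : gnorm 0 y * cosh (PI * y) = gmom 0 1 0 0 ^ 2.
Proof.
assert (Hm0 := gmom_0_pos 0).
assert (Hm2 : 0 < gmom 0 1 0 0 ^ 2) by (apply pow_lt; exact Hm0).
assert (Hc := cosh_ge_1 (PI * y)).
set (L := gnorm 0 y * cosh (PI * y)).
apply Rle_antisym.
(* Upper bound: [gnorm_le] controls the Gamma factor, and [cosmom_le] the cosine factor with an
   error of order [K / n]. *)
- set (K := (2 * y) ^ 2 * exp (Rabs (2 * y) * PI) / 2).
  assert (HK : 0 <= K).
  { unfold K; generalize (pow2_ge_0 (2 * y)) (exp_pos (Rabs (2 * y) * PI)); nra. }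
  apply (le_of_le_inv_INR _ _ (gmom 0 1 0 0 ^ 2 * K)); intros n.
  assert (E := gnorm_cosmom (S n) y); fold L in E.
  replace (2 * S n)%nat with (S (S (2 * n))) in E by lia.
  assert (H1 := gnorm_le (S (S n)) y).
  assert (H2 := cosmom_le (S (2 * n)) (2 * y)); cbv zeta in H2; fold K in H2.
  assert (Hm := gmom_0_pos (S (S n))).
  assert (Hj := cosmom_0_pos (S (S (S (2 * n))))).
  assert (Hjy := cosmom_ge (S (S (S (2 * n)))) (2 * y)).
  assert (HN : 0 < INR (S n)) by (apply lt_0_INR; lia).
  assert (HN2 : INR (S n) <= INR (S (S (2 * n)))) by (apply le_INR; lia).
  assert (H3 : K / INR (S (S (2 * n))) <= K / INR (S n)).
  { apply Rmult_le_compat_l; [exact HK|apply Rinv_le_contravar; assumption]. }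
  revert E H1 H2 Hm Hj Hjy H3.
  generalize (gnorm (S (S n)) y) (gmom (S (S n)) 1 0 0) (cosmom (S (S (S (2 * n)))) (2 * y))
    (cosmom (S (S (S (2 * n)))) 0) (K / INR (S (S (2 * n)))).
  intros g m jy j k E H1 H2 Hm Hj Hjy H3.
  replace (gmom 0 1 0 0 ^ 2 * K / INR (S n)) with (gmom 0 1 0 0 ^ 2 * (K / INR (S n))) by (field; lra).
  revert Hm2 E H3; generalize (gmom 0 1 0 0 ^ 2) (K / INR (S n)); intros M k' HM E H3.
  assert (Hm' : 0 < m ^ 2) by (apply pow_lt; exact Hm).
  apply (Rmult_le_reg_l (m ^ 2 * j)); [apply Rmult_lt_0_compat; assumption|].
  apply Rle_trans with (g * jy * M); [right; rewrite E; ring|].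
  apply Rle_trans with (m ^ 2 * jy * M).
  { apply Rmult_le_compat_r; [lra|]; apply Rmult_le_compat_r; lra. }
  apply Rle_trans with (m ^ 2 * (j * (1 + k')) * M); [|right; ring].
  apply Rmult_le_compat_r; [lra|]; apply Rmult_le_compat_l; [lra|].
  eapply Rle_trans; [exact H2|]; apply Rmult_le_compat_l; lra.
- destruct (Rle_lt_dec 0 L) as [HL|HL].
  2:{ exfalso; unfold L, gnorm in HL.
      generalize (pow2_ge_0 (gmom 0 1 0 y)) (pow2_ge_0 (gmom 0 0 1 y)); nra. }
  (* Lower bound: [gnorm_ge] together with $(1-k)^2\ge1-2k$. The factor 2 in the error also makes
     the claim trivial when $y^2$ exceeds [INR (S n)], the range that [gnorm_ge] leaves out. *)
  apply (le_of_le_inv_INR _ _ (2 * gmom 0 1 0 0 ^ 2 * y ^ 2)); intros n.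
  assert (HN : 0 < INR (S n)) by (apply lt_0_INR; lia).
  destruct (Rle_lt_dec (y ^ 2) (INR (S n))) as [Hy|Hy].
  + assert (E := gnorm_cosmom n y); fold L in E.
    assert (H1 := gnorm_ge n y Hy).
    assert (Hm := gmom_0_pos (S n)).
    assert (Hj := cosmom_0_pos (S (2 * n))).
    assert (Hjy := cosmom_ge (S (2 * n)) (2 * y)).
    replace (2 * gmom 0 1 0 0 ^ 2 * y ^ 2 / INR (S n)) with (2 * gmom 0 1 0 0 ^ 2 * (y ^ 2 / INR (S n))) by (field; lra).
    revert E H1 Hm Hj Hjy.
    generalize (gnorm (S n) y) (gmom (S n) 1 0 0) (cosmom (S (2 * n)) (2 * y))
      (cosmom (S (2 * n)) 0) (y ^ 2 / INR (S n)).
    intros g m jy j k E H1 Hm Hj Hjy.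
    revert Hm2 E; generalize (gmom 0 1 0 0 ^ 2); intros M HM E.
    assert (Hm' : 0 < m ^ 2) by (apply pow_lt; exact Hm).
    assert (H2 : (m ^ 2 * j) * (M * (1 - k) ^ 2) <= (m ^ 2 * j) * L).
    { apply Rle_trans with (g * jy * M); [|right; rewrite E; ring].
      apply Rle_trans with (m ^ 2 * (1 - k) ^ 2 * j * M); [right; ring|].
      apply Rmult_le_compat_r; [lra|]; apply Rmult_le_compat; try lra.
      apply Rmult_le_pos; [lra|apply pow2_ge_0]. }
    apply Rmult_le_reg_l in H2; [|apply Rmult_lt_0_compat; assumption].
    generalize (pow2_ge_0 k); nra.
  + assert (1 < y ^ 2 / INR (S n)).
    { apply (Rmult_lt_reg_r (INR (S n))); [exact HN|].
      replace (y ^ 2 / INR (S n) * INR (S n)) with (y ^ 2) by (field; lra); lra. }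
    replace (2 * gmom 0 1 0 0 ^ 2 * y ^ 2 / INR (S n)) with (2 * gmom 0 1 0 0 ^ 2 * (y ^ 2 / INR (S n))) by (field; lra).
    nra.
Qed.

Lemma Gamma_half_mod : exists C, 0 < C /\ forall y, Cmod (Gamma_half y) ^ 2 = C / cosh (PI * y).
Proof.
exists (gmom 0 1 0 0 ^ 2); split; [apply pow_lt, gmom_0_pos|].
intros y.
assert (Hc := cosh_ge_1 (PI * y)).
rewrite <- (gnorm_0_cosh y).
replace (gnorm 0 y * cosh (PI * y) / cosh (PI * y)) with (gnorm 0 y) by (field; lra).
unfold Cmod; rewrite pow2_sqrt by (generalize (pow2_ge_0 (fst (Gamma_half y))) (pow2_ge_0 (snd (Gamma_half y))); lra).
unfold gnorm, Gamma_half; simpl fst; simpl snd.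
f_equal; f_equal; (eapply is_RInt_gen_unique, is_int0oo_ext; [|apply gmom_correct]);
  intros t _; unfold gker, trig; simpl; ring.
Qed.

(** * Finite sums and series of real numbers *)

Ltac rring := Req; ring.

Lemma sum_n_S (u : nat -> R) n : sum_n u (S n) = sum_n u n + u (S n).
Proof. apply (sum_Sn (G := R_AbelianMonoid)). Qed.

Lemma sum_n_0 (u : nat -> R) : sum_n u 0 = u 0%nat.
Proof. apply (sum_O (G := R_AbelianMonoid)). Qed.

Lemma sum_n_nonneg (u : nat -> R) N : (forall n, 0 <= u n) -> 0 <= sum_n u N.
Proof.
intros H; induction N as [|N IH]; [rewrite sum_n_0; apply H|].
rewrite sum_n_S; specialize (H (S N)); lra.
Qed.

Lemma sum_n_le' (u v : nat -> R) N : (forall n, u n <= v n) -> sum_n u N <= sum_n v N.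
Proof.
intros H; induction N as [|N IH]; [rewrite !sum_n_0; apply H|].
rewrite !sum_n_S; specialize (H (S N)); lra.
Qed.

Lemma sum_n_incr (u : nat -> R) N M : (forall n, 0 <= u n) -> (N <= M)%nat -> sum_n u N <= sum_n u M.
Proof.
intros H; induction 1 as [|M HM IH]; [lra|].
rewrite sum_n_S; specialize (H (S M)); lra.
Qed.

Lemma sum_n_scal (c : R) (u : nat -> R) N : sum_n (fun n => c * u n) N = c * sum_n u N.
Proof. induction N as [|N IH]; [rewrite !sum_n_0; reflexivity|rewrite !sum_n_S, IH; rring]. Qed.

Lemma sum_n_plus' (u v : nat -> R) N : sum_n (fun n => u n + v n) N = sum_n u N + sum_n v N.
Proof. induction N as [|N IH]; [rewrite !sum_n_0; reflexivity|rewrite !sum_n_S, IH; rring]. Qed.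

Lemma sum_n_Rabs (u : nat -> R) N : Rabs (sum_n u N) <= sum_n (fun n => Rabs (u n)) N.
Proof.
induction N as [|N IH]; [rewrite !sum_n_0; lra|].
rewrite !sum_n_S; eapply Rle_trans; [apply Rabs_triang|lra].
Qed.

Lemma series_nonneg_bounded (u : nat -> R) C :
  (forall n, 0 <= u n) -> (forall N, sum_n u N <= C) -> ex_series u /\ Series u <= C.
Proof.
intros Hp Hb.
assert (Hex : ex_finite_lim_seq (sum_n u)).
{ apply ex_finite_lim_seq_incr with C; [|exact Hb].
  intros n; rewrite sum_n_S; specialize (Hp (S n)); lra. }
destruct Hex as [l Hl].
assert (Hs : is_series u l) by exact Hl.
split; [exists l; exact Hs|].
rewrite (is_series_unique _ _ Hs).
apply (is_lim_seq_le (sum_n u) (fun _ => C) l C Hb Hl), is_lim_seq_const.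
Qed.

Lemma sum_n_le_Series (u : nat -> R) N : (forall n, 0 <= u n) -> ex_series u -> sum_n u N <= Series u.
Proof.
intros Hp [l Hl]; rewrite (is_series_unique _ _ Hl).
apply (is_lim_seq_incr_compare (sum_n u) l Hl).
intros n; rewrite sum_n_S; specialize (Hp (S n)); lra.
Qed.

Lemma abs_series_bounded (u : nat -> R) C :
  (forall N, sum_n (fun n => Rabs (u n)) N <= C) -> ex_series u /\ Rabs (Series u) <= C.
Proof.
intros Hb.
destruct (series_nonneg_bounded (fun n => Rabs (u n)) C) as [Hex Hle]; [intros; apply Rabs_pos|exact Hb|].
split; [apply ex_series_Rabs, Hex|].
eapply Rle_trans; [apply Series_Rabs, Hex|exact Hle].
Qed.

(** * Functions with an absolutely bounded power series *)

Definition pcoef (r C : R) (a : nat -> R) : Prop :=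
  forall N, sum_n (fun i => Rabs (a i) * r ^ i) N <= C.

(** Membership in the ball of radius [C] of the Banach algebra of power series normed by
    $\sum|a_i|r^i$. It plays the part of bounded holomorphy: the norm is submultiplicative, bounds
    the derivative at the centre and passes to pointwise limits. *)
Definition pb (r C : R) (f : R -> R) : Prop :=
  exists a, pcoef r C a /\ forall x, Rabs x < r -> is_pseries a x (f x).

Lemma pcoef_term r C a i : 0 <= r -> pcoef r C a -> Rabs (a i) * r ^ i <= C.
Proof.
intros Hr H; apply Rle_trans with (2 := H i).
assert (Hp : forall n, 0 <= Rabs (a n) * r ^ n)
  by (intros; apply Rmult_le_pos; [apply Rabs_pos|apply pow_le, Hr]).
destruct i; [rewrite sum_n_0; lra|rewrite sum_n_S].
assert (H0 := sum_n_nonneg _ i Hp); lra.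
Qed.

Lemma pcoef_abs r C a x : Rabs x <= r -> pcoef r C a ->
  forall N, sum_n (fun n => Rabs (a n * x ^ n)) N <= C.
Proof.
intros Hx Ha N; apply Rle_trans with (2 := Ha N); apply sum_n_le'; intros n.
rewrite Rabs_mult, <- RPow_abs; apply Rmult_le_compat_l; [apply Rabs_pos|].
apply pow_incr; split; [apply Rabs_pos|exact Hx].
Qed.

Lemma pcoef_radius r C a x : pcoef r C a -> Rabs x < r -> Rbar_lt (Rabs x) (CV_radius a).
Proof.
intros Ha Hx; apply Rbar_lt_le_trans with r; [exact Hx|].
destruct (CV_radius_bounded a) as [H _]; apply H.
assert (Hr : 0 <= r) by (generalize (Rabs_pos x); lra).
exists C; intros n; rewrite Rabs_mult, (Rabs_pos_eq (r ^ n)) by (apply pow_le, Hr).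
apply pcoef_term; assumption.
Qed.

Lemma pcoef_mono r r' C C' a : 0 <= r' <= r -> C <= C' -> pcoef r C a -> pcoef r' C' a.
Proof.
intros Hr HC H N; apply Rle_trans with C; [|exact HC]; apply Rle_trans with (2 := H N).
apply sum_n_le'; intros n; apply Rmult_le_compat_l; [apply Rabs_pos|apply pow_incr, Hr].
Qed.

Lemma pb_mono r r' C C' f : 0 <= r' <= r -> C <= C' -> pb r C f -> pb r' C' f.
Proof.
intros Hr HC (a & Ha & Hs); exists a; split; [apply pcoef_mono with r C; assumption|].
intros x Hx; apply Hs; lra.
Qed.

Lemma pb_ext r C f g : (forall x, Rabs x < r -> f x = g x) -> pb r C f -> pb r C g.
Proof.
intros E (a & Ha & Hs); exists a; split; [exact Ha|].
intros x Hx; rewrite <- E by exact Hx; apply Hs, Hx.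
Qed.

Lemma pb_bound r C f x : pb r C f -> Rabs x < r -> Rabs (f x) <= C.
Proof.
intros (a & Ha & Hs) Hx.
assert (H := Hs x Hx); apply is_pseries_R in H.
rewrite <- (is_series_unique _ _ H).
apply abs_series_bounded, pcoef_abs with r; [lra|exact Ha].
Qed.

Lemma pb_const r c C : Rabs c <= C -> pb r C (fun _ => c).
Proof.
intros Hc; exists (fun n => match n with O => c | _ => 0 end); split.
- intros N; apply Rle_trans with (Rabs c); [|exact Hc].
  induction N as [|N IH]; [rewrite sum_n_0; simpl; lra|].
  rewrite sum_n_S, Rabs_R0; lra.
- intros x _; apply is_pseries_R; apply is_series_ext with (fun n => match n with O => c | _ => 0 end).
  + intros [|n]; simpl; rring.
  + assert (H : is_lim_seq (sum_n (fun n => match n with O => c | _ => 0 end)) c).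
    { apply is_lim_seq_ext with (fun _ => c); [|apply is_lim_seq_const].
      induction n as [|n IH]; [rewrite sum_n_0; reflexivity|rewrite sum_n_S, <- IH; rring]. }
    exact H.
Qed.

Lemma pb_id r : 0 <= r -> pb r r (fun x => x).
Proof.
intros Hr; exists (fun n => match n with 1%nat => 1 | _ => 0 end); split.
- intros N; induction N as [|N IH]; [rewrite sum_n_0, Rabs_R0; lra|].
  rewrite sum_n_S; destruct N as [|N].
  + rewrite sum_n_0, Rabs_R0, Rabs_R1; simpl; lra.
  + rewrite Rabs_R0; lra.
- intros x _; apply is_pseries_R.
  assert (H : is_lim_seq (sum_n (fun k => match k with 1%nat => 1 | _ => 0 end * x ^ k)) x); [|exact H].
  apply (is_lim_seq_ext_loc (fun _ => x)); [|apply is_lim_seq_const].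
  exists 1%nat; intros n Hn; induction Hn as [|n Hn IH].
  + rewrite sum_n_S, sum_n_0; simpl; rring.
  + rewrite sum_n_S, <- IH; destruct n; [lia|rring].
Qed.

Lemma pb_plus r C D f g : 0 <= r -> pb r C f -> pb r D g -> pb r (C + D) (fun x => f x + g x).
Proof.
intros Hr (a & Ha & Hf) (b & Hb & Hg); exists (PS_plus a b); split.
- intros N.
  apply Rle_trans with (sum_n (fun i => Rabs (a i) * r ^ i) N + sum_n (fun i => Rabs (b i) * r ^ i) N);
    [|apply Rplus_le_compat; [apply Ha|apply Hb]].
  rewrite <- sum_n_plus'; apply sum_n_le'; intros n; rewrite <- Rmult_plus_distr_r.
  apply Rmult_le_compat_r; [apply pow_le, Hr|apply Rabs_triang].
- intros x Hx; apply (is_pseries_plus (V := R_NormedModule)); auto.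
Qed.

Lemma cauchy_sum (u v : nat -> R) N :
  sum_n (fun n => sum_n (fun k => u k * v (n - k)%nat) n) N = sum_n (fun k => u k * sum_n v (N - k)) N.
Proof.
induction N as [|N IH]; [rewrite !sum_n_0; reflexivity|].
rewrite sum_n_S, IH, !(sum_n_S _ N), Nat.sub_diag, sum_n_0.
rewrite (sum_n_ext_loc (fun k => u k * sum_n v (S N - k)) (fun k => u k * sum_n v (N - k) + u k * v (S N - k)%nat)).
- rewrite sum_n_plus'; rring.
- intros k Hk; replace (S N - k)%nat with (S (N - k)) by lia; rewrite sum_n_S; rring.
Qed.

Lemma pb_mult r C D f g : 0 <= r -> pb r C f -> pb r D g -> pb r (C * D) (fun x => f x * g x).
Proof.
intros Hr (a & Ha & Hf) (b & Hb & Hg); exists (PS_mult a b); split.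
- intros N.
  set (u := fun i => Rabs (a i) * r ^ i); set (v := fun i => Rabs (b i) * r ^ i).
  assert (Hu : forall n, 0 <= u n) by (intros; apply Rmult_le_pos; [apply Rabs_pos|apply pow_le, Hr]).
  assert (Hv : forall n, 0 <= v n) by (intros; apply Rmult_le_pos; [apply Rabs_pos|apply pow_le, Hr]).
  apply Rle_trans with (sum_n (fun n => sum_n (fun k => u k * v (n - k)%nat) n) N).
  + apply sum_n_le'; intros n; unfold PS_mult; rewrite <- sum_n_Reals.
    eapply Rle_trans; [apply Rmult_le_compat_r; [apply pow_le, Hr|apply sum_n_Rabs]|].
    rewrite Rmult_comm, <- sum_n_scal; right; apply sum_n_ext_loc; intros k Hk.
    unfold u, v; rewrite Rabs_mult; replace (r ^ n) with (r ^ k * r ^ (n - k))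
      by (rewrite <- pow_add; f_equal; lia); rring.
  + rewrite cauchy_sum.
    apply Rle_trans with (sum_n (fun k => sum_n v N * u k) N).
    * apply sum_n_le'; intros k; rewrite Rmult_comm; apply Rmult_le_compat_r; [apply Hu|].
      apply sum_n_incr; [exact Hv|lia].
    * rewrite sum_n_scal, Rmult_comm.
      apply Rmult_le_compat; try apply sum_n_nonneg; auto.
- intros x Hx; apply is_pseries_mult; auto; eapply pcoef_radius; eauto.
Qed.

Lemma pb_scal r C c f : 0 <= r -> pb r C f -> pb r (Rabs c * C) (fun x => c * f x).
Proof. intros Hr; apply pb_mult; [exact Hr|apply pb_const; lra]. Qed.

Lemma pb_pow r C f n : 0 <= r -> pb r C f -> pb r (C ^ n) (fun x => f x ^ n).
Proof.
intros Hr Hf; induction n as [|n IH]; simpl; [apply pb_const; rewrite Rabs_R1; lra|].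
apply pb_mult; assumption.
Qed.

Lemma sum_n_PSeries_tail (a : nat -> R) r C x N : pcoef r C a -> Rabs x < r ->
  Rabs (PSeries a x - sum_n (fun i => a i * x ^ i) N) <= C * (Rabs x / r) ^ S N.
Proof.
intros Ha Hx.
assert (Hr : 0 < r) by (generalize (Rabs_pos x); lra).
destruct (abs_series_bounded (fun n => a n * x ^ n) C) as [Hex _];
  [apply pcoef_abs with r; [lra|exact Ha]|].
unfold PSeries; rewrite (Series_incr_n _ (S N)) by (try lia; exact Hex).
simpl pred; rewrite sum_n_Reals.
replace (_ - _) with (Series (fun k => a (S N + k)%nat * x ^ (S N + k))) by ring.
apply abs_series_bounded; intros M.
apply Rle_trans with (sum_n (fun n => (Rabs x / r) ^ S N * (Rabs (a (S N + n)%nat) * r ^ (S N + n))) M).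
- apply sum_n_le'; intros n; rewrite Rabs_mult, <- RPow_abs, pow_add.
  unfold Rdiv; rewrite Rpow_mult_distr, pow_inv, (pow_add r).
  assert (0 < r ^ S N) by (apply pow_lt, Hr).
  replace (Rabs x ^ S N * / r ^ S N * (Rabs (a (S N + n)%nat) * (r ^ S N * r ^ n)))
    with (Rabs (a (S N + n)%nat) * (Rabs x ^ S N * r ^ n)) by (field; lra).
  apply Rmult_le_compat_l; [apply Rabs_pos|].
  apply Rmult_le_compat_l; [apply pow_le, Rabs_pos|].
  apply pow_incr; split; [apply Rabs_pos|lra].
- rewrite sum_n_scal, Rmult_comm; apply Rmult_le_compat_r.
  + apply pow_le; apply Rmult_le_pos; [apply Rabs_pos|left; apply Rinv_0_lt_compat, Hr].
  + apply Rle_trans with (2 := Ha (S N + M)%nat).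
    assert (E : sum_n (fun i => Rabs (a i) * r ^ i) (S N + M) =
      sum_n (fun i => Rabs (a i) * r ^ i) N + sum_n (fun n => Rabs (a (S N + n)%nat) * r ^ (S N + n)) M).
    { clear; induction M as [|M IH].
      - rewrite sum_n_0, Nat.add_0_r, sum_n_S; reflexivity.
      - rewrite Nat.add_succ_r, sum_n_S, IH, sum_n_S, Nat.add_succ_r; rring. }
    rewrite E.
    assert (0 <= sum_n (fun i => Rabs (a i) * r ^ i) N); [|lra].
    apply sum_n_nonneg; intros; apply Rmult_le_pos; [apply Rabs_pos|apply pow_le; lra].
Qed.

Lemma pcoef_PSeries r C a x : pcoef r C a -> Rabs x <= r -> is_pseries a x (PSeries a x).
Proof.
intros Ha Hx; apply is_pseries_R, Series_correct, (abs_series_bounded _ C), pcoef_abs with r; assumption.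
Qed.

Lemma pcoef_shift r C a i : 0 < r -> pcoef r C a -> pcoef r (C / r ^ i) (fun n => a (i + n)%nat).
Proof.
intros Hr Ha N.
assert (Hi : 0 < r ^ i) by (apply pow_lt, Hr).
apply (Rmult_le_reg_l (r ^ i)); [exact Hi|].
replace (r ^ i * (C / r ^ i)) with C by (field; lra).
rewrite <- sum_n_scal; apply Rle_trans with (2 := Ha (i + N)%nat).
assert (Hp : forall n, 0 <= Rabs (a n) * r ^ n)
  by (intros; apply Rmult_le_pos; [apply Rabs_pos|apply pow_le; lra]).
induction N as [|N IH].
- rewrite sum_n_0, Nat.add_0_r; simpl.
  destruct i as [|i]; [rewrite sum_n_0; simpl; lra|rewrite sum_n_S].
  assert (H := sum_n_nonneg _ i Hp); lra.
- rewrite Nat.add_succ_r, !sum_n_S, Nat.add_succ_r.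
  apply Rplus_le_compat; [exact IH|right].
  replace (S (i + N))%nat with (i + S N)%nat by lia; rewrite (pow_add r i); ring.
Qed.

(* Normal families: the coefficients converge one after the other, since the tail series are
   equibounded and hence equicontinuous at 0. *)
Lemma pb_lim r C (f : nat -> R -> R) (g : R -> R) : 0 < r ->
  (forall m, pb r C (f m)) -> (forall x, Rabs x < r -> is_lim_seq (fun m => f m x) (g x)) -> pb r C g.
Proof.
intros Hr Hf Hg.
destruct (choice (fun m a => pcoef r C a /\ forall x, Rabs x < r -> is_pseries a x (f m x)) Hf)
  as [a Ha].
assert (Hpc : forall m i, pcoef r (C / r ^ i) (fun n => a m (i + n)%nat))
  by (intros; apply pcoef_shift; [exact Hr|apply Ha]).
set (T := fun i m x => PSeries (fun n => a m (i + n)%nat) x).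
assert (HT : forall i m x, Rabs x < r -> T i m x = a m i + x * T (S i) m x).
{ intros i m x Hx; unfold T; rewrite PSeries_decr_1.
  - rewrite Nat.add_0_r; f_equal; f_equal; apply PSeries_ext; intros n; unfold PS_decr_1.
    f_equal; lia.
  - eexists; eapply pcoef_PSeries; [apply Hpc|lra]. }
assert (HTb : forall i m x, Rabs x < r -> Rabs (T i m x) <= C / r ^ i).
{ intros i m x Hx; apply (abs_series_bounded (fun n => a m (i + n)%nat * x ^ n)).
  apply pcoef_abs with r; [lra|apply Hpc]. }
assert (Hstep : forall i, (forall x, 0 < Rabs x < r -> ex_finite_lim_seq (fun m => T i m x)) ->
  ex_finite_lim_seq (fun m => a m i)).
{ intros i Hi; apply ex_lim_seq_cauchy_corr; intros eps.
  assert (HC : 0 <= C / r ^ S i).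
  { eapply Rle_trans; [apply Rabs_pos|apply (HTb (S i) 0%nat 0)]; rewrite Rabs_R0; exact Hr. }
  set (x := Rmin (r / 2) (eps / (4 * (C / r ^ S i + 1)))).
  assert (Hx : 0 < x).
  { apply Rmin_case; [lra|apply Rdiv_lt_0_compat; [apply cond_pos|lra]]. }
  assert (Hxr : x < r) by (eapply Rle_lt_trans; [apply Rmin_l|lra]).
  assert (Hxa : Rabs x = x) by (apply Rabs_pos_eq; lra).
  assert (HxC : x * (C / r ^ S i) <= eps / 4).
  { apply Rle_trans with (eps / (4 * (C / r ^ S i + 1)) * (C / r ^ S i + 1)).
    - apply Rmult_le_compat; try lra; apply Rmin_r.
    - revert HC; generalize (C / r ^ S i); intros K HC; right; field; lra. }
  specialize (Hi x ltac:(rewrite Hxa; lra)).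
  apply ex_lim_seq_cauchy_corr in Hi; destruct (Hi (pos_div_2 eps)) as [N HN].
  exists N; intros n m Hn Hm; specialize (HN n m Hn Hm); simpl in HN.
  rewrite (HT i n x), (HT i m x) in HN by (rewrite Hxa; exact Hxr).
  assert (B1 := HTb (S i) n x ltac:(rewrite Hxa; exact Hxr)).
  assert (B2 := HTb (S i) m x ltac:(rewrite Hxa; exact Hxr)).
  assert (B3 : Rabs (x * T (S i) m x - x * T (S i) n x) <= 2 * (x * (C / r ^ S i))).
  { unfold Rminus; eapply Rle_trans; [apply Rabs_triang|].
    rewrite Rabs_Ropp, !Rabs_mult, Hxa.
    assert (x * Rabs (T (S i) n x) <= x * (C / r ^ S i)) by (apply Rmult_le_compat_l; lra).
    assert (x * Rabs (T (S i) m x) <= x * (C / r ^ S i)) by (apply Rmult_le_compat_l; lra).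
    lra. }
  replace (a n i - a m i) with
    ((a n i + x * T (S i) n x - (a m i + x * T (S i) m x)) + (x * T (S i) m x - x * T (S i) n x)) by ring.
  eapply Rle_lt_trans; [apply Rabs_triang|]; lra. }
assert (Hall : forall i x, 0 < Rabs x < r -> ex_finite_lim_seq (fun m => T i m x)).
{ induction i as [|i IH]; intros x Hx.
  - exists (g x); apply is_lim_seq_ext with (fun m => f m x); [|apply Hg; lra].
    intros m; symmetry; apply is_pseries_unique, Ha; lra.
  - destruct (IH x Hx) as [l Hl]; destruct (Hstep i IH) as [c Hc].
    exists ((l - c) / x).
    assert (Hx0 : x <> 0) by (intros E; rewrite E, Rabs_R0 in Hx; lra).
    apply is_lim_seq_ext with (fun m => (T i m x - a m i) * / x).
    + intros m; rewrite HT by lra; field; exact Hx0.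
    + apply (is_lim_seq_scal_r _ (/ x) (l - c)); apply is_lim_seq_minus'; assumption. }
destruct (choice (fun i (c : R) => is_lim_seq (fun m => a m i) c) (fun i => Hstep i (Hall i))) as [b Hb].
assert (Hbc : pcoef r C b).
{ intros N.
  apply (is_lim_seq_le (fun m => sum_n (fun i => Rabs (a m i) * r ^ i) N) (fun _ => C)
    (sum_n (fun i => Rabs (b i) * r ^ i) N) C); [intros m; apply Ha| |apply is_lim_seq_const].
  assert (Hterm : forall i, is_lim_seq (fun m => Rabs (a m i) * r ^ i) (Rabs (b i) * r ^ i)).
  { intros i; apply (is_lim_seq_scal_r (fun m => Rabs (a m i)) (r ^ i) (Rabs (b i))).
    apply (is_lim_seq_abs _ (b i)), Hb. }
  induction N as [|N IH].
  - rewrite sum_n_0; apply is_lim_seq_ext with (2 := Hterm 0%nat); intros; rewrite sum_n_0; reflexivity.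
  - rewrite sum_n_S; eapply is_lim_seq_ext; [|apply is_lim_seq_plus'; [exact IH|exact (Hterm (S N))]].
    intros m; rewrite sum_n_S; reflexivity. }
exists b; split; [exact Hbc|]; intros x Hx.
replace (g x) with (PSeries b x); [apply pcoef_PSeries with r C; [exact Hbc|lra]|].
assert (Hq : is_lim_seq (fun N => 2 * (C * (Rabs x / r) ^ S N)) 0).
{ replace (Finite 0) with (Rbar_mult 2 (Rbar_mult C 0)) by (simpl; f_equal; ring).
  apply is_lim_seq_scal_l, is_lim_seq_scal_l.
  apply (is_lim_seq_incr_1 (fun N => (Rabs x / r) ^ N)).
  apply is_lim_seq_geom; rewrite Rabs_pos_eq.
  - apply (Rmult_lt_reg_r r); [exact Hr|]; replace (Rabs x / r * r) with (Rabs x) by (field; lra); lra.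
  - apply Rmult_le_pos; [apply Rabs_pos|left; apply Rinv_0_lt_compat, Hr]. }
assert (Hle : forall N, Rabs (g x - PSeries b x) <= 2 * (C * (Rabs x / r) ^ S N)).
{ intros N.
  assert (Hfin : is_lim_seq (fun m => sum_n (fun i => a m i * x ^ i) N) (sum_n (fun i => b i * x ^ i) N)).
  { induction N as [|N IH].
    - rewrite sum_n_0; eapply is_lim_seq_ext; [|apply (is_lim_seq_scal_r _ (x ^ 0) _ (Hb 0%nat))].
      intros; rewrite sum_n_0; reflexivity.
    - rewrite sum_n_S; eapply is_lim_seq_ext;
        [|apply is_lim_seq_plus'; [exact IH|apply (is_lim_seq_scal_r _ (x ^ S N) _ (Hb (S N)))]].
      intros m; rewrite sum_n_S; reflexivity. }
  assert (H1 := sum_n_PSeries_tail b r C x N Hbc Hx).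
  assert (H2 : Rabs (g x - sum_n (fun i => b i * x ^ i) N) <= C * (Rabs x / r) ^ S N).
  { refine (is_lim_seq_le _ (fun _ => C * (Rabs x / r) ^ S N)
      (Rabs (g x - sum_n (fun i => b i * x ^ i) N)) (C * (Rabs x / r) ^ S N) _
      (is_lim_seq_abs _ (g x - sum_n (fun i => b i * x ^ i) N)
        (is_lim_seq_minus' _ _ _ _ (Hg x Hx) Hfin)) (is_lim_seq_const _)).
    intros m; cbv beta.
    rewrite <- (is_pseries_unique _ _ _ (proj2 (Ha m) x Hx)).
    apply sum_n_PSeries_tail; [apply Ha|exact Hx]. }
  replace (g x - PSeries b x) with
    ((g x - sum_n (fun i => b i * x ^ i) N) - (PSeries b x - sum_n (fun i => b i * x ^ i) N)) by ring.
  unfold Rminus at 1; eapply Rle_trans; [apply Rabs_triang|]; rewrite Rabs_Ropp; lra. }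
assert (H0 : Rabs (g x - PSeries b x) <= 0).
{ apply (is_lim_seq_le (fun _ => Rabs (g x - PSeries b x)) _ (Rabs (g x - PSeries b x)) 0 Hle);
    [apply is_lim_seq_const|exact Hq]. }
assert (H1 := Rabs_pos (g x - PSeries b x)).
assert (H2 : Rabs (g x - PSeries b x) = 0) by lra.
apply Rabs_eq_0 in H2; lra.
Qed.

Lemma pb_sum_n r (C : nat -> R) (f : nat -> R -> R) N : 0 <= r ->
  (forall j, pb r (C j) (f j)) -> pb r (sum_n C N) (fun x => sum_n (fun j => f j x) N).
Proof.
intros Hr Hf; induction N as [|N IH].
- rewrite sum_n_0; apply pb_ext with (2 := Hf 0%nat); intros; rewrite sum_n_0; reflexivity.
- rewrite sum_n_S; eapply pb_ext; [|apply pb_plus; [exact Hr|exact IH|apply (Hf (S N))]].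
  intros x Hx; rewrite sum_n_S; reflexivity.
Qed.

Lemma pb_nonneg r C f : 0 < r -> pb r C f -> 0 <= C.
Proof.
intros Hr Hf; eapply Rle_trans; [apply Rabs_pos|apply (pb_bound r C f 0 Hf)]; rewrite Rabs_R0; exact Hr.
Qed.

Lemma pb_Series r (C : nat -> R) (f : nat -> R -> R) : 0 < r ->
  (forall j, pb r (C j) (f j)) -> ex_series C -> pb r (Series C) (fun x => Series (fun j => f j x)).
Proof.
intros Hr Hf HC.
assert (Hp : forall j, 0 <= C j) by (intros j; exact (pb_nonneg _ _ _ Hr (Hf j))).
apply pb_lim with (fun N x => sum_n (fun j => f j x) N); [exact Hr| |].
- intros N; apply pb_mono with r (sum_n C N); [lra| |apply pb_sum_n; [lra|exact Hf]].
  apply sum_n_le_Series; assumption.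
- intros x Hx.
  assert (Hex : ex_series (fun j => f j x)).
  { apply ex_series_Rabs, (ex_series_le (K := R_AbsRing) (V := R_CompleteNormedModule) _ C); [|exact HC].
    intros n; unfold norm; simpl; unfold abs; simpl; rewrite Rabs_Rabsolu; apply pb_bound with r; auto. }
  exact (Series_correct _ Hex).
Qed.

(** Expand [h] in powers of [g]: the power of order [i] has norm at most [d ^ i], and the
    coefficients of [h] are summable against these, since [d < s]. *)
Lemma pb_comp r s C d h g : 0 < r -> 0 < s -> d < s -> pb s C h -> pb r d g -> pb r C (fun x => h (g x)).
Proof.
intros Hr Hs Hds (a & Ha & Hh) Hg.
assert (Hd : 0 <= d) by exact (pb_nonneg _ _ _ Hr Hg).
assert (Had : pcoef d C a) by (apply pcoef_mono with s C; [lra|lra|exact Ha]).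
destruct (series_nonneg_bounded (fun i => Rabs (a i) * d ^ i) C) as [Hex Hle].
{ intros n; apply Rmult_le_pos; [apply Rabs_pos|apply pow_le, Hd]. }
{ exact Had. }
apply pb_mono with r (Series (fun i => Rabs (a i) * d ^ i)); [lra|exact Hle|].
apply pb_ext with (fun x => Series (fun i => a i * g x ^ i)).
- intros x Hx; assert (Hgx := pb_bound r d g x Hg Hx).
  assert (H := Hh (g x) ltac:(lra)); apply is_pseries_R in H; apply is_series_unique, H.
- apply pb_Series; [exact Hr| |exact Hex].
  intros i; apply pb_scal; [lra|apply pb_pow; [lra|exact Hg]].
Qed.

Lemma pb_ex_derive r C f x : pb r C f -> Rabs x < r -> ex_derive f x.
Proof.
intros (a & Ha & Hf) Hx.
apply ex_derive_ext_loc with (PSeries a).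
- assert (Hd : 0 < r - Rabs x) by lra.
  exists (mkposreal _ Hd); intros y Hy.
  unfold ball in Hy; simpl in Hy; unfold AbsRing_ball, abs, minus, plus, opp in Hy; simpl in Hy.
  apply is_pseries_unique, Hf.
  replace y with ((y + - x) + x) by ring; eapply Rle_lt_trans; [apply Rabs_triang|lra].
- apply ex_derive_PSeries, pcoef_radius with r C; assumption.
Qed.

Lemma pb_derive_0 r C f a : 0 < r -> pcoef r C a -> (forall x, Rabs x < r -> is_pseries a x (f x)) ->
  is_derive f 0 (a 1%nat).
Proof.
intros Hr Ha Hf.
apply is_derive_ext_loc with (PSeries a).
- exists (mkposreal _ Hr); intros y Hy.
  unfold ball in Hy; simpl in Hy; unfold AbsRing_ball, abs, minus, plus, opp in Hy; simpl in Hy.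
  rewrite Ropp_0, Rplus_0_r in Hy.
  apply is_pseries_unique, Hf, Hy.
- evar_last.
  + apply is_derive_PSeries, pcoef_radius with r C; [exact Ha|rewrite Rabs_R0; exact Hr].
  + rewrite PSeries_0; unfold PS_derive; simpl; rring.
Qed.

(** Cauchy's estimate for the first coefficient. *)
Lemma pb_Derive_bound r C f : 0 < r -> pb r C f -> Rabs (Derive f 0) <= C / r.
Proof.
intros Hr (a & Ha & Hf).
rewrite (is_derive_unique _ _ _ (pb_derive_0 r C f a Hr Ha Hf)).
assert (H := pcoef_term r C a 1 ltac:(lra) Ha).
apply (Rmult_le_reg_r r); [exact Hr|]; unfold Rdiv; rewrite Rmult_assoc, Rinv_l by lra.
simpl in H; lra.
Qed.

Lemma pcoef_nth0 r C f a : 0 < r -> pcoef r C a -> (forall x, Rabs x < r -> is_pseries a x (f x)) ->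
  a 0%nat = f 0.
Proof.
intros Hr Ha Hf; rewrite <- (PSeries_0 a); apply is_pseries_unique, Hf; rewrite Rabs_R0; exact Hr.
Qed.

(** The Schwarz lemma in this norm: every vanishing leading coefficient gains a factor [r' / r] when
    the radius shrinks. *)
Lemma pb_shrink_gen k r r' C f : 0 < r' <= r ->
  (exists a, pcoef r C a /\ (forall x, Rabs x < r -> is_pseries a x (f x)) /\ forall i, (i < k)%nat -> a i = 0) ->
  pb r' ((r' / r) ^ k * C) f.
Proof.
intros Hr (a & Ha & Hf & H0); exists a; split; [|intros x Hx; apply Hf; lra].
intros N; apply Rle_trans with ((r' / r) ^ k * sum_n (fun i => Rabs (a i) * r ^ i) N).
- rewrite <- sum_n_scal; apply sum_n_le'; intros i.
  destruct (Nat.lt_ge_cases i k) as [Hi|Hi]; [rewrite H0, Rabs_R0 by exact Hi; lra|].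
  replace i with (k + (i - k))%nat by lia; rewrite !pow_add.
  unfold Rdiv; rewrite Rpow_mult_distr, pow_inv.
  assert (Hk : 0 < r ^ k) by (apply pow_lt; lra).
  replace (r' ^ k * / r ^ k * (Rabs (a (k + (i - k))%nat) * (r ^ k * r ^ (i - k))))
    with (Rabs (a (k + (i - k))%nat) * (r' ^ k * r ^ (i - k))) by (field; lra).
  apply Rmult_le_compat_l; [apply Rabs_pos|].
  apply Rmult_le_compat_l; [apply pow_le; lra|apply pow_incr; lra].
- apply Rmult_le_compat_l; [|apply Ha].
  apply pow_le; left; apply Rdiv_lt_0_compat; lra.
Qed.

Lemma pb_shrink r r' C f : 0 < r' <= r -> pb r C f -> f 0 = 0 -> pb r' (r' / r * C) f.
Proof.
intros Hr (a & Ha & Hf) H0; rewrite <- (pow_1 (r' / r)); apply pb_shrink_gen; [exact Hr|].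
exists a; split; [exact Ha|split; [exact Hf|]].
intros i Hi; replace i with 0%nat by lia; rewrite (pcoef_nth0 r C f a); auto; lra.
Qed.

Lemma pb_shrink2 r r' C f : 0 < r' <= r -> pb r C f -> f 0 = 0 -> is_derive f 0 0 ->
  pb r' ((r' / r) ^ 2 * C) f.
Proof.
intros Hr (a & Ha & Hf) H0 H1; apply pb_shrink_gen; [exact Hr|].
exists a; split; [exact Ha|split; [exact Hf|]].
intros i Hi; assert (Hi' : i = 0%nat \/ i = 1%nat) by lia; destruct Hi' as [-> | ->].
- rewrite (pcoef_nth0 r C f a); auto; lra.
- rewrite <- (is_derive_unique _ _ _ (pb_derive_0 r C f a ltac:(lra) Ha Hf)).
  apply is_derive_unique, H1.
Qed.

(** Half of the radius is taken because $j(r/2)^{j-1}\le r^{j-1}$ for all $j\ge1$: relative to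
    [r ^ j], all powers then share one Lipschitz constant. *)
Lemma pow_sub_le r y z j : 0 < r -> Rabs y <= r / 2 -> Rabs z <= r / 2 ->
  Rabs (y ^ j - z ^ j) <= r ^ j * (Rabs (y - z) / r).
Proof.
intros Hr Hy Hz.
assert (Hd : 0 <= Rabs (y - z) / r).
{ apply Rmult_le_pos; [apply Rabs_pos|left; apply Rinv_0_lt_compat, Hr]. }
destruct j as [|j]; [simpl; rewrite Rminus_diag, Rabs_R0; lra|].
induction j as [|j IH].
- rewrite !pow_1; right; field; lra.
- replace (y ^ S (S j) - z ^ S (S j)) with (y * (y ^ S j - z ^ S j) + (y - z) * z ^ S j) by (simpl; ring).
  eapply Rle_trans; [apply Rabs_triang|]; rewrite !Rabs_mult.
  assert (H1 : Rabs y * Rabs (y ^ S j - z ^ S j) <= r / 2 * (r ^ S j * (Rabs (y - z) / r))).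
  { apply Rmult_le_compat; try apply Rabs_pos; assumption. }
  assert (H2 : Rabs (z ^ S j) <= r ^ S j / 2).
  { rewrite <- RPow_abs; apply Rle_trans with ((r / 2) ^ S j).
    - apply pow_incr; split; [apply Rabs_pos|exact Hz].
    - simpl; replace (r * r ^ j / 2) with (r / 2 * r ^ j) by field.
      apply Rmult_le_compat_l; [lra|apply pow_incr; lra]. }
  assert (H3 : Rabs (y - z) * Rabs (z ^ S j) <= Rabs (y - z) * (r ^ S j / 2)).
  { apply Rmult_le_compat_l; [apply Rabs_pos|exact H2]. }
  apply Rle_trans with (r / 2 * (r ^ S j * (Rabs (y - z) / r)) + Rabs (y - z) * (r ^ S j / 2)); [lra|].
  right; simpl; field; lra.
Qed.

Lemma pb_lip r C f y z : 0 < r -> pb r C f -> Rabs y <= r / 2 -> Rabs z <= r / 2 ->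
  Rabs (f y - f z) <= C / r * Rabs (y - z).
Proof.
intros Hr (a & Ha & Hf) Hy Hz.
assert (Hy' := Hf y ltac:(lra)); assert (Hz' := Hf z ltac:(lra)).
apply is_pseries_R in Hy', Hz'.
assert (H := is_series_minus (V := R_NormedModule) _ _ _ _ Hy' Hz').
change (is_series (fun n => a n * y ^ n - a n * z ^ n) (f y - f z)) in H.
rewrite <- (is_series_unique _ _ H).
apply abs_series_bounded; intros N.
apply Rle_trans with (sum_n (fun i => (Rabs (y - z) / r) * (Rabs (a i) * r ^ i)) N).
- apply sum_n_le'; intros i; rewrite <- Rmult_minus_distr_l, Rabs_mult.
  replace (Rabs (y - z) / r * (Rabs (a i) * r ^ i)) with (Rabs (a i) * (r ^ i * (Rabs (y - z) / r))) by ring.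
  apply Rmult_le_compat_l; [apply Rabs_pos|apply pow_sub_le; assumption].
- rewrite sum_n_scal; replace (C / r * Rabs (y - z)) with (Rabs (y - z) / r * C) by (field; lra).
  apply Rmult_le_compat_l; [|apply Ha].
  apply Rmult_le_pos; [apply Rabs_pos|left; apply Rinv_0_lt_compat, Hr].
Qed.

(** * Analytic fixed points and implicit functions *)

Lemma pb_fixpoint (Phi : R -> R -> R) (r d : R) : 0 < r -> 0 <= d ->
  (forall g, pb r d g -> pb r d (fun x => Phi x (g x))) ->
  (forall x y z, Rabs x < r -> Rabs y <= d -> Rabs z <= d ->
     Rabs (Phi x y - Phi x z) <= / 2 * Rabs (y - z)) ->
  exists g, pb r d g /\ forall x, Rabs x < r -> g x = Phi x (g x) /\
    forall y, Rabs y <= d -> y = Phi x y -> y = g x.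
Proof.
intros Hr Hd Hpb Hlip.
(* Picard iteration from 0: [pb_lim] keeps the limit analytic, and the contraction factor 1/2 makes
   it the only fixed point within [d]. *)
set (it := fix it n := match n with O => fun _ => 0 | S m => fun x => Phi x (it m x) end).
assert (Hit : forall n, pb r d (it n)).
{ induction n as [|n IH]; [apply pb_const; rewrite Rabs_R0; exact Hd|exact (Hpb _ IH)]. }
assert (Hb : forall n x, Rabs x < r -> Rabs (it n x) <= d) by (intros; apply pb_bound with r; auto).
assert (Hstep : forall n x, Rabs x < r -> Rabs (it (S n) x - it n x) <= d * (/ 2) ^ n).
{ induction n as [|n IH]; intros x Hx.
  - simpl it at 2; rewrite Rminus_0_r; simpl pow; rewrite Rmult_1_r; apply Hb, Hx.
  - change (Rabs (Phi x (it (S n) x) - Phi x (it n x)) <= d * (/ 2 * (/ 2) ^ n)).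
    eapply Rle_trans; [apply Hlip; auto|]; specialize (IH x Hx); lra. }
assert (Hdist : forall n m x, Rabs x < r -> (n <= m)%nat -> Rabs (it m x - it n x) <= 2 * d * ((/2) ^ n - (/ 2) ^ m)).
{ intros n m x Hx; induction 1 as [|m Hm IH]; [rewrite !Rminus_diag, Rabs_R0; lra|].
  replace (it (S m) x - it n x) with ((it (S m) x - it m x) + (it m x - it n x)) by ring.
  eapply Rle_trans; [apply Rabs_triang|]; specialize (Hstep m x Hx).
  replace ((/ 2) ^ S m) with (/ 2 * (/ 2) ^ m) by reflexivity; lra. }
assert (Hcv : forall x, Rabs x < r -> ex_finite_lim_seq (fun n => it n x)).
{ intros x Hx; apply ex_lim_seq_cauchy_corr; intros eps.
  assert (H0 : is_lim_seq (fun n => 2 * d * (/ 2) ^ n) 0).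
  { replace (Finite 0) with (Rbar_mult (2 * d) 0) by (simpl; f_equal; ring).
    apply is_lim_seq_scal_l, is_lim_seq_geom; rewrite Rabs_pos_eq; lra. }
  apply is_lim_seq_spec in H0; destruct (H0 eps) as [N HN].
  exists N; intros n m Hn Hm.
  assert (W : forall n m, (N <= n)%nat -> (n <= m)%nat -> Rabs (it m x - it n x) < eps).
  { clear n m Hn Hm; intros n m Hn Hnm; eapply Rle_lt_trans; [apply Hdist; auto|].
    specialize (HN n Hn); rewrite Rminus_0_r in HN; apply Rabs_lt_between in HN.
    assert (0 <= 2 * d * (/ 2) ^ m) by (apply Rmult_le_pos; [lra|apply pow_le; lra]); lra. }
  destruct (Nat.le_ge_cases n m) as [H|H]; [rewrite Rabs_minus_sym|]; apply W; auto. }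
set (g := fun x => real (Lim_seq (fun n => it n x))).
assert (Hg : forall x, Rabs x < r -> is_lim_seq (fun n => it n x) (g x)).
{ intros x Hx; apply Lim_seq_correct', Hcv, Hx. }
assert (Hpg : pb r d g) by (apply pb_lim with it; assumption).
exists g; split; [exact Hpg|]; intros x Hx.
assert (Hgb := pb_bound r d g x Hpg Hx).
assert (Efix : g x = Phi x (g x)).
{ assert (L1 : is_lim_seq (fun n => Rabs (it (S n) x - Phi x (g x))) (Rabs (g x - Phi x (g x)))).
  { apply (is_lim_seq_abs _ (g x - Phi x (g x))); apply is_lim_seq_minus'; [|apply is_lim_seq_const].
    apply (is_lim_seq_incr_1 (fun n => it n x)), Hg, Hx. }
  assert (L2 : is_lim_seq (fun n => / 2 * Rabs (it n x - g x)) 0).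
  { replace (Finite 0) with (Rbar_mult (/ 2) (Rabs (g x - g x)))
      by (simpl; f_equal; rewrite Rminus_diag, Rabs_R0; ring).
    apply is_lim_seq_scal_l, (is_lim_seq_abs _ (g x - g x)), is_lim_seq_minus'; [apply Hg, Hx|apply is_lim_seq_const]. }
  assert (Hle := is_lim_seq_le _ _ _ _ (fun n => Hlip x (it n x) (g x) Hx (Hb n x Hx) Hgb) L1 L2).
  simpl in Hle.
  assert (H0 := Rabs_pos (g x - Phi x (g x))).
  assert (H1 : Rabs (g x - Phi x (g x)) = 0) by lra.
  apply Rabs_eq_0 in H1; lra. }
split; [exact Efix|]; intros y Hy Ey.
assert (H := Hlip x y (g x) Hx Hy Hgb); rewrite <- Ey, <- Efix in H.
assert (H0 := Rabs_pos (y - g x)).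
assert (H1 : Rabs (y - g x) = 0) by lra.
apply Rabs_eq_0 in H1; lra.
Qed.

(* The two-term shape [p1(x)s1(y)+p2(x)s2(y)] avoids power series in two variables. *)
Lemma pb_implicit (R0 C d0 : R) (p1 p2 s1 s2 : R -> R) (l1 l2 : R) :
  0 < R0 -> 0 < d0 -> pb R0 C p1 -> pb R0 C p2 -> pb R0 C s1 -> pb R0 C s2 ->
  p1 0 * s1 0 + p2 0 * s2 0 = 0 -> is_derive s1 0 l1 -> is_derive s2 0 l2 ->
  p1 0 * l1 + p2 0 * l2 <> 0 ->
  exists r d g, 0 < r /\ 0 < d <= d0 /\ pb r d g /\
    forall x, Rabs x < r -> p1 x * s1 (g x) + p2 x * s2 (g x) = 0 /\
      forall y, Rabs y <= d -> p1 x * s1 y + p2 x * s2 y = 0 -> y = g x.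
Proof.
intros HR Hd0 Hp1 Hp2 Hs1 Hs2 E0 D1 D2 HL.
set (L := p1 0 * l1 + p2 0 * l2) in *.
assert (HC : 0 <= C) by exact (pb_nonneg _ _ _ HR Hp1).
assert (HLp : 0 < Rabs L) by (apply Rabs_pos_lt, HL).
(* The simplified Newton map at [x = 0]. Its value and derivative vanish at 0, hence it is
   quadratically small on small discs. *)
set (h := fun y => y + (- / L) * (p1 0 * s1 y + p2 0 * s2 y)).
set (K := R0 + Rabs (- / L) * (Rabs (p1 0) * C + Rabs (p2 0) * C)).
assert (Hh : pb R0 K h).
{ apply pb_plus; [lra|apply pb_id; lra|]; apply pb_scal; [lra|].
  apply pb_plus; [lra| |]; apply pb_scal; try lra; assumption. }
assert (HK : 0 < K).
{ unfold K; assert (0 <= Rabs (- / L) * (Rabs (p1 0) * C + Rabs (p2 0) * C)); [|lra].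
  apply Rmult_le_pos; [apply Rabs_pos|].
  apply Rplus_le_le_0_compat; apply Rmult_le_pos; try apply Rabs_pos; exact HC. }
assert (Hh0 : h 0 = 0) by (unfold h; rewrite E0; ring).
assert (Hh1 : is_derive h 0 0).
{ unfold h.
  evar_last.
  - apply (is_derive_plus (K := R_AbsRing) (V := R_NormedModule)); [apply is_derive_id|].
    apply is_derive_scal.
    apply (is_derive_plus (K := R_AbsRing) (V := R_NormedModule));
      apply is_derive_scal; [exact D1|exact D2].
  - change (1 + (- / L) * (p1 0 * l1 + p2 0 * l2) = 0); fold L; field; exact HL. }
set (q1 := fun x => p1 x + - p1 0); set (q2 := fun x => p2 x + - p2 0).
assert (Hp0 : forall p, pb R0 C p -> Rabs (- p 0) <= C).
{ intros p Hp; rewrite Rabs_Ropp; apply pb_bound with R0; [exact Hp|rewrite Rabs_R0; exact HR]. }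
assert (Hq1 : pb R0 (C + C) q1) by (apply pb_plus; [lra|exact Hp1|apply pb_const, Hp0, Hp1]).
assert (Hq2 : pb R0 (C + C) q2) by (apply pb_plus; [lra|exact Hp2|apply pb_const, Hp0, Hp2]).
set (Phi := fun x y => h y + (- / L) * (q1 x * s1 y + q2 x * s2 y)).
set (M := (C + C) * C + (C + C) * C + 1).
assert (HM : 0 < M) by (unfold M; nra).
(* [16 * K * d <= R0 ^ 2] makes [h] at most [d / 2] on radius [2 * d] and gives it the Lipschitz
   constant 1/4; the choice of [r] below limits the perturbation in [x] to the other [d / 2] and the
   other 1/4. *)
set (d := Rmin d0 (Rmin (R0 / 4) (R0 ^ 2 / (16 * K)))).
assert (HR2 : 0 < R0 ^ 2) by (apply pow_lt, HR).
assert (Hd : 0 < d).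
{ repeat apply Rmin_case; try lra; apply Rdiv_lt_0_compat; lra. }
assert (Hdd0 : d <= d0) by apply Rmin_l.
assert (HdR : d <= R0 / 4) by (eapply Rle_trans; [apply Rmin_r|apply Rmin_l]).
assert (HdK : 16 * K * d <= R0 ^ 2).
{ apply Rle_trans with (16 * K * (R0 ^ 2 / (16 * K))).
  - apply Rmult_le_compat_l; [lra|]; eapply Rle_trans; [apply Rmin_r|apply Rmin_r].
  - right; field; lra. }
set (r := Rmin R0 (Rmin (d * R0 * Rabs L / (2 * M)) (R0 ^ 2 * Rabs L / (4 * M)))).
assert (Hr : 0 < r).
{ assert (0 < d * R0 * Rabs L) by (apply Rmult_lt_0_compat; [apply Rmult_lt_0_compat; lra|lra]).
  assert (0 < R0 ^ 2 * Rabs L) by (apply Rmult_lt_0_compat; lra).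
  apply Rmin_case; [lra|]; apply Rmin_case; apply Rdiv_lt_0_compat; lra. }
assert (HrR : r <= R0) by apply Rmin_l.
assert (Hr1 : 2 * M * r <= d * R0 * Rabs L).
{ apply Rle_trans with (2 * M * (d * R0 * Rabs L / (2 * M))).
  - apply Rmult_le_compat_l; [lra|]; eapply Rle_trans; [apply Rmin_r|apply Rmin_l].
  - right; field; lra. }
assert (Hr2 : 4 * M * r <= R0 ^ 2 * Rabs L).
{ apply Rle_trans with (4 * M * (R0 ^ 2 * Rabs L / (4 * M))).
  - apply Rmult_le_compat_l; [lra|]; eapply Rle_trans; [apply Rmin_r|apply Rmin_r].
  - right; field; lra. }
assert (HLi : Rabs (- / L) = / Rabs L) by (rewrite Rabs_Ropp; apply Rabs_inv).
assert (Hq1' := pb_shrink R0 r _ q1 ltac:(lra) Hq1 ltac:(unfold q1; ring)).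
assert (Hq2' := pb_shrink R0 r _ q2 ltac:(lra) Hq2 ltac:(unfold q2; ring)).
destruct (pb_fixpoint Phi r d) as (g & Hg & HgP); [exact Hr|lra| | |].
- intros g Hg.
  apply pb_mono with r ((2 * d / R0) ^ 2 * K + Rabs (- / L) * (r / R0 * (C + C) * C + r / R0 * (C + C) * C)); [lra| |].
  + rewrite HLi.
    apply Rle_trans with (d / 2 + d / 2); [apply Rplus_le_compat|lra].
    * apply (Rmult_le_reg_l (4 * R0 ^ 2)); [lra|].
      replace (4 * R0 ^ 2 * ((2 * d / R0) ^ 2 * K)) with (d * (16 * K * d)) by (field; lra).
      apply Rle_trans with (d * R0 ^ 2); [apply Rmult_le_compat_l; lra|nra].
    * apply (Rmult_le_reg_l (2 * (Rabs L * R0))); [apply Rmult_lt_0_compat; [lra|apply Rmult_lt_0_compat; lra]|].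
      replace (2 * (Rabs L * R0) * (/ Rabs L * (r / R0 * (C + C) * C + r / R0 * (C + C) * C)))
        with (2 * (M - 1) * r) by (unfold M; field; lra).
      apply Rle_trans with (2 * M * r); [nra|]; lra.
  + apply pb_plus; [lra| |apply pb_scal; [lra|apply pb_plus; [lra| |]; apply pb_mult; try lra; try assumption]].
    * apply (pb_comp r (2 * d) _ d h g Hr); [lra|lra| |exact Hg].
      apply (pb_shrink2 R0 (2 * d) K h); [lra|exact Hh|exact Hh0|exact Hh1].
    * apply (pb_comp r R0 C d s1 g Hr HR); [lra|exact Hs1|exact Hg].
    * apply (pb_comp r R0 C d s2 g Hr HR); [lra|exact Hs2|exact Hg].
- intros x y z Hx Hy Hz.
  assert (B0 : Rabs (h y - h z) <= / 4 * Rabs (y - z)).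
  { assert (Hh4 := pb_shrink2 R0 (4 * d) K h ltac:(lra) Hh Hh0 Hh1).
    eapply Rle_trans; [apply (pb_lip (4 * d) _ h y z ltac:(lra) Hh4); lra|].
    apply Rmult_le_compat_r; [apply Rabs_pos|].
    apply (Rmult_le_reg_l (4 * R0 ^ 2)); [lra|].
    replace (4 * R0 ^ 2 * ((4 * d / R0) ^ 2 * K / (4 * d))) with (16 * K * d) by (field; lra); lra. }
  assert (B1 := pb_lip R0 C s1 y z HR Hs1 ltac:(lra) ltac:(lra)).
  assert (B2 := pb_lip R0 C s2 y z HR Hs2 ltac:(lra) ltac:(lra)).
  assert (Q1 := pb_bound _ _ _ x Hq1' Hx); assert (Q2 := pb_bound _ _ _ x Hq2' Hx).
  unfold Phi.
  replace (_ - _) with ((h y - h z) + (- / L) * (q1 x * (s1 y - s1 z) + q2 x * (s2 y - s2 z))) by ring.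
  eapply Rle_trans; [apply Rabs_triang|].
  rewrite (Rabs_mult (- / L)), HLi.
  assert (B3 : Rabs (q1 x * (s1 y - s1 z) + q2 x * (s2 y - s2 z)) <=
    (r / R0 * (C + C) * (C / R0) + r / R0 * (C + C) * (C / R0)) * Rabs (y - z)).
  { eapply Rle_trans; [apply Rabs_triang|rewrite !Rabs_mult, Rmult_plus_distr_r].
    apply Rplus_le_compat; rewrite Rmult_assoc; apply Rmult_le_compat; try apply Rabs_pos; assumption. }
  assert (B4 : / Rabs L * ((r / R0 * (C + C) * (C / R0) + r / R0 * (C + C) * (C / R0)) * Rabs (y - z))
    <= / 4 * Rabs (y - z)).
  { rewrite <- Rmult_assoc; apply Rmult_le_compat_r; [apply Rabs_pos|].
    apply (Rmult_le_reg_l (4 * (R0 ^ 2 * Rabs L))); [apply Rmult_lt_0_compat; [lra|apply Rmult_lt_0_compat; lra]|].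
    replace (4 * (R0 ^ 2 * Rabs L) * (/ Rabs L * (r / R0 * (C + C) * (C / R0) + r / R0 * (C + C) * (C / R0))))
      with (4 * (M - 1) * r) by (unfold M; field; lra).
    apply Rle_trans with (4 * M * r); [nra|]; lra. }
  assert (B5 := Rmult_le_compat_l (/ Rabs L) _ _ ltac:(left; apply Rinv_0_lt_compat, HLp) B3).
  lra.
- assert (EPhi : forall x y, y - Phi x y = / L * (p1 x * s1 y + p2 x * s2 y)).
  { intros x y; unfold Phi, h, q1, q2; ring. }
  exists r, d, g; split; [exact Hr|split; [split; assumption|split; [exact Hg|]]].
  intros x Hx; destruct (HgP x Hx) as [E U]; split.
  + apply (Rmult_eq_reg_l (/ L)); [|apply Rinv_neq_0_compat, HL].
    rewrite <- EPhi, Rmult_0_r; lra.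
  + intros y Hy Ey; apply U; [exact Hy|].
    assert (H := EPhi x y); rewrite Ey, Rmult_0_r in H; lra.
Qed.

(** * Double series with geometric bounds *)

Lemma sum_n_zero n : sum_n (fun _ => 0) n = 0.
Proof. induction n as [|n IH]; [rewrite sum_n_0; reflexivity|rewrite sum_n_S, IH; rring]. Qed.

Lemma is_series_zero : is_series (fun _ => 0) 0.
Proof.
assert (H : is_lim_seq (sum_n (fun _ => 0)) 0); [|exact H].
apply (is_lim_seq_ext (fun _ => 0)); [|apply is_lim_seq_const].
intros n; rewrite sum_n_zero; reflexivity.
Qed.

Lemma geom_bound_ex (u : nat -> R) K r : 0 <= r < 1 -> (forall n, Rabs (u n) <= K * r ^ n) -> ex_series u.
Proof.
intros Hr Hu.
apply (ex_series_le (K := R_AbsRing) (V := R_CompleteNormedModule) u (fun n => K * r ^ n)).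
- intros n; apply Hu.
- apply (ex_series_scal (V := R_NormedModule)), ex_series_geom; rewrite Rabs_pos_eq; lra.
Qed.

Lemma geom_bound_tail (u : nat -> R) K r N : 0 <= r < 1 -> (forall n, Rabs (u n) <= K * r ^ n) ->
  Rabs (Series u - sum_n u N) <= K * r ^ S N / (1 - r).
Proof.
intros Hr Hu.
rewrite (Series_incr_n u (S N)) by (try lia; eapply geom_bound_ex; eauto).
simpl pred; rewrite sum_n_Reals.
replace (_ - _) with (Series (fun k => u (S N + k)%nat)) by ring.
assert (Hg : is_series (fun k => K * r ^ S N * r ^ k) (K * r ^ S N * / (1 - r))).
{ apply (is_series_scal (V := R_NormedModule)), is_series_geom; rewrite Rabs_pos_eq; lra. }
assert (Hle : forall n, 0 <= Rabs (u (S N + n)%nat) <= K * r ^ S N * r ^ n).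
{ intros n; split; [apply Rabs_pos|].
  eapply Rle_trans; [apply Hu|rewrite pow_add; right; ring]. }
assert (Hex : ex_series (fun n => Rabs (u (S N + n)%nat))).
{ apply (ex_series_le (K := R_AbsRing) (V := R_CompleteNormedModule) _ (fun k => K * r ^ S N * r ^ k)).
  - intros n; unfold norm; simpl; unfold abs; simpl; rewrite Rabs_Rabsolu; apply Hle.
  - eexists; exact Hg. }
eapply Rle_trans; [apply Series_Rabs, Hex|].
unfold Rdiv; rewrite <- (is_series_unique _ _ Hg); apply Series_le; [exact Hle|eexists; exact Hg].
Qed.

Lemma geom_bound_Series (u : nat -> R) K r : 0 <= r < 1 -> (forall n, Rabs (u n) <= K * r ^ n) ->
  Rabs (Series u) <= K / (1 - r).
Proof.
intros Hr Hu.
assert (Hg : is_series (fun k => K * r ^ k) (K * / (1 - r))).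
{ apply (is_series_scal (V := R_NormedModule)), is_series_geom; rewrite Rabs_pos_eq; lra. }
assert (Hex : ex_series (fun n => Rabs (u n))).
{ apply (ex_series_le (K := R_AbsRing) (V := R_CompleteNormedModule) _ (fun k => K * r ^ k)).
  - intros n; unfold norm; simpl; unfold abs; simpl; rewrite Rabs_Rabsolu; apply Hu.
  - eexists; exact Hg. }
eapply Rle_trans; [apply Series_Rabs, Hex|].
unfold Rdiv; rewrite <- (is_series_unique _ _ Hg); apply Series_le; [|eexists; exact Hg].
intros n; split; [apply Rabs_pos|apply Hu].
Qed.

Lemma Series_Series_box (f : nat -> nat -> R) K r N : 0 <= r < 1 ->
  (forall a b, Rabs (f a b) <= K * r ^ a * r ^ b) ->
  Rabs (Series (fun a => Series (f a)) - sum_n (fun a => sum_n (f a) N) N) <= 2 * K / (1 - r) ^ 2 * r ^ S N.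
Proof.
intros Hr Hf.
assert (HK : 0 <= K).
{ specialize (Hf 0%nat 0%nat); simpl in Hf; generalize (Rabs_pos (f 0%nat 0%nat)); lra. }
assert (H1 : forall a, Rabs (Series (f a)) <= K / (1 - r) * r ^ a).
{ intros a; eapply Rle_trans; [apply (geom_bound_Series _ (K * r ^ a) r Hr (Hf a))|right; field; lra]. }
assert (H2 := geom_bound_tail _ _ r N Hr H1).
assert (H3 : Rabs (sum_n (fun a => Series (f a)) N - sum_n (fun a => sum_n (f a) N) N) <= K / (1 - r) ^ 2 * r ^ S N).
{ replace (sum_n (fun a => Series (f a)) N - sum_n (fun a => sum_n (f a) N) N)
    with (sum_n (fun a => Series (f a) - sum_n (f a) N) N).
  - eapply Rle_trans; [apply sum_n_Rabs|].
    apply Rle_trans with (sum_n (fun a => K * r ^ S N / (1 - r) * r ^ a) N).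
    + apply sum_n_le'; intros a.
      eapply Rle_trans; [apply (geom_bound_tail _ (K * r ^ a) r N Hr (Hf a))|right; field; lra].
    + rewrite sum_n_scal.
      assert (Hg : sum_n (fun a => r ^ a) N <= / (1 - r)).
      { rewrite <- (is_series_unique (fun a => r ^ a) (/ (1 - r)))
          by (apply is_series_geom; rewrite Rabs_pos_eq; lra).
        apply sum_n_le_Series; [intros; apply pow_le; lra|].
        apply ex_series_geom; rewrite Rabs_pos_eq; lra. }
      apply Rle_trans with (K * r ^ S N / (1 - r) * / (1 - r)); [|right; field; lra].
      apply Rmult_le_compat_l; [|exact Hg].
      apply Rmult_le_pos; [|left; apply Rinv_0_lt_compat; lra].
      apply Rmult_le_pos; [exact HK|apply pow_le; lra].
  - unfold Rminus; rewrite sum_n_plus'; f_equal.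
    transitivity (sum_n (fun a => -1 * sum_n (f a) N) N); [apply sum_n_ext; intros; rring|].
    rewrite sum_n_scal; rring. }
replace (_ - _) with ((Series (fun a => Series (f a)) - sum_n (fun a => Series (f a)) N) +
  (sum_n (fun a => Series (f a)) N - sum_n (fun a => sum_n (f a) N) N)) by ring.
eapply Rle_trans; [apply Rabs_triang|].
replace (2 * K / (1 - r) ^ 2 * r ^ S N) with (K / (1 - r) * r ^ S N / (1 - r) + K / (1 - r) ^ 2 * r ^ S N) by (field; lra).
apply Rplus_le_compat; assumption.
Qed.

(** Both iterated sums lie within the same geometric error of the same square partial sums. *)
Lemma Series_switch (f : nat -> nat -> R) K r : 0 <= r < 1 ->
  (forall a b, Rabs (f a b) <= K * r ^ a * r ^ b) ->
  Series (fun a => Series (f a)) = Series (fun b => Series (fun a => f a b)).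
Proof.
intros Hr Hf.
assert (Hf' : forall b a, Rabs (f a b) <= K * r ^ b * r ^ a).
{ intros b a; replace (K * r ^ b * r ^ a) with (K * r ^ a * r ^ b) by ring; apply Hf. }
set (A := Series (fun a => Series (f a))); set (B := Series (fun b => Series (fun a => f a b))).
assert (H : forall N, Rabs (A - B) <= 4 * K / (1 - r) ^ 2 * r ^ S N).
{ intros N.
  assert (H1 := Series_Series_box f K r N Hr Hf).
  assert (H2 := Series_Series_box (fun b a => f a b) K r N Hr Hf').
  fold A in H1; fold B in H2.
  rewrite (sum_n_switch (fun b a => f a b)) in H2.
  set (S0 := sum_n (fun a => sum_n (f a) N) N) in *.
  change (sum_n (fun j => sum_n (fun i => f j i) N) N) with S0 in H2.
  replace (A - B) with ((A - S0) - (B - S0)) by ring.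
  unfold Rminus at 1; eapply Rle_trans; [apply Rabs_triang|]; rewrite Rabs_Ropp.
  replace (4 * K / (1 - r) ^ 2 * r ^ S N) with (2 * K / (1 - r) ^ 2 * r ^ S N + 2 * K / (1 - r) ^ 2 * r ^ S N) by (field; lra).
  change (Series (fun b => Series (fun a => f a b))) with B in H2. apply Rplus_le_compat; assumption. }
assert (L : is_lim_seq (fun N => 4 * K / (1 - r) ^ 2 * r ^ S N) 0).
{ replace (Finite 0) with (Rbar_mult (4 * K / (1 - r) ^ 2) 0) by (simpl; f_equal; ring).
  apply is_lim_seq_scal_l, (is_lim_seq_incr_1 (fun n => r ^ n)), is_lim_seq_geom; rewrite Rabs_pos_eq; lra. }
assert (H0 := is_lim_seq_le _ _ _ _ H (is_lim_seq_const (Rabs (A - B))) L); simpl in H0.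
assert (H1 := Rabs_pos (A - B)); assert (H2 : Rabs (A - B) = 0) by lra.
apply Rabs_eq_0 in H2; lra.
Qed.

(** Collecting terms by the value of [a - b] is what turns the product of a power series in $z$ and
    one in $1/z$ into a Laurent series. *)
Lemma Series_diagonals (f : nat -> nat -> R) K r : 0 <= r < 1 ->
  (forall a b, Rabs (f a b) <= K * r ^ a * r ^ b) ->
  Series (fun a => Series (f a)) =
  Series (fun j => Series (fun b => f (b + j)%nat b)) + Series (fun j => Series (fun a => f a (a + S j)%nat)).
Proof.
intros Hr Hf.
assert (HK : 0 <= K).
{ specialize (Hf 0%nat 0%nat); simpl in Hf; generalize (Rabs_pos (f 0%nat 0%nat)); lra. }
assert (Hp1 : forall n, 0 <= r ^ n <= 1).
{ intros n; split; [apply pow_le; lra|rewrite <- (pow1 n); apply pow_incr; lra]. }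
set (lo := fun a b => if Nat.leb b a then f a b else 0).
assert (Hlo : forall a b, Rabs (lo a b) <= K * r ^ a * r ^ b).
{ intros a b; unfold lo; destruct (Nat.leb b a); [apply Hf|rewrite Rabs_R0].
  apply Rmult_le_pos; [apply Rmult_le_pos|]; try apply Hp1; exact HK. }
assert (Hhi : forall a k, Rabs (f a (a + S k)%nat) <= K * r ^ a * r ^ k).
{ intros a k; eapply Rle_trans; [apply Hf|].
  rewrite pow_add; simpl; assert (H1 := Hp1 a); assert (H2 := Hp1 k).
  apply Rle_trans with ((K * r ^ a * r ^ k) * (r ^ a * r)); [right; ring|].
  rewrite <- (Rmult_1_r (K * r ^ a * r ^ k)) at 2; apply Rmult_le_compat_l; [|nra].
  apply Rmult_le_pos; [apply Rmult_le_pos|]; lra. }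
assert (Hdi : forall b j, Rabs (f (b + j)%nat b) <= K * r ^ b * r ^ j).
{ intros b j; eapply Rle_trans; [apply Hf|].
  rewrite pow_add; simpl; assert (H1 := Hp1 b); assert (H2 := Hp1 j).
  apply Rle_trans with ((K * r ^ b * r ^ j) * (r ^ b)); [right; ring|].
  rewrite <- (Rmult_1_r (K * r ^ b * r ^ j)) at 2; apply Rmult_le_compat_l; [|lra].
  apply Rmult_le_pos; [apply Rmult_le_pos|]; lra. }
assert (Hex : forall a, ex_series (f a)) by (intros a; exact (geom_bound_ex _ _ r Hr (Hf a))).
assert (Hsplit : forall a, Series (f a) = Series (lo a) + Series (fun k => f a (a + S k)%nat)).
{ intros a.
  rewrite (Series_incr_n (f a) (S a)) by (try lia; apply Hex).
  rewrite (Series_incr_n (lo a) (S a)) by (try lia; exact (geom_bound_ex _ _ r Hr (Hlo a))).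
  simpl pred; rewrite <- !sum_n_Reals.
  rewrite (sum_n_ext_loc (lo a) (f a)) by (intros k Hk; unfold lo; rewrite (proj2 (Nat.leb_le _ _)) by exact Hk; reflexivity).
  rewrite (Series_ext (fun k => lo a (S a + k)%nat) (fun _ => 0)).
  - rewrite (is_series_unique (fun _ => 0) 0).
    + rewrite Rplus_0_r; f_equal; apply Series_ext; intros k; f_equal; lia.
    + apply is_series_zero.
  - intros k; unfold lo; rewrite (proj2 (Nat.leb_gt _ _)) by lia; reflexivity. }
rewrite (Series_ext _ _ Hsplit), Series_plus.
- f_equal; [|apply (Series_switch _ K r Hr Hhi)].
  rewrite (Series_switch _ K r Hr Hlo).
  rewrite <- (Series_switch (fun b j => f (b + j)%nat b) K r Hr Hdi).
  apply Series_ext; intros b.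
  assert (Hexb : ex_series (fun a => lo a b)).
  { apply (geom_bound_ex _ (K * r ^ b) r Hr); intros a.
    eapply Rle_trans; [apply Hlo|right; ring]. }
  destruct b as [|b].
  + apply Series_ext; intros k; reflexivity.
  + rewrite (Series_incr_n _ (S b)) by (try lia; exact Hexb); simpl pred.
    rewrite <- sum_n_Reals, (sum_n_ext_loc _ (fun _ => 0)).
    * rewrite sum_n_zero, Rplus_0_l; apply Series_ext; intros k; unfold lo.
      rewrite (proj2 (Nat.leb_le _ _)) by lia; f_equal; lia.
    * intros k Hk; unfold lo; rewrite (proj2 (Nat.leb_gt _ _)) by lia; reflexivity.
- apply (geom_bound_ex _ (K / (1 - r)) r Hr); intros a.
  eapply Rle_trans; [apply (geom_bound_Series _ (K * r ^ a) r Hr (Hlo a))|right; field; lra].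
- apply (geom_bound_ex _ (K / (1 - r)) r Hr); intros a.
  eapply Rle_trans; [apply (geom_bound_Series _ (K * r ^ a) r Hr (Hhi a))|right; field; lra].
Qed.

(** * Coefficient sequences of entire functions *)

Definition superexp (a : nat -> R) : Prop :=
  forall X, 0 < X -> exists M, forall j, Rabs (a j) * X ^ j <= M.

Lemma superexp_series (a : nat -> R) X : superexp a -> 0 < X -> ex_series (fun j => Rabs (a j) * X ^ j).
Proof.
intros Ha HX; destruct (Ha (2 * X) ltac:(lra)) as [M HM].
apply (geom_bound_ex _ M (/ 2)); [lra|]; intros n.
rewrite Rabs_pos_eq by (apply Rmult_le_pos; [apply Rabs_pos|apply pow_le; lra]).
specialize (HM n); rewrite Rpow_mult_distr in HM; rewrite pow_inv.
assert (0 < 2 ^ n) by (apply pow_lt; lra).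
apply (Rmult_le_reg_r (2 ^ n)); [assumption|].
replace (M * / 2 ^ n * 2 ^ n) with M by (field; lra); lra.
Qed.

Lemma superexp_pcoef (a : nat -> R) X : superexp a -> 0 < X ->
  pcoef X (Series (fun j => Rabs (a j) * X ^ j)) a.
Proof.
intros Ha HX N; apply sum_n_le_Series; [|apply superexp_series; assumption].
intros n; apply Rmult_le_pos; [apply Rabs_pos|apply pow_le; lra].
Qed.

Lemma superexp_radius (a : nat -> R) x : superexp a -> Rbar_lt (Rabs x) (CV_radius a).
Proof.
intros Ha; apply pcoef_radius with (Rabs x + 1) (Series (fun j => Rabs (a j) * (Rabs x + 1) ^ j)); [|lra].
apply superexp_pcoef; [exact Ha|generalize (Rabs_pos x); lra].
Qed.

Lemma superexp_ex (a : nat -> R) x : superexp a -> ex_pseries a x.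
Proof. intros Ha; apply CV_radius_inside, superexp_radius, Ha. Qed.

Lemma superexp_le (a b : nat -> R) : (forall j, Rabs (a j) <= Rabs (b j)) -> superexp b -> superexp a.
Proof.
intros H Hb X HX; destruct (Hb X HX) as [M HM]; exists M; intros j.
eapply Rle_trans; [|apply HM]; apply Rmult_le_compat_r; [apply pow_le; lra|apply H].
Qed.

Lemma superexp_scale (a : nat -> R) t : superexp a -> superexp (fun j => t ^ j * a j).
Proof.
intros Ha X HX.
assert (Ht : 0 < (Rabs t + 1) * X) by (apply Rmult_lt_0_compat; [generalize (Rabs_pos t)|]; lra).
destruct (Ha _ Ht) as [M HM]; exists M; intros j.
eapply Rle_trans; [|apply (HM j)].
rewrite Rabs_mult, Rpow_mult_distr, <- RPow_abs.
replace (Rabs t ^ j * Rabs (a j) * X ^ j) with (Rabs (a j) * (Rabs t ^ j * X ^ j)) by ring.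
apply Rmult_le_compat_l; [apply Rabs_pos|]; apply Rmult_le_compat_r; [apply pow_le; lra|].
apply pow_incr; split; [apply Rabs_pos|lra].
Qed.

Lemma superexp_small (r K : R) : 0 <= r < 1 -> 0 <= K -> exists J, forall j, (J <= j)%nat -> K * r ^ j <= 1.
Proof.
intros Hr HK.
destruct (pow_lt_1_zero r ltac:(rewrite Rabs_pos_eq; lra) (/ (K + 1))) as [J HJ];
  [apply Rinv_0_lt_compat; lra|].
exists J; intros j Hj; specialize (HJ j Hj); rewrite Rabs_pos_eq in HJ by (apply pow_le; lra).
assert (K * r ^ j <= K * / (K + 1)) by (apply Rmult_le_compat_l; lra).
assert (K * / (K + 1) <= 1); [|lra].
apply (Rmult_le_reg_r (K + 1)); [lra|]; rewrite Rmult_assoc, Rinv_l; lra.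
Qed.

(** For fixed [X] the geometric factor eventually beats $X+X^2$, and from then on the weights
    $w_j=|a_j|X^j$ satisfy $w_{j+2}\le\max(w_{j+1},w_j)$, so they stay below their earlier
    values. *)
Lemma superexp_of_ratio2 (a : nat -> R) r K : 0 < r < 1 -> 0 <= K ->
  (forall j, Rabs (a (S (S j))) <= K * r ^ j * (Rabs (a (S j)) + Rabs (a j))) -> superexp a.
Proof.
intros Hr HK Ha X HX.
destruct (superexp_small r (K * (X + X ^ 2)) ltac:(lra)) as [J HJ].
{ apply Rmult_le_pos; [exact HK|generalize (pow2_ge_0 X); lra]. }
set (w := fun j => Rabs (a j) * X ^ j).
assert (Hw0 : forall j, 0 <= w j) by (intros; apply Rmult_le_pos; [apply Rabs_pos|apply pow_le; lra]).
assert (Hw : forall j, (J <= j)%nat -> w (S (S j)) <= Rmax (w (S j)) (w j)).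
{ intros j Hj.
  apply Rle_trans with (K * r ^ j * (X * w (S j) + X ^ 2 * w j)).
  - unfold w; simpl.
    apply Rle_trans with (K * r ^ j * (Rabs (a (S j)) + Rabs (a j)) * (X * (X * X ^ j))).
    + apply Rmult_le_compat_r; [|apply Ha].
      apply Rmult_le_pos; [lra|apply Rmult_le_pos; [lra|apply pow_le; lra]].
    + right; ring.
  - assert (H1 := Rmax_l (w (S j)) (w j)); assert (H2 := Rmax_r (w (S j)) (w j)).
    assert (H3 : 0 <= K * r ^ j) by (apply Rmult_le_pos; [exact HK|apply pow_le; lra]).
    assert (HX2 : 0 <= X ^ 2) by apply pow2_ge_0.
    apply Rle_trans with (K * r ^ j * ((X + X ^ 2) * Rmax (w (S j)) (w j))).
    + apply Rmult_le_compat_l; [exact H3|]; rewrite Rmult_plus_distr_r.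
      apply Rplus_le_compat; apply Rmult_le_compat_l; lra.
    + specialize (HJ j Hj); specialize (Hw0 j).
      replace (K * r ^ j * ((X + X ^ 2) * Rmax (w (S j)) (w j)))
        with (K * (X + X ^ 2) * r ^ j * Rmax (w (S j)) (w j)) by ring.
      rewrite <- (Rmult_1_l (Rmax (w (S j)) (w j))) at 2; apply Rmult_le_compat_r; lra. }
set (B := sum_n w (S J)).
assert (HB : forall j, (j <= S J)%nat -> w j <= B).
{ intros j Hj; apply Rle_trans with (sum_n w j).
  - destruct j; [rewrite sum_n_0; lra|rewrite sum_n_S; generalize (sum_n_nonneg w j Hw0); lra].
  - apply sum_n_incr; assumption. }
exists B; intros j; change (w j <= B).
destruct (Nat.le_gt_cases j (S J)) as [Hj|Hj]; [apply HB, Hj|].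
assert (H : forall n, w (n + J)%nat <= B /\ w (S (n + J)) <= B).
{ induction n as [|n [IH1 IH2]]; [split; apply HB; lia|].
  split; [exact IH2|].
  eapply Rle_trans; [apply (Hw (n + J)%nat); lia|]; apply Rmax_case; assumption. }
replace j with ((j - J) + J)%nat by lia; apply H.
Qed.

(** * The q-difference equation *)

(* Coefficients of the entire solution of [U(z) = (1 + z^2 - 2 al z) U(q z) - c z^2 U(q^2 z)], [U(0) = 1]. *)
Fixpoint upair (q al c : R) (j : nat) : R * R :=
  match j with
  | O => (1, - 2 * al / (1 - q))
  | S i => let (a, b) := upair q al c i in
      (b, (- 2 * al * q ^ S i * b + (q ^ i - c * q ^ (2 * i)) * a) / (1 - q ^ S (S i)))
  end.

Definition ucoef (q al c : R) (j : nat) : R := fst (upair q al c j).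

Lemma ucoef_0 q al c : ucoef q al c 0 = 1.
Proof. reflexivity. Qed.

Lemma ucoef_1 q al c : ucoef q al c 1 = - 2 * al / (1 - q).
Proof. reflexivity. Qed.

Lemma ucoef_SS q al c j : ucoef q al c (S (S j)) =
  (- 2 * al * q ^ S j * ucoef q al c (S j) + (q ^ j - c * q ^ (2 * j)) * ucoef q al c j) / (1 - q ^ S (S j)).
Proof.
unfold ucoef; simpl upair; destruct (upair q al c j) as [a b]; reflexivity.
Qed.

Fixpoint mpair (q K : R) (j : nat) : R * R :=
  match j with
  | O => (1, K)
  | S i => let (a, b) := mpair q K i in (b, K * q ^ i * (b + a))
  end.

(** A majorant of [ucoef] that sees the parameters through [K] only. One sequence therefore serves
    all nearby parameters, which later yields continuity and analyticity in them. *)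
Definition ubound (q K : R) (j : nat) : R := fst (mpair q K j).

Lemma ubound_SS q K j : ubound q K (S (S j)) = K * q ^ j * (ubound q K (S j) + ubound q K j).
Proof. unfold ubound; simpl mpair; destruct (mpair q K j) as [a b]; reflexivity. Qed.

Lemma nat_ind2 (P : nat -> Prop) : P 0%nat -> P 1%nat -> (forall n, P n -> P (S n) -> P (S (S n))) -> forall n, P n.
Proof.
intros H0 H1 HS n; assert (H : P n /\ P (S n)); [|apply H].
induction n as [|n [IH1 IH2]]; [split; assumption|split; [exact IH2|apply HS; assumption]].
Qed.

Lemma ubound_pos q K j : 0 < q -> 0 <= K -> 0 <= ubound q K j.
Proof.
intros Hq HK; induction j as [| |j IH1 IH2] using nat_ind2; [unfold ubound; simpl; lra|exact HK|].
rewrite ubound_SS; apply Rmult_le_pos; [apply Rmult_le_pos; [exact HK|apply pow_le; lra]|lra].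
Qed.

Lemma ubound_superexp q K : 0 < q < 1 -> 0 <= K -> superexp (ubound q K).
Proof.
intros Hq HK; apply (superexp_of_ratio2 _ q K Hq HK); intros j.
rewrite !Rabs_pos_eq by (apply ubound_pos; lra).
rewrite ubound_SS; lra.
Qed.

Lemma pow_le_1 q j : 0 < q < 1 -> 0 < q ^ j <= 1.
Proof.
intros Hq; split; [apply pow_lt; lra|rewrite <- (pow1 j); apply pow_incr; lra].
Qed.

Lemma one_sub_pow q j : 0 < q < 1 -> 1 - q <= 1 - q ^ S j.
Proof. intros Hq; simpl; generalize (pow_le_1 q j Hq); nra. Qed.

Lemma ucoef_bound q al c K : 0 < q < 1 -> 2 * Rabs al <= K * (1 - q) -> 1 + Rabs c <= K * (1 - q) ->
  forall j, Rabs (ucoef q al c j) <= ubound q K j.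
Proof.
intros Hq H1 H2 j.
assert (HK : 0 <= K) by (generalize (Rabs_pos c); nra).
induction j as [| |j IH1 IH2] using nat_ind2.
- rewrite ucoef_0, Rabs_R1; unfold ubound; simpl; lra.
- rewrite ucoef_1; change (ubound q K 1) with K; unfold Rdiv.
  rewrite Rabs_mult, Rabs_mult, Rabs_inv, (Rabs_pos_eq (1 - q)) by lra.
  replace (Rabs (- 2)) with 2 by (rewrite Rabs_left; lra).
  apply (Rmult_le_reg_r (1 - q)); [lra|]; rewrite Rmult_assoc, Rinv_l; lra.
- rewrite ucoef_SS, ubound_SS.
  assert (Hd := one_sub_pow q (S j) Hq); assert (Hp := pow_le_1 q j Hq).
  unfold Rdiv; rewrite Rabs_mult, Rabs_inv, (Rabs_pos_eq (1 - q ^ S (S j))) by lra.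
  apply (Rmult_le_reg_r (1 - q ^ S (S j))); [lra|]; rewrite Rmult_assoc, Rinv_l, Rmult_1_r by lra.
  assert (B1 := ubound_pos q K j ltac:(lra) HK); assert (B2 := ubound_pos q K (S j) ltac:(lra) HK).
  apply Rle_trans with (K * q ^ j * (ubound q K (S j) + ubound q K j) * (1 - q)).
  + eapply Rle_trans; [apply Rabs_triang|rewrite !Rabs_mult].
    replace (Rabs (- 2)) with 2 by (rewrite Rabs_left; lra).
    rewrite (Rabs_pos_eq (q ^ S j)) by (apply pow_le; lra).
    assert (E1 : q ^ S j <= q ^ j) by (simpl; nra).
    assert (E2 : Rabs (q ^ j - c * q ^ (2 * j)) <= q ^ j * (1 + Rabs c)).
    { replace (2 * j)%nat with (j + j)%nat by lia; rewrite pow_add.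
      replace (q ^ j - c * (q ^ j * q ^ j)) with (q ^ j * (1 + - c * q ^ j)) by ring.
      rewrite Rabs_mult, (Rabs_pos_eq (q ^ j)) by lra.
      apply Rmult_le_compat_l; [lra|]; eapply Rle_trans; [apply Rabs_triang|].
      rewrite Rabs_R1, Rabs_mult, Rabs_Ropp, (Rabs_pos_eq (q ^ j)) by lra.
      generalize (Rabs_pos c); nra. }
    assert (E3 : 2 * Rabs al * q ^ S j * Rabs (ucoef q al c (S j)) <= K * (1 - q) * q ^ j * ubound q K (S j)).
    { apply Rmult_le_compat; [| apply Rabs_pos| |exact IH2].
      - apply Rmult_le_pos; [generalize (Rabs_pos al); lra|apply pow_le; lra].
      - apply Rmult_le_compat; try lra; [generalize (Rabs_pos al); lra|apply pow_le; lra]. }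
    assert (E4 : Rabs (q ^ j - c * q ^ (2 * j)) * Rabs (ucoef q al c j) <= q ^ j * (K * (1 - q)) * ubound q K j).
    { apply Rmult_le_compat; try apply Rabs_pos; [|exact IH1].
      eapply Rle_trans; [exact E2|]; apply Rmult_le_compat_l; lra. }
    lra.
  + apply Rmult_le_compat_l; [|lra].
    apply Rmult_le_pos; [apply Rmult_le_pos|]; lra.
Qed.

Definition ukap (q al c : R) : R := (2 * Rabs al + 1 + Rabs c) / (1 - q).

Lemma ukap_spec q al c : 0 < q < 1 ->
  0 <= ukap q al c /\ 2 * Rabs al <= ukap q al c * (1 - q) /\ 1 + Rabs c <= ukap q al c * (1 - q).
Proof.
intros Hq; assert (E : ukap q al c * (1 - q) = 2 * Rabs al + 1 + Rabs c) by (unfold ukap; field; lra).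
generalize (Rabs_pos al) (Rabs_pos c); intros; rewrite E; repeat split; try lra.
unfold ukap; apply Rmult_le_pos; [lra|left; apply Rinv_0_lt_compat; lra].
Qed.

Lemma ucoef_superexp q al c : 0 < q < 1 -> superexp (ucoef q al c).
Proof.
intros Hq; destruct (ukap_spec q al c Hq) as (H0 & H1 & H2).
apply superexp_le with (ubound q (ukap q al c)); [|apply ubound_superexp; assumption].
intros j; rewrite (Rabs_pos_eq (ubound _ _ _)) by (apply ubound_pos; lra).
apply ucoef_bound; assumption.
Qed.

Definition Ufun (q al c z : R) : R := PSeries (ucoef q al c) z.

Lemma PSeries_scale (a : nat -> R) t z : PSeries (fun j => t ^ j * a j) z = PSeries a (t * z).
Proof. apply Series_ext; intros n; rewrite Rpow_mult_distr; ring. Qed.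

Lemma Ufun_eq q al c z : 0 < q < 1 ->
  Ufun q al c z = (1 + z ^ 2 - 2 * al * z) * Ufun q al c (q * z) - c * z ^ 2 * Ufun q al c (q * (q * z)).
Proof.
intros Hq; unfold Ufun.
set (u := ucoef q al c); assert (Hu : superexp u) by apply ucoef_superexp, Hq.
rewrite <- !PSeries_scale.
set (a := fun j => q ^ j * u j).
assert (Ha : superexp a) by apply superexp_scale, Hu.
set (b := fun j => q ^ j * (q ^ j * u j)).
assert (Hb : superexp b) by apply superexp_scale, Ha.
assert (E1 : forall f : nat -> R, z * PSeries f z = PSeries (PS_incr_1 f) z) by (intros; symmetry; apply PSeries_incr_1).
replace ((1 + z ^ 2 - 2 * al * z) * PSeries a z - c * z ^ 2 * PSeries b z)
  with (PSeries a z + z * (z * PSeries a z) + (- 2 * al) * (z * PSeries a z) + (- c) * (z * (z * PSeries b z))) by ring.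
rewrite !E1.
assert (X1 : forall f : nat -> R, superexp f -> ex_pseries f z) by (intros f Hf; apply superexp_ex, Hf).
assert (X2 : forall f : nat -> R, ex_pseries f z -> ex_pseries (PS_incr_1 f) z)
  by (intros f Hf; apply (ex_pseries_incr_1 (V := R_NormedModule)), Hf).
assert (X3 : forall (k : R) (f : nat -> R), ex_pseries f z -> ex_pseries (PS_scal k f) z).
{ intros k f Hf; apply (ex_pseries_scal (V := R_NormedModule)); [apply Rmult_comm|exact Hf]. }
assert (X4 : forall f g : nat -> R, ex_pseries f z -> ex_pseries g z -> ex_pseries (PS_plus f g) z)
  by (intros; apply (ex_pseries_plus (V := R_NormedModule)); assumption).
rewrite <- !PSeries_scal, <- !PSeries_plus; auto 10.
apply PSeries_ext; intros n; unfold PS_plus, PS_scal, PS_incr_1.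
change (u n = a n + match n with O => 0 | S m => match m with O => 0 | S k => a k end end
  + (- 2 * al) * match n with O => 0 | S m => a m end
  + (- c) * match n with O => 0 | S m => match m with O => 0 | S k => b k end end).
unfold a, b, u; destruct n as [|[|n]].
- rewrite ucoef_0; simpl; ring.
- rewrite ucoef_1, ucoef_0; simpl; field; lra.
- rewrite ucoef_SS; assert (Hd := one_sub_pow q (S n) Hq).
  replace (2 * n)%nat with (n + n)%nat by lia; rewrite pow_add; simpl in *; field; lra.
Qed.

Lemma Ufun_0 q al c : Ufun q al c 0 = 1.
Proof. unfold Ufun; rewrite PSeries_0; reflexivity. Qed.

Lemma Ufun_cont q al c z : 0 < q < 1 -> continuous (Ufun q al c) z.
Proof.
intros Hq; apply continuity_pt_filterlim, PSeries_continuity, superexp_radius, ucoef_superexp, Hq.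
Qed.

(** * Laurent coefficients of the Wronskian *)

Definition Dterm (q al c : R) (j b : nat) : R :=
  ucoef q al c (b + j) * ucoef q al c b * q ^ (b + j) * (1 - c * q ^ (2 * b + j)).

(* Coefficient of [z^j], for [j >= 0], in the Laurent expansion of [That] below. *)
Definition Dco (q al c : R) (j : nat) : R := Series (Dterm q al c j).

Lemma superexp_half (a : nat -> R) x : superexp a -> exists M, 0 <= M /\ forall j, Rabs (a j * x ^ j) <= M * (/ 2) ^ j.
Proof.
intros Ha.
destruct (Ha (2 * (Rabs x + 1))) as [M HM]; [generalize (Rabs_pos x); lra|].
exists M; split.
{ specialize (HM 0%nat); simpl in HM; generalize (Rabs_pos (a 0%nat)); lra. }
intros j; specialize (HM j); rewrite Rpow_mult_distr in HM.
rewrite Rabs_mult, <- RPow_abs, pow_inv.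
assert (H2 : 0 < 2 ^ j) by (apply pow_lt; lra).
apply (Rmult_le_reg_r (2 ^ j)); [exact H2|].
replace (M * / 2 ^ j * 2 ^ j) with M by (field; lra).
apply Rle_trans with (2 := HM).
replace (Rabs (a j) * Rabs x ^ j * 2 ^ j) with (Rabs (a j) * (2 ^ j * Rabs x ^ j)) by ring.
apply Rmult_le_compat_l; [apply Rabs_pos|]; apply Rmult_le_compat_l; [lra|].
apply pow_incr; split; [apply Rabs_pos|lra].
Qed.

Lemma Dfactor_bound q c n m : 0 < q < 1 -> Rabs (q ^ n * (1 - c * q ^ m)) <= 1 + Rabs c.
Proof.
intros Hq; assert (H1 := pow_le_1 q n Hq); assert (H2 := pow_le_1 q m Hq).
rewrite Rabs_mult, (Rabs_pos_eq (q ^ n)) by lra.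
assert (H3 : Rabs (1 - c * q ^ m) <= 1 + Rabs c).
{ unfold Rminus; eapply Rle_trans; [apply Rabs_triang|].
  rewrite Rabs_R1, Rabs_Ropp, Rabs_mult, (Rabs_pos_eq (q ^ m)) by lra.
  generalize (Rabs_pos c); nra. }
generalize (Rabs_pos (1 - c * q ^ m)); nra.
Qed.

Lemma Dterm_ex q al c j : 0 < q < 1 -> ex_series (Dterm q al c j).
Proof.
intros Hq.
destruct (superexp_half _ 1 (ucoef_superexp q al c Hq)) as (M & HM0 & HM).
apply (geom_bound_ex _ (M * M * (1 + Rabs c)) (/ 2)); [lra|]; intros b.
unfold Dterm; rewrite Rmult_assoc, Rabs_mult.
assert (H1 := HM b); assert (H2 := HM (b + j)%nat); rewrite pow1, Rmult_1_r in H1, H2.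
assert (H3 : (/ 2) ^ (b + j) <= 1) by (rewrite <- (pow1 (b + j)); apply pow_incr; lra).
assert (H4 : 0 <= (/ 2) ^ b) by (apply pow_le; lra).
assert (H5 := Dfactor_bound q c (b + j) (2 * b + j) Hq).
replace (M * M * (1 + Rabs c) * (/ 2) ^ b) with (M * (M * (/ 2) ^ b) * (1 + Rabs c)) by ring.
apply Rmult_le_compat; try apply Rabs_pos; [|exact H5].
rewrite Rabs_mult; apply Rmult_le_compat; try apply Rabs_pos; [|exact H1].
eapply Rle_trans; [exact H2|]; rewrite <- (Rmult_1_r M) at 2; apply Rmult_le_compat_l; lra.
Qed.

Lemma is_lim_superexp_0 (a : nat -> R) : superexp a -> is_lim_seq a 0.
Proof.
intros Ha; destruct (superexp_half a 1 Ha) as (M & HM0 & HM).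
apply is_lim_seq_abs_0.
apply (is_lim_seq_le_le (fun _ => 0) _ (fun n => M * (/ 2) ^ n)).
- intros n; specialize (HM n); rewrite pow1, Rmult_1_r in HM; split; [apply Rabs_pos|exact HM].
- apply is_lim_seq_const.
- replace (Finite 0) with (Rbar_mult M 0) by (simpl; f_equal; ring).
  apply is_lim_seq_scal_l, is_lim_seq_geom; rewrite Rabs_pos_eq; lra.
Qed.

(* With [a = b+j+2] and the recurrence at [a] and at [b], the difference of the two summands is
   [Q b - Q (b-2) - P b + P (b-1)]. *)
Lemma Dco_SS q al c j : 0 < q < 1 -> Dco q al c (S (S j)) = q ^ S (S j) * Dco q al c j.
Proof.
intros Hq.
set (u := ucoef q al c).
assert (Hu : superexp u) by apply ucoef_superexp, Hq.
set (T2 := fun b => u b * u (b + S (S j))%nat * q ^ b * (1 - c * q ^ (2 * b + S (S j)))).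
set (T1 := fun b => u b * u (b + j)%nat * q ^ (b + j) * (1 - c * q ^ (2 * b + j))).
set (P := fun b => 2 * al * q ^ (2 * b + S j) * u (b + S j)%nat * u b).
set (Q := fun b => q ^ (2 * b + S (S j)) * (1 - c * q ^ b) * u (b + S (S j))%nat * u b).
assert (RS : forall n, u (S (S n)) * (1 - q ^ S (S n)) =
  - 2 * al * q ^ S n * u (S n) + (q ^ n - c * q ^ (2 * n)) * u n).
{ intros n; unfold u; rewrite ucoef_SS; field.
  assert (H := one_sub_pow q (S n) Hq); lra. }
assert (R1 : u 1%nat * (1 - q) = - 2 * al) by (unfold u; rewrite ucoef_1; field; lra).
assert (R0 : u 0%nat = 1) by reflexivity.
assert (Hstep : forall n, T2 (S (S n)) - T1 (S (S n)) = Q (S (S n)) - Q n - P (S (S n)) + P (S n)).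
{ intros n.
  assert (EU := RS n); assert (EV := RS (n + 2 + j)%nat).
  unfold T1, T2, P, Q.
  replace (S (S n) + S (S j))%nat with (S (S (n + 2 + j))) by lia.
  replace (S (S n) + S j)%nat with (S (n + 2 + j)) by lia.
  replace (S n + S j)%nat with (n + 2 + j)%nat by lia.
  replace (n + S (S j))%nat with (n + 2 + j)%nat by lia.
  replace (S (S n) + j)%nat with (n + 2 + j)%nat by lia.
  replace (2 * S (S n) + S (S j))%nat with ((n + 2 + j) + (n + 4))%nat by lia.
  replace (2 * S (S n) + S j)%nat with ((n + 2 + j) + (n + 3))%nat by lia.
  replace (2 * S (S n) + j)%nat with ((n + 2 + j) + (n + 2))%nat by lia.
  replace (2 * n + S (S j))%nat with ((n + 2 + j) + n)%nat by lia.
  replace (2 * S n + S j)%nat with ((n + 2 + j) + (n + 1))%nat by lia.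
  replace (2 * n)%nat with (n + n)%nat in EU by lia.
  replace (2 * (n + 2 + j))%nat with ((n + 2 + j) + (n + 2 + j))%nat in EV by lia.
  revert EV; generalize (n + 2 + j)%nat; intros m EV.
  rewrite !pow_add; rewrite pow_add in EU, EV.
  set (p := q ^ n) in *; set (s := q ^ m) in *.
  replace (q ^ S (S n)) with (p * q ^ 2) in * by (unfold p; simpl; ring).
  replace (q ^ S (S m)) with (s * q ^ 2) in * by (unfold s; simpl; ring).
  replace (q ^ S n) with (p * q) in * by (unfold p; simpl; ring).
  replace (q ^ S m) with (s * q) in * by (unfold s; simpl; ring).
  revert EU EV; generalize (u (S (S n))) (u (S n)) (u n) (u (S (S m))) (u (S m)) (u m).
  intros U2 U1 U0 V2 V1 V0 EU EV.
  apply Rminus_diag_uniq.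
  replace (_ - _) with (p * q ^ 2 * U2 * (V2 * (1 - s * q ^ 2) - (- 2 * al * (s * q) * V1 + (s - c * (s * s)) * V0))
    - s * V0 * (U2 * (1 - p * q ^ 2) - (- 2 * al * (p * q) * U1 + (p - c * (p * p)) * U0))) by ring.
  rewrite EU, EV; ring. }
assert (H0 : T2 0%nat - T1 0%nat = Q 0%nat - P 0%nat).
{ assert (EV := RS j); unfold T1, T2, P, Q; simpl (2 * 0)%nat; rewrite !Nat.add_0_l, R0.
  replace (2 * j)%nat with (j + j)%nat in EV by lia; rewrite pow_add in EV.
  apply Rminus_diag_uniq.
  replace (_ - _) with (u (S (S j)) * (1 - q ^ S (S j)) - (- 2 * al * q ^ S j * u (S j) + (q ^ j - c * (q ^ j * q ^ j)) * u j))
    by (simpl; ring).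
  rewrite EV; ring. }
assert (H1 : T2 1%nat - T1 1%nat = Q 1%nat - P 1%nat + P 0%nat).
{ assert (EV := RS (S j)); unfold T1, T2, P, Q; rewrite R0.
  replace (2 * S j)%nat with (S j + S j)%nat in EV by lia; rewrite pow_add in EV.
  replace (2 * 1 + S (S j))%nat with (S (S (S (S j)))) by lia.
  replace (2 * 1 + S j)%nat with (S (S (S j))) by lia.
  replace (2 * 1 + j)%nat with (S (S j)) by lia.
  replace (1 + S (S j))%nat with (S (S (S j))) by lia.
  replace (1 + S j)%nat with (S (S j)) by lia.
  replace (1 + j)%nat with (S j) by lia.
  replace (2 * 0 + S j)%nat with (S j) by lia.
  replace (0 + S j)%nat with (S j) by lia.
  apply Rminus_diag_uniq.
  replace (_ - _) with (q * u 1%nat * (u (S (S (S j))) * (1 - q ^ S (S (S j)))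
      - (- 2 * al * q ^ S (S j) * u (S (S j)) + (q ^ S j - c * (q ^ S j * q ^ S j)) * u (S j)))
    - q ^ S j * u (S j) * (u 1%nat * (1 - q) - (- 2 * al))) by (simpl; ring).
  rewrite EV, R1; ring. }
(* Telescoping, by steps of two in [Q] and of one in [P]; [H0] and [H1] are the cases in which an
   index of the general formula would be negative. *)
assert (Hsum : forall N, sum_n (fun b => T2 b - T1 b) (S N) = Q (S N) + Q N - P (S N)).
{ induction N as [|N IH].
  - rewrite sum_n_S, sum_n_0; rewrite H0, H1; rring.
  - rewrite sum_n_S, IH, Hstep; rring. }
assert (ED1 : Series T1 = Dco q al c j).
{ apply Series_ext; intros b; unfold T1, Dterm; fold u; ring. }
assert (X1 : ex_series T1).
{ apply ex_series_ext with (2 := Dterm_ex q al c j Hq).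
  intros b; unfold T1, Dterm; fold u; rring. }
assert (Hq0 : q ^ S (S j) <> 0) by (apply pow_nonzero; lra).
assert (ET2 : forall b, T2 b = / q ^ S (S j) * Dterm q al c (S (S j)) b).
{ intros b; unfold T2, Dterm; fold u; rewrite (pow_add q b (S (S j))).
  revert Hq0; generalize (q ^ S (S j)); intros w Hw; field; exact Hw. }
assert (ED2 : Series T2 = / q ^ S (S j) * Dco q al c (S (S j))).
{ rewrite (Series_ext _ _ ET2); apply Series_scal_l. }
assert (X2 : ex_series T2).
{ apply ex_series_ext with (fun b => / q ^ S (S j) * Dterm q al c (S (S j)) b); [intros; symmetry; apply ET2|].
  apply (ex_series_scal (V := R_NormedModule)), Dterm_ex, Hq. }
destruct (superexp_half u 1 Hu) as (M & HM0 & HM).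
assert (HMb : forall n, Rabs (u n) <= M).
{ intros n; specialize (HM n); rewrite pow1, Rmult_1_r in HM.
  assert ((/ 2) ^ n <= 1) by (rewrite <- (pow1 n); apply pow_incr; lra); nra. }
assert (Hlim0 : forall (F : nat -> R) K, (forall b, Rabs (F b) <= K * Rabs (u b)) -> is_lim_seq F 0).
{ intros F K HF; apply is_lim_seq_abs_0.
  apply (is_lim_seq_le_le (fun _ => 0) _ (fun n => K * Rabs (u n))).
  - intros n; split; [apply Rabs_pos|apply HF].
  - apply is_lim_seq_const.
  - replace (Finite 0) with (Rbar_mult K 0) by (simpl; f_equal; ring).
    apply is_lim_seq_scal_l, (proj1 (is_lim_seq_abs_0 u)), is_lim_superexp_0, Hu. }
assert (LQ : is_lim_seq Q 0).
{ apply (Hlim0 Q ((1 + Rabs c) * M)); intros b; unfold Q; rewrite !Rabs_mult, <- Rabs_mult.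
  apply Rmult_le_compat_r; [apply Rabs_pos|].
  apply Rmult_le_compat; try apply Rabs_pos; [apply Dfactor_bound, Hq|apply HMb]. }
assert (LP : is_lim_seq P 0).
{ apply (Hlim0 P (Rabs (2 * al) * M)); intros b; unfold P; rewrite (Rabs_mult _ (u b)), (Rabs_mult _ (u (b + S j)%nat)), (Rabs_mult (2 * al)).
  apply Rmult_le_compat_r; [apply Rabs_pos|].
  assert (Hp := pow_le_1 q (2 * b + S j) Hq); rewrite (Rabs_pos_eq (q ^ _)) by lra.
  apply Rmult_le_compat; [|apply Rabs_pos| |apply HMb].
  - apply Rmult_le_pos; [apply Rabs_pos|lra].
  - rewrite <- (Rmult_1_r (Rabs (2 * al))) at 2; apply Rmult_le_compat_l; [apply Rabs_pos|lra]. }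
assert (HE : Series T2 - Series T1 = 0).
{ rewrite <- Series_minus by assumption.
  apply is_series_unique.
  assert (L : is_lim_seq (fun N => sum_n (fun b => T2 b - T1 b) (S N)) 0).
  { apply is_lim_seq_ext with (fun N => Q (S N) + Q N - P (S N)); [intros; symmetry; apply Hsum|].
    replace (Finite 0) with (Finite (0 + 0 - 0)) by (f_equal; ring).
    apply is_lim_seq_minus'; [apply is_lim_seq_plus'|]; try exact LQ.
    - apply (is_lim_seq_incr_1 Q), LQ.
    - apply (is_lim_seq_incr_1 P), LP. }
  apply (is_lim_seq_incr_1 (sum_n (fun b => T2 b - T1 b))) in L; exact L. }
rewrite ED1, ED2 in HE.
apply (Rmult_eq_reg_l (/ q ^ S (S j))); [|apply Rinv_neq_0_compat, Hq0].
rewrite <- Rmult_assoc, Rinv_l, Rmult_1_l by exact Hq0; lra.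
Qed.

(** The recurrence expresses $\Theta(z)=q^2z^2\,\Theta(qz)$ for $\Theta=\sum_jD_jz^j$. Its Laurent
    solutions form a plane with coordinates $D_0$ and $D_1$; carrying pairs makes the two-step
    recursion structural. *)
Fixpoint dpair (q x y : R) (j : nat) : R * R :=
  match j with O => (x, y) | S i => let (a, b) := dpair q x y i in (b, q ^ S (S i) * a) end.

Definition dseq (q x y : R) (j : nat) : R := fst (dpair q x y j).

Lemma dseq_SS q x y j : dseq q x y (S (S j)) = q ^ S (S j) * dseq q x y j.
Proof. unfold dseq; cbn [dpair]; destruct (dpair q x y j); reflexivity. Qed.

Lemma dseq_superexp q x y : 0 < q < 1 -> superexp (dseq q x y).
Proof.
intros Hq; apply (superexp_of_ratio2 _ q 1 Hq); [lra|]; intros j.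
assert (Hj := pow_le_1 q j Hq).
rewrite dseq_SS, Rabs_mult, (Rabs_pos_eq (q ^ _)) by (apply pow_le; lra).
rewrite Rmult_1_l; apply Rle_trans with (q ^ j * Rabs (dseq q x y j)).
- apply Rmult_le_compat_r; [apply Rabs_pos|].
  replace (q ^ S (S j)) with (q * q * q ^ j) by (simpl; ring).
  rewrite <- (Rmult_1_l (q ^ j)) at 2; apply Rmult_le_compat_r; [lra|nra].
- apply Rmult_le_compat_l; [lra|generalize (Rabs_pos (dseq q x y (S j))); lra].
Qed.

Lemma dseq_lin q x y j : dseq q x y j = x * dseq q 1 0 j + y * dseq q 0 1 j.
Proof.
induction j as [| |j IH1 IH2] using nat_ind2; [unfold dseq; simpl; ring|unfold dseq; simpl; ring|].
rewrite !dseq_SS, IH1; ring.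
Qed.

Lemma dseq_nonneg q x y j : 0 < q -> 0 <= x -> 0 <= y -> 0 <= dseq q x y j.
Proof.
intros Hq Hx Hy; induction j as [| |j IH1 IH2] using nat_ind2; [exact Hx|exact Hy|].
rewrite dseq_SS; apply Rmult_le_pos; [apply pow_le; lra|exact IH1].
Qed.

(* Bilateral series [sum_j D_j z^j] with [D_(j+2) = q^(j+2) D_j], [D_0 = x], [D_1 = y]; its negative half is
   [D_(-j) = D_j / q^j], and [- x] compensates for counting [j = 0] twice. *)
Definition Theta (q x y z : R) : R := PSeries (dseq q x y) z + PSeries (dseq q x y) (/ q * / z) - x.

Lemma Theta_lin q x y z : 0 < q < 1 -> Theta q x y z = x * Theta q 1 0 z + y * Theta q 0 1 z.
Proof.
intros Hq.
assert (E : forall w, PSeries (dseq q x y) w = x * PSeries (dseq q 1 0) w + y * PSeries (dseq q 0 1) w).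
{ intros w; rewrite <- !PSeries_scal, <- PSeries_plus.
  - apply PSeries_ext; intros n; apply dseq_lin.
  - apply (ex_pseries_scal (V := R_NormedModule)); [apply Rmult_comm|apply superexp_ex, dseq_superexp, Hq].
  - apply (ex_pseries_scal (V := R_NormedModule)); [apply Rmult_comm|apply superexp_ex, dseq_superexp, Hq]. }
unfold Theta; rewrite !E; ring.
Qed.

(* Up to a nonzero factor, the Wronskian of the solutions decaying at [+oo] and at [-oo] (see [wr_That]). *)
Definition That (q al c z : R) : R :=
  Ufun q al c (q * z) * Ufun q al c (/ z) - c * Ufun q al c (q * (q * z)) * Ufun q al c (q * / z).

Lemma Dco_dseq q al c j : 0 < q < 1 -> Dco q al c j = dseq q (Dco q al c 0) (Dco q al c 1) j.
Proof.
intros Hq; induction j as [| |j IH1 IH2] using nat_ind2; [reflexivity|reflexivity|].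
rewrite Dco_SS, dseq_SS, IH1 by exact Hq; reflexivity.
Qed.

(** Expanding the products of [Ufun] gives a double series whose term [f a b] belongs to $z^{a-b}$.
    The diagonal $a-b=j\ge0$ sums to [Dco j], and the opposite one to [Dco j / q ^ j]. *)
Lemma That_Theta q al c z : 0 < q < 1 -> z <> 0 ->
  That q al c z = Theta q (Dco q al c 0) (Dco q al c 1) z.
Proof.
intros Hq Hz; set (u := ucoef q al c).
assert (Hu : superexp u) by apply ucoef_superexp, Hq.
set (f := fun a b => u a * u b * q ^ a * (1 - c * q ^ (a + b)) * z ^ a * (/ z) ^ b).
destruct (superexp_half u z Hu) as (M1 & HM10 & HM1).
destruct (superexp_half u (/ z) Hu) as (M2 & HM20 & HM2).
assert (Hf : forall a b, Rabs (f a b) <= (1 + Rabs c) * M1 * M2 * (/ 2) ^ a * (/ 2) ^ b).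
{ intros a b.
  replace (f a b) with (q ^ a * (1 - c * q ^ (a + b)) * ((u a * z ^ a) * (u b * (/ z) ^ b))) by (unfold f; ring).
  replace ((1 + Rabs c) * M1 * M2 * (/ 2) ^ a * (/ 2) ^ b) with ((1 + Rabs c) * ((M1 * (/ 2) ^ a) * (M2 * (/ 2) ^ b))) by ring.
  rewrite (Rabs_mult _ (_ * _)), (Rabs_mult (u a * z ^ a)).
  apply Rmult_le_compat; [apply Rabs_pos|apply Rmult_le_pos; apply Rabs_pos|apply Dfactor_bound, Hq|].
  apply Rmult_le_compat; try apply Rabs_pos; [apply HM1|apply HM2]. }
assert (HD := Series_diagonals f _ (/ 2) ltac:(lra) Hf).
assert (Xu : forall w, ex_series (fun n => u n * w ^ n)).
{ intros w; assert (H := superexp_ex u w Hu); apply ex_pseries_R in H; exact H. }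
assert (EL : That q al c z = Series (fun a => Series (f a))).
{ transitivity (Series (fun a => u a * (q * z) ^ a * Ufun q al c (/ z) - c * (u a * (q * (q * z)) ^ a * Ufun q al c (q * / z)))).
  - rewrite Series_minus.
    + unfold That; rewrite Series_scal_r, Series_scal_l, Series_scal_r.
      unfold Ufun, PSeries; fold u; ring.
    + apply ex_series_scal_r, Xu.
    + apply (ex_series_scal (V := R_NormedModule)), ex_series_scal_r, Xu.
  - apply Series_ext; intros a.
    unfold Ufun, PSeries; fold u.
    rewrite <- !Series_scal_l, <- Series_minus.
    + apply Series_ext; intros b; unfold f; rewrite !Rpow_mult_distr, pow_add; ring.
    + apply (ex_series_scal (V := R_NormedModule)), Xu.
    + apply (ex_series_scal (V := R_NormedModule)), (ex_series_scal (V := R_NormedModule)), Xu. }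
rewrite EL, HD; unfold Theta.
set (d := dseq q (Dco q al c 0) (Dco q al c 1)).
assert (Hd : superexp d) by apply dseq_superexp, Hq.
assert (E1 : forall j, Series (fun b => f (b + j)%nat b) = d j * z ^ j).
{ intros j; unfold d; rewrite <- Dco_dseq by exact Hq; unfold Dco; rewrite <- Series_scal_r.
  apply Series_ext; intros b; unfold f, Dterm; fold u.
  replace (b + j + b)%nat with (2 * b + j)%nat by lia.
  rewrite (pow_add z b j), pow_inv; field; apply pow_nonzero, Hz. }
assert (E2 : forall j, Series (fun a => f a (a + j)%nat) = d j * (/ q * / z) ^ j).
{ intros j; unfold d; rewrite <- Dco_dseq by exact Hq; unfold Dco; rewrite <- Series_scal_r.
  apply Series_ext; intros a; unfold f, Dterm; fold u.
  replace (a + (a + j))%nat with (2 * a + j)%nat by lia.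
  rewrite (pow_add q a j), Rpow_mult_distr, !pow_inv, (pow_add z a j); field.
  repeat split; apply pow_nonzero; try exact Hz; lra. }
rewrite (Series_ext _ _ E1), (Series_ext _ _ (fun j => E2 (S j))).
assert (E3 : PSeries d (/ q * / z) = Dco q al c 0 + Series (fun j => d (S j) * (/ q * / z) ^ S j)).
{ unfold PSeries; rewrite Series_incr_1.
  - simpl pow at 1; rewrite Rmult_1_r; reflexivity.
  - assert (H := superexp_ex d (/ q * / z) Hd); apply ex_pseries_R in H; exact H. }
rewrite E3; unfold PSeries; ring.
Qed.

Lemma ucoef_neg q al c j : ucoef q (- al) c j = (-1) ^ j * ucoef q al c j.
Proof.
induction j as [| |j IH1 IH2] using nat_ind2.
- rewrite !ucoef_0; simpl; ring.
- rewrite !ucoef_1; simpl; unfold Rdiv; ring.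
- rewrite !ucoef_SS, IH1, IH2; simpl; unfold Rdiv; ring.
Qed.

Lemma Dco_neg q al c j : Dco q (- al) c j = (-1) ^ j * Dco q al c j.
Proof.
unfold Dco; rewrite <- Series_scal_l; apply Series_ext; intros b; unfold Dterm.
rewrite !ucoef_neg, pow_add.
assert (E : (-1) ^ b * (-1) ^ b = 1) by (rewrite <- Rpow_mult_distr; replace (-1 * -1) with 1 by ring; apply pow1).
replace (_ * _ * (_ * _) * _ * _) with (((-1) ^ b * (-1) ^ b) * ((-1) ^ j * (ucoef q al c (b + j) * ucoef q al c b * q ^ (b + j) * (1 - c * q ^ (2 * b + j)))))
  by (rewrite (pow_add q b j); ring).
rewrite E; ring.
Qed.

(** * Three-term recurrences on the integers *)

Definition Sol (e y : Z -> R) : Prop := forall n, y (n - 1)%Z + y (n + 1)%Z = e n * y n.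

Definition wr (y z : Z -> R) (n : Z) : R := y n * z (n + 1)%Z - y (n + 1)%Z * z n.

Definition to0 (y : Z -> R) : Prop := is_lim_seq (fun n => y (Z.of_nat n)) 0.

Lemma Z_steps (P : Z -> Prop) : (forall n, P n <-> P (n + 1)%Z) -> forall n m, P n -> P m.
Proof.
intros H.
assert (H1 : forall k n, P n -> P (n + Z.of_nat k)%Z).
{ induction k as [|k IH]; intros n Hn; [rewrite Z.add_0_r; exact Hn|].
  replace (n + Z.of_nat (S k))%Z with ((n + Z.of_nat k) + 1)%Z by lia; apply (proj1 (H _)), IH, Hn. }
assert (H2 : forall k n, P n -> P (n - Z.of_nat k)%Z).
{ induction k as [|k IH]; intros n Hn; [rewrite Z.sub_0_r; exact Hn|].
  apply (proj2 (H _)); replace (n - Z.of_nat (S k) + 1)%Z with (n - Z.of_nat k)%Z by lia; apply IH, Hn. }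
intros n m Hn; destruct (Z.le_ge_cases n m) as [Hnm|Hnm].
- replace m with (n + Z.of_nat (Z.to_nat (m - n)))%Z by lia; apply H1, Hn.
- replace m with (n - Z.of_nat (Z.to_nat (n - m)))%Z by lia; apply H2, Hn.
Qed.

Lemma wr_step e y z n : Sol e y -> Sol e z -> wr y z (n + 1) = wr y z n.
Proof.
intros Hy Hz; unfold wr.
assert (E1 := Hy (n + 1)%Z); assert (E2 := Hz (n + 1)%Z).
replace (n + 1 - 1)%Z with n in E1, E2 by lia.
replace (y (n + 1 + 1)%Z) with (e (n + 1)%Z * y (n + 1)%Z - y n) by lra.
replace (z (n + 1 + 1)%Z) with (e (n + 1)%Z * z (n + 1)%Z - z n) by lra; ring.
Qed.

Lemma wr_const e y z n m : Sol e y -> Sol e z -> wr y z n = wr y z m.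
Proof.
intros Hy Hz; apply (Z_steps (fun i => wr y z i = wr y z m)) with m; [|reflexivity].
intros i; rewrite (wr_step e) by assumption; tauto.
Qed.

Lemma Sol_zero e y n : Sol e y -> y n = 0 -> y (n + 1)%Z = 0 -> forall m, y m = 0.
Proof.
intros Hy H0 H1 m.
cut (y m = 0 /\ y (m + 1)%Z = 0); [tauto|].
apply (Z_steps (fun i => y i = 0 /\ y (i + 1)%Z = 0)) with n; [|auto].
intros i; assert (E := Hy (i + 1)%Z); replace (i + 1 - 1)%Z with i in E by lia.
split; intros [Ha Hb]; split; auto; rewrite ?Ha, ?Hb, ?Rmult_0_r in E; lra.
Qed.

Lemma Sol_lin e y z a b : Sol e y -> Sol e z -> Sol e (fun n => a * y n + b * z n).
Proof. intros Hy Hz n; specialize (Hy n); specialize (Hz n); nra. Qed.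

Lemma Sol_wr0_prop e y z : Sol e y -> Sol e z -> wr y z 0 = 0 -> (exists n, y n <> 0) ->
  exists k, forall n, z n = k * y n.
Proof.
intros Hy Hz HW [n Hn].
assert (W : forall m, wr y z m = 0) by (intros m; rewrite <- HW; apply (wr_const e); assumption).
exists (z n / y n); intros m.
assert (H : Sol e (fun i => 1 * z i + (- (z n / y n)) * y i)) by (apply Sol_lin; assumption).
assert (H0 := Sol_zero e _ n H).
cbv beta in H0; specialize (W n); unfold wr in W.
assert (E : 1 * z n + - (z n / y n) * y n = 0) by (field; exact Hn).
assert (E' : 1 * z (n + 1)%Z + - (z n / y n) * y (n + 1)%Z = 0).
{ apply (Rmult_eq_reg_l (y n)); [|exact Hn]; rewrite Rmult_0_r, <- W; field; exact Hn. }
specialize (H0 E E' m); lra.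
Qed.

Lemma to0_shift y k : to0 y -> to0 (fun n => y (n + Z.of_nat k)%Z).
Proof.
intros H; unfold to0.
apply is_lim_seq_ext with (fun n => y (Z.of_nat (n + k))); [intros n; f_equal; lia|].
apply (is_lim_seq_incr_n (fun n => y (Z.of_nat n))), H.
Qed.

Lemma to0_wr y z : to0 y -> to0 z -> to0 (wr y z).
Proof.
intros Hy Hz; unfold to0, wr.
replace (Finite 0) with (Finite (0 * 0 - 0 * 0)) by (f_equal; ring).
apply is_lim_seq_minus'; apply is_lim_seq_mult'; try assumption;
  apply (to0_shift _ 1); assumption.
Qed.

(** The Wronskian is constant and tends to 0. This is why the solutions decaying at $+\infty$ form
    only a line. *)
Lemma wr_to0 e y z n : Sol e y -> Sol e z -> to0 y -> to0 z -> wr y z n = 0.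
Proof.
intros Hy Hz H0 H1.
assert (L := to0_wr y z H0 H1); unfold to0 in L.
apply (is_lim_seq_ext _ (fun _ => wr y z n)) in L.
- apply is_lim_seq_unique in L; rewrite Lim_seq_const in L; injection L; auto.
- intros m; apply (wr_const e); assumption.
Qed.

Definition refl (y : Z -> R) (n : Z) : R := y (- n)%Z.

Lemma Sol_refl e y : Sol e y -> Sol (refl e) (refl y).
Proof.
intros H n; unfold refl; specialize (H (- n)%Z).
replace (- (n - 1))%Z with (- n + 1)%Z by lia; replace (- (n + 1))%Z with (- n - 1)%Z by lia; lra.
Qed.

(** * The decaying solution *)

Definition qz (q zt : R) (n : Z) : R := powerRZ q n * zt.

Lemma qz_succ q zt n : q <> 0 -> qz q zt (n + 1) = q * qz q zt n.
Proof. intros Hq; unfold qz; rewrite powerRZ_add by exact Hq; simpl; ring. Qed.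

Lemma qz_pos q zt n : 0 < q -> 0 < zt -> 0 < qz q zt n.
Proof. intros Hq Hz; apply Rmult_lt_0_compat; [apply powerRZ_lt, Hq|exact Hz]. Qed.

Lemma qz_0 q zt : qz q zt 0 = zt.
Proof. unfold qz; simpl; ring. Qed.

Lemma qz_inv q zt n : q <> 0 -> zt <> 0 -> qz q (/ zt) (- n) = / qz q zt n.
Proof.
intros Hq Hz; unfold qz; rewrite powerRZ_neg', Rinv_mult; reflexivity.
Qed.

Lemma qz_nat q zt n : qz q zt (Z.of_nat n) = q ^ n * zt.
Proof. unfold qz; rewrite <- pow_powerRZ; reflexivity. Qed.

(* [2 cosh(pi(omega n + k)) / be - 2 A] when [q = exp(-pi omega)] and [zt = exp(-pi k)]. *)
Definition ecoef (q A be zt : R) (n : Z) : R := (qz q zt n + / qz q zt n) / be - 2 * A.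

(** The leading behaviour at $+\infty$. There the coefficient is dominated by $1/(\beta q^n\zeta)$,
    so a decaying solution has $y_n\approx\beta q^n\zeta\,y_{n-1}$; this is the product of these
    factors, normalised at $n=0$. *)
Definition gfac (q be zt : R) (n : Z) : R := powerRZ (be * zt) n * powerRZ q (n * (n + 1) / 2).

Lemma gfac_succ q be zt n : q <> 0 -> be * zt <> 0 ->
  gfac q be zt (n + 1) = gfac q be zt n * (be * qz q zt (n + 1)).
Proof.
intros Hq Hb; unfold gfac, qz.
replace ((n + 1) * (n + 1 + 1) / 2)%Z with (n * (n + 1) / 2 + (n + 1))%Z
  by (rewrite <- Z.div_add by lia; f_equal; ring).
rewrite (powerRZ_add (be * zt)), (powerRZ_add q (n * (n + 1) / 2)) by assumption.
simpl (powerRZ (be * zt) 1); ring.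
Qed.

Lemma gfac_0 q be zt : gfac q be zt 0 = 1.
Proof. unfold gfac; simpl; ring. Qed.

(** The parameters come from inserting $y_n=g_nU(q^{n+1}\zeta)$, with [gfac] for $g_n$, into the
    recurrence: after multiplication by $\beta q^n\zeta/g_n$ it is the q-difference equation at
    $z=q^n\zeta$ with $al=A\beta$ and $c=q\beta^2$. *)
Definition Ube (q A be z : R) : R := Ufun q (A * be) (q * be ^ 2) z.

Definition yplus (q A be zt : R) (n : Z) : R := gfac q be zt n * Ube q A be (qz q zt (n + 1)).

Lemma yplus_Sol q A be zt : 0 < q < 1 -> be <> 0 -> 0 < zt -> Sol (ecoef q A be zt) (yplus q A be zt).
Proof.
intros Hq Hb Hz n; unfold yplus, ecoef, Ube.
assert (Hbz : be * zt <> 0) by (apply Rmult_integral_contrapositive; split; lra).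
assert (Hn := qz_pos q zt n ltac:(lra) Hz).
replace (n - 1 + 1)%Z with n by lia.
rewrite (Ufun_eq q _ _ (qz q zt n)) by exact Hq.
assert (E := gfac_succ q be zt (n - 1) ltac:(lra) Hbz); replace (n - 1 + 1)%Z with n in E by lia.
rewrite (gfac_succ q be zt n ltac:(lra) Hbz), E.
rewrite !qz_succ by lra; field; split; lra.
Qed.

Lemma ecoef_refl q A be zt n : 0 < q -> 0 < zt -> ecoef q A be (/ zt) (- n) = ecoef q A be zt n.
Proof.
intros Hq Hz; unfold ecoef; rewrite qz_inv by lra.
assert (H := qz_pos q zt n Hq Hz); rewrite Rinv_inv, Rplus_comm; reflexivity.
Qed.

(** The recurrence is invariant under $n\mapsto-n$ combined with $\zeta\mapsto1/\zeta$, so the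
    solution decaying at $-\infty$ is a reflected [yplus]. *)
Definition yminus (q A be zt : R) : Z -> R := refl (yplus q A be (/ zt)).

Lemma yminus_Sol q A be zt : 0 < q < 1 -> be <> 0 -> 0 < zt -> Sol (ecoef q A be zt) (yminus q A be zt).
Proof.
intros Hq Hb Hz n.
assert (H := Sol_refl _ _ (yplus_Sol q A be (/ zt) Hq Hb ltac:(apply Rinv_0_lt_compat, Hz)) n).
unfold refl at 3 in H; rewrite ecoef_refl in H by lra; exact H.
Qed.

Lemma wr_That q A be zt : 0 < q < 1 -> be <> 0 -> 0 < zt ->
  wr (yplus q A be zt) (yminus q A be zt) 0 = zt / be * That q (A * be) (q * be ^ 2) zt.
Proof.
intros Hq Hb Hz; unfold wr, yminus, refl, yplus, That, Ube.
assert (Hbz : be * zt <> 0) by (apply Rmult_integral_contrapositive; split; lra).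
assert (Hbz' : be * / zt <> 0) by (apply Rmult_integral_contrapositive; split; [lra|apply Rinv_neq_0_compat; lra]).
assert (E1 := gfac_succ q be zt 0 ltac:(lra) Hbz).
assert (E2 := gfac_succ q be (/ zt) (-1) ltac:(lra) Hbz').
change (0 + 1)%Z with 1%Z in *; change (-1 + 1)%Z with 0%Z in *; change (- (1))%Z with (-1)%Z.
change (- 0)%Z with 0%Z; change (1 + 1)%Z with (0 + 1 + 1)%Z; change (-1 + 1)%Z with 0%Z; change (0 + 1)%Z with 1%Z in *.
rewrite gfac_0, qz_0 in E2; rewrite E1, !gfac_0, qz_0.
assert (Q1 : forall w, qz q w 1 = q * w) by (intros w; unfold qz; simpl; ring).
assert (Q2 : forall w, qz q w (1 + 1) = q * (q * w)) by (intros w; unfold qz; simpl; ring).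
rewrite !Q1, !Q2.
replace (gfac q be (/ zt) (-1)) with (zt / be).
- field; lra.
- apply (Rmult_eq_reg_r (be * / zt)); [rewrite <- E2; field; lra|exact Hbz'].
Qed.

Lemma to_zero_ratio (g : nat -> R) r K : 0 < r < 1 -> 0 <= K ->
  (forall n, Rabs (g (S n)) <= K * r ^ n * Rabs (g n)) -> superexp g.
Proof.
intros Hr HK Hg.
assert (HK2 : 0 <= K / r) by (apply Rmult_le_pos; [exact HK|left; apply Rinv_0_lt_compat; lra]).
apply (superexp_of_ratio2 _ r (K * r)); [exact Hr|apply Rmult_le_pos; lra|].
intros j; eapply Rle_trans; [apply Hg|].
replace (K * r ^ S j) with (K * r * r ^ j) by (simpl; ring).
apply Rmult_le_compat_l; [|generalize (Rabs_pos (g j)); lra].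
apply Rmult_le_pos; [apply Rmult_le_pos; lra|apply pow_le; lra].
Qed.

Lemma gfac_superexp q be zt : 0 < q < 1 -> be <> 0 -> 0 < zt -> superexp (fun n => gfac q be zt (Z.of_nat n)).
Proof.
intros Hq Hb Hz.
assert (Hbz : be * zt <> 0) by (apply Rmult_integral_contrapositive; split; lra).
apply (to_zero_ratio _ q (Rabs (be * zt))); [exact Hq|apply Rabs_pos|].
intros n; replace (Z.of_nat (S n)) with (Z.of_nat n + 1)%Z by lia.
rewrite gfac_succ by (try exact Hbz; lra).
rewrite qz_succ, qz_nat by lra.
assert (Hn := pow_le_1 q n Hq).
replace (gfac q be zt (Z.of_nat n) * (be * (q * (q ^ n * zt)))) with ((q * q ^ n) * ((be * zt) * gfac q be zt (Z.of_nat n))) by ring.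
rewrite !(Rabs_mult _ (_ * gfac _ _ _ _)), (Rabs_mult (be * zt)), (Rabs_pos_eq (q * q ^ n)) by nra.
replace (Rabs (be * zt) * q ^ n * Rabs (gfac q be zt (Z.of_nat n))) with (q ^ n * (Rabs (be * zt) * Rabs (gfac q be zt (Z.of_nat n)))) by ring.
apply Rmult_le_compat_r; [apply Rmult_le_pos; apply Rabs_pos|nra].
Qed.

Lemma PSeries_bound (a : nat -> R) X z : superexp a -> 0 < X -> Rabs z <= X ->
  Rabs (PSeries a z) <= Series (fun j => Rabs (a j) * X ^ j).
Proof.
intros Ha HX Hz; apply (abs_series_bounded (fun j => a j * z ^ j)).
apply pcoef_abs with X; [exact Hz|apply superexp_pcoef; assumption].
Qed.

Lemma Ube_bounded q A be zt : 0 < q < 1 -> 0 < zt ->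
  exists M, 0 <= M /\ forall n : nat, Rabs (Ube q A be (qz q zt (Z.of_nat n + 1))) <= M.
Proof.
intros Hq Hz.
assert (Hu := ucoef_superexp q (A * be) (q * be ^ 2) Hq).
exists (Series (fun j => Rabs (ucoef q (A * be) (q * be ^ 2) j) * zt ^ j)); split.
- eapply Rle_trans; [apply Rabs_pos|apply (PSeries_bound _ zt zt Hu Hz)]; rewrite Rabs_pos_eq; lra.
- intros n; apply PSeries_bound; [exact Hu|exact Hz|].
  rewrite qz_succ, qz_nat by lra; assert (Hn := pow_le_1 q n Hq).
  rewrite Rabs_pos_eq by (apply Rmult_le_pos; [lra|apply Rmult_le_pos; lra]).
  rewrite <- Rmult_assoc; rewrite <- (Rmult_1_l zt) at 2; apply Rmult_le_compat_r; nra.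
Qed.

Lemma yplus_superexp q A be zt : 0 < q < 1 -> be <> 0 -> 0 < zt -> superexp (fun n => yplus q A be zt (Z.of_nat n)).
Proof.
intros Hq Hb Hz.
destruct (Ube_bounded q A be zt Hq Hz) as (M & HM0 & HM).
apply superexp_le with (fun n => M * gfac q be zt (Z.of_nat n)).
- intros n; unfold yplus; rewrite Rmult_comm, !Rabs_mult; apply Rmult_le_compat_r; [apply Rabs_pos|].
  rewrite (Rabs_pos_eq M) by exact HM0; apply HM.
- intros X HX; destruct (gfac_superexp q be zt Hq Hb Hz X HX) as [N HN].
  exists (M * N); intros j; rewrite Rabs_mult, (Rabs_pos_eq M), Rmult_assoc by exact HM0.
  apply Rmult_le_compat_l; [exact HM0|apply HN].
Qed.

Lemma yplus_to0 q A be zt : 0 < q < 1 -> be <> 0 -> 0 < zt -> to0 (yplus q A be zt).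
Proof. intros; apply is_lim_superexp_0, yplus_superexp; assumption. Qed.

Lemma Ube_lim1 q A be zt : 0 < q < 1 -> 0 < zt ->
  is_lim_seq (fun n => Ube q A be (qz q zt (Z.of_nat n))) 1.
Proof.
intros Hq Hz; rewrite <- (Ufun_0 q (A * be) (q * be ^ 2)).
apply (is_lim_seq_continuous (Ufun q (A * be) (q * be ^ 2)) (fun n => qz q zt (Z.of_nat n)) 0).
- apply continuity_pt_filterlim, Ufun_cont, Hq.
- apply is_lim_seq_ext with (fun n => q ^ n * zt); [intros; symmetry; apply qz_nat|].
  replace (Finite 0) with (Rbar_mult 0 zt) by (simpl; f_equal; ring).
  apply is_lim_seq_scal_r, is_lim_seq_geom; rewrite Rabs_pos_eq; lra.
Qed.

Lemma gfac_pos q be zt n : 0 < q -> 0 < be -> 0 < zt -> 0 < gfac q be zt n.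
Proof.
intros; apply Rmult_lt_0_compat; apply powerRZ_lt; [apply Rmult_lt_0_compat|]; assumption.
Qed.

Lemma gfac_neq0 q be zt n : 0 < q -> be <> 0 -> 0 < zt -> gfac q be zt n <> 0.
Proof.
intros; apply Rmult_integral_contrapositive; split; apply powerRZ_NOR;
  [apply Rmult_integral_contrapositive; split|]; lra.
Qed.

Lemma Ube_eventually_pos q A be zt : 0 < q < 1 -> 0 < zt ->
  exists N, forall n, (N <= n)%nat -> 0 < Ube q A be (qz q zt (Z.of_nat n)).
Proof.
intros Hq Hz; assert (L := Ube_lim1 q A be zt Hq Hz); apply is_lim_seq_spec in L.
destruct (L (mkposreal _ Rlt_0_1)) as [N HN]; exists N; intros n Hn.
specialize (HN n Hn); simpl in HN; apply Rabs_lt_between in HN; lra.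
Qed.

Lemma yplus_nonzero q A be zt : 0 < q < 1 -> be <> 0 -> 0 < zt -> exists n, yplus q A be zt n <> 0.
Proof.
intros Hq Hb Hz; destruct (Ube_eventually_pos q A be zt Hq Hz) as [N HN].
exists (Z.of_nat N); unfold yplus; apply Rmult_integral_contrapositive; split.
- apply gfac_neq0; lra.
- replace (Z.of_nat N + 1)%Z with (Z.of_nat (S N)) by lia.
  specialize (HN (S N) ltac:(lia)); lra.
Qed.

Definition Tb (q A be zt : R) : R := That q (A * be) (q * be ^ 2) zt.

Lemma Tb_zero_prop q A be zt : 0 < q < 1 -> be <> 0 -> 0 < zt -> Tb q A be zt = 0 ->
  exists kap, kap <> 0 /\ forall n, yminus q A be zt n = kap * yplus q A be zt n.
Proof.
intros Hq Hb Hz HT.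
destruct (Sol_wr0_prop (ecoef q A be zt) (yplus q A be zt) (yminus q A be zt)) as [k Hk].
- apply yplus_Sol; assumption.
- apply yminus_Sol; assumption.
- rewrite wr_That by assumption; fold (Tb q A be zt); rewrite HT; ring.
- apply yplus_nonzero; assumption.
- exists k; split; [|exact Hk]; intros ->.
  destruct (yplus_nonzero q A be (/ zt) Hq Hb ltac:(apply Rinv_0_lt_compat, Hz)) as [n Hn].
  apply Hn; specialize (Hk (- n)%Z); unfold yminus, refl in Hk; rewrite Z.opp_involutive in Hk; lra.
Qed.

Lemma decaying_prop q A be zt y : 0 < q < 1 -> be <> 0 -> 0 < zt ->
  Sol (ecoef q A be zt) y -> to0 y -> exists k, forall n, y n = k * yplus q A be zt n.
Proof.
intros Hq Hb Hz Hy H0.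
apply (Sol_wr0_prop (ecoef q A be zt)); [apply yplus_Sol; assumption|exact Hy| |apply yplus_nonzero; assumption].
apply (wr_to0 (ecoef q A be zt)); [apply yplus_Sol| | apply yplus_to0|]; assumption.
Qed.

(** Decay at the two ends makes [y] a multiple of [yplus] and of [yminus]. The first multiplier is
    not 0, so the Wronskian of the two vanishes. *)
Lemma Tb_zero_of_decaying q A be zt y : 0 < q < 1 -> be <> 0 -> 0 < zt ->
  Sol (ecoef q A be zt) y -> to0 y -> to0 (refl y) -> (exists n, y n <> 0) -> Tb q A be zt = 0.
Proof.
intros Hq Hb Hz Hy H0 H1 [m Hm].
assert (Hz' : 0 < / zt) by (apply Rinv_0_lt_compat, Hz).
destruct (decaying_prop q A be zt y Hq Hb Hz Hy H0) as [k Hk].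
destruct (decaying_prop q A be (/ zt) (refl y) Hq Hb Hz') as [k' Hk']; [|exact H1|].
{ intros n; assert (H := Sol_refl _ _ Hy n); unfold refl at 3 in H.
  rewrite <- (ecoef_refl q A be zt (- n)) in H by lra.
  rewrite Z.opp_involutive in H; exact H. }
assert (HK : k <> 0) by (intros E; apply Hm; rewrite Hk, E; ring).
assert (HW := wr_That q A be zt Hq Hb Hz); fold (Tb q A be zt) in HW.
assert (E : forall n, y n = k' * yminus q A be zt n).
{ intros n; specialize (Hk' (- n)%Z); unfold refl in Hk'; rewrite Z.opp_involutive in Hk'; exact Hk'. }
assert (HW0 : wr (yplus q A be zt) (yminus q A be zt) 0 = 0).
{ apply (Rmult_eq_reg_l k); [|exact HK].
  unfold wr; rewrite Rmult_0_r, Rmult_minus_distr_l, <- !Rmult_assoc, <- !Hk, !E; ring. }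
rewrite HW0 in HW; apply (Rmult_eq_reg_l (zt / be)); [lra|].
apply Rmult_integral_contrapositive; split; [lra|apply Rinv_neq_0_compat, Hb].
Qed.

(** The weight is proportional to $1/|\gamma_n|^2$: this is the square summability at $+\infty$ of
    the eigenvector $x_n=y_n/\gamma_n$. *)
Lemma yplus_weighted_series q A be zt : 0 < q < 1 -> be <> 0 -> 0 < zt ->
  ex_series (fun n : nat => yplus q A be zt (Z.of_nat n) ^ 2 * (qz q zt (Z.of_nat n) + / qz q zt (Z.of_nat n))).
Proof.
intros Hq Hb Hz.
set (y := fun n => yplus q A be zt (Z.of_nat n)).
assert (Hy : superexp y) by (apply yplus_superexp; assumption).
destruct (superexp_half y 1 Hy) as (M & HM0 & HM).
assert (Hqi : 0 < / q) by (apply Rinv_0_lt_compat; lra).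
apply (ex_series_le (K := R_AbsRing) (V := R_CompleteNormedModule) _
  (fun n => (M * (zt + / zt)) * (Rabs (y n) * (/ q) ^ n))).
- intros n; unfold norm; simpl; unfold abs; simpl; fold (y n).
  rewrite qz_nat.
  assert (Hn := pow_le_1 q n Hq); assert (Hzi : 0 < / zt) by (apply Rinv_0_lt_compat, Hz).
  assert (Hqn : 1 <= / q ^ n) by (rewrite <- Rinv_1; apply Rinv_le_contravar; lra).
  assert (E : / (q ^ n * zt) = / q ^ n * / zt) by apply Rinv_mult.
  assert (H1 : q ^ n * zt + / (q ^ n * zt) <= (zt + / zt) * (/ q) ^ n) by (rewrite E, pow_inv; nra).
  assert (H2 : 0 < q ^ n * zt + / (q ^ n * zt)) by (rewrite E; nra).
  specialize (HM n); rewrite pow1, Rmult_1_r in HM.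
  assert (H3 : Rabs (y n) <= M).
  { assert ((/ 2) ^ n <= 1) by (rewrite <- (pow1 n); apply pow_incr; lra); nra. }
  rewrite Rabs_mult, (Rabs_pos_eq (q ^ n * zt + _)) by lra.
  assert (E2 : Rabs (y n * (y n * 1)) = Rabs (y n) * Rabs (y n)) by (rewrite Rmult_1_r; apply Rabs_mult).
  rewrite E2.
  apply Rle_trans with (M * Rabs (y n) * ((zt + / zt) * (/ q) ^ n)); [|right; ring].
  apply Rmult_le_compat; [|lra| |exact H1].
  + apply Rmult_le_pos; apply Rabs_pos.
  + apply Rmult_le_compat_r; [apply Rabs_pos|exact H3].
- apply (ex_series_scal (V := R_NormedModule)), superexp_series; assumption.
Qed.

(** * Spectral parameters of the fibre operator *)

Definition qT (T : R) : R := exp (- (PI * omega T)).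
Definition zk (k : R) : R := exp (- (PI * k)).

Lemma omega_pos T : 0 < T -> 0 < omega T.
Proof. intros HT; unfold omega; generalize PI_RGT_0; intros; apply Rdiv_lt_0_compat; lra. Qed.

Lemma qT_bounds T : 0 < T -> 0 < qT T < 1.
Proof.
intros HT; unfold qT; split; [apply exp_pos|].
rewrite <- exp_0; apply exp_increasing.
assert (0 < PI * omega T) by (apply Rmult_lt_0_compat; [apply PI_RGT_0|apply omega_pos, HT]); lra.
Qed.

Lemma powerRZ_exp x n : powerRZ (exp x) n = exp (IZR n * x).
Proof.
destruct n as [|p|p]; simpl.
- rewrite Rmult_0_l, exp_0; reflexivity.
- rewrite exp_pow_INR, INR_IPR; reflexivity.
- rewrite exp_pow_INR, INR_IPR, <- exp_Ropp; f_equal.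
  change (IZR (Z.neg p)) with (- IPR p); ring.
Qed.

Lemma qz_cosh T k n : qz (qT T) (zk k) n + / qz (qT T) (zk k) n = 2 * cosh (PI * (omega T * IZR n + k)).
Proof.
unfold qz, qT, zk; rewrite powerRZ_exp, <- exp_plus, <- exp_Ropp; unfold cosh.
replace (- (IZR n * - (PI * omega T) + - (PI * k))) with (PI * (omega T * IZR n + k)) by ring.
replace (IZR n * - (PI * omega T) + - (PI * k)) with (- (PI * (omega T * IZR n + k))) by ring.
field.
Qed.

Section Fibre.
Variables (T Cg : R).
Hypothesis (HT : 0 < T).
Hypothesis (HC : 0 < Cg).
Hypothesis (HG : forall y, Cmod (Gamma_half y) ^ 2 = Cg / cosh (PI * y)).

Let q := qT T.

Lemma gam_mod k n : fst (gam T k n) ^ 2 + snd (gam T k n) ^ 2 = Cg / cosh (PI * (omega T * IZR n + k)).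
Proof.
rewrite <- HG; unfold gam, Cmod.
rewrite pow2_sqrt; [reflexivity|].
apply Rplus_le_le_0_compat; apply pow2_ge_0.
Qed.

Lemma gam_mod_pos k n : 0 < fst (gam T k n) ^ 2 + snd (gam T k n) ^ 2.
Proof.
rewrite gam_mod; apply Rdiv_lt_0_compat; [exact HC|generalize (cosh_ge_1 (PI * (omega T * IZR n + k))); lra].
Qed.

Lemma ecoef_gam A k lam n : lam <> 0 ->
  ecoef q A (Cg / lam) (zk k) n = 2 * lam / (fst (gam T k n) ^ 2 + snd (gam T k n) ^ 2) - 2 * A.
Proof.
intros Hl; unfold ecoef, q; rewrite qz_cosh, gam_mod.
assert (H := cosh_ge_1 (PI * (omega T * IZR n + k))); field; repeat split; lra.
Qed.

(* Componentwise form of [gamma_n (H x)_n = |gamma_n|^2 (y_(n-1)/2 + A y_n + y_(n+1)/2)],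
   [y_n = gamma_n x_n]. *)
Lemma Happly_eq A k (lr li : R) (x : Z -> C) n :
  let y := fun m => (gam T k m * x m)%C in
  let N := fst (gam T k n) ^ 2 + snd (gam T k n) ^ 2 in
  Happly T A k x n = ((lr, li) * x n)%C <->
  N * (fst (y (n - 1)%Z) / 2 + A * fst (y n) + fst (y (n + 1)%Z) / 2) = lr * fst (y n) - li * snd (y n) /\
  N * (snd (y (n - 1)%Z) / 2 + A * snd (y n) + snd (y (n + 1)%Z) / 2) = lr * snd (y n) + li * fst (y n).
Proof.
intros y N.
assert (HN : 0 < N) by apply gam_mod_pos.
assert (E : Happly T A k x n = (Cconj (gam T k n) * (RtoC (1 / 2) * y (n - 1)%Z + RtoC A * y n + RtoC (1 / 2) * y (n + 1)%Z))%C).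
{ unfold Happly, Hentry, y, symb.
  replace (n - (n - 1))%Z with 1%Z by lia; replace (n - n)%Z with 0%Z by lia;
  replace (n - (n + 1))%Z with (-1)%Z by lia; simpl; ring. }
rewrite E; clear E.
set (g := gam T k n) in *.
assert (Ey : y n = (g * x n)%C) by reflexivity.
rewrite Ey; unfold N in *; clear Ey N.
generalize (y (n - 1)%Z) (y (n + 1)%Z); clear y; intros [a1 b1] [a2 b2].
destruct (x n) as [xr xi]; clearbody g; destruct g as [gr gi]; simpl in *.
unfold Cconj, Cmult, Cplus, RtoC; simpl.
set (X := 1 / 2 * a1 - 0 * b1 + (A * (gr * xr - gi * xi) - 0 * (gr * xi + gi * xr)) + (1 / 2 * a2 - 0 * b2)).
set (Y := 1 / 2 * b1 + 0 * a1 + (A * (gr * xi + gi * xr) + 0 * (gr * xr - gi * xi)) + (1 / 2 * b2 + 0 * a2)).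
assert (EX : a1 / 2 + A * (gr * xr - gi * xi) + a2 / 2 = X) by (unfold X; field).
assert (EY : b1 / 2 + A * (gr * xi + gi * xr) + b2 / 2 = Y) by (unfold Y; field).
rewrite EX, EY; clearbody X Y.
split.
- intros H; injection H; intros H2 H1; split.
  + transitivity (gr * (gr * X - - gi * Y) - gi * (gr * Y + - gi * X)); [ring|rewrite H1, H2; ring].
  + transitivity (gr * (gr * Y + - gi * X) + gi * (gr * X - - gi * Y)); [ring|rewrite H1, H2; ring].
- intros [H1 H2].
  assert (HN2 : gr ^ 2 + gi ^ 2 <> 0) by (simpl; lra).
  f_equal; apply (Rmult_eq_reg_l (gr ^ 2 + gi ^ 2)); try exact HN2.
  + transitivity (gr * ((gr * (gr * 1) + gi * (gi * 1)) * X) + gi * ((gr * (gr * 1) + gi * (gi * 1)) * Y)); [ring|rewrite H1, H2; ring].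
  + transitivity (gr * ((gr * (gr * 1) + gi * (gi * 1)) * Y) - gi * ((gr * (gr * 1) + gi * (gi * 1)) * X)); [ring|rewrite H1, H2; ring].
Qed.

Lemma sq_le_to0 (u b : nat -> R) : (forall n, u n ^ 2 <= b n) -> is_lim_seq b 0 -> is_lim_seq u 0.
Proof.
intros H Hb; apply is_lim_seq_abs_0.
apply (is_lim_seq_le_le (fun _ => 0) _ (fun n => sqrt (b n))).
- intros n; split; [apply Rabs_pos|].
  rewrite <- sqrt_Rsqr_abs; apply sqrt_le_1_alt; rewrite Rsqr_pow2; apply H.
- apply is_lim_seq_const.
- rewrite <- sqrt_0; apply (is_lim_seq_continuous sqrt b 0); [|exact Hb].
  apply continuity_pt_filterlim, continuous_sqrt.
Qed.

Lemma gam_prod_le k n (x : Z -> C) :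
  fst (gam T k n * x n)%C ^ 2 + snd (gam T k n * x n)%C ^ 2 <= Cg * Cmod (x n) ^ 2.
Proof.
assert (H := gam_mod k n).
assert (Hc := cosh_ge_1 (PI * (omega T * IZR n + k))).
assert (Hle : fst (gam T k n) ^ 2 + snd (gam T k n) ^ 2 <= Cg).
{ rewrite H; apply (Rmult_le_reg_r (cosh (PI * (omega T * IZR n + k)))); [lra|].
  unfold Rdiv; rewrite Rmult_assoc, Rinv_l by lra; nra. }
unfold Cmod; rewrite pow2_sqrt by (apply Rplus_le_le_0_compat; apply pow2_ge_0).
destruct (gam T k n) as [a b]; destruct (x n) as [c d]; simpl in *.
replace ((a * c - b * d) * ((a * c - b * d) * 1) + (a * d + b * c) * ((a * d + b * c) * 1))
  with ((a * (a * 1) + b * (b * 1)) * (c * (c * 1) + d * (d * 1))) by ring.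
apply Rmult_le_compat_r; [nra|exact Hle].
Qed.

Lemma in_l2_to0 k (x : Z -> C) : in_l2 x ->
  let yr := fun n => fst (gam T k n * x n)%C in let yi := fun n => snd (gam T k n * x n)%C in
  (to0 yr /\ to0 (refl yr)) /\ (to0 yi /\ to0 (refl yi)).
Proof.
intros [H1 H2] yr yi.
assert (L1 : is_lim_seq (fun n => Cg * Cmod (x (Z.of_nat n)) ^ 2) 0).
{ replace (Finite 0) with (Rbar_mult Cg 0) by (simpl; f_equal; ring).
  apply is_lim_seq_scal_l, ex_series_lim_0, H1. }
assert (L2 : is_lim_seq (fun n => Cg * Cmod (x (- Z.of_nat n)%Z) ^ 2) 0).
{ replace (Finite 0) with (Rbar_mult Cg 0) by (simpl; f_equal; ring).
  apply is_lim_seq_scal_l, ex_series_lim_0, H2. }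
assert (B : forall n, yr n ^ 2 <= Cg * Cmod (x n) ^ 2 /\ yi n ^ 2 <= Cg * Cmod (x n) ^ 2).
{ intros n; assert (H := gam_prod_le k n x); fold (yr n) (yi n) in H.
  generalize (pow2_ge_0 (yr n)) (pow2_ge_0 (yi n)); lra. }
split; split.
- apply sq_le_to0 with (2 := L1); intros n; apply B.
- apply sq_le_to0 with (2 := L2); intros n; apply B.
- apply sq_le_to0 with (2 := L1); intros n; apply B.
- apply sq_le_to0 with (2 := L2); intros n; apply B.
Qed.

Lemma gam_neq0 k n : gam T k n <> RtoC 0.
Proof.
intros E; assert (H := gam_mod_pos k n); rewrite E in H; simpl in H; lra.
Qed.

Lemma gam_cancel k n (x : C) : (gam T k n * x)%C = RtoC 0 -> x = RtoC 0.
Proof.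
intros H; replace x with (/ gam T k n * (gam T k n * x))%C by (field; apply gam_neq0).
rewrite H; ring.
Qed.

(** For real [lam] the equation does not mix the real and imaginary parts of $\gamma_nx_n$, so each
    is a real solution. *)
Lemma eigvec_Sol A k lam x : lam <> 0 -> in_eigenspace T A k (RtoC lam) x ->
  let e := ecoef q A (Cg / lam) (zk k) in
  Sol e (fun n => fst (gam T k n * x n)%C) /\ Sol e (fun n => snd (gam T k n * x n)%C).
Proof.
intros Hl [_ Hx] e.
split; intros n; unfold e; rewrite ecoef_gam by exact Hl;
  destruct (proj1 (Happly_eq A k lam 0 x n) (Hx n)) as [E1 E2];
  assert (HN := gam_mod_pos k n).
- set (N := fst (gam T k n) ^ 2 + snd (gam T k n) ^ 2) in *.
  apply (Rmult_eq_reg_l (N / 2)); [|apply Rmult_integral_contrapositive; split; lra].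
  transitivity (lam * fst (gam T k n * x n)%C - N * A * fst (gam T k n * x n)%C); [|field; lra].
  rewrite Rmult_0_l, Rminus_0_r in E1; rewrite <- E1; field.
- set (N := fst (gam T k n) ^ 2 + snd (gam T k n) ^ 2) in *.
  apply (Rmult_eq_reg_l (N / 2)); [|apply Rmult_integral_contrapositive; split; lra].
  transitivity (lam * snd (gam T k n * x n)%C - N * A * snd (gam T k n * x n)%C); [|field; lra].
  rewrite Rmult_0_l, Rplus_0_r in E2; rewrite <- E2; field.
Qed.

Lemma zk_pos k : 0 < zk k.
Proof. apply exp_pos. Qed.

Lemma be_neq0 lam : lam <> 0 -> Cg / lam <> 0.
Proof. intros; apply Rmult_integral_contrapositive; split; [lra|apply Rinv_neq_0_compat; assumption]. Qed.

Lemma eigvec_prop A k lam x : lam <> 0 -> in_eigenspace T A k (RtoC lam) x ->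
  exists kap : C, forall n, (gam T k n * x n)%C = (kap * RtoC (yplus q A (Cg / lam) (zk k) n))%C.
Proof.
intros Hl Hx; destruct (eigvec_Sol A k lam x Hl Hx) as [S1 S2].
destruct (in_l2_to0 k x (proj1 Hx)) as [[Z1 _] [Z2 _]].
destruct (decaying_prop q A (Cg / lam) (zk k) _ (qT_bounds T HT) (be_neq0 lam Hl) (zk_pos k) S1 Z1) as [k1 E1].
destruct (decaying_prop q A (Cg / lam) (zk k) _ (qT_bounds T HT) (be_neq0 lam Hl) (zk_pos k) S2 Z2) as [k2 E2].
exists (k1, k2); intros n; specialize (E1 n); specialize (E2 n); cbv beta in E1, E2.
rewrite (surjective_pairing (gam T k n * x n)%C), E1, E2.
unfold Cmult, RtoC; simpl; f_equal; ring.
Qed.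

Lemma eigvec_zero A k lam x : lam <> 0 -> Tb q A (Cg / lam) (zk k) <> 0 ->
  in_eigenspace T A k (RtoC lam) x -> forall n, x n = RtoC 0.
Proof.
intros Hl HT0 Hx n; destruct (eigvec_Sol A k lam x Hl Hx) as [S1 S2].
destruct (in_l2_to0 k x (proj1 Hx)) as [[Z1 Z1'] [Z2 Z2']].
apply (gam_cancel k n); rewrite (surjective_pairing (gam T k n * x n)%C).
unfold RtoC; f_equal; apply Classical_Prop.NNPP; intros Hn; apply HT0.
- apply (Tb_zero_of_decaying q A (Cg / lam) (zk k) (fun n => fst (gam T k n * x n)%C)); auto;
    [apply qT_bounds, HT|apply be_neq0, Hl|apply zk_pos|exists n; exact Hn].
- apply (Tb_zero_of_decaying q A (Cg / lam) (zk k) (fun n => snd (gam T k n * x n)%C)); auto;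
    [apply qT_bounds, HT|apply be_neq0, Hl|apply zk_pos|exists n; exact Hn].
Qed.

(* The sequence [Im (conj y_n y_(n+1))] is monotone with increments [2 Im(lam) |y_n|^2/|gamma_n|^2]
   and tends to 0 at both ends. *)
Lemma eigvec_nonreal_zero A k lr li x : li <> 0 -> in_eigenspace T A k (lr, li) x -> forall n, x n = RtoC 0.
Proof.
intros Hl Hx.
set (yr := fun n => fst (gam T k n * x n)%C); set (yi := fun n => snd (gam T k n * x n)%C).
destruct (in_l2_to0 k x (proj1 Hx)) as [[Z1 Z1'] [Z2 Z2']].
fold yr yi in Z1, Z1', Z2, Z2'.
set (N := fun n => fst (gam T k n) ^ 2 + snd (gam T k n) ^ 2).
assert (HN : forall n, 0 < N n) by (intros n; exact (gam_mod_pos k n)).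
set (J := wr yr yi).
assert (HJ : forall n, / li * J n - / li * J (n - 1)%Z = 2 / N n * (yr n ^ 2 + yi n ^ 2)).
{ intros n; destruct (proj1 (Happly_eq A k lr li x n) (proj2 Hx n)) as [E1 E2].
  fold (N n) (yr (n - 1)%Z) (yr n) (yr (n + 1)%Z) (yi (n - 1)%Z) (yi n) (yi (n + 1)%Z) in E1, E2.
  specialize (HN n); unfold J, wr; replace (n - 1 + 1)%Z with n by lia.
  apply (Rmult_eq_reg_l (li * N n / 2)); [|repeat (apply Rmult_integral_contrapositive; split); lra].
  transitivity (yr n * (N n * (yi (n - 1)%Z / 2 + A * yi n + yi (n + 1)%Z / 2)) - yi n * (N n * (yr (n - 1)%Z / 2 + A * yr n + yr (n + 1)%Z / 2))).
  - field; exact Hl.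
  - rewrite E1, E2; field; lra. }
assert (Hinc : forall n, / li * J n <= / li * J (n + 1)%Z).
{ intros n; specialize (HJ (n + 1)%Z); replace (n + 1 - 1)%Z with n in HJ by lia.
  specialize (HN (n + 1)%Z).
  assert (0 <= 2 / N (n + 1)%Z * (yr (n + 1)%Z ^ 2 + yi (n + 1)%Z ^ 2)); [|lra].
  apply Rmult_le_pos; [left; apply Rdiv_lt_0_compat; lra|apply Rplus_le_le_0_compat; apply pow2_ge_0]. }
assert (L1 : is_lim_seq (fun n => / li * J (Z.of_nat n)) 0).
{ replace (Finite 0) with (Rbar_mult (/ li) 0) by (simpl; f_equal; ring).
  apply is_lim_seq_scal_l; exact (to0_wr yr yi Z1 Z2). }
assert (L2 : is_lim_seq (fun n => / li * J (- Z.of_nat n - 1)%Z) 0).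
{ replace (Finite 0) with (Rbar_mult (/ li) (- 0)) by (simpl; f_equal; ring).
  apply is_lim_seq_scal_l.
  apply is_lim_seq_ext with (fun n => - wr (refl yr) (refl yi) (Z.of_nat n)).
  - intros n; unfold J, wr, refl.
    replace (- (Z.of_nat n + 1))%Z with (- Z.of_nat n - 1)%Z by lia.
    replace (- Z.of_nat n - 1 + 1)%Z with (- Z.of_nat n)%Z by lia; ring.
  - apply (is_lim_seq_opp _ 0); exact (to0_wr (refl yr) (refl yi) Z1' Z2'). }
assert (Hle : forall m (j : nat), / li * J m <= / li * J (m + Z.of_nat j)%Z).
{ intros m; induction j as [|j IH]; [rewrite Z.add_0_r; lra|].
  replace (m + Z.of_nat (S j))%Z with (m + Z.of_nat j + 1)%Z by lia.
  eapply Rle_trans; [exact IH|apply Hinc]. }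
assert (Hup : forall m, / li * J m <= 0).
{ intros m.
  apply (is_lim_seq_le_loc (fun _ => / li * J m) (fun n => / li * J (Z.of_nat n)) (/ li * J m) 0);
    [|apply is_lim_seq_const|exact L1].
  exists (Z.to_nat m); intros n Hn.
  replace (Z.of_nat n) with (m + Z.of_nat (Z.to_nat (Z.of_nat n - m)))%Z by lia; apply Hle. }
assert (Hlo : forall m, 0 <= / li * J m).
{ intros m.
  apply (is_lim_seq_le_loc (fun n => / li * J (- Z.of_nat n - 1)%Z) (fun _ => / li * J m) 0 (/ li * J m));
    [|exact L2|apply is_lim_seq_const].
  exists (Z.to_nat (- m)); intros n Hn.
  assert (H := Hle (- Z.of_nat n - 1)%Z (Z.to_nat (m + Z.of_nat n + 1))).
  rewrite Z2Nat.id in H by lia.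
  replace (- Z.of_nat n - 1 + (m + Z.of_nat n + 1))%Z with m in H by lia; exact H. }
intros n; apply (gam_cancel k n); rewrite (surjective_pairing (gam T k n * x n)%C).
fold (yr n) (yi n).
specialize (HJ n); assert (H1 := Hup n); assert (H2 := Hlo n); assert (H3 := Hup (n - 1)%Z); assert (H4 := Hlo (n - 1)%Z).
assert (H5 : 0 < 2 / N n) by (apply Rdiv_lt_0_compat; [lra|apply HN]).
assert (H6 : yr n ^ 2 + yi n ^ 2 = 0).
{ apply (Rmult_eq_reg_l (2 / N n)); [|lra]; rewrite <- HJ; lra. }
unfold RtoC; f_equal; simpl in H6; nra.
Qed.

(** At a zero of the Wronskian [yplus] is a multiple of [yminus], a reflected [yplus]; the estimate
    at $+\infty$ therefore gives summability at both ends. *)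
Lemma eigvec_exists A k lam : lam <> 0 -> Tb q A (Cg / lam) (zk k) = 0 ->
  in_eigenspace T A k (RtoC lam) (fun n => (RtoC (yplus q A (Cg / lam) (zk k) n) / gam T k n)%C).
Proof.
intros Hl HT0.
assert (Hq := qT_bounds T HT); assert (Hb := be_neq0 lam Hl); assert (Hz := zk_pos k).
set (be := Cg / lam) in *; set (p := yplus q A be (zk k)).
set (x := fun n => (RtoC (p n) / gam T k n)%C).
assert (Hgx : forall n, (gam T k n * x n)%C = RtoC (p n)) by (intros n; unfold x; field; apply gam_neq0).
assert (Hmod : forall n, Cmod (x n) ^ 2 = p n ^ 2 * (qz q (zk k) n + / qz q (zk k) n) * / (2 * Cg)).
{ intros n; unfold x, Cdiv; rewrite Cmod_mult, Cmod_inv, Rpow_mult_distr, Cmod_R by apply gam_neq0.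
  rewrite pow2_abs, pow_inv; unfold q; rewrite qz_cosh.
  assert (E : Cmod (gam T k n) ^ 2 = Cg / cosh (PI * (omega T * IZR n + k))) by apply HG.
  rewrite E; assert (H := cosh_ge_1 (PI * (omega T * IZR n + k))); field; lra. }
split; [split|].
- apply ex_series_ext with (fun j => p (Z.of_nat j) ^ 2 * (qz q (zk k) (Z.of_nat j) + / qz q (zk k) (Z.of_nat j)) * / (2 * Cg)).
  { intros n; symmetry; apply Hmod. }
  apply ex_series_scal_r, yplus_weighted_series; assumption.
- destruct (Tb_zero_prop q A be (zk k) Hq Hb Hz HT0) as (kap & Hkap & Ek).
  assert (Hz' : 0 < / zk k) by (apply Rinv_0_lt_compat, Hz).
  apply ex_series_ext with (fun j => yplus q A be (/ zk k) (Z.of_nat j) ^ 2 * (qz q (/ zk k) (Z.of_nat j) + / qz q (/ zk k) (Z.of_nat j)) * / (2 * Cg * kap ^ 2)).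
  { intros n; change (yplus q A be (/ zk k) (Z.of_nat n) ^ 2 * (qz q (/ zk k) (Z.of_nat n) + / qz q (/ zk k) (Z.of_nat n)) * / (2 * Cg * kap ^ 2) = Cmod (x (- Z.of_nat n)%Z) ^ 2).
    rewrite Hmod.
    assert (E1 : yplus q A be (/ zk k) (Z.of_nat n) = kap * p (- Z.of_nat n)%Z).
    { unfold p; rewrite <- Ek; unfold yminus, refl; rewrite Z.opp_involutive; reflexivity. }
    assert (E2 : qz q (/ zk k) (Z.of_nat n) = / qz q (zk k) (- Z.of_nat n)).
    { rewrite <- qz_inv by (unfold q; lra); rewrite Z.opp_involutive; reflexivity. }
    assert (H2 := qz_pos q (zk k) (- Z.of_nat n) ltac:(unfold q; lra) Hz).
    rewrite E1, E2, Rinv_inv; field; repeat split; lra. }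
  apply ex_series_scal_r, yplus_weighted_series; assumption.
- intros n; apply (Happly_eq A k lam 0 x n); rewrite !Hgx; simpl.
  assert (HS := yplus_Sol q A be (zk k) Hq Hb Hz n); fold p in HS.
  unfold be in HS; rewrite ecoef_gam in HS by exact Hl.
  assert (HN := gam_mod_pos k n); simpl in HS, HN.
  set (N := fst (gam T k n) * (fst (gam T k n) * 1) + snd (gam T k n) * (snd (gam T k n) * 1)) in *.
  split; [|field].
  replace (p (n - 1)%Z / 2 + A * p n + p (n + 1)%Z / 2) with ((p (n - 1)%Z + p (n + 1)%Z) / 2 + A * p n) by field.
  rewrite HS; field; lra.
Qed.

(** * Multiplicities of the eigenvalues *)

Lemma lincomb_1 c v n : lincomb 1 c v n = (c 0%nat * v 0%nat n)%C.
Proof. unfold lincomb; simpl; ring. Qed.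

Lemma lincomb_2 c v n : lincomb 2 c v n = (c 0%nat * v 0%nat n + c 1%nat * v 1%nat n)%C.
Proof. unfold lincomb; simpl; ring. Qed.

Lemma fold_right_Cplus l (z : C) : fold_right Cplus z l = (fold_right Cplus (RtoC 0) l + z)%C.
Proof. induction l as [|a l IH]; simpl; [ring|rewrite IH; ring]. Qed.

Lemma lincomb_S m c v n : lincomb (S m) c v n = (lincomb m c v n + c m * v m n)%C.
Proof.
unfold lincomb; rewrite seq_S, map_app, fold_right_app, fold_right_Cplus; simpl; ring.
Qed.

Lemma lincomb_ext m c c' v n : (forall i, (i < m)%nat -> c i = c' i) -> lincomb m c v n = lincomb m c' v n.
Proof.
induction m as [|m IH]; intros H; [reflexivity|].
rewrite !lincomb_S, IH by (intros; apply H; lia); rewrite H by lia; reflexivity.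
Qed.

Lemma has_indep_pred A k lam m : has_indep_eigvecs T A k lam (S m) -> has_indep_eigvecs T A k lam m.
Proof.
intros (v & Hv & Hi); exists v; split; [intros i Hm; apply Hv; lia|].
intros c Hc i Him.
set (c' := fun j => if Nat.eqb j m then RtoC 0 else c j).
assert (E : c' i = RtoC 0).
{ apply (Hi c'); [|lia]; intros n; rewrite lincomb_S.
  rewrite (lincomb_ext m c' c), Hc.
  - unfold c'; rewrite Nat.eqb_refl; ring.
  - intros j Hj; unfold c'; rewrite (proj2 (Nat.eqb_neq j m)) by lia; reflexivity. }
unfold c' in E; rewrite (proj2 (Nat.eqb_neq i m)) in E by lia; exact E.
Qed.

Lemma has_indep_le A k lam m m' : (m <= m')%nat -> has_indep_eigvecs T A k lam m' -> has_indep_eigvecs T A k lam m.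
Proof. induction 1 as [|m' Hm IH]; [tauto|intros H'; apply IH, has_indep_pred, H']. Qed.

Lemma has_indep_0 A k lam : has_indep_eigvecs T A k lam 0.
Proof. exists (fun _ _ => RtoC 0); split; [intros i Hi; lia|intros c _ i Hi; lia]. Qed.

Lemma no_indep_1 A k lam : (forall x, in_eigenspace T A k lam x -> forall n, x n = RtoC 0) ->
  ~ has_indep_eigvecs T A k lam 1.
Proof.
intros H (v & Hv & Hi).
assert (E : RtoC 1 = RtoC 0).
{ apply (Hi (fun _ => RtoC 1)) with 0%nat; [|lia].
  intros n; rewrite lincomb_1, (H _ (Hv 0%nat ltac:(lia))); ring. }
injection E; lra.
Qed.

Lemma eig_mult_none A k lam m : (forall x, in_eigenspace T A k lam x -> forall n, x n = RtoC 0) ->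
  eig_mult T A k lam m <-> m = 0%nat.
Proof.
intros H; assert (H1 := no_indep_1 A k lam H); split.
- intros [Hm _]; destruct m as [|m]; [reflexivity|].
  exfalso; apply H1, (has_indep_le A k lam 1 (S m)); [lia|exact Hm].
- intros ->; split; [apply has_indep_0|exact H1].
Qed.

Lemma eig_mult_one A k lam m : lam <> 0 -> Tb q A (Cg / lam) (zk k) = 0 ->
  eig_mult T A k (RtoC lam) m <-> m = 1%nat.
Proof.
intros Hl HT0.
assert (H1 : has_indep_eigvecs T A k (RtoC lam) 1).
{ exists (fun _ n => (RtoC (yplus q A (Cg / lam) (zk k) n) / gam T k n)%C); split.
  - intros i _; apply eigvec_exists; assumption.
  - intros c Hc i Hi; replace i with 0%nat by lia.
    destruct (yplus_nonzero q A (Cg / lam) (zk k) (qT_bounds T HT) (be_neq0 lam Hl) (zk_pos k)) as [n Hn].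
    specialize (Hc n); rewrite lincomb_1 in Hc.
    set (y := yplus q A (Cg / lam) (zk k) n) in *.
    assert (Hy : RtoC y <> RtoC 0) by (intros E; injection E; exact Hn).
    replace (c 0%nat) with (gam T k n / RtoC y * (c 0%nat * (RtoC y / gam T k n)))%C
      by (field; split; [apply gam_neq0|exact Hy]).
    rewrite Hc; ring. }
assert (H2 : ~ has_indep_eigvecs T A k (RtoC lam) 2).
{ intros (v & Hv & Hi).
  destruct (eigvec_prop A k lam _ Hl (Hv 0%nat ltac:(lia))) as [k0 E0].
  destruct (eigvec_prop A k lam _ Hl (Hv 1%nat ltac:(lia))) as [k1 E1].
  assert (F : forall c : nat -> C, (c 0%nat * k0 + c 1%nat * k1)%C = RtoC 0 -> forall i, (i < 2)%nat -> c i = RtoC 0).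
  { intros c Hc; apply Hi; intros n; rewrite lincomb_2.
    apply (gam_cancel k n).
    replace (gam T k n * (c 0%nat * v 0%nat n + c 1%nat * v 1%nat n))%C
      with (c 0%nat * (gam T k n * v 0%nat n) + c 1%nat * (gam T k n * v 1%nat n))%C by ring.
    rewrite E0, E1.
    transitivity ((c 0%nat * k0 + c 1%nat * k1) * RtoC (yplus q A (Cg / lam) (zk k) n))%C; [ring|rewrite Hc; ring]. }
  (* Both vectors lie on one line, with coordinates [k0] and [k1]. The relations [(k1, - k0)] and
     [(- k1, k0)] hold there, so independence makes both coordinates 0; then [(1, 1)] is a relation
     as well. *)
  assert (K1 := F (fun i => match i with O => k1 | _ => (- k0)%C end) ltac:(cbv beta iota; ring) 0%nat ltac:(lia)).
  assert (K0 := F (fun i => match i with O => (- k1)%C | _ => k0 end) ltac:(cbv beta iota; ring) 1%nat ltac:(lia)).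
  cbv beta iota in K0, K1.
  assert (E : RtoC 1 = RtoC 0).
  { apply (F (fun _ => RtoC 1)) with 0%nat; [|lia]; rewrite K0, K1; ring. }
  injection E; lra. }
split.
- intros [Hm Hm']; destruct m as [|[|m]]; [contradiction|reflexivity|].
  exfalso; apply H2, (has_indep_le A k (RtoC lam) 2 (S (S m))); [lia|exact Hm].
- intros ->; split; assumption.
Qed.
End Fibre.

(** * Continuous dependence on the parameters *)

Lemma locally_R (x : R) (P : R -> Prop) : locally x P <-> exists d, 0 < d /\ forall y, Rabs (y - x) < d -> P y.
Proof.
split.
- intros [d Hd]; exists d; split; [apply cond_pos|exact Hd].
- intros (d & Hd & H); exists (mkposreal d Hd); exact H.
Qed.

Lemma continuous_R (f : R -> R) (x : R) :
  continuous f x <-> forall eps, 0 < eps -> exists d, 0 < d /\ forall y, Rabs (y - x) < d -> Rabs (f y - f x) < eps.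
Proof.
split.
- intros H eps He.
  assert (L : locally (f x) (fun z => Rabs (z - f x) < eps)) by (apply locally_R; exists eps; auto).
  apply locally_R, (H _ L).
- intros H P HP; apply locally_R in HP; destruct HP as (eps & He & HP).
  destruct (H eps He) as (d & Hd & Hy); apply locally_R; exists d; auto.
Qed.

Lemma Series_continuous (f : nat -> R -> R) (m : nat -> R) (t0 : R) :
  (forall j, continuous (f j) t0) -> locally t0 (fun t => forall j, Rabs (f j t) <= m j) -> ex_series m ->
  continuous (fun t => Series (fun j => f j t)) t0.
Proof.
intros Hc Hb Hm; apply continuous_R; intros eps He.
apply locally_R in Hb; destruct Hb as (d0 & Hd0 & Hb).
assert (Hm0 : forall j, 0 <= m j).
{ intros j; eapply Rle_trans; [apply Rabs_pos|apply (Hb t0); rewrite Rminus_diag, Rabs_R0; exact Hd0]. }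
destruct Hm as [l Hl].
assert (HN : exists N, Rabs (sum_n m N - l) < eps / 3).
{ assert (L : is_lim_seq (sum_n m) l) by exact Hl.
  apply is_lim_seq_spec in L; destruct (L (mkposreal (eps / 3) ltac:(lra))) as [N HN].
  exists N; apply HN; lia. }
destruct HN as [N HN].
assert (Htail : forall t, Rabs (t - t0) < d0 -> Rabs (Series (fun j => f j t) - sum_n (fun j => f j t) N) < eps / 3).
{ intros t Ht.
  assert (Hex : ex_series (fun j => Rabs (f j t))).
  { apply (ex_series_le (K := R_AbsRing) (V := R_CompleteNormedModule) _ m); [|exists l; exact Hl].
    intros n; unfold norm; simpl; unfold abs; simpl; rewrite Rabs_Rabsolu; apply Hb, Ht. }
  rewrite (Series_incr_n _ (S N)) by (try lia; apply ex_series_Rabs, Hex).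
  simpl pred; rewrite sum_n_Reals.
  replace (_ - _) with (Series (fun k => f (S N + k)%nat t)) by ring.
  assert (Hexm : ex_series m) by (exists l; exact Hl).
  assert (E : Series m = sum_n m N + Series (fun k => m (S N + k)%nat)).
  { rewrite (Series_incr_n m (S N)) by (try lia; exact Hexm); simpl pred; rewrite sum_n_Reals; reflexivity. }
  rewrite (is_series_unique _ _ Hl) in E.
  apply Rle_lt_trans with (Series (fun k => m (S N + k)%nat)).
  - eapply Rle_trans; [apply Series_Rabs, (ex_series_incr_n (fun j => Rabs (f j t)) (S N)), Hex|].
    apply Series_le; [|apply (ex_series_incr_n m (S N)), Hexm].
    intros n; split; [apply Rabs_pos|apply Hb, Ht].
  - apply Rabs_lt_between in HN; lra. }
assert (Hfin : continuous (fun t => sum_n (fun j => f j t) N) t0).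
{ clear - Hc; induction N as [|N IH].
  - apply continuous_ext with (f 0%nat); [intros; rewrite sum_n_0; reflexivity|apply Hc].
  - apply continuous_ext with (fun t => sum_n (fun j => f j t) N + f (S N) t); [intros; rewrite sum_n_S; reflexivity|].
    apply (continuous_plus (V := R_NormedModule)); [exact IH|apply Hc]. }
destruct (proj1 (continuous_R _ _) Hfin (eps / 3) ltac:(lra)) as (d1 & Hd1 & H1).
exists (Rmin d0 d1); split; [apply Rmin_case; assumption|].
intros t Ht.
assert (T1 := Htail t ltac:(eapply Rlt_le_trans; [exact Ht|apply Rmin_l])).
assert (T2 := Htail t0 ltac:(rewrite Rminus_diag, Rabs_R0; exact Hd0)).
specialize (H1 t ltac:(eapply Rlt_le_trans; [exact Ht|apply Rmin_r])).
apply Rabs_lt_between in T1, T2, H1; apply Rabs_lt_between; lra.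
Qed.

Lemma cR_plus (f g : R -> R) t : continuous f t -> continuous g t -> continuous (fun t => f t + g t) t.
Proof. intros; apply (continuous_plus (V := R_NormedModule)); assumption. Qed.

Lemma cR_minus (f g : R -> R) t : continuous f t -> continuous g t -> continuous (fun t => f t - g t) t.
Proof. intros; apply (continuous_minus (V := R_NormedModule)); assumption. Qed.

Lemma cR_mult (f g : R -> R) t : continuous f t -> continuous g t -> continuous (fun t => f t * g t) t.
Proof. intros; apply (continuous_mult (K := R_AbsRing)); assumption. Qed.

Lemma cR_const (a t : R) : continuous (fun _ : R => a) t.
Proof. apply continuous_const. Qed.

Lemma cR_inv (f : R -> R) t : continuous f t -> f t <> 0 -> continuous (fun t => / f t) t.
Proof. intros; apply continuous_Rinv_comp; assumption. Qed.

Lemma cR_pow (f : R -> R) n t : continuous f t -> continuous (fun t => f t ^ n) t.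
Proof. intros Hf; induction n as [|n IH]; simpl; [apply cR_const|apply cR_mult; assumption]. Qed.

Ltac ctac := lazymatch goal with
  | |- continuous (fun _ => ?a) _ => apply cR_const
  | |- continuous (fun t => t) _ => apply continuous_id
  | |- continuous (fun t => @?f t + @?g t) _ => apply (cR_plus f g); ctac
  | |- continuous (fun t => @?f t - @?g t) _ => apply (cR_minus f g); ctac
  | |- continuous (fun t => @?f t * @?g t) _ => apply (cR_mult f g); ctac
  | |- continuous (fun t => @?f t ^ ?n) _ => apply (cR_pow f n); ctac
  | _ => idtac
  end.

Lemma ucoef_continuous q (al c : R -> R) t0 j : continuous al t0 -> continuous c t0 ->
  continuous (fun t => ucoef q (al t) (c t) j) t0.
Proof.
intros Ha Hc; induction j as [| |j IH1 IH2] using nat_ind2.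
- apply continuous_const.
- apply continuous_ext with (fun t => al t * (- 2 / (1 - q))).
  + intros t; rewrite ucoef_1; unfold Rdiv; rring.
  + apply (continuous_mult (K := R_AbsRing)); [exact Ha|apply continuous_const].
- apply continuous_ext with (fun t => (al t * (- 2 * q ^ S j)) * ucoef q (al t) (c t) (S j) * / (1 - q ^ S (S j))
    + (q ^ j - c t * q ^ (2 * j)) * ucoef q (al t) (c t) j * / (1 - q ^ S (S j))).
  + intros t; rewrite ucoef_SS; unfold Rdiv; rring.
  + ctac; assumption.
Qed.

Lemma Ufun_param_continuous q (al c : R -> R) z t0 : 0 < q < 1 -> continuous al t0 -> continuous c t0 ->
  continuous (fun t => Ufun q (al t) (c t) z) t0.
Proof.
intros Hq Ha Hc; unfold Ufun, PSeries.
(* The margins of 1 let a single majorant serve all parameters near [t0]. *)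
set (K := (2 * (Rabs (al t0) + 1) + 1 + (Rabs (c t0) + 1)) / (1 - q)).
assert (EK : K * (1 - q) = 2 * (Rabs (al t0) + 1) + 1 + (Rabs (c t0) + 1)) by (unfold K; field; lra).
assert (HK : 0 <= K).
{ apply Rmult_le_pos; [generalize (Rabs_pos (al t0)) (Rabs_pos (c t0)); lra|left; apply Rinv_0_lt_compat; lra]. }
assert (HX : 0 < Rabs z + 1) by (generalize (Rabs_pos z); lra).
apply Series_continuous with (fun j => Rabs (ubound q K j) * (Rabs z + 1) ^ j).
- intros j; apply (continuous_mult (K := R_AbsRing)); [apply ucoef_continuous; assumption|apply continuous_const].
- destruct (proj1 (continuous_R _ _) Ha 1 Rlt_0_1) as (d1 & Hd1 & H1).
  destruct (proj1 (continuous_R _ _) Hc 1 Rlt_0_1) as (d2 & Hd2 & H2).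
  apply locally_R; exists (Rmin d1 d2); split; [apply Rmin_case; assumption|].
  intros t Ht j.
  specialize (H1 t ltac:(eapply Rlt_le_trans; [exact Ht|apply Rmin_l])).
  specialize (H2 t ltac:(eapply Rlt_le_trans; [exact Ht|apply Rmin_r])).
  assert (B1 : Rabs (al t) <= Rabs (al t0) + 1).
  { replace (al t) with (al t0 + (al t - al t0)) by ring; eapply Rle_trans; [apply Rabs_triang|lra]. }
  assert (B2 : Rabs (c t) <= Rabs (c t0) + 1).
  { replace (c t) with (c t0 + (c t - c t0)) by ring; eapply Rle_trans; [apply Rabs_triang|lra]. }
  rewrite Rabs_mult, <- RPow_abs; apply Rmult_le_compat; [apply Rabs_pos|apply pow_le, Rabs_pos| |].
  + rewrite (Rabs_pos_eq (ubound q K j)) by (apply ubound_pos; lra).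
    apply ucoef_bound; [exact Hq| |]; rewrite EK; generalize (Rabs_pos (al t0)) (Rabs_pos (c t0)); lra.
  + apply pow_incr; split; [apply Rabs_pos|lra].
- apply superexp_series; [apply ubound_superexp; assumption|exact HX].
Qed.

(** * Comparison of decaying solutions *)

(** Green's identity for two coefficient sequences; summed from $+\infty$ it yields the Sturm
    comparison below. *)
Lemma wr_compare_step e e' y y' n : Sol e y -> Sol e' y' ->
  wr y' y (n - 1) = wr y' y n + (e' n - e n) * (y' n * y n).
Proof.
intros Hy Hy'; unfold wr; specialize (Hy n); specialize (Hy' n).
replace (n - 1 + 1)%Z with n by lia.
replace (y (n - 1)%Z) with (e n * y n - y (n + 1)%Z) by lra.
replace (y' (n - 1)%Z) with (e' n * y' n - y' (n + 1)%Z) by lra; ring.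
Qed.

Lemma nonneg_of_decr_lim (F : Z -> R) n : to0 F -> (forall m, (n < m)%Z -> F m <= F (m - 1)%Z) -> 0 <= F n.
Proof.
intros HF Hd.
assert (Hle : forall j : nat, F (n + Z.of_nat j)%Z <= F n).
{ induction j as [|j IH]; [rewrite Z.add_0_r; lra|].
  eapply Rle_trans; [apply Hd; lia|].
  replace (n + Z.of_nat (S j) - 1)%Z with (n + Z.of_nat j)%Z by lia; exact IH. }
apply (is_lim_seq_le_loc (fun j => F (Z.of_nat j)) (fun _ => F n) 0 (F n)); [|exact HF|apply is_lim_seq_const].
exists (Z.to_nat n); intros j Hj.
specialize (Hle (Z.to_nat (Z.of_nat j - n))); rewrite Z2Nat.id in Hle by lia.
replace (n + (Z.of_nat j - n))%Z with (Z.of_nat j) in Hle by lia; exact Hle.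
Qed.

Lemma wr_nonneg e e' y y' n : Sol e y -> Sol e' y' -> to0 y -> to0 y' ->
  (forall m, (n < m)%Z -> e m <= e' m /\ 0 <= y m /\ 0 <= y' m) -> 0 <= wr y' y n.
Proof.
intros Hy Hy' H0 H0' H; apply nonneg_of_decr_lim; [apply to0_wr; assumption|].
intros m Hm; rewrite (wr_compare_step e e') by assumption.
destruct (H m Hm) as (H1 & H2 & H3).
assert (0 <= (e' m - e m) * (y' m * y m)) by (apply Rmult_le_pos; [lra|apply Rmult_le_pos; assumption]); lra.
Qed.

Lemma wr_pos e e' y y' n : Sol e y -> Sol e' y' -> to0 y -> to0 y' ->
  (forall m, (n < m)%Z -> e m < e' m /\ 0 < y m /\ 0 < y' m) -> 0 < wr y' y n.
Proof.
intros Hy Hy' H0 H0' H.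
assert (H1 : 0 <= wr y' y (n + 1)).
{ apply (wr_nonneg e e'); auto; intros m Hm; destruct (H m ltac:(lia)) as (? & ? & ?); lra. }
assert (E := wr_compare_step e e' y y' (n + 1) Hy Hy'); replace (n + 1 - 1)%Z with n in E by lia.
destruct (H (n + 1)%Z ltac:(lia)) as (H2 & H3 & H4).
assert (0 < (e' (n + 1)%Z - e (n + 1)%Z) * (y' (n + 1)%Z * y (n + 1)%Z)) by (apply Rmult_lt_0_compat; [lra|apply Rmult_lt_0_compat; assumption]); lra.
Qed.

Definition evpos (y : Z -> R) : Prop := exists M, forall n, (M <= n)%Z -> 0 < y n.

Lemma descend (P : Z -> Prop) N M : (forall n, (M <= n)%Z -> P n) ->
  (forall n, (N <= n)%Z -> (forall m, (n < m)%Z -> P m) -> P n) -> forall n, (N <= n)%Z -> P n.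
Proof.
intros HM Hs.
assert (H : forall (k : nat) n, (M - Z.of_nat k <= n)%Z -> (N <= n)%Z -> P n).
{ induction k as [|k IH]; intros n Hk Hn; [apply HM; lia|].
  destruct (Z.le_gt_cases (M - Z.of_nat k) n) as [H|H]; [apply IH; assumption|].
  apply Hs; [exact Hn|]; intros m Hm; apply IH; lia. }
intros n Hn; apply (H (Z.to_nat (M - n))); lia.
Qed.

(** Sturm comparison by descending induction: positivity of both solutions to the right of [n] gives
    [0 <= wr y' y n], and this inequality forces [y' n] to be positive. *)
Lemma compare_pos e e' y y' N : Sol e y -> Sol e' y' -> to0 y -> to0 y' -> evpos y' ->
  (forall n, (N <= n)%Z -> 0 < y n) -> (forall n, (N < n)%Z -> e n <= e' n) -> forall n, (N <= n)%Z -> 0 < y' n.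
Proof.
intros Hy Hy' H0 H0' [M HM] Hp He.
apply (descend (fun n => 0 < y' n) N M HM); intros n Hn IH.
assert (W : 0 <= wr y' y n).
{ apply (wr_nonneg e e'); auto; intros m Hm; specialize (IH m Hm); specialize (Hp m ltac:(lia)); specialize (He m ltac:(lia)); lra. }
unfold wr in W; assert (H1 := Hp n Hn); assert (H2 := Hp (n + 1)%Z ltac:(lia)); assert (H3 := IH (n + 1)%Z ltac:(lia)).
nra.
Qed.

Lemma large_coef_pos e y N : Sol e y -> to0 y -> evpos y -> (forall n, (N <= n)%Z -> 2 <= e n) ->
  forall n, (N - 1 <= n)%Z -> 0 < y n /\ y (n + 1)%Z <= y n.
Proof.
intros Hy H0 [M HM] He.
set (d := fun n => y n - y (n + 1)%Z).
assert (Hd0 : to0 d).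
{ unfold to0, d; replace (Finite 0) with (Finite (0 - 0)) by (f_equal; ring).
  apply is_lim_seq_minus'; [exact H0|apply (to0_shift y 1), H0]. }
assert (Hd : forall n, (N <= n)%Z -> 0 <= y n -> d n <= d (n - 1)%Z).
{ intros n Hn Hp; unfold d; replace (n - 1 + 1)%Z with n by lia.
  specialize (Hy n); specialize (He n Hn); nra. }
apply (descend (fun n => 0 < y n /\ y (n + 1)%Z <= y n) (N - 1) (Z.max M N)).
- intros n Hn; split; [apply HM; lia|].
  assert (H : 0 <= d n); [|unfold d in H; lra].
  apply nonneg_of_decr_lim; [exact Hd0|]; intros m Hm; apply Hd; [lia|left; apply HM; lia].
- intros n Hn IH; destruct (IH (n + 1)%Z ltac:(lia)) as [H1 H2].
  assert (H3 := Hd (n + 1)%Z ltac:(lia) ltac:(lra)); unfold d in H3; replace (n + 1 - 1)%Z with n in H3 by lia.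
  lra.
Qed.

(** * Even and odd spectrum at k = 0 *)

Lemma Ube_continuous q (A l : R -> R) z t0 : 0 < q < 1 -> continuous A t0 -> continuous l t0 -> l t0 <> 0 ->
  continuous (fun t => Ube q (A t) (/ l t) z) t0.
Proof.
intros Hq HA Hl H0; unfold Ube.
apply (Ufun_param_continuous q (fun t => A t * / l t) (fun t => q * (/ l t) ^ 2)); [exact Hq| |]; ctac;
  try apply cR_inv; assumption.
Qed.

Lemma gfac_continuous q (l : R -> R) n t0 : 0 < q -> continuous l t0 -> 0 < l t0 ->
  continuous (fun t => gfac q (/ l t) 1 n) t0.
Proof.
intros Hq Hl H0; unfold gfac; ctac.
destruct n as [|p|p]; simpl; ctac; [apply cR_inv; [assumption|lra]|].
apply cR_inv; [ctac; apply cR_inv; [assumption|lra]|].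
apply pow_nonzero, Rmult_integral_contrapositive; split; [apply Rinv_neq_0_compat; lra|lra].
Qed.

(* Right-decaying solution at [zeta = 1] in terms of the rescaled eigenvalue [l = 1/beta]. *)
Definition yl (q A l : R) : Z -> R := yplus q A (/ l) 1.

Definition el (q A l : R) (n : Z) : R := l * (qz q 1 n + / qz q 1 n) - 2 * A.

Lemma yl_continuous q (A l : R -> R) n t0 : 0 < q < 1 -> continuous A t0 -> continuous l t0 -> 0 < l t0 ->
  continuous (fun t => yl q (A t) (l t) n) t0.
Proof.
intros Hq HA Hl H0; unfold yl, yplus.
apply (cR_mult (fun t => gfac q (/ l t) 1 n) (fun t => Ube q (A t) (/ l t) (qz q 1 (n + 1)))).
- apply gfac_continuous; try assumption; lra.
- apply Ube_continuous; try assumption; lra.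
Qed.

Lemma yl_Sol q A l : 0 < q < 1 -> 0 < l -> Sol (el q A l) (yl q A l).
Proof.
intros Hq Hl n.
assert (Hb : / l <> 0) by (apply Rinv_neq_0_compat; lra).
unfold yl; rewrite (yplus_Sol q A (/ l) 1 Hq Hb Rlt_0_1 n); unfold ecoef, el; f_equal.
unfold Rdiv; rewrite Rinv_inv; ring.
Qed.

Lemma yl_to0 q A l : 0 < q < 1 -> 0 < l -> to0 (yl q A l).
Proof. intros Hq Hl; apply yplus_to0; [exact Hq|apply Rinv_neq_0_compat; lra|lra]. Qed.

Lemma yl_evpos q A l : 0 < q < 1 -> 0 < l -> evpos (yl q A l).
Proof.
intros Hq Hl; destruct (Ube_eventually_pos q A (/ l) 1 Hq Rlt_0_1) as [N HN].
exists (Z.of_nat N); intros n Hn; unfold yl, yplus; apply Rmult_lt_0_compat.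
- apply gfac_pos; [lra|apply Rinv_0_lt_compat, Hl|lra].
- replace (n + 1)%Z with (Z.of_nat (Z.to_nat (n + 1))) by lia; apply HN; lia.
Qed.

Lemma cosh_ge q n : 0 < q -> 2 <= qz q 1 n + / qz q 1 n.
Proof.
intros Hq; assert (H := qz_pos q 1 n Hq Rlt_0_1); revert H; generalize (qz q 1 n); intros a H.
apply (Rmult_le_reg_r a); [exact H|]; rewrite Rmult_plus_distr_r, Rinv_l by lra.
generalize (pow2_ge_0 (a - 1)); nra.
Qed.

(** At $\zeta=1$ the left solution is the mirror image of the right one, so the Wronskian factors:
    $y_0=0$ produces an odd eigenvector and $y_{-1}=y_1$ an even one. *)
Lemma Tb_yl q A l : 0 < q < 1 -> 0 < l ->
  Tb q A (/ l) 1 = yl q A l 0 * (/ l * (yl q A l (-1) - yl q A l 1)).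
Proof.
intros Hq Hl.
assert (Hb : / l <> 0) by (apply Rinv_neq_0_compat; lra).
assert (H := wr_That q A (/ l) 1 Hq Hb Rlt_0_1); fold (Tb q A (/ l) 1) in H.
unfold wr, yminus, refl in H; rewrite Rinv_1 in H; fold (yl q A l) in H.
change (0 + 1)%Z with 1%Z in H; change (- (1))%Z with (-1)%Z in H; change (- 0)%Z with 0%Z in H.
apply (Rmult_eq_reg_l (1 / / l)); [rewrite <- H; field; lra|].
apply Rmult_integral_contrapositive; split; [lra|apply Rinv_neq_0_compat, Hb].
Qed.

(** Only [A * be] and [be ^ 2] enter. Negative [be] can thus be studied with a positive parameter
    and the coupling [- A], where the comparison theorems apply. *)
Lemma Tb_neg q A be zt : Tb q A (- be) zt = Tb q (- A) be zt.
Proof.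
unfold Tb; replace (A * - be) with (- A * be) by ring.
replace ((- be) ^ 2) with (be ^ 2) by ring; reflexivity.
Qed.

(* No sign change on [n >= 0], that is, [l] lies above the odd spectrum at [k = 0]. *)
Definition good (q A l : R) : Prop := 0 < l /\ forall n, (0 <= n)%Z -> 0 < yl q A l n.

Lemma good_mono q A l A' l' : 0 < q < 1 -> good q A l -> 0 < l' ->
  (forall n, (0 < n)%Z -> el q A l n <= el q A' l' n) -> good q A' l'.
Proof.
intros Hq [Hl Hg] Hl' He; split; [exact Hl'|].
apply (compare_pos (el q A l) (el q A' l') (yl q A l) (yl q A' l') 0);
  try apply yl_Sol; try apply yl_to0; try apply yl_evpos; assumption.
Qed.

Lemma good_mono_l q A l l' : 0 < q < 1 -> good q A l -> l <= l' -> good q A l'.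
Proof.
intros Hq Hg Hl; assert (H0 := proj1 Hg).
apply (good_mono q A l); [exact Hq|exact Hg|lra|].
intros n _; unfold el; assert (H := cosh_ge q n ltac:(lra)); nra.
Qed.

Lemma el_ge_2 q A l n : 0 < q -> 0 < l -> A + 1 <= l -> 2 <= el q A l n.
Proof. intros Hq Hl H; unfold el; assert (H1 := cosh_ge q n Hq); nra. Qed.

Lemma yl_decr q A l n : 0 < q < 1 -> 0 < l -> A + 1 <= l -> 0 < yl q A l n /\ yl q A l (n + 1) <= yl q A l n.
Proof.
intros Hq Hl H.
apply (large_coef_pos (el q A l) (yl q A l) (n + 1)); try apply yl_Sol; try apply yl_to0; try apply yl_evpos;
  try assumption; [|lia].
intros m _; apply el_ge_2; lra.
Qed.

(** The coefficient at [n = 1] exceeds 2 strictly, because [q + / q > 2]; this makes the decrease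
    from $y_0$ to $y_1$ strict. *)
Lemma yl_gap q A l : 0 < q < 1 -> 0 < l -> A + 1 <= l -> 0 < yl q A l 0 /\ 0 < yl q A l (-1) - yl q A l 1.
Proof.
intros Hq Hl H.
destruct (yl_decr q A l 0 Hq Hl H) as [P0 D0]; destruct (yl_decr q A l (-1) Hq Hl H) as [P1 D1].
change (0 + 1)%Z with 1%Z in D0; change (-1 + 1)%Z with 0%Z in D1.
split; [exact P0|].
assert (E := yl_Sol q A l Hq Hl 0%Z); change (0 - 1)%Z with (-1)%Z in E; change (0 + 1)%Z with 1%Z in E.
assert (E1 := yl_Sol q A l Hq Hl 1%Z); change (1 - 1)%Z with 0%Z in E1; change (1 + 1)%Z with 2%Z in E1.
assert (D2 := proj2 (yl_decr q A l 1 Hq Hl H)); change (1 + 1)%Z with 2%Z in D2.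
assert (P2 := proj1 (yl_decr q A l 1 Hq Hl H)).
assert (S : 2 < el q A l 1).
{ unfold el, qz; simpl powerRZ; rewrite !Rmult_1_r.
  assert (2 < q + / q); [|nra].
  apply (Rmult_lt_reg_r q); [lra|]; rewrite Rmult_plus_distr_r, Rinv_l by lra; nra. }
nra.
Qed.

Lemma good_large q A l : 0 < q < 1 -> 0 < l -> A + 1 <= l -> good q A l.
Proof. intros Hq Hl H; split; [exact Hl|]; intros n _; apply yl_decr; assumption. Qed.

(** For [A >= 0] and [l] below this value, the coefficients at 1 and 2 are both less than 1, and
    adding the recurrences there gives $y_0+y_3<0$. This keeps the infimum of the good values
    positive. *)
Definition lmin (q : R) : R := / (q + / q + (q ^ 2 + / q ^ 2)).

Lemma lmin_pos q : 0 < q -> 0 < lmin q.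
Proof.
intros Hq; apply Rinv_0_lt_compat.
assert (0 < / q) by (apply Rinv_0_lt_compat, Hq).
assert (0 < q ^ 2) by (apply pow_lt, Hq); assert (0 < / q ^ 2) by (apply Rinv_0_lt_compat; lra); lra.
Qed.

Lemma good_ge_lmin q A l : 0 < q < 1 -> 0 <= A -> good q A l -> lmin q <= l.
Proof.
intros Hq HA [Hl Hg]; apply Rnot_lt_le; intros Hlt.
assert (H0 := Hg 0%Z ltac:(lia)); assert (H1 := Hg 1%Z ltac:(lia)).
assert (H2 := Hg 2%Z ltac:(lia)); assert (H3 := Hg 3%Z ltac:(lia)).
assert (E1 := yl_Sol q A l Hq Hl 1%Z); assert (E2 := yl_Sol q A l Hq Hl 2%Z).
change (1 - 1)%Z with 0%Z in E1; change (1 + 1)%Z with 2%Z in E1.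
change (2 - 1)%Z with 1%Z in E2; change (2 + 1)%Z with 3%Z in E2.
assert (Q0 : 0 < / q) by (apply Rinv_0_lt_compat; lra).
assert (Q1 : 0 < q ^ 2) by (apply pow_lt; lra); assert (Q2 : 0 < / q ^ 2) by (apply Rinv_0_lt_compat; lra).
assert (Hs : l * (q + / q + (q ^ 2 + / q ^ 2)) < 1).
{ unfold lmin in Hlt; rewrite <- (Rinv_l (q + / q + (q ^ 2 + / q ^ 2))) by lra.
  apply Rmult_lt_compat_r; lra. }
assert (B1 : el q A l 1 < 1) by (unfold el, qz; simpl powerRZ; rewrite !Rmult_1_r; nra).
assert (B2 : el q A l 2 < 1).
{ unfold el, qz; replace (powerRZ q 2) with (q ^ 2) by (simpl; ring); rewrite Rmult_1_r; nra. }
assert (C1 := Rmult_lt_compat_r _ _ _ H1 B1); assert (C2 := Rmult_lt_compat_r _ _ _ H2 B2); lra.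
Qed.

Lemma qz_small q X : 0 < q < 1 -> exists N, forall n, (N <= n)%Z -> X <= / qz q 1 n.
Proof.
intros Hq.
destruct (superexp_small q (Rabs X) ltac:(lra) (Rabs_pos X)) as [J HJ].
exists (Z.of_nat J); intros n Hn.
assert (Hp := qz_pos q 1 n ltac:(lra) Rlt_0_1).
apply (Rmult_le_reg_r (qz q 1 n)); [exact Hp|]; rewrite Rinv_l by lra.
replace n with (Z.of_nat (Z.to_nat n)) by lia; rewrite qz_nat, Rmult_1_r.
eapply Rle_trans; [|apply (HJ (Z.to_nat n)); lia].
apply Rmult_le_compat_r; [apply pow_le; lra|apply Rle_abs].
Qed.

(** Far to the right the coefficient is at least 2 for all [l' >= l / 2], so positivity is automatic
    there; continuity in [l'] handles the finitely many remaining indices. *)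
Lemma good_open q A l : 0 < q < 1 -> good q A l -> exists l', 0 < l' < l /\ good q A l'.
Proof.
intros Hq [Hl Hg].
destruct (qz_small q ((2 + 2 * A) / (l / 2)) Hq) as [N HN].
assert (Htail : forall l', l / 2 <= l' -> forall n, (N - 1 <= n)%Z -> 0 < yl q A l' n).
{ intros l' Hl' n Hn.
  apply (large_coef_pos (el q A l') (yl q A l') N); try apply yl_Sol; try apply yl_to0; try apply yl_evpos; try assumption; try lra.
  intros m Hm; specialize (HN m Hm); unfold el.
  assert (Hp := qz_pos q 1 m ltac:(lra) Rlt_0_1).
  assert (Hi : 0 < / qz q 1 m) by (apply Rinv_0_lt_compat, Hp).
  assert (l / 2 * ((2 + 2 * A) / (l / 2)) <= l / 2 * / qz q 1 m) by (apply Rmult_le_compat_l; lra).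
  replace (l / 2 * ((2 + 2 * A) / (l / 2))) with (2 + 2 * A) in H by (field; lra).
  nra. }
assert (Hfin : forall k : nat, exists d, 0 < d /\ forall l', Rabs (l' - l) < d -> forall n, (0 <= n < Z.of_nat k)%Z -> 0 < yl q A l' n).
{ induction k as [|k (d & Hd & IH)]; [exists 1; split; [lra|intros; lia]|].
  assert (Hc : continuous (fun t => yl q A t (Z.of_nat k)) l)
    by (apply (yl_continuous q (fun _ => A) (fun t => t)); [exact Hq|apply cR_const|apply continuous_id|exact Hl]).
  destruct (proj1 (continuous_R _ _) Hc _ (Hg (Z.of_nat k) ltac:(lia))) as (d' & Hd' & H').
  exists (Rmin d d'); split; [apply Rmin_case; assumption|].
  intros l' Hl' n Hn; destruct (Z.eq_dec n (Z.of_nat k)) as [->|Hne].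
  - specialize (H' l' ltac:(eapply Rlt_le_trans; [exact Hl'|apply Rmin_r])).
    apply Rabs_lt_between in H'; lra.
  - apply IH; [eapply Rlt_le_trans; [exact Hl'|apply Rmin_l]|lia]. }
destruct (Hfin (Z.to_nat N)) as (d & Hd & H).
set (l' := l - Rmin (l / 2) (d / 2)).
assert (H1 : 0 < Rmin (l / 2) (d / 2)) by (apply Rmin_case; lra).
assert (H2 : Rmin (l / 2) (d / 2) <= l / 2) by apply Rmin_l.
assert (H3 : Rmin (l / 2) (d / 2) <= d / 2) by apply Rmin_r.
exists l'; split; [unfold l'; lra|]; split; [unfold l'; lra|].
intros n Hn; destruct (Z.le_gt_cases N n) as [HNn|HNn].
- apply Htail; [unfold l'; lra|lia].
- apply H; [|lia].
  unfold l'; replace (l - Rmin (l / 2) (d / 2) - l) with (- Rmin (l / 2) (d / 2)) by ring.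
  rewrite Rabs_Ropp, Rabs_pos_eq; lra.
Qed.

(** The infimum of the good values, that is, the top of the odd spectrum on the scale $l=1/\beta$.
    As goodness is an open condition, the infimum is not attained. *)
Definition is_l0 (q A l0 : R) : Prop :=
  0 < l0 /\ (forall l, good q A l -> l0 <= l) /\ (forall l, l0 < l -> good q A l).

Lemma is_l0_exists q A : 0 < q < 1 -> 0 <= A -> exists l0, is_l0 q A l0.
Proof.
intros Hq HA.
destruct (completeness (fun x => good q A (- x))) as [m [Hub Hlub]].
- exists (- lmin q); intros x Hx; assert (H := good_ge_lmin q A _ Hq HA Hx); lra.
- exists (- (A + 1)); rewrite Ropp_involutive; apply good_large; lra.
- assert (Hm : m <= - lmin q).
  { apply Hlub; intros x Hx; assert (H := good_ge_lmin q A _ Hq HA Hx); lra. }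
  exists (- m); split; [|split].
  + generalize (lmin_pos q ltac:(lra)); lra.
  + intros l Hl; assert (H := Hub (- l)); cbv beta in H; rewrite Ropp_involutive in H; specialize (H Hl); lra.
  + intros l Hl.
    assert (Hex : exists x, good q A (- x) /\ - l < x).
    { apply Classical_Prop.NNPP; intros Hn.
      assert (m <= - l); [|lra].
      apply Hlub; intros x Hx; apply Rnot_lt_le; intros Hlt; apply Hn; exists x; auto. }
    destruct Hex as (x & Hx & Hxl); apply (good_mono_l q A (- x)); [exact Hq|exact Hx|lra].
Qed.

(** In the limit positivity weakens to nonnegativity. A zero at [n > 0] would force both neighbours,
    hence the whole solution, to vanish; and $y_0>0$ would make [l0] good, against openness. *)
Lemma is_l0_zero q A l0 : 0 < q < 1 -> is_l0 q A l0 ->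
  yl q A l0 0 = 0 /\ forall n, (0 < n)%Z -> 0 < yl q A l0 n.
Proof.
intros Hq (Hl & Hlow & Hup).
assert (Hnn : forall n, (0 <= n)%Z -> 0 <= yl q A l0 n).
{ intros n Hn; apply Rnot_lt_le; intros Hlt.
  assert (Hc : continuous (fun t => yl q A t n) l0)
    by (apply (yl_continuous q (fun _ => A) (fun t => t)); [exact Hq|apply cR_const|apply continuous_id|exact Hl]).
  destruct (proj1 (continuous_R _ _) Hc (- yl q A l0 n) ltac:(lra)) as (d & Hd & H).
  specialize (H (l0 + d / 2) ltac:(replace (l0 + d / 2 - l0) with (d / 2) by ring; rewrite Rabs_pos_eq; lra)).
  assert (Hp := proj2 (Hup (l0 + d / 2) ltac:(lra)) n Hn).
  apply Rabs_lt_between in H; lra. }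
assert (HS := yl_Sol q A l0 Hq Hl).
assert (Hpos : forall n, (0 < n)%Z -> 0 < yl q A l0 n).
{ intros n Hn; destruct (Rle_lt_or_eq_dec _ _ (Hnn n ltac:(lia))) as [H|H]; [exact H|exfalso].
  assert (E := HS n); rewrite <- H, Rmult_0_r in E.
  assert (H1 := Hnn (n - 1)%Z ltac:(lia)); assert (H2 := Hnn (n + 1)%Z ltac:(lia)).
  destruct (yl_evpos q A l0 Hq Hl) as [M HM].
  assert (Z0 := Sol_zero _ _ n HS (eq_sym H) ltac:(lra) M).
  specialize (HM M ltac:(lia)); lra. }
split; [|exact Hpos].
destruct (Rle_lt_or_eq_dec _ _ (Hnn 0%Z ltac:(lia))) as [H|H]; [exfalso|symmetry; exact H].
destruct (good_open q A l0 Hq) as (l' & Hl' & Hg).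
- split; [exact Hl|]; intros n Hn; destruct (Z.eq_dec n 0) as [->|Hne]; [exact H|apply Hpos; lia].
- specialize (Hlow l' Hg); lra.
Qed.

(** Raising [A] by $\delta$ lowers the coefficient by $2\delta$, and raising [l] by $\delta$
    restores at least as much, since $q^n+q^{-n}\ge2$. *)
Lemma is_l0_lip q A A' l0 l0' : 0 < q < 1 -> A <= A' -> is_l0 q A l0 -> is_l0 q A' l0' ->
  l0 <= l0' <= l0 + (A' - A).
Proof.
intros Hq HA (Hl & Hlow & Hup) (Hl' & Hlow' & Hup').
assert (Hs := fun n => cosh_ge q n ltac:(lra)).
split; apply Rnot_lt_le; intros Hlt.
- assert (H := Hup' ((l0 + l0') / 2) ltac:(lra)).
  assert (H1 : good q A ((l0 + l0') / 2)).
  { apply (good_mono q A' ((l0 + l0') / 2)); [exact Hq|exact H|lra|intros n _; unfold el; lra]. }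
  specialize (Hlow _ H1); lra.
- set (l := (l0 + (l0' - (A' - A))) / 2).
  assert (H := Hup l ltac:(unfold l; lra)).
  assert (H1 : good q A' (l + (A' - A))).
  { apply (good_mono q A l); [exact Hq|exact H|unfold l; lra|].
    intros n _; unfold el; specialize (Hs n).
    assert (0 <= (A' - A) * (qz q 1 n + / qz q 1 n - 2)) by (apply Rmult_le_pos; lra); lra. }
  specialize (Hlow' _ H1); unfold l in Hlow'; lra.
Qed.

Lemma el_lt_neg q A l n : 0 < A -> el q A l n < el q (- A) l n.
Proof. intros; unfold el; lra. Qed.

(** The coefficient at coupling [- A] is strictly larger, so the Wronskian at 0 is strictly
    positive; this excludes a zero even in the borderline case [yl q A l 0 = 0]. *)
Lemma yl_neg_pos q A l : 0 < q < 1 -> 0 < A -> 0 < l -> (forall n, (0 < n)%Z -> 0 < yl q A l n) ->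
  0 <= yl q A l 0 -> 0 < yl q (- A) l 0.
Proof.
intros Hq HA Hl Hp H0.
assert (P1 : forall n, (1 <= n)%Z -> 0 < yl q (- A) l n).
{ apply (compare_pos (el q A l) (el q (- A) l) (yl q A l) (yl q (- A) l) 1);
    try apply yl_Sol; try apply yl_to0; try apply yl_evpos; try assumption.
  - intros n Hn; apply Hp; lia.
  - intros n _; left; apply el_lt_neg, HA. }
assert (W : 0 < wr (yl q (- A) l) (yl q A l) 0).
{ apply (wr_pos (el q A l) (el q (- A) l)); try apply yl_Sol; try apply yl_to0; try assumption.
  intros m Hm; split; [apply el_lt_neg, HA|split; [apply Hp, Hm|apply P1; lia]]. }
unfold wr in W; change (0 + 1)%Z with 1%Z in W.
assert (H1 := Hp 1%Z ltac:(lia)); assert (H2 := P1 1%Z ltac:(lia)); nra.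
Qed.

Lemma IVT_cont (f : R -> R) (a b : R) : a < b -> (forall x, a <= x <= b -> continuous f x) -> f a < 0 -> 0 < f b ->
  exists x, a < x < b /\ f x = 0.
Proof.
intros Hab Hc Ha Hb.
destruct (IVT_interv f a b) as (x & Hx & E); auto.
- intros x Hx; apply continuity_pt_filterlim, Hc, Hx.
- exists x; split; [|exact E].
  destruct Hx as [H1 H2]; destruct H1 as [H1|H1]; [|rewrite <- H1 in E; lra].
  destruct H2 as [H2|H2]; [lra|rewrite H2 in E; lra].
Qed.

(* [That(1; -beta0(A))] is negative for small [A > 0] and positive at [A = 1], where the operator
   is nonnegative; at its zero both [beta0] and [-beta0] belong to the spectrum at [k = 0]. *)
Lemma critical_coupling q : 0 < q < 1 -> exists A b0 b1, 0 < A < 1 /\ 0 < b0 /\ 0 < b1 /\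
  Tb q A b0 1 = 0 /\ Tb q A (- b0) 1 = 0 /\ Tb q A b1 1 = 0 /\ Tb q A (- b1) 1 <> 0.
Proof.
intros Hq.
destruct (ClassicalEpsilon.choice (fun A l => 0 <= A -> is_l0 q A l)) as [L HL].
{ intros A; destruct (Rle_lt_dec 0 A) as [HA|HA].
  - destruct (is_l0_exists q A Hq HA) as [l Hl]; exists l; auto.
  - exists 0; intros; lra. }
(* The even extension makes [l0] continuous and positive on the whole line; [L] itself is
   constrained for nonnegative arguments only. *)
set (l0 := fun A => L (Rabs A)).
assert (Hl0 : forall A, 0 <= A -> is_l0 q A (l0 A)).
{ intros A HA; unfold l0; rewrite Rabs_pos_eq by exact HA; apply HL, HA. }
assert (Hl0p : forall A, 0 < l0 A) by (intros A; exact (proj1 (HL (Rabs A) (Rabs_pos A)))).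
assert (Hl0c : forall A, continuous l0 A).
{ assert (Hlip : forall a b, 0 <= a -> 0 <= b -> Rabs (L a - L b) <= Rabs (a - b)).
  { intros a b Ha Hb; destruct (Rle_lt_dec a b) as [Hab|Hab].
    - destruct (is_l0_lip q a b _ _ Hq Hab (HL a Ha) (HL b Hb)).
      rewrite !Rabs_left1 by lra; lra.
    - destruct (is_l0_lip q b a _ _ Hq ltac:(lra) (HL b Hb) (HL a Ha)).
      rewrite !Rabs_pos_eq by lra; lra. }
  intros A; apply continuous_R; intros eps He; exists eps; split; [exact He|]; intros y Hy.
  eapply Rle_lt_trans; [apply Hlip; apply Rabs_pos|].
  eapply Rle_lt_trans; [apply Rabs_triang_inv2|exact Hy]. }
assert (Hcy : forall n A, continuous (fun A => yl q (- A) (l0 A) n) A).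
{ intros n A; apply (yl_continuous q (fun A => - A) l0); [exact Hq| |apply Hl0c|apply Hl0p].
  apply (continuous_opp (V := R_NormedModule)), continuous_id. }
(* By [Tb_neg] and [Tb_yl] this is the Wronskian at $-\beta_0(A)$ with $\beta_0=1/l_0$, the sign
   having been moved to the coupling. *)
set (Ph := fun A => yl q (- A) (l0 A) 0 * (/ l0 A * (yl q (- A) (l0 A) (-1) - yl q (- A) (l0 A) 1))).
assert (HPh : forall A, continuous Ph A).
{ intros A; unfold Ph.
  apply (cR_mult (fun A => yl q (- A) (l0 A) 0)); [apply Hcy|].
  apply (cR_mult (fun A => / l0 A)); [apply cR_inv; [apply Hl0c|generalize (Hl0p A); lra]|].
  apply (cR_minus (fun A => yl q (- A) (l0 A) (-1))); apply Hcy. }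
(* At coupling $-1$ all coefficients are at least 2, whatever the positive [l], so both factors are
   positive. *)
assert (HPh1 : 0 < Ph 1).
{ destruct (yl_gap q (- (1)) (l0 1) Hq (Hl0p 1)) as [P1 P2]; [generalize (Hl0p 1); lra|].
  unfold Ph; apply Rmult_lt_0_compat; [exact P1|apply Rmult_lt_0_compat; [apply Rinv_0_lt_compat, Hl0p|exact P2]]. }
assert (Hl0z : forall A, 0 <= A -> yl q A (l0 A) 0 = 0 /\ forall n, (0 < n)%Z -> 0 < yl q A (l0 A) n).
{ intros A HA; apply is_l0_zero; [exact Hq|apply Hl0, HA]. }
assert (Hl0e : forall A, 0 <= A -> yl q A (l0 A) (-1) - yl q A (l0 A) 1 < 0).
{ intros A HA; destruct (Hl0z A HA) as [Z0 P].
  assert (E := yl_Sol q A (l0 A) Hq (Hl0p A) 0%Z); rewrite Z0, Rmult_0_r in E.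
  change (0 - 1)%Z with (-1)%Z in E; change (0 + 1)%Z with 1%Z in E; specialize (P 1%Z ltac:(lia)); lra. }
(* At $A=0$ the first factor of [Ph] is 0 and the second is negative. For small $A>0$ the first is
   positive by strict comparison, and the second still negative by continuity. *)
assert (HA1 : exists A1, 0 < A1 < 1 /\ Ph A1 < 0).
{ assert (Hc : continuous (fun A => yl q (- A) (l0 A) (-1) - yl q (- A) (l0 A) 1) 0)
    by (apply (cR_minus (fun A => yl q (- A) (l0 A) (-1))); apply Hcy).
  assert (H0 := Hl0e 0 ltac:(lra)).
  destruct (proj1 (continuous_R _ _) Hc (- (yl q 0 (l0 0) (-1) - yl q 0 (l0 0) 1)) ltac:(lra)) as (d & Hd & H).
  cbv beta in H; rewrite Ropp_0 in H.
  set (A1 := Rmin (d / 2) (/ 2)).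
  assert (B0 : 0 < A1) by (apply Rmin_case; lra).
  assert (B1 : A1 <= d / 2) by apply Rmin_l; assert (B2 : A1 <= / 2) by apply Rmin_r.
  exists A1; split; [lra|].
  specialize (H A1 ltac:(rewrite Rminus_0_r, Rabs_pos_eq; lra)); apply Rabs_lt_between in H.
  destruct (Hl0z A1 ltac:(lra)) as [Z0 P].
  assert (Y0 : 0 < yl q (- A1) (l0 A1) 0).
  { apply yl_neg_pos; [exact Hq|exact B0|apply Hl0p|exact P|lra]. }
  assert (Hi : 0 < / l0 A1) by (apply Rinv_0_lt_compat, Hl0p).
  unfold Ph.
  assert (0 < yl q (- A1) (l0 A1) 0 * (/ l0 A1 * - (yl q (- A1) (l0 A1) (-1) - yl q (- A1) (l0 A1) 1))); [|lra].
  apply Rmult_lt_0_compat; [exact Y0|apply Rmult_lt_0_compat; [exact Hi|lra]]. }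
destruct HA1 as (A1 & HA1 & HPA1).
destruct (IVT_cont Ph A1 1 ltac:(lra) (fun x _ => HPh x) HPA1 HPh1) as (A & HA & EA).
assert (HA0 : 0 < A < 1) by lra.
destruct (Hl0z A ltac:(lra)) as [Z0 P].
destruct (Hl0 A ltac:(lra)) as (HlA & Hlow & Hup).
(* The even factor at coupling [A] is negative at [l0 A] and positive at [A + 1]. Its zero [l1]
   exceeds [l0 A], so the solution there is positive on $n\ge0$. *)
set (F := fun l => yl q A l (-1) - yl q A l 1).
assert (HFc : forall l, 0 < l -> continuous F l).
{ intros l Hl; apply (cR_minus (fun l => yl q A l (-1)));
    apply (yl_continuous q (fun _ => A) (fun t => t)); try exact Hq; try apply cR_const; try apply continuous_id; exact Hl. }
assert (Hle : l0 A < A + 1).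
{ destruct (Rlt_le_dec (l0 A) (A + 1)) as [H|H]; [exact H|exfalso].
  destruct (yl_gap q A (l0 A) Hq HlA H) as [H1 _]; lra. }
destruct (IVT_cont F (l0 A) (A + 1) Hle) as (l1 & Hl1 & E1).
{ intros x Hx; apply HFc; lra. }
{ apply Hl0e; lra. }
{ apply yl_gap; lra. }
assert (G1 := Hup l1 ltac:(lra)); destruct G1 as [Hl1p G1].
exists A, (/ l0 A), (/ l1).
split; [exact HA0|]; split; [apply Rinv_0_lt_compat, HlA|]; split; [apply Rinv_0_lt_compat, Hl1p|].
rewrite !Tb_neg, !Tb_yl by (try exact Hq; assumption).
fold (F l1); rewrite E1, Z0; repeat split; try ring; [exact EA|].
(* At coupling [- A] the first factor is positive by comparison. The Wronskians at 0 and at $-1$ are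
   positive, and since $y_{-1}=y_1$ their sum is $y_0$ times the second factor. *)
set (y := yl q A l1) in *; set (y' := yl q (- A) l1).
assert (G' : forall n, (0 <= n)%Z -> 0 < y' n).
{ apply (compare_pos (el q A l1) (el q (- A) l1) y y' 0);
    try apply yl_Sol; try apply yl_to0; try apply yl_evpos; try assumption.
  intros n _; left; apply el_lt_neg; lra. }
assert (W : forall n, (-1 <= n)%Z -> 0 < wr y' y n).
{ intros n Hn; apply (wr_pos (el q A l1) (el q (- A) l1)); try apply yl_Sol; try apply yl_to0; try assumption.
  intros m Hm; split; [apply el_lt_neg; lra|split; [apply G1; lia|apply G'; lia]]. }
assert (W0 := W 0%Z ltac:(lia)); assert (W1 := W (-1)%Z ltac:(lia)); unfold wr in W0, W1.
change (0 + 1)%Z with 1%Z in W0; change (-1 + 1)%Z with 0%Z in W1.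
unfold F in E1; fold y in E1.
assert (Y0 := G1 0%Z ltac:(lia)); assert (Y0' := G' 0%Z ltac:(lia)).
assert (0 < y' (-1)%Z - y' 1%Z).
{ apply (Rmult_lt_reg_r (y 0%Z)); [exact Y0|]; rewrite Rmult_0_l.
  replace (y (-1)%Z) with (y 1%Z) in W1 by lra; lra. }
apply Rgt_not_eq; apply Rmult_lt_0_compat; [exact Y0'|apply Rmult_lt_0_compat; [apply Rinv_0_lt_compat, Hl1p|assumption]].
Qed.

(** * Analytic dependence on k and on beta *)

Lemma pb_exp a r : 0 < r -> pb r (exp (Rabs a * r)) (fun t => exp (a * t)).
Proof.
intros Hr; exists (fun n => a ^ n * / INR (fact n)); split.
- intros N.
  assert (H := is_exp_Reals (Rabs a * r)); apply is_pseries_R in H.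
  assert (Hp : forall n, 0 <= / INR (fact n) * (Rabs a * r) ^ n).
  { intros n; apply Rmult_le_pos; [left; apply Rinv_0_lt_compat, INR_fact_lt_0|].
    apply pow_le, Rmult_le_pos; [apply Rabs_pos|lra]. }
  rewrite <- (is_series_unique _ _ H).
  apply Rle_trans with (sum_n (fun n => / INR (fact n) * (Rabs a * r) ^ n) N).
  + apply sum_n_le'; intros n; right.
    assert (Hf : 0 < / INR (fact n)) by (apply Rinv_0_lt_compat, INR_fact_lt_0).
    rewrite Rabs_mult, (Rabs_pos_eq (/ _)), <- RPow_abs, Rpow_mult_distr by lra; ring.
  + apply sum_n_le_Series; [exact Hp|eexists; exact H].
- intros x _; assert (H := is_exp_Reals (a * x)); apply is_pseries_R in H; apply is_pseries_R.
  apply is_series_ext with (2 := H); intros n; rewrite Rpow_mult_distr; rring.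
Qed.

(** The recurrence bounds norms just as it bounds values, so the majorant [ubound] serves again. *)
Lemma pb_ucoef r q a0 c0 K (al c : R -> R) j : 0 < r -> 0 < q < 1 -> pb r a0 al -> pb r c0 c ->
  2 * a0 <= K * (1 - q) -> 1 + c0 <= K * (1 - q) -> pb r (ubound q K j) (fun t => ucoef q (al t) (c t) j).
Proof.
intros Hr Hq Ha Hc H1 H2.
assert (Ha0 := pb_nonneg _ _ _ Hr Ha); assert (Hc0 := pb_nonneg _ _ _ Hr Hc).
assert (HK : 0 <= K) by nra.
induction j as [| |j IH1 IH2] using nat_ind2.
- apply (pb_const r 1); rewrite Rabs_R1; unfold ubound; simpl; lra.
- apply pb_ext with (fun t => (- 2 / (1 - q)) * al t); [intros t _; rewrite ucoef_1; field; lra|].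
  apply pb_mono with r (Rabs (- 2 / (1 - q)) * a0); [lra| |apply pb_scal; [lra|exact Ha]].
  change (ubound q K 1) with K; unfold Rdiv; rewrite Rabs_mult, Rabs_inv, (Rabs_pos_eq (1 - q)), Rabs_left by lra.
  apply (Rmult_le_reg_r (1 - q)); [lra|].
  replace (- -2 * / (1 - q) * a0 * (1 - q)) with (2 * a0) by (field; lra); exact H1.
- assert (Hd := one_sub_pow q (S j) Hq); assert (Hp := pow_le_1 q j Hq).
  apply pb_ext with (fun t => (/ (1 - q ^ S (S j)) * q ^ j) *
     ((- 2 * q) * (al t * ucoef q (al t) (c t) (S j)) + ((1 + (- q ^ j) * c t) * ucoef q (al t) (c t) j))).
  { intros t _; rewrite ucoef_SS; replace (2 * j)%nat with (j + j)%nat by lia; rewrite pow_add.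
    replace (q ^ S j) with (q * q ^ j) by reflexivity; field; lra. }
  apply pb_mono with r (Rabs (/ (1 - q ^ S (S j)) * q ^ j) *
     (Rabs (- 2 * q) * (a0 * ubound q K (S j)) + (1 + Rabs (- q ^ j) * c0) * ubound q K j)); [lra| |].
  + rewrite ubound_SS, Rabs_mult, Rabs_inv, (Rabs_pos_eq (q ^ j)), (Rabs_pos_eq (1 - _)), Rabs_Ropp, (Rabs_pos_eq (q ^ j)) by lra.
    rewrite (Rabs_left (-2 * q)) by lra.
    assert (B1 := ubound_pos q K j ltac:(lra) HK); assert (B2 := ubound_pos q K (S j) ltac:(lra) HK).
    apply (Rmult_le_reg_l (1 - q ^ S (S j))); [lra|].
    match goal with |- ?l <= _ => replace l with
      (q ^ j * (2 * q * a0 * ubound q K (S j) + (1 + q ^ j * c0) * ubound q K j)) by (field; lra) end.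
    apply Rle_trans with ((1 - q) * (K * q ^ j * (ubound q K (S j) + ubound q K j))).
    * replace ((1 - q) * (K * q ^ j * (ubound q K (S j) + ubound q K j)))
        with (q ^ j * ((K * (1 - q)) * ubound q K (S j) + (K * (1 - q)) * ubound q K j)) by ring.
      apply Rmult_le_compat_l; [lra|]; apply Rplus_le_compat; apply Rmult_le_compat_r; try assumption; nra.
    * apply Rmult_le_compat_r; [|exact Hd].
      apply Rmult_le_pos; [apply Rmult_le_pos|]; lra.
  + apply pb_scal; [lra|]; apply pb_plus; [lra| |].
    * apply pb_scal; [lra|]; apply pb_mult; [lra|exact Ha|exact IH2].
    * apply pb_mult; [lra| |exact IH1]; apply pb_plus; [lra|apply pb_const; rewrite Rabs_R1; lra|].
      apply pb_scal; [lra|exact Hc].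
Qed.

Lemma pb_Ufun r q a0 c0 z0 K (al c z : R -> R) : 0 < r -> 0 < q < 1 -> pb r a0 al -> pb r c0 c -> pb r z0 z ->
  0 < z0 -> 2 * a0 <= K * (1 - q) -> 1 + c0 <= K * (1 - q) ->
  pb r (Series (fun j => Rabs (ubound q K j) * z0 ^ j)) (fun t => Ufun q (al t) (c t) (z t)).
Proof.
intros Hr Hq Ha Hc Hz Hz0 H1 H2.
assert (Ha0 := pb_nonneg _ _ _ Hr Ha); assert (Hc0 := pb_nonneg _ _ _ Hr Hc).
assert (HK : 0 <= K) by nra.
unfold Ufun, PSeries; apply (pb_Series r (fun j => Rabs (ubound q K j) * z0 ^ j)
  (fun j t => ucoef q (al t) (c t) j * z t ^ j)); [exact Hr| |].
- intros j; apply pb_mult; [lra| |apply pb_pow; [lra|exact Hz]].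
  rewrite Rabs_pos_eq by (apply ubound_pos; lra).
  apply (pb_ucoef r q a0 c0 K); assumption.
- apply superexp_series; [apply ubound_superexp; assumption|exact Hz0].
Qed.

Lemma pb_Dco r q a0 c0 K (al c : R -> R) j : 0 < r -> 0 < q < 1 -> pb r a0 al -> pb r c0 c ->
  2 * a0 <= K * (1 - q) -> 1 + c0 <= K * (1 - q) -> exists M, pb r M (fun t => Dco q (al t) (c t) j).
Proof.
intros Hr Hq Ha Hc H1 H2.
assert (Ha0 := pb_nonneg _ _ _ Hr Ha); assert (Hc0 := pb_nonneg _ _ _ Hr Hc).
assert (HK : 0 <= K) by nra.
assert (Hm := ubound_superexp q K Hq HK).
destruct (superexp_half _ 1 Hm) as (M & HM0 & HM).
assert (HMb : forall n, ubound q K n <= M * (/ 2) ^ n).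
{ intros n; specialize (HM n); rewrite pow1, Rmult_1_r in HM.
  rewrite Rabs_pos_eq in HM by (apply ubound_pos; lra); exact HM. }
assert (Hh : forall n, 0 <= (/ 2) ^ n <= 1).
{ intros n; split; [apply pow_le; lra|rewrite <- (pow1 n); apply pow_incr; lra]. }
exists (Series (fun b => M * M * (1 + c0) * (/ 2) ^ b)).
unfold Dco; apply (pb_Series r _ (fun b t => Dterm q (al t) (c t) j b)); [exact Hr| |].
- intros b; unfold Dterm.
  apply pb_ext with (fun t => q ^ (b + j) * ((ucoef q (al t) (c t) (b + j) * ucoef q (al t) (c t) b) * (1 + (- q ^ (2 * b + j)) * c t))).
  { intros t _; ring. }
  apply pb_mono with r (Rabs (q ^ (b + j)) * ((ubound q K (b + j) * ubound q K b) * (1 + Rabs (- q ^ (2 * b + j)) * c0))); [lra| |].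
  + assert (P1 := pow_le_1 q (b + j) Hq); assert (P2 := pow_le_1 q (2 * b + j) Hq).
    rewrite Rabs_Ropp, (Rabs_pos_eq (q ^ (b + j))), (Rabs_pos_eq (q ^ (2 * b + j))) by lra.
    assert (U1 := ubound_pos q K (b + j) ltac:(lra) HK); assert (U2 := ubound_pos q K b ltac:(lra) HK).
    assert (V1 := HMb (b + j)%nat); assert (V2 := HMb b).
    assert (W : ubound q K (b + j) * ubound q K b <= M * (M * (/ 2) ^ b)).
    { apply Rmult_le_compat; try assumption; eapply Rle_trans; [exact V1|].
      destruct (Hh (b + j)%nat); rewrite <- (Rmult_1_r M) at 2; apply Rmult_le_compat_l; assumption. }
    assert (W2 : 0 <= ubound q K (b + j) * ubound q K b) by (apply Rmult_le_pos; assumption).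
    apply Rle_trans with (1 * ((M * (M * (/ 2) ^ b)) * (1 + c0))); [|right; ring].
    apply Rmult_le_compat; [lra|apply Rmult_le_pos; [assumption|nra]|lra|].
    apply Rmult_le_compat; [assumption|nra|exact W|nra].
  + apply pb_scal; [lra|]; apply pb_mult; [lra| |].
    * apply pb_mult; [lra| |]; apply (pb_ucoef r q a0 c0 K); assumption.
    * apply pb_plus; [lra|apply pb_const; rewrite Rabs_R1; lra|apply pb_scal; [lra|exact Hc]].
- apply (ex_series_scal (V := R_NormedModule)), ex_series_geom; rewrite Rabs_pos_eq; lra.
Qed.

Lemma pb_PSeries r z0 (a : nat -> R) (z : R -> R) : 0 < r -> superexp a -> 0 < z0 -> pb r z0 z ->
  exists M, pb r M (fun t => PSeries a (z t)).
Proof.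
intros Hr Ha Hz0 Hz; exists (Series (fun j => Rabs (a j) * z0 ^ j)).
apply (pb_Series r (fun j => Rabs (a j) * z0 ^ j) (fun j t => a j * z t ^ j)); [exact Hr| |apply superexp_series; assumption].
intros j; apply pb_scal; [lra|apply pb_pow; [lra|exact Hz]].
Qed.

Definition Th (T x y k : R) : R := Theta (qT T) x y (zk k).

Lemma zk_plus k t : zk (k + t) = zk k * exp (- PI * t).
Proof. unfold zk; rewrite <- exp_plus; f_equal; ring. Qed.

Lemma zk_plus_inv k t : / zk (k + t) = / zk k * exp (PI * t).
Proof. unfold zk; rewrite <- !exp_Ropp, <- exp_plus; f_equal; ring. Qed.

Lemma pb_Th T x y k r : 0 < T -> 0 < r -> exists M, pb r M (fun t => Th T x y (k + t)).
Proof.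
intros HT Hr; assert (Hq := qT_bounds T HT); unfold Th, Theta.
assert (Hs := dseq_superexp (qT T) x y Hq).
assert (Hzk := zk_pos k).
destruct (pb_PSeries r (Rabs (zk k) * exp (Rabs (- PI) * r)) _ (fun t => zk k * exp (- PI * t)) Hr Hs) as [M1 H1].
{ rewrite Rabs_pos_eq by lra; apply Rmult_lt_0_compat; [exact Hzk|apply exp_pos]. }
{ apply pb_scal; [lra|apply pb_exp, Hr]. }
destruct (pb_PSeries r (Rabs (/ qT T * / zk k) * exp (Rabs PI * r)) _ (fun t => (/ qT T * / zk k) * exp (PI * t)) Hr Hs) as [M2 H2].
{ apply Rmult_lt_0_compat; [|apply exp_pos].
  apply Rabs_pos_lt, Rmult_integral_contrapositive; split; apply Rinv_neq_0_compat; lra. }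
{ apply pb_scal; [lra|apply pb_exp, Hr]. }
exists (M1 + M2 + Rabs (- x)).
apply pb_ext with (fun t => PSeries (dseq (qT T) x y) (zk k * exp (- PI * t)) +
   PSeries (dseq (qT T) x y) ((/ qT T * / zk k) * exp (PI * t)) + - x).
- intros t _; rewrite zk_plus_inv, zk_plus, Rmult_assoc; ring.
- apply pb_plus; [lra|apply pb_plus; [lra| |]; assumption|apply pb_const; lra].
Qed.

(** * Derivatives along exponential paths *)

Section Path.
Variables (q A be0 zt0 a b : R).
Hypothesis (Hq : 0 < q < 1).
Hypothesis (Hbe0 : be0 <> 0).
Hypothesis (Hzt0 : 0 < zt0).

Let be t := be0 * exp (a * t).
Let zt t := zt0 * exp (b * t).
Let y0 := yplus q A be0 zt0.

(* Derivative of the coefficient [ecoef] along the path, at the origin. *)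
Definition edot (n : Z) : R := ((b - a) * qz q zt0 n - (a + b) * / qz q zt0 n) / be0.

Lemma path_be_neq0 t : be t <> 0.
Proof. apply Rmult_integral_contrapositive; split; [exact Hbe0|apply Rgt_not_eq, exp_pos]. Qed.

Lemma path_zt_pos t : 0 < zt t.
Proof. apply Rmult_lt_0_compat; [exact Hzt0|apply exp_pos]. Qed.

Lemma path_0 : be 0 = be0 /\ zt 0 = zt0.
Proof. unfold be, zt; rewrite !Rmult_0_r, exp_0; lra. Qed.

Lemma path_qz t n : qz q (zt t) n = qz q zt0 n * exp (b * t).
Proof. unfold qz, zt; ring. Qed.

(** Exponential paths are chosen so that the prefactor merely acquires an exponential in [t]; a
    translation of [k] is such a path in [zt]. *)
Lemma path_gfac t n : gfac q (be t) (zt t) n = gfac q be0 zt0 n * exp (IZR n * (a + b) * t).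
Proof.
unfold gfac, be, zt.
replace (be0 * exp (a * t) * (zt0 * exp (b * t))) with (be0 * zt0 * exp ((a + b) * t))
  by (rewrite Rmult_plus_distr_r, exp_plus; ring).
rewrite powerRZ_mult, powerRZ_exp.
replace (IZR n * ((a + b) * t)) with (IZR n * (a + b) * t) by ring; ring.
Qed.

Lemma path_U n : exists r M, 0 < r /\ pb r M (fun t => Ube q A (be t) (qz q (zt t) n)).
Proof.
set (B := Rabs be0 * exp (Rabs a * 1)).
assert (HB : pb 1 B be) by (apply pb_scal; [lra|apply pb_exp; lra]).
assert (HB0 : 0 <= B) by (apply (pb_nonneg 1 B be); [lra|exact HB]).
set (a0 := Rabs A * B); set (c0 := Rabs q * B ^ 2).
assert (Ha0 : 0 <= a0) by (apply Rmult_le_pos; [apply Rabs_pos|exact HB0]).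
assert (Hc0 : 0 <= c0) by (apply Rmult_le_pos; [apply Rabs_pos|apply pow2_ge_0]).
set (K := (2 * a0 + 1 + c0) / (1 - q)).
assert (EK : K * (1 - q) = 2 * a0 + 1 + c0) by (unfold K; field; lra).
exists 1; eexists; split; [lra|].
apply (pb_Ufun 1 q a0 c0 (Rabs (qz q zt0 n) * exp (Rabs b * 1)) K (fun t => A * be t) (fun t => q * be t ^ 2) (fun t => qz q (zt t) n));
  try exact Hq; try lra.
- apply pb_scal; [lra|exact HB].
- apply pb_scal; [lra|apply pb_pow; [lra|exact HB]].
- apply pb_ext with (fun t => qz q zt0 n * exp (b * t)); [intros; symmetry; apply path_qz|].
  apply pb_scal; [lra|apply pb_exp; lra].
- apply Rmult_lt_0_compat; [apply Rabs_pos_lt, Rgt_not_eq, qz_pos; lra|apply exp_pos].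
Qed.

(** For $n\ge0$ the arguments stay in one disc, so Cauchy's estimate does not depend on [n]. *)
Lemma path_U_Derive_bound : exists M, forall n : nat,
  Rabs (Derive (fun t => Ube q A (be t) (qz q (zt t) (Z.of_nat n + 1))) 0) <= M.
Proof.
set (B := Rabs be0 * exp (Rabs a * 1)).
assert (HB : pb 1 B be) by (apply pb_scal; [lra|apply pb_exp; lra]).
assert (HB0 : 0 <= B) by (apply (pb_nonneg 1 B be); [lra|exact HB]).
set (a0 := Rabs A * B); set (c0 := Rabs q * B ^ 2).
assert (Ha0 : 0 <= a0) by (apply Rmult_le_pos; [apply Rabs_pos|exact HB0]).
assert (Hc0 : 0 <= c0) by (apply Rmult_le_pos; [apply Rabs_pos|apply pow2_ge_0]).
set (K := (2 * a0 + 1 + c0) / (1 - q)).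
assert (EK : K * (1 - q) = 2 * a0 + 1 + c0) by (unfold K; field; lra).
set (z0 := zt0 * exp (Rabs b * 1)).
assert (Hz0 : 0 < z0) by (apply Rmult_lt_0_compat; [exact Hzt0|apply exp_pos]).
exists (Series (fun j => Rabs (ubound q K j) * z0 ^ j) / 1); intros n.
apply pb_Derive_bound; [lra|].
apply (pb_Ufun 1 q a0 c0 z0 K (fun t => A * be t) (fun t => q * be t ^ 2) (fun t => qz q (zt t) (Z.of_nat n + 1)));
  try exact Hq; try lra.
- apply pb_scal; [lra|exact HB].
- apply pb_scal; [lra|apply pb_pow; [lra|exact HB]].
- apply pb_ext with (fun t => qz q zt0 (Z.of_nat n + 1) * exp (b * t)); [intros; symmetry; apply path_qz|].
  assert (Hn := pow_le_1 q n Hq).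
  apply pb_mono with 1 (Rabs (qz q zt0 (Z.of_nat n + 1)) * exp (Rabs b * 1)); [lra| |apply pb_scal; [lra|apply pb_exp; lra]].
  apply Rmult_le_compat_r; [left; apply exp_pos|].
  rewrite qz_succ, qz_nat by lra; rewrite Rabs_pos_eq by (apply Rmult_le_pos; [lra|apply Rmult_le_pos; lra]).
  rewrite <- Rmult_assoc; rewrite <- (Rmult_1_l zt0) at 2; apply Rmult_le_compat_r; nra.
Qed.

Definition yt (n : Z) (t : R) : R := yplus q A (be t) (zt t) n.

Lemma is_derive_exp_lin c t : is_derive (fun t => exp (c * t)) t (c * exp (c * t)).
Proof. auto_derive; [trivial|ring]. Qed.

Lemma Derive_exp_lin c (t : R) : Derive (fun t : R => exp (c * t)) t = c * exp (c * t).
Proof. apply is_derive_unique, is_derive_exp_lin. Qed.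

Lemma yt_ex_derive n : ex_derive (yt n) 0.
Proof.
destruct (path_U (n + 1)) as (r & M & Hr & HU).
apply ex_derive_ext with (fun t => gfac q be0 zt0 n * exp (IZR n * (a + b) * t) * Ube q A (be t) (qz q (zt t) (n + 1))).
- intros t; unfold yt, yplus; rewrite path_gfac; reflexivity.
- apply ex_derive_mult.
  + apply (ex_derive_scal (fun t => exp (IZR n * (a + b) * t))); eexists; apply is_derive_exp_lin.
  + apply (pb_ex_derive r M); [exact HU|rewrite Rabs_R0; exact Hr].
Qed.

Definition ydot (n : Z) : R := Derive (yt n) 0.

Lemma ydot_eq n : ydot n = gfac q be0 zt0 n * (IZR n * (a + b) * Ube q A be0 (qz q zt0 (n + 1))
   + Derive (fun t => Ube q A (be t) (qz q (zt t) (n + 1))) 0).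
Proof.
destruct (path_U (n + 1)) as (r & M & Hr & HU).
unfold ydot.
rewrite (Derive_ext _ (fun t => (gfac q be0 zt0 n * exp (IZR n * (a + b) * t)) * Ube q A (be t) (qz q (zt t) (n + 1))))
  by (intros t; unfold yt, yplus; rewrite path_gfac; reflexivity).
rewrite Derive_mult.
- rewrite Derive_scal, Derive_exp_lin.
  destruct path_0 as [-> ->]; rewrite Rmult_0_r, exp_0; ring.
- apply (ex_derive_scal (fun t => exp (IZR n * (a + b) * t))); eexists; apply is_derive_exp_lin.
- apply (pb_ex_derive r M); [exact HU|rewrite Rabs_R0; exact Hr].
Qed.

(** Differentiating the prefactor costs a factor [n], and the derivative of the series factor is
    bounded. The decay of [gfac], used at the rate $2^{-n}$ only, beats both. *)
Lemma ydot_to0 : to0 ydot.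
Proof.
destruct (Ube_bounded q A be0 zt0 Hq Hzt0) as (M & HM0 & HM).
destruct path_U_Derive_bound as (M' & HM').
destruct (gfac_superexp q be0 zt0 Hq Hbe0 Hzt0 2 ltac:(lra)) as [G HG].
assert (HM'0 : 0 <= M') by (eapply Rle_trans; [apply Rabs_pos|apply (HM' 0%nat)]).
assert (HG0 : 0 <= G).
{ specialize (HG 0%nat); eapply Rle_trans; [|exact HG]; apply Rmult_le_pos; [apply Rabs_pos|apply pow_le; lra]. }
unfold to0; apply is_lim_seq_abs_0.
apply (is_lim_seq_le_le (fun _ => 0) _ (fun n => (G * Rabs (a + b) * M) * (INR n * (/ 2) ^ n) + G * M' * (/ 2) ^ n)).
- intros n; split; [apply Rabs_pos|].
  rewrite ydot_eq, Rabs_mult.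
  assert (H2 : 0 < 2 ^ n) by (apply pow_lt; lra).
  assert (B1 : Rabs (gfac q be0 zt0 (Z.of_nat n)) <= G * (/ 2) ^ n).
  { rewrite pow_inv; apply (Rmult_le_reg_r (2 ^ n)); [exact H2|].
    replace (G * / 2 ^ n * 2 ^ n) with G by (field; lra); apply HG. }
  assert (B2 : Rabs (IZR (Z.of_nat n) * (a + b) * Ube q A be0 (qz q zt0 (Z.of_nat n + 1))
   + Derive (fun t => Ube q A (be t) (qz q (zt t) (Z.of_nat n + 1))) 0) <= INR n * Rabs (a + b) * M + M').
  { eapply Rle_trans; [apply Rabs_triang|]; apply Rplus_le_compat; [|apply HM'].
    rewrite !Rabs_mult, <- INR_IZR_INZ, (Rabs_pos_eq (INR n)) by apply pos_INR.
    apply Rmult_le_compat_l; [apply Rmult_le_pos; [apply pos_INR|apply Rabs_pos]|apply HM]. }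
  apply Rle_trans with ((G * (/ 2) ^ n) * (INR n * Rabs (a + b) * M + M')).
  + apply Rmult_le_compat; try apply Rabs_pos; assumption.
  + right; ring.
- apply is_lim_seq_const.
- replace (Finite 0) with (Finite (G * Rabs (a + b) * M * 0 + G * M' * 0)) by (f_equal; ring).
  apply is_lim_seq_plus'.
  + apply (is_lim_seq_scal_l _ _ 0).
    apply (is_lim_seq_le_le (fun _ => 0) _ (fun n => 2 * (3 / 4) ^ n)).
    * intros n; split; [apply Rmult_le_pos; [apply pos_INR|apply pow_le; lra]|].
      assert (Hb : INR n <= 2 * (3 / 2) ^ n).
      { assert (H := poly n (/ 2) ltac:(lra)); replace (1 + / 2) with (3 / 2) in H by field.
        assert (H3 := pos_INR n); lra. }
      replace (3 / 4) with (3 / 2 * / 2) by field; rewrite Rpow_mult_distr.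
      rewrite <- Rmult_assoc; apply Rmult_le_compat_r; [apply pow_le; lra|exact Hb].
    * apply is_lim_seq_const.
    * replace (Finite 0) with (Rbar_mult 2 0) by (simpl; f_equal; ring).
      apply is_lim_seq_scal_l, is_lim_seq_geom; rewrite Rabs_pos_eq; lra.
  + apply (is_lim_seq_scal_l _ _ 0), is_lim_seq_geom; rewrite Rabs_pos_eq; lra.
Qed.

Lemma path_ecoef_derive n : is_derive (fun t => ecoef q A (be t) (zt t) n) 0 (edot n).
Proof.
assert (Hz := qz_pos q zt0 n ltac:(lra) Hzt0).
apply is_derive_ext with (fun t => (qz q zt0 n * exp (b * t) + / (qz q zt0 n * exp (b * t))) * / (be0 * exp (a * t)) - 2 * A).
- intros t; unfold ecoef; rewrite path_qz; reflexivity.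
- assert (H1 := exp_pos (b * 0)); assert (H2 := exp_pos (a * 0)).
  auto_derive.
  + repeat split; try (apply Rmult_integral_contrapositive; split; lra).
  + rewrite !Rmult_0_r, exp_0; unfold edot; field; lra.
Qed.

Lemma path_ecoef_Derive n : Derive (fun t : R => ecoef q A (be t) (zt t) n) 0 = edot n.
Proof. apply is_derive_unique, path_ecoef_derive. Qed.

Lemma ydot_rec n : ydot (n - 1) + ydot (n + 1) = edot n * y0 n + ecoef q A be0 zt0 n * ydot n.
Proof.
assert (E : forall t, yt (n - 1) t + yt (n + 1) t = ecoef q A (be t) (zt t) n * yt n t).
{ intros t; unfold yt; apply yplus_Sol; [exact Hq|apply path_be_neq0|apply path_zt_pos]. }
unfold ydot; rewrite <- Derive_plus by apply yt_ex_derive.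
rewrite (Derive_ext _ _ _ E), Derive_mult; [|eexists; apply path_ecoef_derive|apply yt_ex_derive].
rewrite path_ecoef_Derive.
unfold yt; destruct path_0 as [-> ->]; reflexivity.
Qed.

Definition wdot (n : Z) : R := ydot n * y0 (n + 1)%Z - ydot (n + 1)%Z * y0 n.

Lemma wdot_step n : wdot (n - 1) = wdot n + edot n * y0 n ^ 2.
Proof.
unfold wdot; assert (E1 := ydot_rec n); assert (E2 := yplus_Sol q A be0 zt0 Hq Hbe0 Hzt0 n).
fold y0 in E2; replace (n - 1 + 1)%Z with n by lia.
replace (ydot (n - 1)%Z) with (edot n * y0 n + ecoef q A be0 zt0 n * ydot n - ydot (n + 1)%Z) by lra.
replace (y0 (n - 1)%Z) with (ecoef q A be0 zt0 n * y0 n - y0 (n + 1)%Z) by lra; ring.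
Qed.

(** Summing [wdot_step] from $+\infty$ writes [wdot n] as the sum of [edot m * y0 m ^ 2] over $m>n$.
    It cannot vanish, since [y0] would be zero at two consecutive indices and hence everywhere. *)
Lemma wdot_sign s : (forall n, 0 < s * edot n) -> forall n, 0 < s * wdot n.
Proof.
intros Hs n.
assert (Hy0 : to0 y0) by (apply yplus_to0; assumption).
assert (L : to0 (fun m => s * wdot m)).
{ unfold to0; replace (Finite 0) with (Rbar_mult s (0 * 0 - 0 * 0)) by (simpl; f_equal; ring).
  apply is_lim_seq_scal_l, is_lim_seq_minus'; apply is_lim_seq_mult';
    try exact ydot_to0; try exact Hy0; [apply (to0_shift y0 1), Hy0|apply (to0_shift ydot 1), ydot_to0]. }
assert (St : forall m, s * wdot (m - 1) = s * wdot m + s * edot m * y0 m ^ 2) by (intros m; rewrite wdot_step; ring).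
assert (Hsq : forall m, 0 <= s * edot m * y0 m ^ 2).
{ intros m; apply Rmult_le_pos; [left; apply Hs|apply pow2_ge_0]. }
assert (H2 : 0 <= s * wdot (n + 2)).
{ apply (nonneg_of_decr_lim (fun m => s * wdot m)); [exact L|]; intros m _; rewrite St; generalize (Hsq m); lra. }
assert (S1 := St (n + 1)%Z); assert (S2 := St (n + 2)%Z).
replace (n + 1 - 1)%Z with n in S1 by lia; replace (n + 2 - 1)%Z with (n + 1)%Z in S2 by lia.
assert (Q1 := Hsq (n + 1)%Z); assert (Q2 := Hsq (n + 2)%Z).
destruct (Rle_lt_dec (s * wdot n) 0) as [Hle|Hlt]; [exfalso|exact Hlt].
assert (Hz : forall m, s * edot m * y0 m ^ 2 = 0 -> y0 m = 0).
{ intros m Hm; apply Rmult_integral in Hm; destruct Hm as [Hm|Hm]; [specialize (Hs m); lra|nra]. }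
assert (Z1 : y0 (n + 1)%Z = 0) by (apply Hz; lra).
assert (Z2 : y0 (n + 1 + 1)%Z = 0) by (replace (n + 1 + 1)%Z with (n + 2)%Z by lia; apply Hz; lra).
destruct (yplus_nonzero q A be0 zt0 Hq Hbe0 Hzt0) as [m Hm].
apply Hm, (Sol_zero (ecoef q A be0 zt0) y0 (n + 1)); [apply yplus_Sol; assumption|exact Z1|exact Z2].
Qed.
End Path.

(** * The zero set of the Wronskian and its transversality *)

Definition Dbe (T A : R) (i : nat) (be : R) : R := Dco (qT T) (A * be) (qT T * be ^ 2) i.

(** The Wronskian with [k] and [be] separated, in the two-term shape that [pb_implicit] asks for. *)
Definition Pfun (T A k be : R) : R := Dbe T A 0 be * Th T 1 0 k + Dbe T A 1 be * Th T 0 1 k.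

Lemma Tb_Pfun T A be k : 0 < T -> Tb (qT T) A be (zk k) = Pfun T A k be.
Proof.
intros HT; assert (Hq := qT_bounds T HT); unfold Tb, Pfun.
rewrite That_Theta by (try exact Hq; generalize (zk_pos k); lra).
rewrite Theta_lin by exact Hq; reflexivity.
Qed.

Lemma Dbe_neg T A i be : Dbe T A i (- be) = (-1) ^ i * Dbe T A i be.
Proof.
unfold Dbe; replace (A * - be) with (- (A * be)) by ring; rewrite Dco_neg.
replace ((- be) ^ 2) with (be ^ 2) by ring; reflexivity.
Qed.

Lemma pb_Dbe T A i be0 r : 0 < T -> 0 < r -> exists M, pb r M (fun y => Dbe T A i (be0 + y)).
Proof.
intros HT Hr; assert (Hq := qT_bounds T HT); unfold Dbe.
set (B := Rabs be0 + r).
assert (HB : pb r B (fun y => be0 + y)) by (apply pb_plus; [lra|apply pb_const; lra|apply pb_id; lra]).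
assert (HB0 : 0 <= B) by (unfold B; generalize (Rabs_pos be0); lra).
set (a0 := Rabs A * B); set (c0 := Rabs (qT T) * B ^ 2).
assert (Ha0 : 0 <= a0) by (apply Rmult_le_pos; [apply Rabs_pos|exact HB0]).
assert (Hc0 : 0 <= c0) by (apply Rmult_le_pos; [apply Rabs_pos|apply pow2_ge_0]).
set (K := (2 * a0 + 1 + c0) / (1 - qT T)).
assert (EK : K * (1 - qT T) = 2 * a0 + 1 + c0) by (unfold K; field; lra).
apply (pb_Dco r (qT T) a0 c0 K (fun y => A * (be0 + y)) (fun y => qT T * (be0 + y) ^ 2)); try assumption; try lra.
- apply pb_scal; [lra|exact HB].
- apply pb_scal; [lra|apply pb_pow; [lra|exact HB]].
Qed.

Lemma is_derive_Rmult (f g : R -> R) (x df dg : R) : is_derive f x df -> is_derive g x dg ->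
  is_derive (fun t => f t * g t) x (df * g x + f x * dg).
Proof. intros Hf Hg; exact (is_derive_mult f g x df dg Hf Hg Rmult_comm). Qed.

Lemma is_derive_Rplus (f g : R -> R) (x df dg : R) : is_derive f x df -> is_derive g x dg ->
  is_derive (fun t => f t + g t) x (df + dg).
Proof. intros Hf Hg; exact (is_derive_plus f g x df dg Hf Hg). Qed.

Lemma is_derive_Rminus (f g : R -> R) (x df dg : R) : is_derive f x df -> is_derive g x dg ->
  is_derive (fun t => f t - g t) x (df - dg).
Proof. intros Hf Hg; exact (is_derive_minus f g x df dg Hf Hg). Qed.

Lemma ex_derive_shift (f : R -> R) x : ex_derive (fun t => f (x + t)) 0 -> ex_derive f x.
Proof.
intros [l Hl]; exists l.
apply is_derive_ext with (fun t => (fun t => f (x + t)) (t - x)).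
- intros t; cbv beta; f_equal; ring.
- evar_last.
  + apply (is_derive_comp (fun t => f (x + t)) (fun t => t - x) x l 1).
    * replace (x - x) with 0 by ring; exact Hl.
    * auto_derive; [trivial|ring].
  + unfold scal; simpl; unfold mult; simpl; rring.
Qed.

Lemma Dbe_ex_derive T A i be : 0 < T -> ex_derive (Dbe T A i) be.
Proof.
intros HT; destruct (pb_Dbe T A i be 1 HT Rlt_0_1) as [M HM].
apply ex_derive_shift, (pb_ex_derive 1 M); [exact HM|rewrite Rabs_R0; lra].
Qed.

Lemma Th_ex_derive T x y k : 0 < T -> ex_derive (Th T x y) k.
Proof.
intros HT; destruct (pb_Th T x y k 1 HT Rlt_0_1) as [M HM].
apply ex_derive_shift, (pb_ex_derive 1 M); [exact HM|rewrite Rabs_R0; lra].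
Qed.

Definition Pbe (T A k be : R) : R := Derive (Dbe T A 0) be * Th T 1 0 k + Derive (Dbe T A 1) be * Th T 0 1 k.
Definition Pk (T A k be : R) : R := Dbe T A 0 be * Derive (Th T 1 0) k + Dbe T A 1 be * Derive (Th T 0 1) k.

Lemma Pfun_path_derive T A (be kk : R -> R) t db dk : 0 < T -> is_derive be t db -> is_derive kk t dk ->
  is_derive (fun t => Pfun T A (kk t) (be t)) t (db * Pbe T A (kk t) (be t) + dk * Pk T A (kk t) (be t)).
Proof.
intros HT Hb Hk.
assert (HD : forall i, is_derive (fun t => Dbe T A i (be t)) t (db * Derive (Dbe T A i) (be t))).
{ intros i; apply (is_derive_comp (Dbe T A i) be); [apply Derive_correct, Dbe_ex_derive, HT|exact Hb]. }
assert (HTh : forall x y, is_derive (fun t => Th T x y (kk t)) t (dk * Derive (Th T x y) (kk t))).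
{ intros x y; apply (is_derive_comp (Th T x y) kk); [apply Derive_correct, Th_ex_derive, HT|exact Hk]. }
unfold Pfun.
replace (db * Pbe T A (kk t) (be t) + dk * Pk T A (kk t) (be t)) with
  ((db * Derive (Dbe T A 0) (be t) * Th T 1 0 (kk t) + Dbe T A 0 (be t) * (dk * Derive (Th T 1 0) (kk t)))
   + (db * Derive (Dbe T A 1) (be t) * Th T 0 1 (kk t) + Dbe T A 1 (be t) * (dk * Derive (Th T 0 1) (kk t))))
  by (unfold Pbe, Pk; ring).
apply (is_derive_Rplus (fun t => Dbe T A 0 (be t) * Th T 1 0 (kk t)) (fun t => Dbe T A 1 (be t) * Th T 0 1 (kk t))).
- apply (is_derive_Rmult (fun t => Dbe T A 0 (be t)) (fun t => Th T 1 0 (kk t))); [apply HD|apply HTh].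
- apply (is_derive_Rmult (fun t => Dbe T A 1 (be t)) (fun t => Th T 0 1 (kk t))); [apply HD|apply HTh].
Qed.

Section Transversal.
Variables (T A k0 be0 : R).
Hypothesis (HT : 0 < T).
Hypothesis (Hb : be0 <> 0).
Hypothesis (HP : Pfun T A k0 be0 = 0).

Let q := qT T.
Let zt0 := zk k0.

(** At a zero the two decaying solutions are proportional, and the derivative of their Wronskian
    splits into one [wdot] from each end, both of the sign of [s]. The factor [kap] is exposed
    because its unknown sign has to cancel between two paths. *)
Lemma path_derive_sign a s :
  (forall n, 0 < s * edot q be0 zt0 a (- PI) n) -> (forall n, 0 < s * edot q be0 (/ zt0) a PI n) ->
  exists kap, kap <> 0 /\ (forall n, yminus q A be0 zt0 n = kap * yplus q A be0 zt0 n) /\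
    0 < s * kap * (zt0 / be0) * (a * be0 * Pbe T A k0 be0 + Pk T A k0 be0).
Proof.
intros Hs Hs'.
assert (Hq : 0 < q < 1) by (apply qT_bounds, HT).
assert (Hz : 0 < zt0) by apply zk_pos.
assert (Hz' : 0 < / zt0) by (apply Rinv_0_lt_compat, Hz).
assert (HTb : Tb q A be0 zt0 = 0) by (unfold q, zt0; rewrite Tb_Pfun; assumption).
destruct (Tb_zero_prop q A be0 zt0 Hq Hb Hz HTb) as (kap & Hkap & Ek).
exists kap; split; [exact Hkap|split; [exact Ek|]].
set (be := fun t => be0 * exp (a * t)).
set (y := yt q A be0 zt0 a (- PI)); set (y' := yt q A be0 (/ zt0) a PI).
set (yd := ydot q A be0 zt0 a (- PI)); set (yd' := ydot q A be0 (/ zt0) a PI).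
assert (Hbe0 : be 0 = be0) by (unfold be; rewrite Rmult_0_r, exp_0; ring).
assert (Ey0 : forall n, y n 0 = yplus q A be0 zt0 n).
{ intros n; unfold y, yt; rewrite !Rmult_0_r, exp_0, !Rmult_1_r; reflexivity. }
assert (Ey0' : forall n, y' n 0 = yplus q A be0 (/ zt0) n).
{ intros n; unfold y', yt; rewrite !Rmult_0_r, exp_0, !Rmult_1_r; reflexivity. }
assert (Ek' : forall n, y' (- n)%Z 0 = kap * y n 0).
{ intros n; rewrite Ey0, Ey0', <- Ek; reflexivity. }
(* The left solution is a reflected [yplus] at [/ zt], which moves at rate [PI] while [zt] moves at
   rate [- PI]. *)
set (W := fun t => y 0%Z t * y' (-1)%Z t - y 1%Z t * y' 0%Z t).
assert (EW : forall t, W t = (zt0 * exp (- PI * t)) * / be t * Pfun T A (k0 + t) (be t)).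
{ intros t; unfold W.
  assert (Hbt : be t <> 0) by (apply path_be_neq0, Hb).
  assert (H := wr_That q A (be t) (zk (k0 + t)) Hq Hbt (zk_pos _)).
  fold (Tb q A (be t) (zk (k0 + t))) in H; unfold q in H at 3; rewrite Tb_Pfun in H by exact HT.
  unfold wr, yminus, refl in H; rewrite zk_plus_inv, zk_plus in H; fold zt0 in H.
  exact H. }
assert (Dy : forall n, is_derive (y n) 0 (yd n)) by (intros n; apply Derive_correct, yt_ex_derive; assumption).
assert (Dy' : forall n, is_derive (y' n) 0 (yd' n)) by (intros n; apply Derive_correct, yt_ex_derive; assumption).
assert (DW1 : is_derive W 0 (yd 0%Z * y' (-1)%Z 0 + y 0%Z 0 * yd' (-1)%Z - (yd 1%Z * y' 0%Z 0 + y 1%Z 0 * yd' 0%Z))).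
{ apply (is_derive_Rminus (fun t => y 0%Z t * y' (-1)%Z t) (fun t => y 1%Z t * y' 0%Z t)).
  - exact (is_derive_Rmult (y 0%Z) (y' (-1)%Z) 0 _ _ (Dy _) (Dy' _)).
  - exact (is_derive_Rmult (y 1%Z) (y' 0%Z) 0 _ _ (Dy _) (Dy' _)). }
assert (Dbe1 : is_derive be 0 (a * be0)).
{ unfold be; auto_derive; [trivial|]; rewrite Rmult_0_r, exp_0; ring. }
assert (Dk1 : is_derive (fun t => k0 + t) 0 1) by (auto_derive; [trivial|ring]).
assert (DP := Pfun_path_derive T A be (fun t => k0 + t) 0 (a * be0) 1 HT Dbe1 Dk1).
rewrite Hbe0, Rplus_0_r in DP.
set (D := a * be0 * Pbe T A k0 be0 + 1 * Pk T A k0 be0) in *.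
assert (Hfac : exists c, is_derive (fun t => (zt0 * exp (- PI * t)) * / be t) 0 c).
{ eexists; unfold be; auto_derive; [|reflexivity].
  apply Rmult_integral_contrapositive; split; [exact Hb|apply Rgt_not_eq, exp_pos]. }
destruct Hfac as [c Hfac].
assert (DW2 : is_derive W 0 (zt0 / be0 * D)).
{ apply is_derive_ext with (fun t => (zt0 * exp (- PI * t)) * / be t * Pfun T A (k0 + t) (be t)).
  - intros t; symmetry; apply EW.
  - evar_last.
    + exact (is_derive_Rmult (fun t => (zt0 * exp (- PI * t)) * / be t) (fun t => Pfun T A (k0 + t) (be t)) 0 _ _ Hfac DP).
    + cbv beta; rewrite Hbe0, Rplus_0_r, HP, !Rmult_0_r, Rplus_0_l, exp_0; unfold Rdiv; rring. }
assert (E : zt0 / be0 * D = kap * wdot q A be0 zt0 a (- PI) 0 + / kap * wdot q A be0 (/ zt0) a PI (-1)).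
{ rewrite <- (is_derive_unique _ _ _ DW2), (is_derive_unique _ _ _ DW1).
  unfold wdot; fold yd yd'; change (-1 + 1)%Z with 0%Z; change (0 + 1)%Z with 1%Z.
  rewrite <- !Ey0, <- !Ey0'.
  assert (F0 := Ek' 0%Z); assert (F1 := Ek' 1%Z); change (- 0)%Z with 0%Z in F0; change (- (1))%Z with (-1)%Z in F1.
  rewrite F0, F1; field; exact Hkap. }
replace (s * kap * (zt0 / be0) * (a * be0 * Pbe T A k0 be0 + Pk T A k0 be0)) with (s * kap * (zt0 / be0 * D)) by (unfold D; ring).
rewrite E.
replace (s * kap * (kap * wdot q A be0 zt0 a (- PI) 0 + / kap * wdot q A be0 (/ zt0) a PI (-1)))
  with (kap ^ 2 * (s * wdot q A be0 zt0 a (- PI) 0) + s * wdot q A be0 (/ zt0) a PI (-1)) by (field; exact Hkap).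
assert (W1 : 0 < s * wdot q A be0 zt0 a (- PI) 0) by (apply wdot_sign; assumption).
assert (W2 : 0 < s * wdot q A be0 (/ zt0) a PI (-1)) by (apply wdot_sign; assumption).
assert (0 <= kap ^ 2) by apply pow2_ge_0; nra.
Qed.

(* Along [beta' = +pi beta] and [beta' = -pi beta] the coefficients of the recurrence are monotone
   in opposite directions. *)
Lemma Pfun_transversal :
  (PI * be0 * Pbe T A k0 be0 + Pk T A k0 be0) * (- PI * be0 * Pbe T A k0 be0 + Pk T A k0 be0) < 0.
Proof.
assert (Hq : 0 < q < 1) by (apply qT_bounds, HT).
assert (Hz : 0 < zt0) by apply zk_pos.
assert (Hz' : 0 < / zt0) by (apply Rinv_0_lt_compat, Hz).
assert (HPI := PI_RGT_0).
assert (Q : forall z n, 0 < z -> 0 < 2 * PI * qz q z n).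
{ intros z n H; apply Rmult_lt_0_compat; [lra|apply qz_pos; lra]. }
assert (Q' : forall z n, 0 < z -> 0 < 2 * PI * / qz q z n).
{ intros z n H; apply Rmult_lt_0_compat; [lra|apply Rinv_0_lt_compat, qz_pos; lra]. }
(* As [b = - PI], the choice [a = PI] cancels the [/ qz] term of [edot] and [a = - PI] the [qz]
   term; on the reflected side the roles are exchanged. What remains has the sign of [- be0] or of
   [be0]. *)
destruct (path_derive_sign PI (- be0)) as (k1 & Hk1 & E1 & S1).
{ intros n; unfold edot; eapply Rlt_le_trans; [apply (Q zt0 n Hz)|right; field; repeat split; try exact Hb; apply Rgt_not_eq, qz_pos; lra]. }
{ intros n; unfold edot; eapply Rlt_le_trans; [apply (Q' (/ zt0) n Hz')|right; field; repeat split; try exact Hb; apply Rgt_not_eq, qz_pos; lra]. }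
destruct (path_derive_sign (- PI) be0) as (k2 & Hk2 & E2 & S2).
{ intros n; unfold edot; eapply Rlt_le_trans; [apply (Q' zt0 n Hz)|right; field; repeat split; try exact Hb; apply Rgt_not_eq, qz_pos; lra]. }
{ intros n; unfold edot; eapply Rlt_le_trans; [apply (Q (/ zt0) n Hz')|right; field; repeat split; try exact Hb; apply Rgt_not_eq, qz_pos; lra]. }
assert (Ek : k1 = k2).
{ destruct (yplus_nonzero q A be0 zt0 Hq Hb Hz) as [n Hn].
  apply (Rmult_eq_reg_r (yplus q A be0 zt0 n)); [|exact Hn]; rewrite <- E1, <- E2; reflexivity. }
subst k2.
set (X := PI * be0 * Pbe T A k0 be0 + Pk T A k0 be0) in *; set (Y := - PI * be0 * Pbe T A k0 be0 + Pk T A k0 be0) in *.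
assert (S : 0 < (- be0 * k1 * (zt0 / be0) * X) * (be0 * k1 * (zt0 / be0) * Y)) by (apply Rmult_lt_0_compat; assumption).
replace ((- be0 * k1 * (zt0 / be0) * X) * (be0 * k1 * (zt0 / be0) * Y)) with ((k1 * zt0) ^ 2 * (- (X * Y))) in S by (field; exact Hb).
assert (0 <= (k1 * zt0) ^ 2) by apply pow2_ge_0.
destruct (Rlt_le_dec (X * Y) 0) as [H1|H1]; [exact H1|exfalso; nra].
Qed.

Lemma Pbe_neq0 : Pbe T A k0 be0 <> 0.
Proof. intros E; assert (H := Pfun_transversal); rewrite E in H; nra. Qed.

(** Transversality reads [Pk ^ 2 < (PI * be0 * Pbe) ^ 2]. On a branch this bounds the logarithmic
    derivative. *)
Lemma Pk_le : Rabs (Pk T A k0 be0) <= PI * Rabs be0 * Rabs (Pbe T A k0 be0).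
Proof.
assert (H := Pfun_transversal); assert (HPI := PI_RGT_0).
rewrite <- (Rabs_pos_eq PI) by lra; rewrite <- !Rabs_mult; apply Rsqr_le_abs_0; unfold Rsqr; nra.
Qed.
End Transversal.

(** * Positivity and independence of the two theta functions *)

Lemma Theta_pos q x y z : 0 < q < 1 -> 0 < z -> 0 <= x -> 0 <= y -> 0 < x + y -> 0 < Theta q x y z.
Proof.
intros Hq Hz Hx Hy Hxy; unfold Theta.
assert (Hs := dseq_superexp q x y Hq).
(* Two terms of each series suffice: [x] occurs twice and is subtracted once, and [y * z] covers the
   case [x = 0]. *)
assert (Hp : forall w, 0 < w -> x + y * w <= PSeries (dseq q x y) w).
{ intros w Hw; unfold PSeries.
  apply Rle_trans with (sum_n (fun n => dseq q x y n * w ^ n) 1).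
  - rewrite sum_n_S, sum_n_0; unfold dseq; simpl; lra.
  - apply sum_n_le_Series.
    + intros n; apply Rmult_le_pos; [apply dseq_nonneg; lra|apply pow_le; lra].
    + assert (H := superexp_ex _ w Hs); apply ex_pseries_R in H; exact H. }
assert (H1 := Hp z Hz).
assert (Hw : 0 < / q * / z) by (apply Rmult_lt_0_compat; apply Rinv_0_lt_compat; lra).
assert (H2 := Hp _ Hw).
assert (0 <= y * (/ q * / z)) by (apply Rmult_le_pos; lra).
assert (0 <= y * z) by (apply Rmult_le_pos; lra).
destruct Hx as [Hx|Hx]; [lra|].
assert (0 < y * z) by (apply Rmult_lt_0_compat; lra); lra.
Qed.

Lemma Th0_pos T k : 0 < T -> 0 < Th T 1 0 k.
Proof. intros HT; apply Theta_pos; try lra; [apply qT_bounds, HT|apply zk_pos]. Qed.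

Lemma Th1_pos T k : 0 < T -> 0 < Th T 0 1 k.
Proof. intros HT; apply Theta_pos; try lra; [apply qT_bounds, HT|apply zk_pos]. Qed.

(* With [alpha = 1], [c = 0] (diagonal operator) the determinant is a product which vanishes at
   [k = 0] only modulo the period. *)
Lemma Th_ratio_not_const T c : 0 < T -> ~ (forall k, Th T 0 1 k = c * Th T 1 0 k).
Proof.
intros HT Hc.
assert (Hq := qT_bounds T HT); set (q := qT T) in *.
assert (E : forall k, That q 1 0 (zk k) = (Dco q 1 0 0 + c * Dco q 1 0 1) * Th T 1 0 k).
{ intros k; rewrite That_Theta by (try exact Hq; generalize (zk_pos k); lra).
  rewrite Theta_lin by exact Hq.
  change (Theta q 1 0 (zk k)) with (Th T 1 0 k); change (Theta q 0 1 (zk k)) with (Th T 0 1 k); rewrite Hc; ring. }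
(* For [c = 0] the q-difference equation has first order; its solution is the product of the
   $(1-q^nz)^2$. *)
assert (HU : forall z, Ufun q 1 0 z = (1 - z) ^ 2 * Ufun q 1 0 (q * z)) by (intros z; rewrite Ufun_eq by exact Hq; ring).
assert (E0 := E 0).
assert (Hz0 : zk 0 = 1) by (unfold zk; rewrite Rmult_0_r, Ropp_0, exp_0; reflexivity).
rewrite Hz0 in E0; unfold That in E0; rewrite Rinv_1, (HU 1) in E0.
assert (Hd : Dco q 1 0 0 + c * Dco q 1 0 1 = 0).
{ apply (Rmult_eq_reg_r (Th T 1 0 0)); [rewrite <- E0; ring|generalize (Th0_pos T 0 HT); lra]. }
(* Half a period away from [k = 0]: since [q * / r = r], the determinant at [/ r] is the square of
   [Ufun q 1 0 r], and proportionality makes it vanish. Iterating the equation carries this zero to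
   the origin, where [Ufun] is 1. *)
set (r := zk (omega T / 2)).
assert (Hr : q = r * r).
{ unfold q, qT, r, zk; rewrite <- exp_plus; f_equal; field. }
assert (Hr0 : 0 < r) by apply zk_pos.
assert (Hr1 : r < 1) by nra.
assert (E1 := E (- (omega T / 2))).
assert (Hzi : zk (- (omega T / 2)) = / r).
{ unfold r, zk; rewrite <- exp_Ropp; f_equal; ring. }
rewrite Hzi, Hd, Rmult_0_l in E1; unfold That in E1.
rewrite Rinv_inv in E1; replace (q * / r) with r in E1 by (rewrite Hr; field; lra).
assert (HUr : Ufun q 1 0 r = 0) by nra.
assert (Hall : forall n, Ufun q 1 0 (q ^ n * r) = 0).
{ induction n as [|n IH]; [rewrite Rmult_1_l; exact HUr|].
  rewrite HU in IH; apply Rmult_integral in IH; destruct IH as [IH|IH].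
  - exfalso; assert (Hn := pow_le_1 q n Hq).
    assert (q ^ n * r < 1) by nra; nra.
  - replace (q ^ S n * r) with (q * (q ^ n * r)) by (simpl; ring); exact IH. }
assert (L : is_lim_seq (fun n => Ufun q 1 0 (q ^ n * r)) (Ufun q 1 0 0)).
{ apply (is_lim_seq_continuous (Ufun q 1 0) (fun n => q ^ n * r) 0).
  - apply continuity_pt_filterlim, Ufun_cont, Hq.
  - replace (Finite 0) with (Rbar_mult 0 r) by (simpl; f_equal; ring).
    apply is_lim_seq_scal_r, is_lim_seq_geom; rewrite Rabs_pos_eq; lra. }
apply (is_lim_seq_ext _ (fun _ => 0)) in L; [|intros; apply Hall].
apply is_lim_seq_unique in L; rewrite Lim_seq_const, Ufun_0 in L; injection L; lra.
Qed.

(** * Continuation of branches of a planar set *)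

Lemma clopen_interval (P : R -> Prop) (a b c : R) : a < c < b -> P c ->
  (forall x, a < x < b -> P x -> locally x P) -> (forall x, a < x < b -> ~ P x -> locally x (fun y => ~ P y)) ->
  forall x, a < x < b -> P x.
Proof.
intros Hc Pc Ho Hc' x Hx; apply Classical_Prop.NNPP; intros Hn.
(* If [P] is clopen on the interval and false at [x], this function is continuous and has no zero
   for [s <> 0], yet changes sign between [c] and [x]; [s] adapts the sign to the order of the two
   points. *)
set (f := fun s y => if excluded_middle_informative (P y) then s else - s : R).
assert (Hf : forall s y, a < y < b -> continuous (f s) y).
{ intros s y Hy; apply (continuous_ext_loc _ (fun _ => f s y)); [|apply continuous_const].
  destruct (classic (P y)) as [H|H].
  - generalize (Ho y Hy H); apply filter_imp; intros z Hz; unfold f.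
    destruct (excluded_middle_informative (P y)); destruct (excluded_middle_informative (P z)); tauto.
  - generalize (Hc' y Hy H); apply filter_imp; intros z Hz; unfold f.
    destruct (excluded_middle_informative (P y)); destruct (excluded_middle_informative (P z)); tauto. }
assert (Hne : forall s y, s <> 0 -> f s y <> 0).
{ intros s y Hs; unfold f; destruct (excluded_middle_informative (P y)); lra. }
assert (Ex : forall s, f s x = - s) by (intros s; unfold f; destruct (excluded_middle_informative (P x)); tauto).
assert (Ec : forall s, f s c = s) by (intros s; unfold f; destruct (excluded_middle_informative (P c)); tauto).
destruct (Rtotal_order c x) as [H|[H|H]].
- destruct (IVT_cont (f (-1)) c x H) as (z & _ & Hz).
  + intros y Hy; apply Hf; lra.
  + rewrite Ec; lra.
  + rewrite Ex; lra.
  + apply (Hne (-1) z); lra.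
- apply Hn; rewrite <- H; exact Pc.
- destruct (IVT_cont (f 1) x c H) as (z & _ & Hz).
  + intros y Hy; apply Hf; lra.
  + rewrite Ex; lra.
  + rewrite Ec; lra.
  + apply (Hne 1 z); lra.
Qed.

Section Continuation.
Variable (Z : R -> R -> Prop).

Definition br (a b : R) (g : R -> R) : Prop := forall t, a < t < b -> Z t (g t) /\ continuous g t.

(** The uniqueness clause says that branches cannot cross or split; the existence clause is what
    extends them. *)
Definition local_graph : Prop := forall k0 y0, Z k0 y0 -> exists r d h, 0 < r /\ 0 < d /\ br (k0 - r) (k0 + r) h /\
  forall x, Rabs (x - k0) < r -> forall y, Rabs (y - y0) <= d -> Z x y -> y = h x.

Definition lipschitz_br : Prop := forall a b g, a < b -> br a b g ->
  exists K, forall s t, a < s < b -> a < t < b -> Rabs (g s - g t) <= K * Rabs (s - t).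

(** Closedness is asked along branches only, where a lower bound for the branch is at hand to
    exclude the limit 0. *)
Definition closed_br : Prop := forall a b g x L, a < b -> br a b g -> a <= x <= b ->
  (forall eps, 0 < eps -> exists t, a < t < b /\ Rabs (t - x) < eps /\ Rabs (g t - L) < eps) -> Z x L.

Hypothesis (HL : local_graph).

Lemma br_sub a b a' b' g : a <= a' -> b' <= b -> br a b g -> br a' b' g.
Proof. intros Ha Hb H t Ht; apply H; lra. Qed.

(** The agreement set is open by the uniqueness clause of [local_graph] and closed by continuity. *)
Lemma br_unique a b g h c : br a b g -> br a b h -> a < c < b -> g c = h c -> forall t, a < t < b -> g t = h t.
Proof.
intros Hg Hh Hc E; apply (clopen_interval (fun t => g t = h t) a b c Hc E).
- intros x Hx Ex.
  destruct (Hg x Hx) as [Zx Cg]; destruct (Hh x Hx) as [_ Ch].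
  destruct (HL x (g x) Zx) as (r & d & l & Hr & Hd & _ & Hu).
  destruct (proj1 (continuous_R _ _) Cg d Hd) as (d1 & Hd1 & H1).
  destruct (proj1 (continuous_R _ _) Ch d Hd) as (d2 & Hd2 & H2).
  apply locally_R; exists (Rmin (Rmin r (Rmin d1 d2)) (Rmin (x - a) (b - x))); split.
  { repeat apply Rmin_case; lra. }
  intros y Hy.
  assert (B1 := Rmin_l (Rmin r (Rmin d1 d2)) (Rmin (x - a) (b - x))).
  assert (B2 := Rmin_r (Rmin r (Rmin d1 d2)) (Rmin (x - a) (b - x))).
  assert (B3 := Rmin_l r (Rmin d1 d2)); assert (B4 := Rmin_r r (Rmin d1 d2)).
  assert (B5 := Rmin_l d1 d2); assert (B6 := Rmin_r d1 d2).
  assert (B7 := Rmin_l (x - a) (b - x)); assert (B8 := Rmin_r (x - a) (b - x)).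
  assert (Hyab : a < y < b) by (apply Rabs_lt_between in Hy; lra).
  transitivity (l y); [|symmetry]; apply Hu; try lra; try (apply Hg; exact Hyab); try (apply Hh; exact Hyab).
  + left; apply H1; lra.
  + rewrite Ex; left; apply H2; lra.
- intros x Hx Ex.
  destruct (Hg x Hx) as [_ Cg]; destruct (Hh x Hx) as [_ Ch].
  assert (Hp : 0 < Rabs (g x - h x)) by (apply Rabs_pos_lt; lra).
  assert (C := cR_minus g h x Cg Ch).
  destruct (proj1 (continuous_R _ _) C _ Hp) as (d1 & Hd1 & H1).
  apply locally_R; exists d1; split; [exact Hd1|]; intros y Hy E'.
  specialize (H1 y Hy); cbv beta in H1; rewrite E' in H1.
  replace (h y - h y - (g x - h x)) with (- (g x - h x)) in H1 by ring; rewrite Rabs_Ropp in H1; lra.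
Qed.

Lemma br_glue a b c d g h e : a <= c -> b <= d -> c < e < b -> br a b g -> br c d h -> g e = h e ->
  exists f, br a d f /\ (forall t, a < t < b -> f t = g t).
Proof.
intros Hac Hbd He Hg Hh E.
assert (HE : forall t, c < t < b -> g t = h t).
{ apply (br_unique c b g h e); [apply (br_sub a b); try exact Hg; lra|apply (br_sub c d); try exact Hh; lra|exact He|exact E]. }
set (f := fun t => if Rlt_dec t b then g t else h t).
assert (Fg : forall t, t < b -> f t = g t) by (intros t Ht; unfold f; destruct (Rlt_dec t b); [reflexivity|lra]).
assert (Fh : forall t, c < t -> f t = h t).
{ intros t Ht; unfold f; destruct (Rlt_dec t b) as [H|H]; [apply HE; lra|reflexivity]. }
exists f; split; [|intros t Ht; apply Fg; lra].
intros t Ht; destruct (Rlt_le_dec t b) as [H|H].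
- rewrite Fg by exact H; destruct (Hg t ltac:(lra)) as [H1 H2]; split; [exact H1|].
  apply (continuous_ext_loc _ g); [|exact H2].
  apply locally_R; exists (b - t); split; [lra|]; intros y Hy; symmetry; apply Fg; apply Rabs_lt_between in Hy; lra.
- rewrite Fh by lra; destruct (Hh t ltac:(lra)) as [H1 H2]; split; [exact H1|].
  apply (continuous_ext_loc _ h); [|exact H2].
  apply locally_R; exists (t - c); split; [lra|]; intros y Hy; symmetry; apply Fh; apply Rabs_lt_between in Hy; lra.
Qed.

Hypothesis (HLip : lipschitz_br).
Hypothesis (HCl : closed_br).

Lemma lipschitz_left_limit a b g K : a < b -> (forall s t, a < s < b -> a < t < b -> Rabs (g s - g t) <= K * Rabs (s - t)) ->
  exists L, forall t, a < t < b -> Rabs (g t - L) <= K * (b - t).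
Proof.
intros Hab HK.
set (u := fun n => b - (b - a) * (/ 2) ^ S n).
assert (Hu : forall n, a < u n < b).
{ intros n; unfold u; assert (H : 0 < (/ 2) ^ S n <= / 2).
  { split; [apply pow_lt; lra|]; rewrite <- (Rmult_1_r (/ 2)) at 2; simpl; apply Rmult_le_compat_l; [lra|].
    rewrite <- (pow1 n); apply pow_incr; lra. }
  nra. }
assert (Lu : is_lim_seq u b).
{ replace (Finite b) with (Finite (b - (b - a) * 0)) by (f_equal; ring).
  apply is_lim_seq_minus'; [apply is_lim_seq_const|].
  apply (is_lim_seq_scal_l _ _ 0), (is_lim_seq_incr_1 (fun n => (/ 2) ^ n)), is_lim_seq_geom; rewrite Rabs_pos_eq; lra. }
assert (HKp : 0 <= K).
{ specialize (HK ((2 * a + b) / 3) ((a + 2 * b) / 3) ltac:(lra) ltac:(lra)).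
  assert (H := Rabs_pos (g ((2 * a + b) / 3) - g ((a + 2 * b) / 3))).
  assert (0 < Rabs ((2 * a + b) / 3 - (a + 2 * b) / 3)) by (apply Rabs_pos_lt; lra); nra. }
assert (Hex : ex_finite_lim_seq (fun n => g (u n))).
{ apply ex_lim_seq_cauchy_corr; intros eps.
  assert (He : 0 < eps / (2 * (K + 1))) by (apply Rdiv_lt_0_compat; [apply cond_pos|lra]).
  apply is_lim_seq_spec in Lu; destruct (Lu (mkposreal _ He)) as [N HN]; simpl in HN.
  exists N; intros n m Hn Hm.
  eapply Rle_lt_trans; [apply HK; apply Hu|].
  assert (H1 := HN n Hn); assert (H2 := HN m Hm).
  assert (H3 : Rabs (u n - u m) <= eps / (K + 1)).
  { replace (u n - u m) with ((u n - b) - (u m - b)) by ring; unfold Rminus at 1.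
    eapply Rle_trans; [apply Rabs_triang|]; rewrite Rabs_Ropp.
    replace (eps / (K + 1)) with (eps / (2 * (K + 1)) + eps / (2 * (K + 1))) by (field; lra); lra. }
  apply Rle_lt_trans with (K * (eps / (K + 1))); [apply Rmult_le_compat_l; lra|].
  apply (Rmult_lt_reg_r (K + 1)); [lra|].
  replace (K * (eps / (K + 1)) * (K + 1)) with (K * eps) by (field; lra).
  generalize (cond_pos eps); nra. }
destruct Hex as [L HLim]; exists L; intros t Ht.
assert (Hd : 0 < b - t) by lra.
apply is_lim_seq_spec in Lu; destruct (Lu (mkposreal _ Hd)) as [N HN]; simpl in HN.
apply (is_lim_seq_le_loc (fun n => Rabs (g t - g (u n))) (fun _ => K * (b - t)) (Rabs (g t - L)) (K * (b - t))).
- exists N; intros n Hn; specialize (HN n Hn); eapply Rle_trans; [apply HK; [exact Ht|apply Hu]|].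
  apply Rmult_le_compat_l; [exact HKp|].
  assert (H := Hu n); apply Rabs_lt_between in HN; rewrite Rabs_left1; lra.
- apply (is_lim_seq_abs _ (g t - L)), is_lim_seq_minus'; [apply is_lim_seq_const|exact HLim].
- apply is_lim_seq_const.
Qed.

(** Branches from [x0] agree where they overlap, so they glue up to the supremum [B] of the end
    points reached. The Lipschitz bound supplies a limit at [B], closedness puts it into [Z], and
    the local graph there leads beyond [B]. *)
Lemma br_right x0 y0 b : Z x0 y0 -> x0 < b -> exists a g, a < x0 /\ br a b g /\ g x0 = y0.
Proof.
intros H0 Hb.
destruct (HL x0 y0 H0) as (r0 & d0 & h0 & Hr0 & Hd0 & Hbr0 & Hu0).
assert (Eh0 : h0 x0 = y0).
{ symmetry; apply Hu0; [rewrite Rminus_diag, Rabs_R0; exact Hr0|rewrite Rminus_diag, Rabs_R0; lra|exact H0]. }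
set (a0 := x0 - r0).
set (S := fun c => exists g, br a0 c g /\ g x0 = y0).
destruct (classic (S b)) as [HSb|HSb].
{ destruct HSb as (g & Hg & Eg); exists a0, g; split; [unfold a0; lra|auto]. }
exfalso.
assert (Hub : is_upper_bound S b).
{ intros c (g & Hg & Eg); apply Rnot_lt_le; intros Hlt; apply HSb; exists g; split; [|exact Eg].
  apply (br_sub a0 c); [lra|lra|exact Hg]. }
assert (HS0 : S (x0 + r0)) by (exists h0; split; assumption).
destruct (completeness S) as [B [HB1 HB2]]; [exists b; exact Hub|exists (x0 + r0); exact HS0|].
assert (HBx : x0 + r0 <= B) by (apply HB1, HS0).
assert (Hch : forall t, exists g, t < B -> exists c, t < c /\ x0 < c /\ br a0 c g /\ g x0 = y0).
{ intros t; destruct (Rlt_le_dec t B) as [Ht|Ht]; [|exists h0; intros; lra].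
  assert (Hex : exists c, S c /\ Rmax t x0 < c).
  { apply Classical_Prop.NNPP; intros Hn; assert (B <= Rmax t x0).
    - apply HB2; intros c Hc; apply Rnot_lt_le; intros Hlt; apply Hn; exists c; auto.
    - assert (Rmax t x0 < B) by (apply Rmax_case; lra); lra. }
  assert (X1 := Rmax_l t x0); assert (X2 := Rmax_r t x0).
  destruct Hex as (c & (g & Hg & Eg) & Htc); exists g; intros _; exists c; split; [lra|split; [lra|split; assumption]]. }
destruct (choice _ Hch) as [gam Hgam].
(* Diagonal gluing: at [t] the value is taken from a branch that reaches beyond [t]. For [t >= B]
   the chosen function carries no information. *)
set (G := fun t => gam t t).
assert (HGe : forall t c g, a0 < t < B -> t < c -> br a0 c g -> g x0 = y0 -> x0 < c -> G t = g t).
{ intros t c g Ht Hc Hg Eg Hxc; destruct (Hgam t ltac:(lra)) as (c2 & Hc2 & Hx2 & Hg2 & Eg2).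
  assert (M1 := Rmin_l c c2); assert (M2 := Rmin_r c c2); unfold G.
  apply (br_unique a0 (Rmin c c2) (gam t) g x0).
  - apply (br_sub a0 c2); [lra|exact M2|exact Hg2].
  - apply (br_sub a0 c); [lra|exact M1|exact Hg].
  - split; [unfold a0; lra|apply Rmin_case; lra].
  - rewrite Eg, Eg2; reflexivity.
  - split; [lra|apply Rmin_case; lra]. }
assert (HG : br a0 B G).
{ intros t Ht; destruct (Hgam t ltac:(lra)) as (c & Hc & Hxc & Hg & Eg).
  destruct (Hg t ltac:(lra)) as [H1 H2]; split; [exact H1|].
  apply (continuous_ext_loc _ (gam t)); [|exact H2].
  apply locally_R; exists (Rmin (t - a0) (Rmin (c - t) (B - t))); split; [repeat apply Rmin_case; lra|].
  intros s Hs; symmetry.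
  assert (Y1 := Rmin_l (t - a0) (Rmin (c - t) (B - t))); assert (Y2 := Rmin_r (t - a0) (Rmin (c - t) (B - t))).
  assert (Y3 := Rmin_l (c - t) (B - t)); assert (Y4 := Rmin_r (c - t) (B - t)).
  apply Rabs_lt_between in Hs; apply (HGe s c); try assumption; lra. }
assert (EG : G x0 = y0).
{ rewrite (HGe x0 (x0 + r0) h0); try assumption; unfold a0; lra. }
assert (HaB : a0 < B) by (unfold a0; lra).
destruct (HLip a0 B G HaB HG) as [K HK].
destruct (lipschitz_left_limit a0 B G K HaB HK) as [L HLt].
assert (HZ : Z B L).
{ apply (HCl a0 B G B L HaB HG); [lra|]; intros eps He.
  set (dl := Rmin (eps / (Rabs K + 1)) (Rmin eps (B - a0)) / 2).
  assert (HKa : 0 < Rabs K + 1) by (generalize (Rabs_pos K); lra).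
  assert (Hm : 0 < Rmin (eps / (Rabs K + 1)) (Rmin eps (B - a0))).
  { apply Rmin_case; [apply Rdiv_lt_0_compat; lra|apply Rmin_case; lra]. }
  assert (M1 := Rmin_l (eps / (Rabs K + 1)) (Rmin eps (B - a0))).
  assert (M2 := Rmin_r (eps / (Rabs K + 1)) (Rmin eps (B - a0))).
  assert (M3 := Rmin_l eps (B - a0)); assert (M4 := Rmin_r eps (B - a0)).
  assert (Hdl : 0 < dl) by (unfold dl; lra).
  assert (HdK : dl < eps / (Rabs K + 1)) by (unfold dl; lra).
  exists (B - dl); split; [unfold dl in *; lra|split].
  - replace (B - dl - B) with (- dl) by ring; rewrite Rabs_Ropp, Rabs_pos_eq by lra; unfold dl in *; lra.
  - eapply Rle_lt_trans; [apply HLt; unfold dl in *; lra|].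
    replace (B - (B - dl)) with dl by ring.
    apply Rle_lt_trans with ((Rabs K + 1) * dl); [apply Rmult_le_compat_r; [lra|generalize (Rle_abs K); lra]|].
    replace eps with ((Rabs K + 1) * (eps / (Rabs K + 1))) by (field; lra).
    apply Rmult_lt_compat_l; assumption. }
destruct (HL B L HZ) as (r & d & h & Hr & Hd & Hh & Hu).
(* The point [B - dl] lies in the box of the local graph [h] at [B], horizontally since [dl < r] and
   vertically by the Lipschitz bound; [G] and [h] therefore agree there and can be glued. *)
set (dl := Rmin (d / (Rabs K + 1)) (Rmin r r0) / 2).
assert (HKa : 0 < Rabs K + 1) by (generalize (Rabs_pos K); lra).
assert (Hm : 0 < Rmin (d / (Rabs K + 1)) (Rmin r r0)).
{ apply Rmin_case; [apply Rdiv_lt_0_compat; lra|apply Rmin_case; lra]. }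
assert (M1 := Rmin_l (d / (Rabs K + 1)) (Rmin r r0)).
assert (M2 := Rmin_r (d / (Rabs K + 1)) (Rmin r r0)).
assert (M3 := Rmin_l r r0); assert (M4 := Rmin_r r r0).
assert (Hdl : 0 < dl < r /\ dl < r0 /\ dl <= d / (Rabs K + 1)) by (unfold dl; lra).
assert (Ht1 : a0 < B - dl < B) by (unfold a0 in *; lra).
assert (E1 : G (B - dl) = h (B - dl)).
{ apply Hu.
  - replace (B - dl - B) with (- dl) by ring; rewrite Rabs_Ropp, Rabs_pos_eq; lra.
  - eapply Rle_trans; [apply HLt, Ht1|]; replace (B - (B - dl)) with dl by ring.
    apply Rle_trans with ((Rabs K + 1) * (d / (Rabs K + 1))); [|right; field; lra].
    apply Rmult_le_compat; try lra; [|generalize (Rle_abs K); lra].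
    destruct (Rle_lt_dec 0 K) as [H|H]; [exact H|exfalso].
    assert (Hneg := HLt (B - dl) Ht1); replace (B - (B - dl)) with dl in Hneg by ring.
    generalize (Rabs_pos (G (B - dl) - L)); nra.
  - apply HG, Ht1. }
destruct (br_glue a0 B (Rmax a0 (B - r)) (B + r) G h (B - dl)) as (f & Hf & Ef).
- apply Rmax_l.
- lra.
- split; [apply Rmax_case; lra|lra].
- exact HG.
- apply (br_sub (B - r) (B + r)); [apply Rmax_r|lra|exact Hh].
- exact E1.
- assert (HSB : S (B + r)).
  { exists f; split; [exact Hf|]; rewrite Ef by (unfold a0; lra); exact EG. }
  specialize (HB1 _ HSB); lra.
Qed.
End Continuation.

Lemma continuous_flip (f : R -> R) (t : R) : continuous f (- t) -> continuous (fun s => f (- s)) t.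
Proof.
intros H; apply (continuous_comp (fun s => - s) f); [|exact H].
apply (continuous_opp (V := R_NormedModule)), continuous_id.
Qed.

Lemma br_flip (Z : R -> R -> Prop) a b g : br Z a b g -> br (fun k => Z (- k)) (- b) (- a) (fun t => g (- t)).
Proof.
intros H t Ht; destruct (H (- t) ltac:(lra)) as [H1 H2]; split; [exact H1|apply continuous_flip, H2].
Qed.

Lemma br_unflip (Z : R -> R -> Prop) a b g : br (fun k => Z (- k)) a b g -> br Z (- b) (- a) (fun t => g (- t)).
Proof.
intros H t Ht; destruct (H (- t) ltac:(lra)) as [H1 H2]; rewrite Ropp_involutive in H1.
split; [exact H1|apply continuous_flip, H2].
Qed.

Lemma local_graph_flip Z : local_graph Z -> local_graph (fun k => Z (- k)).
Proof.
intros HL k0 y0 H0; destruct (HL (- k0) y0 H0) as (r & d & h & Hr & Hd & Hh & Hu).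
exists r, d, (fun t => h (- t)); split; [exact Hr|split; [exact Hd|split]].
- replace (k0 - r) with (- (- k0 + r)) by ring; replace (k0 + r) with (- (- k0 - r)) by ring; apply br_flip, Hh.
- intros x Hx y Hy Hz; apply Hu; [|exact Hy|exact Hz].
  replace (- x - - k0) with (- (x - k0)) by ring; rewrite Rabs_Ropp; exact Hx.
Qed.

Lemma lipschitz_br_flip Z : lipschitz_br Z -> lipschitz_br (fun k => Z (- k)).
Proof.
intros H a b g Hab Hg; destruct (H (- b) (- a) (fun t => g (- t)) ltac:(lra) (br_unflip Z a b g Hg)) as [K HK].
exists K; intros s t Hs Ht; specialize (HK (- s) (- t) ltac:(lra) ltac:(lra)).
rewrite !Ropp_involutive in HK; replace (- s - - t) with (- (s - t)) in HK by ring; rewrite Rabs_Ropp in HK; exact HK.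
Qed.

Lemma closed_br_flip Z : closed_br Z -> closed_br (fun k => Z (- k)).
Proof.
intros H a b g x L Hab Hg Hx Hlim; apply (H (- b) (- a) (fun t => g (- t)) (- x) L ltac:(lra) (br_unflip Z a b g Hg)); [lra|].
intros eps He; destruct (Hlim eps He) as (t & Ht & H1 & H2); exists (- t); split; [lra|].
replace (- t - - x) with (- (t - x)) by ring; rewrite Rabs_Ropp, Ropp_involutive; split; assumption.
Qed.

(** Reflection in [k] reduces continuation to the left to continuation to the right; branches over
    growing intervals agree by uniqueness and define one function. *)
Lemma global_branch Z x0 y0 : local_graph Z -> lipschitz_br Z -> closed_br Z -> Z x0 y0 ->
  exists g, g x0 = y0 /\ forall t, Z t (g t) /\ continuous g t.
Proof.
intros HL HLip HCl H0.
assert (Hn : forall N, 0 < N -> exists g, br Z (x0 - N) (x0 + N) g /\ g x0 = y0).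
{ intros N HN.
  destruct (br_right Z HL HLip HCl x0 y0 (x0 + N) H0 ltac:(lra)) as (a & g1 & Ha & Hg1 & E1).
  destruct (br_right (fun k => Z (- k)) (local_graph_flip Z HL) (lipschitz_br_flip Z HLip) (closed_br_flip Z HCl)
    (- x0) y0 (- x0 + N)) as (b & g2 & Hb & Hg2 & E2); [rewrite Ropp_involutive; exact H0|lra|].
  apply br_unflip in Hg2; set (g2' := fun t => g2 (- t)) in *.
  assert (M1 := Rmin_l (- b) (x0 + N)); assert (M2 := Rmin_r (- b) (x0 + N)).
  assert (M3 := Rmax_l a (x0 - N)); assert (M4 := Rmax_r a (x0 - N)).
  destruct (br_glue Z HL (x0 - N) (Rmin (- b) (x0 + N)) (Rmax a (x0 - N)) (x0 + N) g2' g1 x0) as (f & Hf & Ef).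
  - exact M4.
  - exact M2.
  - split; [apply Rmax_case; lra|apply Rmin_case; lra].
  - apply (br_sub Z (- (- x0 + N)) (- b)); [lra|exact M1|exact Hg2].
  - apply (br_sub Z a (x0 + N)); [exact M3|lra|exact Hg1].
  - unfold g2'; rewrite E1, E2; reflexivity.
  - exists f; split; [exact Hf|]; rewrite Ef; [exact E2|split; [lra|apply Rmin_case; lra]]. }
destruct (choice (fun t g => br Z (x0 - (Rabs (t - x0) + 1)) (x0 + (Rabs (t - x0) + 1)) g /\ g x0 = y0)) as [gam Hgam].
{ intros t; apply Hn; generalize (Rabs_pos (t - x0)); lra. }
set (G := fun t => gam t t).
assert (HGe : forall t N g, Rabs (t - x0) < N -> br Z (x0 - N) (x0 + N) g -> g x0 = y0 -> G t = g t).
{ intros t N g Ht Hg Eg; destruct (Hgam t) as [Hg' Eg']; unfold G.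
  set (N' := Rabs (t - x0) + 1) in *.
  assert (M1 := Rmin_l N N'); assert (M2 := Rmin_r N N').
  assert (HM : Rabs (t - x0) < Rmin N N') by (apply Rmin_case; [exact Ht|unfold N'; lra]).
  assert (Hp := Rabs_pos (t - x0)).
  apply (br_unique Z HL (x0 - Rmin N N') (x0 + Rmin N N') (gam t) g x0).
  - apply (br_sub Z (x0 - N') (x0 + N')); [lra|lra|exact Hg'].
  - apply (br_sub Z (x0 - N) (x0 + N)); [lra|lra|exact Hg].
  - lra.
  - rewrite Eg, Eg'; reflexivity.
  - apply Rabs_lt_between in HM; lra. }
exists G; split; [unfold G; apply Hgam|]; intros t.
destruct (Hgam t) as [Hg Eg].
assert (Ht : x0 - (Rabs (t - x0) + 1) < t < x0 + (Rabs (t - x0) + 1)).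
{ assert (H : Rabs (t - x0) < Rabs (t - x0) + 1) by lra; apply Rabs_lt_between in H; lra. }
destruct (Hg t Ht) as [H1 H2]; split; [exact H1|].
apply (continuous_ext_loc _ (gam t)); [|exact H2].
apply locally_R; exists 1; split; [lra|]; intros s Hs; symmetry.
apply (HGe s (Rabs (t - x0) + 1)); try assumption.
replace (s - x0) with ((s - t) + (t - x0)) by ring.
eapply Rle_lt_trans; [apply Rabs_triang|lra].
Qed.

(* [be = C / lambda] for the nonzero eigenvalues [lambda] of the fibre at [k], where [|Gamma(1/2 + i y)|^2 = C / cosh (pi y)]. *)
Definition Zc (T A k be : R) : Prop := be <> 0 /\ Pfun T A k be = 0.

(** * Branches of the zero set *)

Lemma local_branch T A k0 be0 : 0 < T -> Zc T A k0 be0 ->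
  exists r d g, 0 < r /\ 0 < d < Rabs be0 /\ pb r d g /\
    forall x, Rabs x < r -> Zc T A (k0 + x) (be0 + g x) /\
      forall y, Rabs y <= d -> Pfun T A (k0 + x) (be0 + y) = 0 -> y = g x.
Proof.
intros HT [Hb HP]; assert (Hb' := Rabs_pos_lt _ Hb).
destruct (pb_Th T 1 0 k0 1 HT Rlt_0_1) as [M1 H1]; destruct (pb_Th T 0 1 k0 1 HT Rlt_0_1) as [M2 H2].
destruct (pb_Dbe T A 0 be0 1 HT Rlt_0_1) as [M3 H3]; destruct (pb_Dbe T A 1 be0 1 HT Rlt_0_1) as [M4 H4].
set (M := Rmax (Rmax M1 M2) (Rmax M3 M4)).
assert (X1 := Rmax_l (Rmax M1 M2) (Rmax M3 M4)); assert (X2 := Rmax_r (Rmax M1 M2) (Rmax M3 M4)).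
assert (X3 := Rmax_l M1 M2); assert (X4 := Rmax_r M1 M2); assert (X5 := Rmax_l M3 M4); assert (X6 := Rmax_r M3 M4).
assert (HD : forall i, is_derive (fun y => Dbe T A i (be0 + y)) 0 (Derive (Dbe T A i) be0)).
{ intros i; evar_last.
  - apply (is_derive_comp (Dbe T A i) (fun y => be0 + y) 0 (Derive (Dbe T A i) be0) 1).
    + rewrite Rplus_0_r; apply Derive_correct, Dbe_ex_derive, HT.
    + auto_derive; [trivial|ring].
  - unfold scal; simpl; unfold mult; simpl; rring. }
(* The height [Rabs be0 / 2] of the box keeps the branch away from [be = 0]. *)
destruct (pb_implicit 1 M (Rabs be0 / 2) (fun t => Th T 1 0 (k0 + t)) (fun t => Th T 0 1 (k0 + t))
  (fun y => Dbe T A 0 (be0 + y)) (fun y => Dbe T A 1 (be0 + y)) (Derive (Dbe T A 0) be0) (Derive (Dbe T A 1) be0))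
  as (r & d & g & Hr & Hd & Hg & Hz); try apply HD; try lra.
- apply (pb_mono 1 1 M1); [lra|unfold M; lra|exact H1].
- apply (pb_mono 1 1 M2); [lra|unfold M; lra|exact H2].
- apply (pb_mono 1 1 M3); [lra|unfold M; lra|exact H3].
- apply (pb_mono 1 1 M4); [lra|unfold M; lra|exact H4].
- rewrite !Rplus_0_r; unfold Pfun in HP; lra.
- rewrite !Rplus_0_r; assert (H := Pbe_neq0 T A k0 be0 HT Hb HP); unfold Pbe in H; lra.
- exists r, d, g; split; [exact Hr|split; [lra|split; [exact Hg|]]]; intros x Hx.
  destruct (Hz x Hx) as [E U]; split; [split|].
  + intros E0; assert (B := pb_bound r d g x Hg Hx); replace (g x) with (- be0) in B by lra.
    rewrite Rabs_Ropp in B; lra.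
  + unfold Pfun; lra.
  + intros y Hy Ey; apply U; [exact Hy|unfold Pfun in Ey; lra].
Qed.

Lemma Zc_local_graph T A : 0 < T -> local_graph (Zc T A).
Proof.
intros HT k0 y0 H0; destruct (local_branch T A k0 y0 HT H0) as (r & d & g & Hr & Hd & Hg & Hz).
exists r, d, (fun k => y0 + g (k - k0)); split; [exact Hr|split; [lra|split]].
- intros t Ht; assert (Hx : Rabs (t - k0) < r) by (apply Rabs_lt_between; lra); split.
  + destruct (Hz _ Hx) as [E _]; replace (k0 + (t - k0)) with t in E by ring; exact E.
  + apply (ex_derive_continuous (fun k => y0 + g (k - k0))); auto_derive.
    apply (pb_ex_derive r d); [exact Hg|exact Hx].
- intros x Hx y Hy [_ Hxy]; destruct (Hz _ Hx) as [_ U].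
  rewrite <- (U (y - y0) Hy); [ring|].
  replace (k0 + (x - k0)) with x by ring; replace (y0 + (y - y0)) with y by ring; exact Hxy.
Qed.

Lemma branch_local T A a b g t : 0 < T -> br (Zc T A) a b g -> a < t < b ->
  exists r d h, 0 < r /\ 0 < d < Rabs (g t) /\ pb r d h /\ forall x, Rabs x < r -> a < t + x < b /\ g (t + x) = g t + h x.
Proof.
intros HT Hg Ht; destruct (Hg t Ht) as [Hz Hc].
destruct (local_branch T A t (g t) HT Hz) as (r & d & h & Hr & Hd & Hh & Hu).
destruct (proj1 (continuous_R _ _) Hc d ltac:(lra)) as (d1 & Hd1 & H1).
set (r' := Rmin (Rmin r d1) (Rmin (t - a) (b - t))).
assert (X1 := Rmin_l (Rmin r d1) (Rmin (t - a) (b - t))); assert (X2 := Rmin_r (Rmin r d1) (Rmin (t - a) (b - t))).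
assert (X3 := Rmin_l r d1); assert (X4 := Rmin_r r d1).
assert (X5 := Rmin_l (t - a) (b - t)); assert (X6 := Rmin_r (t - a) (b - t)).
assert (Hr' : 0 < r') by (unfold r'; repeat apply Rmin_case; lra).
exists r', d, h; split; [exact Hr'|split; [exact Hd|split]].
- apply (pb_mono r r' d d); [unfold r' in *; lra|lra|exact Hh].
- intros x Hx; fold r' in X1, X2.
  assert (Hab : a < t + x < b) by (apply Rabs_lt_between in Hx; lra); split; [exact Hab|].
  destruct (Hu x ltac:(lra)) as [_ U]; rewrite <- (U (g (t + x) - g t)); [ring| |].
  + left; apply H1; replace (t + x - t) with x by ring; lra.
  + replace (g t + (g (t + x) - g t)) with (g (t + x)) by ring; apply Hg, Hab.
Qed.

(** Implicit differentiation gives [g' * Pbe + Pk = 0], and [Pk_le] bounds the quotient. *)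
Lemma branch_derive T A a b g t : 0 < T -> br (Zc T A) a b g -> a < t < b ->
  ex_derive g t /\ Rabs (Derive g t) <= PI * Rabs (g t).
Proof.
intros HT Hg Ht; destruct (Hg t Ht) as [[Hb HP] _].
destruct (branch_local T A a b g t HT Hg Ht) as (r & d & h & Hr & Hd & Hh & E).
assert (Hex : ex_derive g t).
{ apply ex_derive_shift.
  apply ex_derive_ext_loc with (fun x => g t + h x).
  - apply locally_R; exists r; split; [exact Hr|]; intros y Hy; rewrite Rminus_0_r in Hy; symmetry; apply E, Hy.
  - auto_derive; apply (pb_ex_derive r d); [exact Hh|rewrite Rabs_R0; exact Hr]. }
split; [exact Hex|].
assert (D1 := Pfun_path_derive T A g (fun s => s) t (Derive g t) 1 HT (Derive_correct _ _ Hex) (is_derive_id t)).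
cbv beta in D1.
assert (D2 : is_derive (fun s => Pfun T A s (g s)) t 0).
{ apply (is_derive_ext_loc (fun _ => 0)); [|apply (is_derive_const (V := R_NormedModule) 0)].
  apply locally_R; exists r; split; [exact Hr|]; intros y Hy.
  destruct (E _ Hy) as [Hab _]; replace (t + (y - t)) with y in Hab by ring; symmetry; apply Hg, Hab. }
apply is_derive_unique in D1; apply is_derive_unique in D2; rewrite D1 in D2.
assert (HN := Pbe_neq0 T A t (g t) HT Hb HP); assert (HK := Pk_le T A t (g t) HT Hb HP).
apply (Rmult_le_reg_r (Rabs (Pbe T A t (g t)))); [apply Rabs_pos_lt, HN|].
rewrite <- Rabs_mult; replace (Derive g t * Pbe T A t (g t)) with (- Pk T A t (g t)); [rewrite Rabs_Ropp; exact HK|].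
change (Derive g t * Pbe T A t (g t) + 1 * Pk T A t (g t) = 0) in D2; lra.
Qed.

Lemma derive_nonneg_incr (f df : R -> R) a b : (forall x, a < x < b -> is_derive f x (df x)) ->
  (forall x, a < x < b -> 0 <= df x) -> forall s t, a < s -> s <= t -> t < b -> f s <= f t.
Proof.
intros Hf Hp s t Hs Hst Ht.
destruct (MVT_gen f s t df) as (c & Hc & E).
- intros x Hx; rewrite Rmin_left, Rmax_right in Hx by lra; apply Hf; lra.
- intros x Hx; rewrite Rmin_left, Rmax_right in Hx by lra; apply derivable_continuous_pt.
  exists (df x); apply is_derive_Reals, Hf; lra.
- rewrite Rmin_left, Rmax_right in Hc by lra; assert (0 <= df c) by (apply Hp; lra); nra.
Qed.

(** Squares avoid the kink of the absolute value: $g^2e^{2Mx}$ increases and $g^2e^{-2Mx}$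
    decreases, which covers both orders of [s] and [t]. *)
Lemma gronwall_sqr (g : R -> R) M a b : 0 <= M ->
  (forall t, a < t < b -> ex_derive g t /\ Rabs (Derive g t) <= M * Rabs (g t)) ->
  forall s t, a < s < b -> a < t < b -> g s ^ 2 <= g t ^ 2 * exp (2 * M * Rabs (s - t)).
Proof.
intros HM Hg s t Hs Ht.
assert (Hgg : forall x, a < x < b -> Rabs (g x * Derive g x) <= M * g x ^ 2).
{ intros x Hx; rewrite Rabs_mult, <- (pow2_abs (g x)); destruct (Hg x Hx) as [_ H].
  generalize (Rabs_pos (g x)); nra. }
assert (HD : forall c x, a < x < b ->
  is_derive (fun x => g x ^ 2 * exp (c * x)) x ((2 * (g x * Derive g x) + c * g x ^ 2) * exp (c * x))).
{ intros c x Hx; auto_derive; [apply Hg, Hx|]; change (Derive (fun x => g x) x) with (Derive g x); ring. }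
assert (Hm : forall u v, a < u -> u <= v -> v < b -> g u ^ 2 <= g v ^ 2 * exp (2 * M * (v - u)) /\ g v ^ 2 <= g u ^ 2 * exp (2 * M * (v - u))).
{ intros u v Hu Huv Hv.
  assert (Ee : exp (2 * M * (v - u)) = exp (2 * M * v) * exp (- (2 * M) * u)) by (rewrite <- exp_plus; f_equal; ring).
  assert (Ei : forall y, exp (2 * M * y) * exp (- (2 * M) * y) = 1).
  { intros y; rewrite <- exp_plus, <- exp_0; f_equal; ring. }
  split.
  - assert (H := derive_nonneg_incr _ _ a b (HD (2 * M)) ltac:(intros x Hx; apply Rmult_le_pos; [|left; apply exp_pos];
      specialize (Hgg x Hx); apply Rabs_le_between in Hgg; lra) u v Hu Huv Hv).
    cbv beta in H; rewrite Ee, <- (Rmult_1_r (g u ^ 2)), <- (Ei u).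
    rewrite <- !Rmult_assoc; apply Rmult_le_compat_r; [left; apply exp_pos|exact H].
  - assert (H := derive_nonneg_incr (fun x => - (g x ^ 2 * exp (- (2 * M) * x)))
      (fun x => - ((2 * (g x * Derive g x) + - (2 * M) * g x ^ 2) * exp (- (2 * M) * x))) a b).
    assert (H' := H ltac:(intros x Hx; apply (is_derive_opp (V := R_NormedModule)), HD, Hx)
      ltac:(intros x Hx; specialize (Hgg x Hx); apply Rabs_le_between in Hgg; generalize (exp_pos (- (2 * M) * x)); nra) u v Hu Huv Hv).
    cbv beta in H'.
    replace (g u ^ 2 * exp (2 * M * (v - u))) with ((g u ^ 2 * exp (- (2 * M) * u)) * exp (2 * M * v)) by (rewrite Ee; ring).
    rewrite <- (Rmult_1_r (g v ^ 2)), <- (Ei v), (Rmult_comm (exp (2 * M * v))), <- Rmult_assoc.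
    apply Rmult_le_compat_r; [left; apply exp_pos|lra]. }
destruct (Rle_lt_dec s t) as [H|H].
- rewrite Rabs_left1 by lra; replace (- (s - t)) with (t - s) by ring; apply Hm; lra.
- rewrite Rabs_pos_eq by lra; apply Hm; lra.
Qed.

(* [|g'| <= pi |g|] keeps a branch away from [0] and from infinity on bounded intervals. *)
Lemma branch_bounds T A a b g : 0 < T -> a < b -> br (Zc T A) a b g ->
  exists m K, 0 < m /\ forall t, a < t < b -> m <= g t ^ 2 /\ Rabs (Derive g t) <= K.
Proof.
intros HT Hab Hg; assert (HPI := PI_RGT_0).
set (c := (a + b) / 2); set (E := exp (2 * PI * (b - a))).
assert (Hc : a < c < b) by (unfold c; lra).
assert (HE : 0 < E) by apply exp_pos.
assert (Hgc : 0 < g c ^ 2) by (apply pow2_gt_0, (Hg c Hc)).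
assert (HG := gronwall_sqr g PI a b ltac:(lra) (fun t Ht => branch_derive T A a b g t HT Hg Ht)).
assert (HX : forall s t, a < s < b -> a < t < b -> g s ^ 2 <= g t ^ 2 * E).
{ intros s t Hs Ht; eapply Rle_trans; [apply (HG s t Hs Ht)|].
  apply Rmult_le_compat_l; [apply pow2_ge_0|].
  assert (Hst : Rabs (s - t) <= b - a) by (apply Rabs_le_between; lra).
  unfold E; apply exp_le_compat; nra. }
exists (g c ^ 2 / E), (PI * (g c ^ 2 * E + 1)); split; [apply Rdiv_lt_0_compat; lra|].
intros t Ht; split.
- apply Rle_div_l; [lra|]; apply HX; assumption.
- eapply Rle_trans; [apply (branch_derive T A a b g t HT Hg Ht)|].
  apply Rmult_le_compat_l; [lra|].
  assert (H := HX t c Ht Hc); rewrite <- pow2_abs in H.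
  assert (Hp := Rabs_pos (g t)); nra.
Qed.

Lemma Zc_lipschitz T A : 0 < T -> lipschitz_br (Zc T A).
Proof.
intros HT a b g Hab Hg; destruct (branch_bounds T A a b g HT Hab Hg) as (m & K & _ & HK).
exists K; intros s t Hs Ht.
assert (Hin : forall x, Rmin t s <= x <= Rmax t s -> a < x < b).
{ intros x Hx; assert (a < Rmin t s) by (apply Rmin_case; lra); assert (Rmax t s < b) by (apply Rmax_case; lra); lra. }
destruct (MVT_gen g t s (Derive g)) as (c & Hc & E).
- intros x Hx; apply Derive_correct, (branch_derive T A a b g x HT Hg), Hin; lra.
- intros x Hx; apply derivable_continuous_pt, ex_derive_Reals_0, (branch_derive T A a b g x HT Hg), Hin, Hx.
- rewrite E, Rabs_mult; apply Rmult_le_compat_r; [apply Rabs_pos|]; apply HK, Hin, Hc.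
Qed.

Lemma Pfun_continuous T A x y : 0 < T -> continuous (fun p : R * R => Pfun T A (fst p) (snd p)) (x, y).
Proof.
intros HT.
assert (H1 : forall u v, continuous (fun p : R * R => Th T u v (fst p)) (x, y)).
{ intros u v; apply (continuous_comp fst (Th T u v)); [apply continuous_fst|].
  apply (ex_derive_continuous (Th T u v)), Th_ex_derive, HT. }
assert (H2 : forall i, continuous (fun p : R * R => Dbe T A i (snd p)) (x, y)).
{ intros i; apply (continuous_comp snd (Dbe T A i)); [apply continuous_snd|].
  apply (ex_derive_continuous (Dbe T A i)), Dbe_ex_derive, HT. }
unfold Pfun.
apply (continuous_plus (fun p : R * R => Dbe T A 0 (snd p) * Th T 1 0 (fst p)) (fun p : R * R => Dbe T A 1 (snd p) * Th T 0 1 (fst p))).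
- apply (continuous_mult (fun p : R * R => Dbe T A 0 (snd p)) (fun p : R * R => Th T 1 0 (fst p))); auto.
- apply (continuous_mult (fun p : R * R => Dbe T A 1 (snd p)) (fun p : R * R => Th T 0 1 (fst p))); auto.
Qed.

Lemma Zc_closed T A : 0 < T -> closed_br (Zc T A).
Proof.
intros HT a b g x L Hab Hg Hx Hlim; destruct (branch_bounds T A a b g HT Hab Hg) as (m & K & Hm & HK); split.
- intros E; destruct (Hlim (Rmin 1 (m / 2))) as (t & Ht & _ & H2); [apply Rmin_case; lra|].
  assert (X1 := Rmin_l 1 (m / 2)); assert (X2 := Rmin_r 1 (m / 2)).
  rewrite E, Rminus_0_r in H2; destruct (HK t Ht) as [H3 _]; rewrite <- pow2_abs in H3.
  assert (Hp := Rabs_pos (g t)); nra.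
- apply Classical_Prop.NNPP; intros Hn.
  assert (Hc := Pfun_continuous T A x L HT).
  assert (Hl : locally (x, L) (fun p : R * R => Pfun T A (fst p) (snd p) <> 0)).
  { apply (Hc (fun v : R => v <> 0)).
    apply locally_R; exists (Rabs (Pfun T A x L)); split; [apply Rabs_pos_lt, Hn|].
    simpl; intros v Hv E; subst v; rewrite Rminus_0_l, Rabs_Ropp in Hv; lra. }
  destruct Hl as [eps He]; destruct (Hlim eps (cond_pos eps)) as (t & Ht & H1 & H2).
  apply (He (t, g t)); [split; [exact H1|exact H2]|apply Hg, Ht].
Qed.

Lemma Zc_global T A x0 y0 : 0 < T -> Zc T A x0 y0 -> exists g, g x0 = y0 /\ forall t, Zc T A t (g t) /\ continuous g t.
Proof. intros HT; apply global_branch; [apply Zc_local_graph|apply Zc_lipschitz|apply Zc_closed]; exact HT. Qed.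

Lemma Zc_unique T A g h c : 0 < T -> (forall t, Zc T A t (g t) /\ continuous g t) ->
  (forall t, Zc T A t (h t) /\ continuous h t) -> g c = h c -> forall t, g t = h t.
Proof.
intros HT Hg Hh E t.
apply (br_unique (Zc T A) (Zc_local_graph T A HT) (c - (Rabs (t - c) + 1)) (c + (Rabs (t - c) + 1)) g h c).
- intros s _; apply Hg.
- intros s _; apply Hh.
- generalize (Rabs_pos (t - c)); lra.
- exact E.
- assert (H : Rabs (t - c) < Rabs (t - c) + 1) by lra; apply Rabs_lt_between in H; lra.
Qed.

(** * Enumeration of a discrete set of reals *)

Section Rank.
Variable (Q : nat -> Prop).

Fixpoint rank (n : nat) : nat :=
  match n with O => O | S n => if excluded_middle_informative (Q n) then S (rank n) else rank n end.

Lemma rank_mono n m : (n <= m)%nat -> (rank n <= rank m)%nat.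
Proof. induction 1 as [|m _ IH]; [lia|]; simpl; destruct (excluded_middle_informative (Q m)); lia. Qed.

Lemma rank_lt n m : Q n -> (n < m)%nat -> (rank n < rank m)%nat.
Proof.
intros Hn Hm; apply Nat.lt_le_trans with (rank (S n)); [|apply rank_mono; lia].
simpl; destruct (excluded_middle_informative (Q n)); [lia|tauto].
Qed.

Lemma rank_inj n m : Q n -> Q m -> rank n = rank m -> n = m.
Proof.
intros Hn Hm E; destruct (Nat.lt_trichotomy n m) as [H|[H|H]]; [|exact H|].
- generalize (rank_lt n m Hn H); lia.
- generalize (rank_lt m n Hm H); lia.
Qed.

Lemma rank_surj n i : (i < rank n)%nat -> exists m, Q m /\ rank m = i.
Proof.
induction n as [|n IH]; simpl; [lia|]; destruct (excluded_middle_informative (Q n)) as [H|H]; [|exact IH].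
intros Hi; destruct (Nat.eq_dec i (rank n)) as [E|E]; [exists n; auto|apply IH; lia].
Qed.

(** [rank] sends [Q] onto an initial segment of the naturals; its first missed value, if there is
    one, is the length of the list. *)
Lemma rank_range : exists len, forall j, in_range len j <-> exists m, Q m /\ rank m = j.
Proof.
destruct (classic (forall j, exists m, Q m /\ rank m = j)) as [H|H].
{ exists None; intros j; simpl; split; auto. }
assert (HN : exists N, ~ (exists m, Q m /\ rank m = N) /\ forall i, (i < N)%nat -> exists m, Q m /\ rank m = i).
{ apply Classical_Prop.NNPP; intros Hn; apply H; intros j.
  induction j as [j IH] using lt_wf_ind; apply Classical_Prop.NNPP; intros Hj; apply Hn; exists j; auto. }
destruct HN as (N & HN & Hi); exists (Some N); intros j; simpl; split; [apply Hi|].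
intros (m & Hm & E); apply Nat.nle_gt; intros HNj; apply HN.
destruct (Nat.eq_dec N j) as [E'|E']; [exists m; subst; auto|apply (rank_surj m); lia].
Qed.
End Rank.

(** A point $b$ isolated within $1/(n+1)$ is recorded by $n$ and by the integer part of $b(n+1)$:
    points with equal codes are at most that far apart. The integer is stored through its positive
    and negative parts. *)
Lemma discrete_code (P : R -> Prop) :
  (forall b, P b -> exists d, 0 < d /\ forall b', P b' -> Rabs (b' - b) <= d -> b' = b) ->
  exists code : R -> nat, forall b b', P b -> P b' -> code b = code b' -> b = b'.
Proof.
intros HP.
assert (Hn : forall b, exists n : nat, P b -> forall b', P b' -> Rabs (b' - b) * (INR n + 1) <= 1 -> b' = b).
{ intros b; destruct (classic (P b)) as [Hb|Hb]; [|exists O; tauto].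
  destruct (HP b Hb) as (d & Hd & H); destruct (nfloor_ex (/ d)) as [n Hn]; [left; apply Rinv_0_lt_compat, Hd|].
  exists n; intros _ b' Hb' Hl; apply H; [exact Hb'|].
  assert (Hn0 := pos_INR n).
  apply (Rmult_le_reg_r (INR n + 1)); [lra|]; apply Rle_trans with (1 := Hl).
  apply (Rmult_le_reg_l (/ d)); [apply Rinv_0_lt_compat, Hd|].
  rewrite <- Rmult_assoc, Rinv_l, Rmult_1_l, Rmult_1_r by lra; lra. }
destruct (choice _ Hn) as [n Hn'].
set (fl := fun b => Int_part (b * (INR (n b) + 1))).
exists (fun b => Cantor.to_nat (n b, Cantor.to_nat (Z.to_nat (fl b), Z.to_nat (- fl b)))).
intros b b' Hb Hb' E.
apply Cantor.to_nat_inj, pair_equal_spec in E; destruct E as [En E]; apply Cantor.to_nat_inj, pair_equal_spec in E; destruct E as [E1 E2].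
symmetry; apply (Hn' b Hb b' Hb').
assert (Ef : fl b = fl b') by lia; unfold fl in Ef; rewrite <- En in Ef.
assert (Hp := pos_INR (n b)).
rewrite <- (Rabs_pos_eq (INR (n b) + 1)) by lra; rewrite <- Rabs_mult.
destruct (base_Int_part (b * (INR (n b) + 1))) as [B1 B2]; destruct (base_Int_part (b' * (INR (n b) + 1))) as [B3 B4].
rewrite <- Ef in B3, B4; rewrite Rmult_minus_distr_r; apply Rabs_le_between; lra.
Qed.

Lemma discrete_enum (P : R -> Prop) :
  (forall b, P b -> exists d, 0 < d /\ forall b', P b' -> Rabs (b' - b) <= d -> b' = b) ->
  exists len (e : nat -> R), (forall j, in_range len j -> P (e j)) /\
    (forall i j, in_range len i -> in_range len j -> e i = e j -> i = j) /\
    forall b, P b -> exists j, in_range len j /\ e j = b.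
Proof.
intros HP; destruct (discrete_code P HP) as [code Hc].
set (Q := fun n => exists b, P b /\ code b = n).
destruct (rank_range Q) as [len Hlen].
assert (He : forall j, exists b, in_range len j -> P b /\ rank Q (code b) = j).
{ intros j; destruct (classic (in_range len j)) as [H|H]; [|exists 0; tauto].
  destruct (proj1 (Hlen j) H) as (m & (b & Hb & Ec) & Em); exists b; intros _; rewrite Ec; auto. }
destruct (choice _ He) as [e He'].
exists len, e; split; [intros j Hj; apply He', Hj|split].
- intros i j Hi Hj E; destruct (He' i Hi) as [_ <-]; destruct (He' j Hj) as [_ <-]; rewrite E; reflexivity.
- intros b Hb; assert (Hj : in_range len (rank Q (code b))).
  { apply Hlen; exists (code b); split; [exists b; auto|reflexivity]. }
  exists (rank Q (code b)); split; [exact Hj|].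
  destruct (He' _ Hj) as [H1 H2]; apply Hc; [exact H1|exact Hb|].
  apply (rank_inj Q); [exists (e (rank Q (code b))); auto|exists b; auto|exact H2].
Qed.

(** * The list of band functions *)

Lemma pb_inv b0 s : 0 <= s < Rabs b0 -> exists M, pb s M (fun y => / (b0 + y)).
Proof.
intros Hs; assert (Hb : b0 <> 0) by (intros E; rewrite E, Rabs_R0 in Hs; lra).
set (x := s / Rabs b0).
assert (Hx : 0 <= x < 1).
{ unfold x; split; [apply Rmult_le_pos; [lra|left; apply Rinv_0_lt_compat; lra]|].
  apply (Rmult_lt_reg_r (Rabs b0)); [lra|]; unfold Rdiv; rewrite Rmult_assoc, Rinv_l by lra; lra. }
exists (/ Rabs b0 * / (1 - x)), (fun i => / b0 * (- / b0) ^ i); split.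
- intros N.
  rewrite (sum_n_ext _ (fun i => mult (/ Rabs b0) (x ^ i))).
  + rewrite sum_n_mult_l, sum_n_Reals, tech3 by lra; unfold mult; simpl.
    apply Rmult_le_compat_l; [left; apply Rinv_0_lt_compat; lra|].
    assert (Hp : 0 <= x ^ S N) by (apply pow_le; lra); simpl in Hp.
    unfold Rdiv; rewrite <- (Rmult_1_l (/ (1 - x))) at 2; apply Rmult_le_compat_r; [left; apply Rinv_0_lt_compat; lra|lra].
  + intros i; unfold mult; simpl; unfold x, Rdiv.
    rewrite Rabs_mult, <- RPow_abs, Rabs_Ropp, Rabs_inv, Rpow_mult_distr; rring.
- intros y Hy; apply is_pseries_R.
  assert (Hy' : Rabs (- y * / b0) < 1).
  { rewrite Rabs_mult, Rabs_Ropp, Rabs_inv; apply (Rmult_lt_reg_r (Rabs b0)); [lra|].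
    rewrite Rmult_assoc, Rinv_l by lra; lra. }
  assert (Hby : b0 + y <> 0).
  { intros E; replace b0 with (- y) in Hs by lra; rewrite Rabs_Ropp in Hs; lra. }
  replace (/ (b0 + y)) with (/ b0 * / (1 - (- y * / b0))) by (field; split; assumption).
  apply (is_series_ext (fun n => / b0 * (- y * / b0) ^ n)).
  + intros n; replace (- y * / b0) with (- / b0 * y) by ring; rewrite Rpow_mult_distr; rring.
  + apply (is_series_scal (V := R_NormedModule) (/ b0)), is_series_geom, Hy'.
Qed.

Lemma branch_analytic T A c g : 0 < T -> (forall t, Zc T A t (g t) /\ continuous g t) -> real_analytic (fun k => c / g k).
Proof.
intros HT Hg k0.
destruct (branch_local T A (k0 - 1) (k0 + 1) g k0 HT (fun t _ => Hg t) ltac:(lra)) as (r & d & h & Hr & Hd & Hh & E).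
(* The radius lies strictly between the bound [d] of the local branch and [Rabs (g k0)], the
   distance to the pole of [/ (g k0 + y)]. *)
destruct (pb_inv (g k0) ((d + Rabs (g k0)) / 2)) as [M HM]; [lra|].
assert (H : pb r (Rabs c * M) (fun x => c * / (g k0 + h x))).
{ apply (pb_scal r M c); [lra|].
  apply (pb_comp r ((d + Rabs (g k0)) / 2) M d (fun y => / (g k0 + y)) h); try assumption; lra. }
destruct H as (a & _ & Ha); exists r; split; [exact Hr|exists a]; intros x Hx.
specialize (Ha _ Hx); destruct (E _ Hx) as [_ E']; rewrite <- E' in Ha.
replace (k0 + (x - k0)) with x in Ha by ring; exact Ha.
Qed.

Lemma band_count_one len f k lam j m : in_range len j -> RtoC (f j k) = lam ->
  (forall i, in_range len i -> RtoC (f i k) = lam -> i = j) -> (band_count len f k lam m <-> m = 1%nat).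
Proof.
intros Hj Ej Hu; split.
- intros (l & Hnd & Hl & Hin); rewrite <- Hl.
  apply Nat.le_antisymm.
  + apply (NoDup_incl_length Hnd (l' := j :: nil)); intros i Hi; apply Hin in Hi; left; symmetry; apply Hu; tauto.
  + apply (NoDup_incl_length (l := j :: nil)); [constructor; [simpl; tauto|constructor]|].
    intros i [<-|[]]; apply Hin; auto.
- intros ->; exists (j :: nil); split; [constructor; [simpl; tauto|constructor]|split; [reflexivity|]].
  intros i; split; [intros [Hi Ei]; left; symmetry; apply Hu; assumption|].
  intros [<-|[]]; auto.
Qed.

Lemma band_count_none len f k lam m : (forall i, in_range len i -> RtoC (f i k) <> lam) ->
  (band_count len f k lam m <-> m = 0%nat).
Proof.
intros Hn; split.
- intros (l & _ & Hl & Hin); destruct l as [|i l]; [auto|].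
  destruct (proj2 (Hin i) (or_introl eq_refl)) as [Hi Ei]; destruct (Hn i Hi Ei).
- intros ->; exists nil; split; [constructor|split; [reflexivity|]].
  intros i; split; [intros [Hi Ei]; destruct (Hn i Hi Ei)|intros []].
Qed.

(** The last clause gives access to the band through a prescribed zero at [k = 0]; the flat and the
    non-flat band are both reached in this way. *)
Lemma band_functions_exist T A : 0 < T -> exists Cg len f, 0 < Cg /\ is_band_functions T A len f /\
  forall b, Zc T A 0 b -> exists j g, in_range len j /\ g 0 = b /\ (forall t, f j t = Cg / g t) /\
    forall t, Zc T A t (g t) /\ continuous g t.
Proof.
intros HT; destruct Gamma_half_mod as (Cg & HC & HG).
destruct (discrete_enum (Zc T A 0)) as (len & e & He & Hinj & Hsurj).
{ intros b Hb; destruct (local_branch T A 0 b HT Hb) as (r & d & g & Hr & Hd & Hg & Hz).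
  exists d; split; [lra|]; intros b' [_ Hb'] Hd'.
  assert (H0 : Rabs 0 < r) by (rewrite Rabs_R0; exact Hr).
  destruct (Hz 0 H0) as [_ U]; rewrite Rplus_0_l in U.
  assert (E1 := U (b' - b) Hd' ltac:(replace (b + (b' - b)) with b' by ring; exact Hb')).
  assert (E2 := U 0 ltac:(rewrite Rabs_R0; lra) ltac:(rewrite Rplus_0_r; apply Hb)); lra. }
assert (Hbr : forall j, exists g : R -> R, in_range len j -> g 0 = e j /\ forall t, Zc T A t (g t) /\ continuous g t).
{ intros j; destruct (classic (in_range len j)) as [Hj|Hj]; [|exists (fun _ => 0); tauto].
  destruct (Zc_global T A 0 (e j) HT (He j Hj)) as (g & H); exists g; intros _; exact H. }
destruct (choice _ Hbr) as [G HGr].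
assert (Hval : forall j k lam, in_range len j -> lam <> 0 -> (RtoC (Cg / G j k) = RtoC lam <-> G j k = Cg / lam)).
{ intros j k lam Hj Hl; destruct (HGr j Hj) as [_ H]; destruct (H k) as [[Hz _] _]; split.
  - intros E; injection E as <-; field; split; lra.
  - intros ->; f_equal; field; split; lra. }
exists Cg, len, (fun j k => Cg / G j k); split; [exact HC|split; [split|]].
- intros j Hj; destruct (HGr j Hj) as [_ H]; split; [apply (branch_analytic T A Cg (G j) HT H)|].
  intros k; destruct (H k) as [[Hz _] _]; apply Rmult_integral_contrapositive; split; [lra|apply Rinv_neq_0_compat, Hz].
- intros k [lr li] Hlam m.
  destruct (Req_dec li 0) as [->|Hli].
  + assert (Hlr : lr <> 0) by (intros ->; apply Hlam; reflexivity).
    change (lr, 0) with (RtoC lr).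
    destruct (Req_dec (Tb (qT T) A (Cg / lr) (zk k)) 0) as [H0|H0].
    * rewrite (eig_mult_one T Cg HT HC HG A k lr m Hlr H0).
      rewrite Tb_Pfun in H0 by exact HT.
      assert (HZ : Zc T A k (Cg / lr)).
      { split; [apply Rmult_integral_contrapositive; split; [lra|apply Rinv_neq_0_compat, Hlr]|exact H0]. }
      (* The eigenvalue at [k] is continued back to [k = 0], where it meets an enumerated zero;
         uniqueness identifies the branch with [G j], and every other index is excluded by
         injectivity of the enumeration. *)
      destruct (Zc_global T A k (Cg / lr) HT HZ) as (g & Eg & Hg).
      destruct (Hsurj (g 0) (proj1 (Hg 0))) as (j & Hj & Ej).
      destruct (HGr j Hj) as [G0 HGj].
      symmetry; apply (band_count_one len _ k (RtoC lr) j).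
      -- exact Hj.
      -- apply Hval; [exact Hj|exact Hlr|]; rewrite <- Eg.
         apply (Zc_unique T A (G j) g 0 HT HGj Hg); rewrite G0; exact Ej.
      -- intros i Hi Ei; apply Hval in Ei; [|exact Hi|exact Hlr].
         destruct (HGr i Hi) as [Gi0 HGi]; apply Hinj; [exact Hi|exact Hj|].
         rewrite <- Gi0, Ej; apply (Zc_unique T A (G i) g k HT HGi Hg); rewrite Ei, Eg; reflexivity.
    * rewrite (eig_mult_none T A k (RtoC lr) m (fun x => eigvec_zero T Cg HT HC HG A k lr x Hlr H0)).
      symmetry; apply band_count_none; intros i Hi Ei; apply Hval in Ei; [|exact Hi|exact Hlr].
      apply H0; rewrite Tb_Pfun, <- Ei by exact HT; apply (HGr i Hi).
  + rewrite (eig_mult_none T A k (lr, li) m (fun x => eigvec_nonreal_zero T Cg HC HG A k lr li x Hli)).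
    symmetry; apply band_count_none; intros i Hi Ei; injection Ei as _ E; apply Hli; symmetry; exact E.
- intros b Hb; destruct (Hsurj b Hb) as (j & Hj & Ej); destruct (HGr j Hj) as [G0 HGj].
  exists j, (G j); split; [exact Hj|split; [rewrite G0; exact Ej|split; [reflexivity|exact HGj]]].
Qed.

Theorem theorem8p6 (T : R) (hT : 0 < T) :
  exists Astar : R, 0 < Astar < 1 /\
    exists (len : option nat) (f : nat -> R -> R),
      is_band_functions T Astar len f /\
      (exists j, in_range len j /\ flat (f j)) /\
      (exists j, in_range len j /\ ~ flat (f j)).
Proof.
destruct (critical_coupling (qT T) (qT_bounds T hT)) as (A & b0 & b1 & HA & Hb0 & Hb1 & T1 & T2 & T3 & T4).
assert (Hz0 : zk 0 = 1) by (unfold zk; rewrite Rmult_0_r, Ropp_0, exp_0; reflexivity).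
rewrite <- Hz0, Tb_Pfun in T1, T2, T3, T4 by exact hT.
destruct (band_functions_exist T A hT) as (Cg & len & f & HC & Hf & Hb).
exists A; split; [exact HA|exists len, f; split; [exact Hf|split]].
- destruct (Hb b0) as (j & g & Hj & E0 & Ef & Hg); [split; [lra|exact T1]|].
  exists j; split; [exact Hj|exists (Cg / b0)]; intros k; rewrite Ef; f_equal.
  assert (P0 := Th0_pos T 0 hT); assert (P1 := Th1_pos T 0 hT).
  assert (Q1 := T1); assert (Q2 := T2); unfold Pfun in Q1, Q2; rewrite !Dbe_neg in Q2.
  (* By parity, the sum and the difference of the two equations isolate the two terms, and the theta
     values at [k = 0] are positive. *)
  assert (D0 : Dbe T A 0 b0 = 0) by (apply (Rmult_eq_reg_r (Th T 1 0 0)); lra).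
  assert (D1 : Dbe T A 1 b0 = 0) by (apply (Rmult_eq_reg_r (Th T 0 1 0)); lra).
  (* Both coefficients vanish, so the constant [b0] is itself a branch, and [g] coincides with
     it. *)
  apply (Zc_unique T A g (fun _ => b0) 0 hT Hg); [|exact E0].
  intros t; split; [split; [lra|unfold Pfun; rewrite D0, D1; ring]|apply cR_const].
- destruct (Hb b1) as (j & g & Hj & E0 & Ef & Hg); [split; [lra|exact T3]|].
  exists j; split; [exact Hj|]; intros [c Hc].
  assert (Hgc : forall t, g t = b1).
  { intros t; assert (Et : Cg / g t = Cg / g 0) by (rewrite <- !Ef, !Hc; reflexivity).
    destruct (Hg t) as [[Hz _] _]; destruct (Hg 0) as [[Hz' _] _].
    rewrite <- E0, <- (Rinv_inv (g t)), <- (Rinv_inv (g 0)); f_equal.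
    apply (Rmult_eq_reg_l Cg); [exact Et|lra]. }
  assert (HP : forall t, Dbe T A 0 b1 * Th T 1 0 t + Dbe T A 1 b1 * Th T 0 1 t = 0).
  { intros t; destruct (Hg t) as [[_ H] _]; rewrite Hgc in H; exact H. }
  (* Otherwise [Dbe T A 0 b1] would vanish too, and [- b1] would be a zero at [k = 0]. *)
  assert (Hd1 : Dbe T A 1 b1 <> 0).
  { intros D1; assert (H := HP 0); rewrite D1 in H; assert (P0 := Th0_pos T 0 hT).
    assert (D0 : Dbe T A 0 b1 = 0) by (apply (Rmult_eq_reg_r (Th T 1 0 0)); lra).
    apply T4; unfold Pfun; rewrite !Dbe_neg, D0, D1; ring. }
  apply (Th_ratio_not_const T (- Dbe T A 0 b1 / Dbe T A 1 b1) hT); intros t.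
  apply (Rmult_eq_reg_l (Dbe T A 1 b1)); [|exact Hd1].
  specialize (HP t); replace (Dbe T A 1 b1 * (- Dbe T A 0 b1 / Dbe T A 1 b1 * Th T 1 0 t)) with (- Dbe T A 0 b1 * Th T 1 0 t) by (field; exact Hd1).
  lra.
Qed.
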